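(* Let $\mathbb K\in\{\mathbb T,\mathbb R\}$, $\alpha\in(0,1]$ and $s>\max\{\frac12,s_\alpha\}$. Assume that the symbol $\omega_{\alpha+1}$ of $L_{\alpha+1}$ satisfies Hypothesis 1 (see context). Let $u_0\in H^s(\mathbb K)$ be real-valued. Then there exists a unique solution of $$\partial_t u-L_{\alpha+1}u=\partial_x(u^2),\qquad u(0,\cdot)=u_0,$$ in the class $C([0,T]:H^s(\mathbb K))$, where $T$ is the local existence time defined in the context.
   Context: $\mathbb T=\mathbb R/2\pi\mathbb Z$. Functions $u=u(t,x)$ are real-valued, $x\in\mathbb K$; solutions are understood in the sense of distributions. $L_{\alpha+1}$ is the Fourier multiplier (in $x$) with symbol $i\omega_{\alpha+1}(\xi)$. Hypothesis 1: $\omega_{\alpha+1}\in C^1(\mathbb R)\cap C^3(\mathbb R\setminus\{0\})$ is a real-valued odd function and there exists $\xi_0>0$ such that for all $|\xi|\ge\xi_0$ and $\beta\in\{0,1,2,3\}$, $|\partial^\beta\omega_{\alpha+1}(\xi)|\sim|\xi|^{\alpha+1-\beta}$ (comparable up to positive multiplicative constants). Thresholds: $$s_\alpha=\begin{cases}1-\frac{3\alpha}4,&\frac23\le\alpha\le1,\\ \frac32(1-\alpha),&\frac13\le\alpha\le\frac23,\\ \frac32-\frac{\alpha}{1-\alpha},&0<\alpha\le\frac13,\end{cases}\qquad \widetilde s_\alpha=\begin{cases}\frac12-\frac\alpha4,&\frac23\le\alpha\le1,\\ 1-\alpha,&\frac12\le\alpha\le\frac23,\\ \frac32-\frac{\alpha}{1-\alpha},&0<\alpha\le\frac12.\end{cases}$$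 Local existence time: for $s'$ with $\widetilde s_\alpha<s'\le s$, $T:=A_0(1+\|u_0\|_{H^{s'}})^{-\beta_0}$, where $A_0,\beta_0>0$ are constants (independent of $u_0$) for which the local well-posedness theorem holds: for every $u_0\in H^s(\mathbb K)$ there is a unique solution of the initial value problem on $[0,T]$ in $C([0,T]:H^s(\mathbb K))\cap L^2((0,T):W^{(s-(\frac12-\frac\alpha4))_-,\infty}(\mathbb K))$, and for every $0<\widetilde T<T$ the flow map is continuous from a neighbourhood of $u_0$ in $H^s(\mathbb K)$ into $C([0,\widetilde T]:H^s(\mathbb K))$. Here $\|f\|_{W^{r,p}}=\|J_x^rf\|_{L^p}$ with $J_x^r$ the Fourier multiplier with symbol $(1+\xi^2)^{r/2}$, $H^r=W^{r,2}$, and $x_-$ denotes a number slightly smaller than $x$. *)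

(* Defs.v *)
From HB Require Import structures.
From mathcomp Require Import all_boot all_order all_algebra.
From mathcomp Require Import complex.
From mathcomp Require Import all_classical all_reals all_analysis.

Set Implicit Arguments.
Unset Strict Implicit.
Unset Printing Implicit Defensive.

Import Order.TTheory GRing.Theory Num.Theory.
Import numFieldNormedType.Exports.

Local Open Scope classical_set_scope.
Local Open Scope complex_scope.
Local Open Scope ring_scope.

(* Torus is R / 2 pi Z. *)
Inductive spatial_domain := Torus | Line.

Section Analysis.
Context {R : realType}.
Implicit Types (K : spatial_domain) (f g h : R -> R) (u v : R -> R -> R)
  (phi : R -> R) (m : R -> R[i]).

Local Notation leb := (@lebesgue_measure R).

(* Functions on the torus are 2pi-periodic functions on R, integrated over one
   period. *)
Definition dom K : set R :=
  match K with Torus => `[0, 2 * pi[ | Line => setT end.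

Definition on_space K f : Prop :=
  match K with Torus => periodic f (2 * pi) | Line => True end.

Definition integral_space K f : R := \int[leb]_(x in dom K) f x.

(* The frequency variable runs over Z, with counting measure, for the torus and
   over R, with Lebesgue measure, for the line. *)
Definition integral_freq K f : R :=
  match K with
  | Torus => \int[counting]_(xi in range (fun k : int => k%:~R : R)) f xi
  | Line => \int[leb]_(xi in setT) f xi
  end.

Definition ae_eq_space K f g : Prop := ae_eq leb (dom K) f g.

Definition Lp_norm K (p : \bar R) f : \bar R :=
  ('N[leb]_p[EFin \o (f \_ (dom K))])%E.

Definition in_Lp K (p : \bar R) f : Prop :=
  measurable_fun (dom K) f /\ (Lp_norm K p f < +oo)%E.

(* C^infty test functions on K, compactly supported (automatic on the torus). *)
Definition test_space K phi : Prop :=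
  (forall n x, derivable (derive1n n phi) x 1) /\
  match K with
  | Torus => periodic phi (2 * pi)
  | Line => exists M, forall x, M < `|x| -> phi x = 0
  end.

Definition cis (x : R) : R[i] := cos x +i* sin x.

(* phi^(xi) = int_K phi(x) e^{-i x xi} dx *)
Definition fourier K phi (xi : R) : R[i] :=
  integral_space K (fun x => complex.Re ((phi x)%:C * cis (- (x * xi)))) +i*
  integral_space K (fun x => complex.Im ((phi x)%:C * cis (- (x * xi)))).

(* m(D) phi (x) = (2 pi)^-1 int m(xi) phi^(xi) e^{i x xi} dxi.  Every symbol used
   below satisfies m(- xi) = conj m(xi), so that this integral is real; its
   imaginary part is dropped only to get a real-valued function. *)
Definition multiplier K m phi (x : R) : R :=
  (2 * pi)^-1 *
  integral_freq K (fun xi => complex.Re (m xi * fourier K phi xi * cis (x * xi))).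

(* The distribution m(D) f, for f in L^2(K), evaluated at the test function phi:
   the transpose of m(D) is the multiplier with symbol m(- xi). *)
Definition multiplier_distr K m f phi : R :=
  integral_space K (fun x => f x * multiplier K (fun xi => m (- xi)) phi x).

Definition J_symbol (r : R) (xi : R) : R[i] :=
  ((1 + xi ^+ 2) `^ (r / 2))%:C.

(* J^r f = h in the sense of distributions. *)
Definition is_J K (r : R) f h : Prop :=
  forall phi, test_space K phi ->
    integral_space K (fun x => h x * phi x) =
    multiplier_distr K (J_symbol r) f phi.

(* || J^r f ||_{L^p}, for f in L^2(K).  The function J^r f is unique almost
   everywhere, so the infimum is that of a set with at most one element; it is
   +oo when the distribution J^r f is not in L^p. *)
Definition W_norm K (r : R) (p : \bar R) f : \bar R :=
  ereal_inf [set Lp_norm K p h | h in [set h | in_Lp K p h /\ is_J K r f h]].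

Definition H_norm K (r : R) f : \bar R := W_norm K r 2%:E f.

(* H^r(K) for r >= 0, the only case that is used; then H^r is contained in
   L^2. *)
Definition in_H K (r : R) f : Prop :=
  [/\ on_space K f, in_Lp K 2%:E f & (H_norm K r f < +oo)%E].

(* C([0,T] : H^s(K)) *)
Definition C_H K (T s : R) u : Prop :=
  (forall t, t \in `[0, T] -> in_H K s (u t)) /\
  (forall t, t \in `[0, T] ->
    H_norm K s (u t' \- u t) @[t' --> within `[0, T] (nbhs t)] --> 0%E).

(* || u ||_{L^2((0,T) : W^{r,infty})} < oo, for u in C([0,T] : L^2); the norm
   in W^{r,infty} is then a lower semicontinuous function of t. *)
Definition L2_Winfty K (T r : R) u : Prop :=
  (\int[leb]_(t in `]0%R, T[) (W_norm K r +oo (u t) ^+ 2) < +oo)%E.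

Definition dt u : R -> R -> R := fun t x => derive1 (u ^~ x) t.
Definition dx u : R -> R -> R := fun t x => derive1 (u t) x.

(* It suffices to differentiate first in x and then in t: continuity of these
   derivatives yields that of all the mixed ones, and they commute. *)
Definition smooth2 (phi : R -> R -> R) : Prop :=
  forall i j, let psi := iter i dt (iter j dx phi) in
    (forall t x, derivable (psi ^~ x) t 1 /\ derivable (psi t) x 1) /\
    continuous (fun p : R * R => psi p.1 p.2).

(* Test functions on (0,T) x K. *)
Definition test_spacetime K (T : R) (phi : R -> R -> R) : Prop :=
  [/\ smooth2 phi,
      exists a b, [/\ 0 < a, b < T &
        forall t x, t \notin `[a, b] -> phi t x = 0] &
      match K with
      | Torus => forall t, periodic (phi t) (2 * pi)
      | Line => exists M, forall t x, M < `|x| -> phi t x = 0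
      end].

Definition L_symbol (omega : R -> R) (xi : R) : R[i] := 0 +i* omega xi.

(* u_t - L u = (u^2)_x in D'((0,T) x K), with u(0) = u0.  The space-time pairings
   are iterated integrals, in x and then in t; this is meaningful for u in
   C([0,T] : L^2) without any choice of a jointly measurable representative. *)
Definition is_solution K (omega : R -> R) (T : R) (u0 : R -> R) u : Prop :=
  ae_eq_space K (u 0) u0 /\
  forall phi : R -> R -> R, test_spacetime K T phi ->
    \int[leb]_(t in `[0, T])
      (- integral_space K (fun x => u t x * dt phi t x)
       - multiplier_distr K (L_symbol omega) (u t) (phi t)
       + integral_space K (fun x => u t x ^+ 2 * dx phi t x)) = 0.

Definition unique_solution_in K (omega : R -> R) (T : R) (u0 : R -> R)
    (X : set (R -> R -> R)) : Prop :=
  exists u, [/\ X u, is_solution K omega T u0 u &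
    forall v, X v -> is_solution K omega T u0 v ->
      forall t, t \in `[0, T] -> ae_eq_space K (v t) (u t)].

Definition hypothesis1 (alpha : R) (omega : R -> R) : Prop :=
  [/\ (forall xi, derivable omega xi 1) /\ continuous (derive1 omega),
      forall xi, xi != 0 ->
        (forall b : nat, (b < 3)%N -> derivable (derive1n b omega) xi 1) /\
        {for xi, continuous (derive1n 3 omega)},
      forall xi, omega (- xi) = - omega xi &
      exists2 xi0, 0 < xi0 & forall b : nat, (b <= 3)%N ->
        exists c C, [/\ 0 < c, 0 < C & forall xi, xi0 <= `|xi| ->
          c * `|xi| `^ (alpha + 1 - b%:R) <= `|(derive1n b omega) xi|
            <= C * `|xi| `^ (alpha + 1 - b%:R)]].

Definition s_threshold (alpha : R) : R :=
  if 2 / 3 <= alpha then 1 - 3 * alpha / 4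
  else if 1 / 3 <= alpha then 3 / 2 * (1 - alpha)
  else 3 / 2 - alpha / (1 - alpha).

Definition s_tilde_threshold (alpha : R) : R :=
  if 2 / 3 <= alpha then 1 / 2 - alpha / 4
  else if 1 / 2 <= alpha then 1 - alpha
  else 3 / 2 - alpha / (1 - alpha).

Definition existence_time K (s' A0 beta0 : R) (u0 : R -> R) : R :=
  A0 * (1 + fine (H_norm K s' u0)) `^ (- beta0).

(* C([0,T] : H^s) with L^2((0,T) : W^{r,infty}), where
   r = s - (1/2 - alpha/4) - eps. *)
Definition lwp_class K (alpha s eps T : R) : set (R -> R -> R) :=
  [set u | C_H K T s u /\ L2_Winfty K T (s - (1 / 2 - alpha / 4) - eps) u].

(* The flow map is continuous from the ball of radius delta around u0 in H^s
   into C([0,T'] : H^s). *)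
Definition flow_continuous_near K (omega : R -> R)
    (alpha s s' eps A0 beta0 T' : R) (u0 : R -> R) (delta : R) : Prop :=
  let time := existence_time K s' A0 beta0 in
  let ball_u0 := [set v0 : R -> R | in_H K s v0 /\ (H_norm K s (v0 \- u0)%R < delta%:E)%E] in
  let flow (v0 : R -> R) v :=
    lwp_class K alpha s eps (time v0) v /\ is_solution K omega (time v0) v0 v in
  (forall v0 : R -> R, ball_u0 v0 -> T' <= time v0) /\
  (forall v0 : R -> R, ball_u0 v0 -> forall e, 0 < e -> exists2 eta, 0 < eta &
    forall w0 : R -> R, ball_u0 w0 -> (H_norm K s (w0 \- v0)%R < eta%:E)%E ->
    forall v w : R -> R -> R, flow v0 v -> flow w0 w ->
    forall t, t \in `[0, T'] -> (H_norm K s (w t \- v t)%R <= e%:E)%E).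

(* Local well-posedness in H^s holds with the time of existence given by the
   constants A0 and beta0, which do not depend on u0. *)
Definition locally_wellposed K (omega : R -> R)
    (alpha s s' eps A0 beta0 : R) : Prop :=
  forall u0 : R -> R, in_H K s u0 ->
    let T := existence_time K s' A0 beta0 u0 in
    unique_solution_in K omega T u0 (lwp_class K alpha s eps T) /\
    forall T', 0 < T' -> T' < T -> exists2 delta, 0 < delta &
      flow_continuous_near K omega alpha s s' eps A0 beta0 T' u0 delta.

End Analysis.

(* Main.v *)
Require Import Defs.
From mathcomp Require Import all_boot all_order all_algebra.
From mathcomp Require Import complex.
From mathcomp Require Import all_classical all_reals all_analysis.
From mathcomp Require Import measurable_realfun ring lra.

(* Existence is part of the local well-posedness theorem, so the point is
   uniqueness in C([0,T] : H^s): every solution v in that class is shown to lie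
   in L^2((0,T) : W^{r,oo}) with r = s - (1/2 - alpha/4) - eps, and the
   uniqueness half of the well-posedness theorem applies to it.

   Fix a dyadic frequency N and cut [0,T] into about N pieces of length c/N.  On
   such a short time scale the van der Corput second derivative test bounds
   |sum_{N <= k < 2N} cos (k x + t omega(k))| by (|t| N^(alpha-1))^(-1/2), on the
   torus as well as on the line.  A discrete TT* argument (Bombieri's inequality)
   turns this into a Strichartz estimate, which controls the free part of
   Duhamel's formula; the nonlinear part is bounded by N times the length of the
   piece, using only s > 1/2.  Summing over the pieces, the integral over [0,T] of
   the square of the sup norm of the block P_N J^r v is O(N^(2(r-s)) N^(1-alpha/2))
   = O(N^(-2 eps)), which is summable over dyadic N.

   Functions stay real-valued throughout: the Fourier transform is replaced by
   the Hartley transform, whose kernel is cas y = cos y + sin y.  A sum over Z is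
   written as the Lebesgue integral of f(floor xi), so that the torus and the
   line are treated together. *)

Set Implicit Arguments.
Unset Strict Implicit.
Unset Printing Implicit Defensive.
Import Order.TTheory GRing.Theory Num.Theory.
Import numFieldNormedType.Exports.
Local Open Scope classical_set_scope.
Local Open Scope ring_scope.

(** * Integrals on the line *)

(** The sup norm in x of a block is linearised by choosing, at each sampled time, a point where it
    is nearly attained. Sampling at finitely many equidistant times spares a measurable choice of
    that point; the diagonal of the Gram matrix then contributes 2 N D for a time step D, and this
    is harmless because D may be taken as small as desired. The length c/N is dictated by the
    integers: for |t| <= c/N the increments of the phase k x + t omega(k) vary by at most 1 over a
    block, so they come close to a single multiple of 2 pi and integer frequencies behave like real
    ones. The same length pays for the derivative in the nonlinearity. As for the exponent, a piece
    of length 1/N contributes (N^(-1) / N^(alpha-1))^(1/2) = N^(-alpha/2), and there are about N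
    pieces. A solution is only known through test functions, so its equation has to become a scalar
    integral identity in time for each frequency symbol; the dyadic cutoffs being sharp, these
    symbols are discontinuous at finitely many points and must be approximated by transforms of test
    functions. *)

Section RealIntegrals.
Context {R : realType}.
Local Notation leb := (@lebesgue_measure R).
Implicit Types (f g h : R -> R) (c a : R).

#[global] Instance ae_leb_filter : Filter (nbhs (almost_everywhere leb)).
Proof. exact: (@ae_filter_ringOfSetsType _ _ _ leb). Qed.

Definition Ig f : Prop := leb.-integrable setT (EFin \o f).

Lemma Ig_meas f : Ig f -> measurable_fun setT f.
Proof. by move/measurable_int/measurable_EFinP. Qed.

Lemma Ig_le f g : measurable_fun setT f -> Ig g ->
  (forall x, `|f x| <= `|g x|) -> Ig f.
Proof.
move=> mf ig fg; apply: (le_integrable measurableT _ _ ig).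
  exact/measurable_EFinP.
by move=> x _; rewrite lee_fin.
Qed.

Lemma IgD f g : Ig f -> Ig g -> Ig (fun x => f x + g x).
Proof. by move=> fi gi; have := integrableD measurableT fi gi. Qed.

Lemma IgZ c f : Ig f -> Ig (fun x => c * f x).
Proof. by move=> fi; have := integrableZl measurableT c fi. Qed.

Lemma IgN f : Ig f -> Ig (fun x => - f x).
Proof. by move=> fi; have := integrableN fi. Qed.

Lemma IgB f g : Ig f -> Ig g -> Ig (fun x => f x - g x).
Proof. by move=> fi gi; apply: IgD => //; exact: IgN. Qed.

Lemma Ig0 : Ig (fun=> 0).
Proof. exact: integrable0. Qed.

Lemma Ig_sum (J : Type) (s : seq J) (F : J -> R -> R) :
  (forall j, Ig (F j)) -> Ig (fun x => \sum_(j <- s) F j x).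
Proof.
move=> iF; elim: s => [|j s IH].
  by under eq_fun do rewrite big_nil; exact: Ig0.
by under eq_fun do rewrite big_cons; exact: IgD.
Qed.

Lemma Ig_abs f : Ig f -> Ig (fun x => `|f x|).
Proof. by move=> fi; have := integrable_norm fi. Qed.

Lemma IgMb M f g : Ig f -> measurable_fun setT g -> (forall x, `|g x| <= M) ->
  Ig (fun x => f x * g x).
Proof.
move=> fi mg gM; apply: (@Ig_le _ (fun x => M * f x)).
- by apply: measurable_funM => //; exact: Ig_meas.
- exact: IgZ.
- move=> x; rewrite !normrM mulrC ler_wpM2r//.
  exact: le_trans (gM x) (ler_norm _).
Qed.

Lemma IntD f g : Ig f -> Ig g ->
  \int[leb]_x (f x + g x) = \int[leb]_x f x + \int[leb]_x g x.
Proof. exact: RintegralD. Qed.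

Lemma IntZ c f : Ig f -> \int[leb]_x (c * f x) = c * \int[leb]_x f x.
Proof. exact: RintegralZl. Qed.

Lemma IntN f : Ig f -> \int[leb]_x (- f x) = - \int[leb]_x f x.
Proof.
move=> fi; rewrite -mulN1r -IntZ//.
by apply: eq_Rintegral => x _; rewrite mulN1r.
Qed.

Lemma IntB f g : Ig f -> Ig g ->
  \int[leb]_x (f x - g x) = \int[leb]_x f x - \int[leb]_x g x.
Proof. exact: RintegralB. Qed.

Lemma Int_ext f g : (forall x, f x = g x) ->
  \int[leb]_x f x = \int[leb]_x g x.
Proof. by move=> fg; apply: eq_Rintegral => x _. Qed.

Lemma Int0 : \int[leb]_x (0 : R) = 0.
Proof. by rewrite /Rintegral integral0. Qed.

Lemma Int_sum (J : Type) (s : seq J) (F : J -> R -> R) :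
  (forall j, Ig (F j)) ->
  \int[leb]_x (\sum_(j <- s) F j x) = \sum_(j <- s) \int[leb]_x F j x.
Proof.
move=> iF; elim: s => [|j s IH].
  by rewrite big_nil; under Int_ext do rewrite big_nil; exact: Int0.
rewrite big_cons -IH -IntD//; last exact: Ig_sum.
by apply: Int_ext => x; rewrite big_cons.
Qed.

Lemma Int_ge0 f : (forall x, 0 <= f x) -> 0 <= \int[leb]_x f x.
Proof. by move=> f0; apply: Rintegral_ge0. Qed.

Lemma Int_le f g : Ig f -> Ig g -> (forall x, f x <= g x) ->
  \int[leb]_x f x <= \int[leb]_x g x.
Proof. by move=> fi gi fg; apply: le_Rintegral. Qed.

Lemma Int_norm f : Ig f -> `|\int[leb]_x f x| <= \int[leb]_x `|f x|.
Proof. exact: le_normr_Rintegral. Qed.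

Lemma Int_le_norm f g : Ig f -> Ig g -> (forall x, `|f x| <= g x) ->
  `|\int[leb]_x f x| <= \int[leb]_x g x.
Proof.
move=> fi gi fg; apply: (le_trans (Int_norm fi)).
by apply: Int_le => //; exact: Ig_abs.
Qed.

Lemma IntE f : Ig f -> (\int[leb]_x f x)%:E = (\int[leb]_x (f x)%:E)%E.
Proof. by move=> fi; rewrite fineK//; exact: integrable_fin_num. Qed.

Lemma Ig_lty f : measurable_fun setT f ->
  (\int[leb]_x (`|f x|%:E) < +oo)%E -> Ig f.
Proof. by move=> mf h; apply/integrableP; split => //; exact/measurable_EFinP. Qed.

Lemma lty_Ig f : Ig f -> (\int[leb]_x (`|f x|%:E) < +oo)%E.
Proof. by move/integrableP => []. Qed.

(** * Square-integrable functions and the Cauchy-Schwarz inequality *)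

Definition L2 f : Prop := measurable_fun setT f /\ Ig (fun x => f x ^+ 2).
Definition n2 f : R := \int[leb]_x (f x ^+ 2).

Lemma n2_ge0 f : 0 <= n2 f.
Proof. by apply: Int_ge0 => x; exact: sqr_ge0. Qed.

Lemma L2M_Ig f g : L2 f -> L2 g -> Ig (fun x => f x * g x).
Proof.
move=> [mf fi] [mg gi]; apply: (@Ig_le _ (fun x => f x ^+ 2 + g x ^+ 2)).
- exact: measurable_funM.
- exact: IgD.
- move=> x; rewrite [X in _ <= X]ger0_norm ?addr_ge0 ?sqr_ge0// normrM.
  rewrite -(real_normK (num_real (f x))) -(real_normK (num_real (g x))).
  have := sqr_ge0 (`|f x| - `|g x|).
  have := normr_ge0 (f x); have := normr_ge0 (g x); nra.
Qed.

Lemma L2_le f g : measurable_fun setT f -> L2 g ->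
  (forall x, `|f x| <= `|g x|) -> L2 f.
Proof.
move=> mf [mg gi] fg; split => //; apply: (Ig_le _ gi).
  exact: measurable_funX.
by move=> x; rewrite !normrX lerXn2r ?nnegrE.
Qed.

Lemma L2Z c f : L2 f -> L2 (fun x => c * f x).
Proof.
move=> [mf fi]; split; first exact: measurable_funM.
by under eq_fun do rewrite exprMn; exact: IgZ.
Qed.

Lemma L2D f g : L2 f -> L2 g -> L2 (fun x => f x + g x).
Proof.
move=> Lf Lg; split; first by apply: measurable_funD; [case: Lf|case: Lg].
rewrite (_ : (fun x => _) = (fun x => f x ^+ 2 + (2 * (f x * g x) + g x ^+ 2))).
  apply: IgD; first by case: Lf.
  by apply: IgD; [apply: IgZ; exact: L2M_Ig|case: Lg].
by apply/funext => x; ring.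
Qed.

Lemma L2N f : L2 f -> L2 (fun x => - f x).
Proof. by move/(L2Z (-1)); under eq_fun do rewrite mulN1r. Qed.

Lemma L2B f g : L2 f -> L2 g -> L2 (fun x => f x - g x).
Proof. by move=> Lf Lg; apply: L2D => //; exact: L2N. Qed.

Lemma L20 : L2 (fun=> 0).
Proof. by split=> //; under eq_fun do rewrite expr0n; exact: Ig0. Qed.

Lemma L2_sum (J : Type) (s : seq J) (F : J -> R -> R) :
  (forall j, L2 (F j)) -> L2 (fun x => \sum_(j <- s) F j x).
Proof.
move=> iF; elim: s => [|j s IH].
  by under eq_fun do rewrite big_nil; exact: L20.
by under eq_fun do rewrite big_cons; exact: L2D.
Qed.

Lemma L2Mb M f g : L2 f -> measurable_fun setT g -> (forall x, `|g x| <= M) ->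
  L2 (fun x => f x * g x).
Proof.
move=> Lf mg gM; apply: (@L2_le _ (fun x => M * f x)).
- by apply: measurable_funM => //; case: Lf.
- exact: L2Z.
- move=> x; rewrite !normrM mulrC ler_wpM2r//.
  exact: le_trans (gM x) (ler_norm _).
Qed.

Lemma n2Z c f : L2 f -> n2 (fun x => c * f x) = c ^+ 2 * n2 f.
Proof.
move=> [mf fi]; rewrite /n2 -IntZ//.
by apply: Int_ext => x; rewrite exprMn.
Qed.

Lemma n2D f g : L2 f -> L2 g ->
  n2 (fun x => f x + g x) = n2 f + 2 * \int[leb]_x (f x * g x) + n2 g.
Proof.
move=> Lf Lg; have ifg := L2M_Ig Lf Lg; case: Lf Lg => [mf fi] [mg gi].
rewrite /n2 -IntZ// -IntD//; last exact: IgZ.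
rewrite -IntD//; last by apply: IgD => //; exact: IgZ.
by apply: Int_ext => x; ring.
Qed.

Lemma CS f g : L2 f -> L2 g ->
  (\int[leb]_x (f x * g x)) ^+ 2 <= n2 f * n2 g.
Proof.
move=> Lf Lg; set d := \int[leb]_x _.
have key c : 0 <= n2 f + 2 * (c * d) + c ^+ 2 * n2 g.
  have := n2_ge0 (fun x => f x + c * g x).
  rewrite n2D//; last exact: L2Z.
  rewrite n2Z// (_ : \int[leb]_x (f x * (c * g x)) = c * d)//.
  rewrite /d -IntZ; last exact: L2M_Ig.
  by apply: Int_ext => x; ring.
have [g0|g0] := eqVneq (n2 g) 0.
  have [->|d0] := eqVneq d 0; first by rewrite expr0n/= mulr_ge0// n2_ge0.
  (* When g has norm 0 the quadratic is affine in c; this c makes it equal to - n2 f - 2, which is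
     negative. *)
  have := key (- (n2 f + 1) / d).
  rewrite g0 !mulr0 addr0 divfK//.
  by have := n2_ge0 f; lra.
have g1 : 0 < n2 g by rewrite lt_def g0 n2_ge0.
have := key (- d / n2 g).
rewrite -(ler_pM2r g1) mul0r.
have -> : (n2 f + 2 * (- d / n2 g * d) + (- d / n2 g) ^+ 2 * n2 g) * n2 g =
  n2 f * n2 g - d ^+ 2 by field.
by rewrite subr_ge0.
Qed.

Lemma CS_abs f g : L2 f -> L2 g ->
  `|\int[leb]_x (f x * g x)| <= Num.sqrt (n2 f) * Num.sqrt (n2 g).
Proof.
move=> Lf Lg; rewrite -sqrtrM ?n2_ge0// -(sqrtr_sqr (\int[leb]_x _)).
by rewrite ler_sqrt ?mulr_ge0 ?n2_ge0// CS.
Qed.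

Lemma n2_le f g : L2 f -> L2 g -> (forall x, `|f x| <= `|g x|) -> n2 f <= n2 g.
Proof.
move=> [mf fi] [mg gi] fg; apply: Int_le => // x.
rewrite -(real_normK (num_real (f x))) -(real_normK (num_real (g x))).
by rewrite lerXn2r ?nnegrE.
Qed.

Lemma sqrt_n2D f g : L2 f -> L2 g ->
  Num.sqrt (n2 (fun x => f x + g x)) <= Num.sqrt (n2 f) + Num.sqrt (n2 g).
Proof.
move=> Lf Lg; rewrite -[leRHS]ger0_norm ?addr_ge0 ?sqrtr_ge0//.
rewrite -sqrtr_sqr ler_sqrt ?sqr_ge0// n2D// sqrrD !sqr_sqrtr ?n2_ge0// lerD2r lerD2l.
have := CS_abs Lf Lg; have := ler_norm (\int[leb]_x (f x * g x)).
by rewrite mulr2n; lra.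
Qed.

Lemma L2_abs f : L2 f -> L2 (fun x => `|f x|).
Proof.
move=> Lf; apply: (L2_le _ Lf) => [|x]; last by rewrite normr_id.
by apply: measurableT_comp => //; case: Lf.
Qed.

Lemma n2_abs f : n2 (fun x => `|f x|) = n2 f.
Proof. by apply: Int_ext => x; rewrite real_normK// num_real. Qed.

Lemma Int_ae f g : measurable_fun setT f -> measurable_fun setT g ->
  {ae leb, forall x, f x = g x} -> \int[leb]_x f x = \int[leb]_x g x.
Proof.
move=> mf mg fg; congr fine; apply: ae_eq_integral => //.
- exact/measurable_EFinP.
- exact/measurable_EFinP.
- by apply: filterS fg => x + _ => /= ->.
Qed.

Lemma DCT (F : nat -> R -> R) f g : (forall n, measurable_fun setT (F n)) ->
  measurable_fun setT f -> Ig g -> (forall n x, `|F n x| <= g x) ->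
  {ae leb, forall x, F ^~ x @ \oo --> f x} ->
  Ig f /\ \int[leb]_x F n x @[n --> \oo] --> \int[leb]_x f x.
Proof.
move=> mF mf gi Fg Ff.
have mF' n : measurable_fun setT (EFin \o F n) by exact/measurable_EFinP.
have mf' : measurable_fun setT (EFin \o f) by exact/measurable_EFinP.
have Ff' : {ae leb, forall x, setT x -> (fun n => (EFin \o F n) x) @ \oo --> (EFin \o f) x}.
  by apply: filterS Ff => x h _; apply: cvg_EFin => //; exact: nearW.
have Fg' : {ae leb, forall x n, setT x -> (`|(EFin \o F n) x| <= (EFin \o g) x)%E}.
  by apply: aeW => x n _; rewrite lee_fin.
have [i1 _ i2] := @dominated_convergence _ _ _ leb _ measurableT _ _ _ mF' mf' Ff' gi Fg'.
split => //; apply: fine_cvg; rewrite IntE//.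
Qed.


(** The image of Lebesgue measure under x -> c x + a, scaled by c, gives each interval ]u, v] its
    length, and this characterises Lebesgue measure. *)
Lemma ge0_int_affine (c a : R) (f : R -> \bar R) : 0 < c ->
  measurable_fun setT f -> (forall x, 0 <= f x)%E ->
  (\int[leb]_x f (c * x + a)%R = (c^-1)%:E * \int[leb]_x f x)%E.
Proof.
move=> c0 mf f0.
pose phi : measurableTypeR R -> measurableTypeR R := fun x => c * x + a.
have mphi : measurable_fun [set: measurableTypeR R] phi.
  by apply: measurable_funD => //; apply: measurable_funM.
have [m' m'E] : exists m' : {measure set (measurableTypeR R) -> \bar R},
    (forall A, m' A = leb (phi @^-1` A)) /\
    (\int[m']_x f x = \int[leb]_x f (phi x))%E.
  unshelve eexists; first exact: (pushforward leb phi).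
  by split => //; rewrite (ge0_integral_pushforward mphi).
have cge : (0 <= c)%R by exact: ltW.
have mE A : measurable A -> leb A = mscale (NngNum cge) m' A.
  apply: lebesgue_measure_unique => _ [[u v] /= _ <-].
  rewrite /mscale/= m'E.1.
  have -> : phi @^-1` `]u, v]%classic = `](u - a) / c, (v - a) / c]%classic.
    apply/seteqP; split=> x /=; rewrite !in_itv/= /phi => /andP[h1 h2].
      by apply/andP; split; rewrite ?ltr_pdivrMr ?ler_pdivlMr// mulrC; lra.
    move: h1 h2; rewrite ltr_pdivrMr// ler_pdivlMr// mulrC => h1 h2.
    by apply/andP; split; lra.
  rewrite !lebesgue_measure_itv/= !lte_fin ltr_pM2r ?invr_gt0//.
  rewrite ltrD2r; case: ifPn => _; last by rewrite mule0.
  by rewrite -!EFinD -EFinM; congr EFin; field; rewrite gt_eqF.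
have -> : (\int[leb]_x f x = \int[mscale (NngNum cge) m']_x f x)%E.
  by apply: eq_measure_integral => A mA _; exact: mE.
rewrite ge0_integral_mscale//= muleA -EFinM mulVf ?gt_eqF// mul1e.
by rewrite m'E.2.
Qed.

Lemma ge0_int_opp (f : R -> \bar R) :
  measurable_fun setT f -> (forall x, 0 <= f x)%E ->
  (\int[leb]_x f (- x)%R = \int[leb]_x f x)%E.
Proof.
move=> mf f0.
have [m' m'E] : exists m' : {measure set (measurableTypeR R) -> \bar R},
    (forall A, m' A = leb ((-%R : R -> measurableTypeR R) @^-1` A)) /\
    (\int[m']_x f x = \int[leb]_x f (- x)%R)%E.
  unshelve eexists; first exact: (pushforward leb (-%R : R -> measurableTypeR R)).
  split => //; rewrite ge0_integral_pushforward//.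
rewrite -m'E.2; apply: eq_measure_integral => A mA _.
by rewrite m'E.1; exact: lebesgue_measureN.
Qed.

(** Positive and negative parts transfer a change of variables from nonnegative extended-valued
    functions to integrable real ones. The map [phi] stays abstract so as to serve affine maps and
    the reflection alike. *)
Lemma Ig_map (phi : R -> R) k f : 0 <= k -> measurable_fun setT phi ->
  (forall g : R -> \bar R, measurable_fun setT g -> (forall x, 0 <= g x)%E ->
    (\int[leb]_x g (phi x) = k%:E * \int[leb]_x g x)%E) ->
  Ig f -> Ig (fun x => f (phi x)) /\
    \int[leb]_x f (phi x) = k * \int[leb]_x f x.
Proof.
move=> k0 mphi H fi.
have pos g : Ig g -> (forall x, 0 <= g x) ->
    Ig (fun x => g (phi x)) /\ \int[leb]_x g (phi x) = k * \int[leb]_x g x.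
  move=> gi g0; have mg := Ig_meas gi.
  have e : (\int[leb]_x (g (phi x))%:E = k%:E * \int[leb]_x (g x)%:E)%E.
    by rewrite (H (EFin \o g))//; exact/measurable_EFinP.
  have i : Ig (fun x => g (phi x)).
    apply: Ig_lty; first exact: (measurableT_comp mg).
    under eq_integral do rewrite ger0_norm//.
    by rewrite e -IntE// -EFinM ltry.
  by split => //; apply: EFin_inj; rewrite IntE// e -IntE.
have ip : Ig (fun x => Num.max (f x) 0).
  apply: (Ig_le _ fi); first exact: measurable_maxr (Ig_meas fi) _.
  by move=> x; rewrite ger0_norm ?le_max ?lexx ?orbT// ge_max normr_ge0 ler_norm.
have iN : Ig (fun x => Num.max (- f x) 0).
  apply: (Ig_le _ fi); first exact: measurable_maxr (Ig_meas (IgN fi)) _.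
  by move=> x; rewrite ger0_norm ?le_max ?lexx ?orbT// ge_max normr_ge0 -normrN ler_norm.
have fE x : f x = Num.max (f x) 0 - Num.max (- f x) 0.
  by have [h|h] := leP (f x) 0; [rewrite max_l|rewrite max_r]; lra.
have [i1 e1] := pos _ ip (fun x => ltac:(by rewrite le_max lexx orbT)).
have [i2 e2] := pos _ iN (fun x => ltac:(by rewrite le_max lexx orbT)).
split.
  by rewrite (_ : (fun x => _) = (fun x => Num.max (f (phi x)) 0 -
    Num.max (- f (phi x)) 0)); [exact: IgB|apply/funext => x; exact: fE].
rewrite (Int_ext (fun x => fE (phi x))) (Int_ext fE) !IntB// e1 e2.
by rewrite mulrBr.
Qed.

Lemma Ig_affine c a f : 0 < c -> Ig f -> Ig (fun x => f (c * x + a)).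
Proof.
move=> c0 fi; apply: (Ig_map (ltac:(rewrite invr_ge0; exact: ltW) : 0 <= c^-1) _ _ fi).1.
- by apply: measurable_funD => //; apply: measurable_funM.
- by move=> g mg g0; exact: ge0_int_affine.
Qed.

Lemma Int_affine c a f : 0 < c -> Ig f ->
  \int[leb]_x f (c * x + a) = c^-1 * \int[leb]_x f x.
Proof.
move=> c0 fi; apply: (Ig_map (ltac:(rewrite invr_ge0; exact: ltW) : 0 <= c^-1) _ _ fi).2.
- by apply: measurable_funD => //; apply: measurable_funM.
- by move=> g mg g0; exact: ge0_int_affine.
Qed.

Lemma Ig_shift a f : Ig f -> Ig (fun x => f (x + a)).
Proof.
by move=> /(Ig_affine a (@ltr01 R)); under eq_fun do rewrite mul1r.
Qed.

Lemma Int_shift a f : Ig f -> \int[leb]_x f (x + a) = \int[leb]_x f x.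
Proof.
move=> fi; rewrite -[RHS]mul1r -[X in X * _]invr1 -(Int_affine a)//.
by apply: Int_ext => x; rewrite mul1r.
Qed.

Lemma Ig_opp f : Ig f -> Ig (fun x => f (- x)).
Proof.
move=> fi; apply: (Ig_map (@ler01 R) _ _ fi).1 => // g mg g0.
by rewrite mul1e ge0_int_opp.
Qed.

Lemma Int_opp f : Ig f -> \int[leb]_x f (- x) = \int[leb]_x f x.
Proof.
move=> fi; rewrite -[RHS]mul1r.
by apply: (Ig_map (@ler01 R) _ _ fi).2 => // g mg g0; rewrite mul1e ge0_int_opp.
Qed.

Lemma Int_odd f : Ig f -> (forall x, f (- x) = - f x) -> \int[leb]_x f x = 0.
Proof.
move=> fi fodd; have := Int_opp fi; rewrite (Int_ext fodd) IntN//; lra.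
Qed.

(** [H] may be infinite on a null set, where [fine] puts 0 without changing the integral. This is
    how the inner integrals of Fubini's theorem become real functions. *)
Lemma Ig_fine (H : R -> \bar R) : leb.-integrable setT H ->
  Ig (fine \o H) /\ \int[leb]_x fine (H x) = fine (\int[leb]_x H x).
Proof.
move=> iH; have mH := measurable_int _ iH.
have mfH : measurable_fun setT (EFin \o (fine \o H)).
  by apply/measurable_EFinP; exact: measurableT_comp.
have e : ae_eq leb setT (EFin \o (fine \o H)) H.
  apply: filterS (integrable_ae measurableT iH) => x /(_ Logic.I) h _ /=.
  by rewrite fineK.
split; last by congr fine; apply: ae_eq_integral.
apply: (le_integrable measurableT _ _ iH) => [|x _] /=; first exact: mfH.
by case: (H x) => [r| |] //=; rewrite ?normr0 ?lee_fin ?leey.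
Qed.

Lemma Fubini_real (F : R -> R -> R) :
  measurable_fun setT (fun p : R * R => F p.1 p.2) ->
  (\int[leb]_x \int[leb]_y (`|F x y|%:E) < +oo)%E ->
  [/\ Ig (fun x => \int[leb]_y F x y), Ig (fun y => \int[leb]_x F x y) &
  \int[leb]_x (\int[leb]_y F x y) = \int[leb]_y (\int[leb]_x F x y)].
Proof.
move=> mF Foo; pose G (p : R * R) := (F p.1 p.2)%:E.
have mG : measurable_fun setT G by exact/measurable_EFinP.
have iG : ((leb \x leb).-integrable setT G)%E by apply/integrable12ltyP.
have [i1 e1] := Ig_fine (integrable_fubini_F iG).
pose G' (p : R * R) := (F p.2 p.1)%:E.
have mG' : measurable_fun setT G'.
  exact: (measurableT_comp mG (@measurable_swap _ _ R R)).
have iG' : ((leb \x leb).-integrable setT G')%E.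
  apply/integrable12ltyP => //.
  have <- := @fubini_tonelli _ _ _ _ _ leb leb (abse \o G) _ (fun=> abse_ge0 _) => //.
  exact: measurableT_comp.
have [i2 e2] := Ig_fine (integrable_fubini_F iG').
split; [exact: i1|exact: i2|].
rewrite [LHS]e1 [RHS]e2; congr fine; exact: Fubini.
Qed.

Lemma measurable_int_y (F : R -> R -> R) :
  measurable_fun setT (fun p : R * R => F p.1 p.2) -> (forall x y, 0 <= F x y) ->
  measurable_fun setT (fun x => \int[leb]_y (F x y)%:E)%E.
Proof.
move=> mF F0.
have := @measurable_fun_fubini_tonelli_F _ _ _ _ _ leb (fun p : R * R => (F p.1 p.2)%:E).
apply => [|p]; last by rewrite lee_fin.
exact/measurable_EFinP.
Qed.

Lemma Fubini_prod (F : R -> R -> R) (a b : R -> R) :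
  measurable_fun setT (fun p : R * R => F p.1 p.2) -> Ig a -> Ig b ->
  (forall x y, `|F x y| <= a x * b y) ->
  [/\ Ig (fun x => \int[leb]_y F x y), Ig (fun y => \int[leb]_x F x y) &
  \int[leb]_x (\int[leb]_y F x y) = \int[leb]_y (\int[leb]_x F x y)].
Proof.
move=> mF ia ib Fab; apply: Fubini_real => //.
have Fab' x y : `|F x y| <= `|a x| * `|b y|.
  by rewrite -normrM; exact: le_trans (Fab _ _) (ler_norm _).
have mFx x : measurable_fun setT (fun y => `|F x y|%:E).
  apply/measurable_EFinP; apply: measurableT_comp => //.
  exact: (measurableT_comp mF (measurable_pair1 x)).
have iA : Ig (fun x => `|a x| * \int[leb]_y `|b y|).
  by under eq_fun do rewrite mulrC; apply: IgZ; exact: Ig_abs.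
apply: (@le_lt_trans _ _ (\int[leb]_x (`|a x| * \int[leb]_y `|b y|)%:E)%E).
  apply: ge0_le_integral => //.
  - by move=> x _; apply: integral_ge0.
  - apply: measurable_int_y => //; exact: measurableT_comp.
  - by apply/measurable_EFinP; exact: Ig_meas iA.
  - move=> x _; rewrite -IntZ; last exact: Ig_abs.
    rewrite IntE; last by apply: IgZ; exact: Ig_abs.
    apply: ge0_le_integral => //; first exact: mFx.
    + by apply/measurable_EFinP; apply: Ig_meas; apply: IgZ; exact: Ig_abs.
    + by move=> y _; rewrite lee_fin.
have := lty_Ig iA; congr (_ < _)%E; apply: eq_integral => x _.
by rewrite ger0_norm// mulr_ge0// Int_ge0.
Qed.

End RealIntegrals.

(** * Van der Corput's second derivative test *)
Section VanDerCorput.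
Context {R : realType}.
Implicit Types (u : nat -> R) (x y t : R).

Definition cot y := cos y / sin y.

(** Real part of e^(ix) = (e^(i(x+y)) - e^(ix)) / (e^(iy) - 1), where 1 / (e^(iy) - 1) = - 1/2 -
    (i/2) cot (y/2). *)
Lemma cos_abel x y : sin (y / 2) != 0 ->
  cos x = - 2^-1 * (cos (x + y) - cos x) + 2^-1 * (cot (y / 2) * (sin (x + y) - sin x)).
Proof.
set h := y / 2 => s0.
suff H z : cos (z - h) = - 2^-1 * (cos (z + h) - cos (z - h)) +
    2^-1 * (cot h * (sin (z + h) - sin (z - h))).
  have := H (x + h); rewrite addrK (_ : x + h + h = x + y)//.
  by rewrite /h; field.
by rewrite !cosD !sinD !cosN !sinN /cot; field.
Qed.

Lemma cot_le x y : 0 < sin x * sin y -> 0 <= sin (y - x) -> cot y <= cot x.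
Proof.
move=> s0 sxy; have [x0 y0] : sin x != 0 /\ sin y != 0.
  by split; apply: contraTneq s0 => ->; rewrite ?mul0r ?mulr0 ltxx.
rewrite -subr_ge0 (_ : cot x - cot y = sin (y - x) / (sin x * sin y)).
  by rewrite divr_ge0// ltW.
rewrite sinB /cot; field.
by rewrite x0 y0.
Qed.

(** Summation by parts against the weights cot (d k / 2). As these decrease, their total variation
    telescopes to the difference of the end values, so that only the bound [G] at the two ends
    enters. *)
Lemma kusmin_landau u n (G : R) : let d k := u k.+1 - u k in
  (forall k, (k <= n)%N -> sin (d k / 2) != 0) ->
  (forall k, (k < n)%N -> cot (d k.+1 / 2) <= cot (d k / 2)) ->
  (`|cot (d 0%N / 2)| <= G) -> (`|cot (d n / 2)| <= G) ->
  `|\sum_(0 <= k < n.+1) cos (u k)| <= 1 + 2 * G.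
Proof.
move=> d s0 mono g0 gn; pose g k := cot (d k / 2).
have E : \sum_(0 <= k < n.+1) cos (u k) = - 2^-1 * (cos (u n.+1) - cos (u 0%N)) +
    2^-1 * \sum_(0 <= k < n.+1) (g k * (sin (u k.+1) - sin (u k))).
  rewrite -(telescope_sumr (fun k => cos (u k)))// !mulr_sumr -big_split/=.
  rewrite !big_nat; apply: eq_bigr => k /andP[_ kn].
  have := @cos_abel (u k) (d k); rewrite [u k + _]addrC subrK; apply.
  exact: s0.
have A m : (m <= n)%N -> `|\sum_(0 <= k < m.+1) (g k * (sin (u k.+1) - sin (u k)))
    - g m * sin (u m.+1) + g 0%N * sin (u 0%N)| <= g 0%N - g m.
  elim: m => [_|m IH mn].
    by rewrite big_nat1 subrr (_ : _ + _ = 0) ?normr0//; ring.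
  rewrite big_nat_recr//=; set S := \sum_(_ <= _ < _) _ in IH *.
  have -> : S + g m.+1 * (sin (u m.+2) - sin (u m.+1)) - g m.+1 * sin (u m.+2) +
    g 0%N * sin (u 0%N) = (S - g m * sin (u m.+1) + g 0%N * sin (u 0%N)) +
    (g m - g m.+1) * sin (u m.+1) by ring.
  have h := mono m mn; rewrite -/(g m) -/(g m.+1) in h.
  apply: (le_trans (ler_normD _ _)).
  have -> : g 0%N - g m.+1 = (g 0%N - g m) + (g m - g m.+1) by ring.
  apply: lerD; first by apply: IH; exact: ltnW.
  by rewrite normrM ger0_norm ?subr_ge0// ler_piMr ?subr_ge0// sin_max.
have := A n (leqnn n); rewrite E.
set S := \sum_(_ <= _ < _) _.
have := cos_max (u n.+1); have := cos_max (u 0%N).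
have := sin_max (u n.+1); have := sin_max (u 0%N).
move: g0 gn; rewrite -/(g 0%N) -/(g n).
move: (g 0%N) (g n) (cos _) (cos _) (sin _) (sin _) S => a b c1 c2 s1 s2 S.
rewrite !ler_norml => /andP[a1 a2] /andP[b1 b2] h1 h2 h3 h4 /andP[h5 h6].
have : `|a * s2| <= G.
  rewrite normrM; apply: (@le_trans _ _ `|a|); last by rewrite ler_norml a1.
  by rewrite ler_piMr// ler_norml.
have : `|b * s1| <= G.
  rewrite normrM; apply: (@le_trans _ _ `|b|); last by rewrite ler_norml b1.
  by rewrite ler_piMr// ler_norml.
rewrite !ler_norml => /andP[h7 h8] /andP[h9 h10].
by move: h3 h4 => /andP[h11 h12] /andP[h13 h14]; apply/andP; split; lra.
Qed.

Lemma mulr_cos_le_sin y : 0 <= y -> y <= pi / 2 -> y * cos y <= sin y.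
Proof.
move=> y0 yp; rewrite -subr_ge0.
have d (x : R) : is_derive x 1 (fun z : R => sin z - z * cos z) (x * sin x).
  apply: is_derive_eq; rewrite /GRing.scale/=; ring.
have [->|yn0] := eqVneq y 0; first by rewrite sin0 mul0r subrr.
have ygt0 : 0 < y by rewrite lt_def yn0.
have [|c /[!in_itv]/= /andP[c0 cy] e] := @MVT _ (fun z : R => sin z - z * cos z)
  (fun x => x * sin x) 0 y ygt0 (fun x _ => d x).
  apply: continuous_subspaceT => x.
  by apply: differentiable_continuous; apply/derivable1_diffP; case: (d x).
move: e; rewrite sin0 mul0r subr0 subr0 => ->.
rewrite !mulr_ge0 ?subr0 ?(ltW c0) ?(ltW ygt0)//.
by apply: sin_ge0_pi; rewrite ltW//=; move: (@pi_ge0 R); lra.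
Qed.

(** Up to pi/2 this is y cos y <= sin y, that is tan y >= y; between pi/2 and 3 pi/4 the cotangent
    is at most 1 in absolute value, hence at most 1/r. The range 3 pi/4 is half of the range 3 pi/2
    allowed to phase increments. *)
Lemma cot_bound (r y : R) : 0 < r -> r <= 1 -> r <= `|y| -> `|y| <= 3 * pi / 4 ->
  sin y != 0 /\ `|cot y| <= r^-1.
Proof.
move=> r0 r1; have p0 := @pi_gt0 R.
wlog y0 : y / 0 <= y => [H|].
  have [y0|y0] := leP 0 y; first exact: H.
  move=> h1 h2; have [|||h3 h4] := H (- y); rewrite ?normrN//; first by lra.
  rewrite sinN oppr_eq0 in h3; split=> //.
  by move: h4; rewrite /cot sinN cosN invrN mulrN normrN.
rewrite ger0_norm// => ry y3.
have s0 : 0 < sin y by apply: sin_gt0_pi; apply/andP; split; lra.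
split; first exact: lt0r_neq0.
rewrite /cot normf_div (gtr0_norm s0) ler_pdivrMr// [r^-1 * _]mulrC ler_pdivlMr//.
have [yp|yp] := leP y (pi / 2).
  rewrite ger0_norm; last by apply: cos_ge0_pihalf; apply/andP; split; lra.
  apply: le_trans (mulr_cos_le_sin y0 yp); rewrite mulrC ler_wpM2r//.
  by apply: cos_ge0_pihalf; apply/andP; split; lra.
apply: (@le_trans _ _ `|cos y|); first by rewrite ler_piMr.
have -> : y = y - pi / 2 + pi / 2 by ring.
set z := y - pi / 2; rewrite cosDpihalf sinDpihalf normrN.
have z0 : 0 <= z by rewrite /z; lra.
have z4 : z <= pi / 4 by rewrite /z; lra.
rewrite ger0_norm; last by apply: sin_ge0_pi; rewrite z0/=; lra.
have c4 : 0 < cos (pi / 4 : R) by apply: cos_gt0_pihalf; apply/andP; split; lra.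
have s4 : sin (pi / 4 : R) = cos (pi / 4).
  by have := tan_piquarter R; rewrite /tan => /(congr1 (fun w => w * cos (pi / 4)));
    rewrite divfK ?gt_eqF// mul1r.
have : 0 <= cos (z + pi / 4) by apply: cos_ge0_pihalf; apply/andP; split; lra.
by rewrite cosD s4 -mulrBl pmulr_lge0// subr_ge0.
Qed.

Lemma increasing_split (d : nat -> R) c n :
  (forall k, (k.+1 < n)%N -> d k <= d k.+1) ->
  exists a, [/\ (a <= n)%N, forall k, (k < a)%N -> d k < c &
    forall k, (a <= k)%N -> (k < n)%N -> c <= d k].
Proof.
elim: n => [_|n IH H]; first by exists 0%N; split.
have [k kn|a [an h1 h2]] := IH; first by apply: H; exact: ltnW.
have [ean|nan] := eqVneq a n; last first.
  have {}an : (a < n)%N by rewrite ltn_neqAle nan.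
  exists a; split => [|//|k ak]; first exact: leq_trans (ltnW an) (leqnSn n).
 rewrite ltnS leq_eqVlt => /orP[/eqP ->|]; last exact: h2.
  have n0 : (0 < n)%N by exact: leq_ltn_trans an.
  apply: (@le_trans _ _ (d n.-1)); first by apply: h2; rewrite ?ltn_predL// -ltnS prednK.
  by have := H n.-1; rewrite prednK//; apply.
have [h|h] := ltP (d n) c.
  exists n.+1; split => // k.
    by rewrite ltnS leq_eqVlt => /orP[/eqP ->//|]; rewrite -ean; exact: h1.
  by move=> n1k kn1; have := leq_ltn_trans n1k kn1; rewrite ltnn.
exists n; split => // [k|k nk]; first by rewrite -ean; exact: h1.
by rewrite ltnS => kn; have -> : k = n by apply/eqP; rewrite eqn_leq kn.
Qed.

(** Half-increments lie between r/2 and 3 pi/4 in absolute value, where the cotangent is at most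
    2/r. That consecutive increments grow by at most 1 keeps the sine of their half-difference
    nonnegative, so the cotangent decreases. *)
Lemma kusmin_landau_bound u n (r : R) : let d k := u k.+1 - u k in
  0 < r -> r <= 1 ->
  (forall k, (k <= n)%N -> r <= d k <= 3 * pi / 2) \/
  (forall k, (k <= n)%N -> r <= - d k <= 3 * pi / 2) ->
  (forall k, (k < n)%N -> d k <= d k.+1 <= d k + 1) ->
  `|\sum_(0 <= k < n.+1) cos (u k)| <= 1 + 4 / r.
Proof.
move=> d r0 r1 H mono; have p2 := @pi_ge2 R.
have B k : (k <= n)%N -> r / 2 <= `|d k / 2| /\ `|d k / 2| <= 3 * pi / 4.
  move=> kn; have rk : r <= `|d k| <= 3 * pi / 2.
    case: H => /(_ k kn) /andP[h1 h2]; first by rewrite ger0_norm ?h1//; lra.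
    by rewrite ler0_norm ?h1//; lra.
  by rewrite normf_div (@ger0_norm _ 2)//; move/andP: rk => [h1 h2]; split; lra.
have r20 : 0 < r / 2 by lra.
have r21 : r / 2 <= 1 by lra.
have C k : (k <= n)%N -> sin (d k / 2) != 0 /\ `|cot (d k / 2)| <= (r / 2)^-1.
  by move=> /B[h1 h2]; exact: cot_bound.
have -> : 1 + 4 / r = 1 + 2 * (r / 2)^-1 by field; rewrite gt_eqF.
apply: kusmin_landau => [k /C[]//|k kn||]; [|exact: (C 0%N _).2|exact: (C n _).2].
have /andP[m1 m2] := mono k kn; apply: cot_le.
  case: H => H; have := H k (ltnW kn); have := H _ kn => /andP[h1 h2] /andP[h3 h4];
      rewrite /d in h1 h2 h3 h4 m1 m2.
    by apply: mulr_gt0; apply: sin_gt0_pi; apply/andP; split; lra.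
  rewrite -mulrNN -!sinN -!mulNr.
  by apply: mulr_gt0; apply: sin_gt0_pi; apply/andP; split; lra.
by rewrite /d in m1 m2; apply: sin_ge0_pi; apply/andP; split; lra.
Qed.

Lemma cos_2pi_int x (m : int) : cos (x - m%:~R * (2 * pi)) = cos x.
Proof.
have P n y : cos (y + n%:R * (2 * pi)) = cos y.
  rewrite (_ : n%:R * (2 * pi) = (pi *+ 2) *+ n); last by rewrite mulr_natl [2 * pi]mulr_natl.
  by elim: n => [|n IH]; rewrite ?mulr0n ?addr0// mulrSr addrA cosD2pi.
case: m => n; last by rewrite NegzE mulrNz mulNr opprK P.
by have := P n (x - n%:R * (2 * pi)); rewrite subrK => ->.
Qed.

(** The second derivative test: increments grow by at least [l] at each step, so at most 2 r / l + 1
    of them lie within r of 0; before and after this zone the Kusmin-Landau bound applies. There is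
    one such zone because the increments vary by at most 1 altogether. *)
Lemma second_difference_sum u n (l r : R) : let d k := u k.+1 - u k in
  0 < l -> l <= 1 -> 0 < r -> r <= 1 ->
  (forall k, (k.+1 < n)%N -> l <= d k.+1 - d k) ->
  (forall k, (k < n)%N -> d k <= d 0%N + 1) ->
  `|\sum_(0 <= k < n) cos (u k)| <= 2 * (1 + 4 / r) + (2 * r / l + 1).
Proof.
move=> d l0 l1 r0 r1 dl d1; have p2 := @pi_ge2 R.
(* Subtracting [m] turns at each step leaves the cosines unchanged and brings the first increment
   into [- pi, pi[; all increments then stay below pi + 1 <= 3 pi / 2. *)
pose m := Num.floor ((d 0%N + pi) / (2 * pi)).
pose v k := u k - (m * k%:Z)%:~R * (2 * pi).
pose e k := v k.+1 - v k.
have eE k : e k = d k - m%:~R * (2 * pi).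
  by rewrite /e /v /d !intrM -natr1; ring.
have -> : \sum_(0 <= k < n) cos (u k) = \sum_(0 <= k < n) cos (v k).
  by apply: eq_bigr => k _; rewrite /v cos_2pi_int.
have /andP[m1 m2] : m%:~R <= (d 0%N + pi) / (2 * pi) < m%:~R + 1.
  by have := floor_itv ((d 0%N + pi) / (2 * pi)); rewrite intrD.
have pp : 0 < 2 * pi :> R by lra.
move: m1 m2; rewrite ler_pdivlMr// ltr_pdivrMr// => m1 m2.
have e0 : - pi <= e 0%N < pi by rewrite eE; apply/andP; split; lra.
have e0k k : (k < n)%N -> e 0%N <= e k.
  elim: k => [//|k IH kn]; apply: le_trans (IH (ltnW kn)) _.
  by rewrite !eE; have := dl k kn; lra.
have e1 k : (k < n)%N -> e k <= e 0%N + 1 by move=> /d1; rewrite !eE; lra.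
have emono k : (k.+1 < n)%N -> e k <= e k.+1 <= e k + 1.
  move=> kn; have := dl k kn; have := e1 _ kn; have := e0k _ (ltnW kn).
  by rewrite !eE => *; apply/andP; split; lra.
have [a [an a1 a2]] := increasing_split (- r) (fun k kn => proj1 (andP (emono k kn))).
have [b [bn b1 b2]] := increasing_split r (fun k kn => proj1 (andP (emono k kn))).
have ab : (a <= b)%N.
  rewrite leqNgt; apply/negP => ba.
  have := a1 _ ba; have := b2 b (leqnn b) (leq_trans ba an); lra.
rewrite (big_cat_nat (n := a))//= (big_cat_nat (n := b) (m := a))//=.
have S1 : `|\sum_(0 <= k < a) cos (v k)| <= 1 + 4 / r.
  case: a an a1 {a2 ab} => [|a] an a1.
    by rewrite big_nil normr0 addr_ge0// divr_ge0// ltW.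
  apply: kusmin_landau_bound => //.
    right => k ka; have := a1 k ka; have := e0k k (leq_ltn_trans ka an).
    rewrite -/(e k) => *; move/andP: e0 => [*]; apply/andP; split; lra.
  by move=> k ka; apply: emono; apply: leq_trans an.
have S3 : `|\sum_(b <= k < n) cos (v k)| <= 1 + 4 / r.
  rewrite -{1}(add0n b) big_addn; case E : (n - b)%N => [|c].
    by rewrite big_nil normr0 addr_ge0// divr_ge0// ltW.
  have bc k : (k <= c)%N -> (k + b < n)%N.
    by move=> kc; rewrite addnC -ltn_subRL E ltnS.
  apply: (@kusmin_landau_bound (fun k => v (k + b)%N)) => //.
    left => k kc; rewrite -/(e (k + b)%N); have := b2 _ (leq_addl k b) (bc k kc).
    have := e1 _ (bc k kc); move/andP: e0 => [*]; apply/andP; split; lra.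
  by move=> k kc; apply: emono; exact: (bc k.+1).
have S2 : `|\sum_(a <= k < b) cos (v k)| <= 2 * r / l + 1.
  apply: (le_trans (ler_norm_sum _ _ _)).
  apply: (@le_trans _ _ (\sum_(a <= k < b) 1)).
    by apply: ler_sum => k _; exact: cos_max.
  rewrite sumr_const_nat.
  have step j : (a + j < n)%N -> e a + l *+ j <= e (a + j)%N.
    elim: j => [|j IH] jn; first by rewrite addn0 mulr0n addr0.
    rewrite addnS in jn *; have := IH (ltnW jn); have := dl _ jn.
    by rewrite !eE mulrS; lra.
  case E : (b - a)%N => [|c]; first by rewrite mulr0n addr_ge0// divr_ge0 ?mulr_ge0// ltW.
  have bE : b = (a + c).+1 by rewrite -addnS -E subnKC.
  have acn : (a + c < n)%N by rewrite -bE.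
  have := step c acn; have := b1 (a + c)%N; rewrite bE => /(_ (leqnn _)).
  have := a2 a (leqnn a) (leq_ltn_trans (leq_addr c a) acn).
  move=> h1 h2 h3; rewrite -[c.+1%:R]natr1 lerD2r ler_pdivlMr// mulr_natl; lra.
apply: (le_trans (ler_normD _ _)); apply: (@le_trans _ _ (1 + 4 / r + (2 * r / l + 1 + (1 + 4 / r)))).
  by apply: lerD => //; apply: (le_trans (ler_normD _ _)); exact: lerD.
lra.
Qed.


(** Two mean values: one for x -> omega (x + 1) - omega x, the other for omega'. *)
Lemma second_difference_omega (omega : R -> R) (y : R) : 0 < y ->
  (forall x, derivable omega x 1) ->
  (forall x, 0 < x -> derivable (derive1 omega) x 1) ->
  exists2 z, y < z < y + 2 &
    omega (y + 2) - 2 * omega (y + 1) + omega y = derive1n 2 omega z.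
Proof.
move=> y0 d1 d2; pose g (x : R) := omega (x + 1) - omega x.
have dsh (f : R -> R) x : derivable f (x + 1) 1 ->
    is_derive x 1 (fun w : R => f (w + 1)) (derive1 f (x + 1)).
  move=> df; have dc : is_derive (x + 1) 1 f (derive1 f (x + 1)).
    by apply: DeriveDef => //; rewrite derive1E.
  have h1 : is_derive x 1 (fun w : R => w + 1) 1.
    by apply: is_derive_eq; rewrite addr0.
  have := @is_derive1_comp _ f (fun w : R => w + 1) x (derive1 f (x + 1)) 1 dc h1.
  by rewrite mulr1.
have dg x : is_derive x 1 g (derive1 omega (x + 1) - derive1 omega x).
  have h1 := dsh omega x (d1 _).
  have h2 : is_derive x 1 omega (derive1 omega x).
    by apply: DeriveDef => //; rewrite derive1E.
  exact: is_deriveB.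
have cont (f : R -> R) a b : (forall x, a <= x -> derivable f x 1) ->
    {within `[a, b], continuous f}.
  move=> df; apply: continuous_in_subspaceT => x /[!inE]/=.
  rewrite in_itv/= => /andP[ax _].
  by apply: differentiable_continuous; apply/derivable1_diffP; exact: df.
have [|c /[!in_itv]/= /andP[c0 c1]] := @MVT _ g _ y (y + 1)
  (ltac:(by rewrite ltrDl)) (fun x _ => dg x).
  by apply: cont => x _; case: (dg x).
have -> : y + 1 - y = 1 by ring.
rewrite mulr1 => e1.
have [|x /[!in_itv]/= /andP[x0 _]||z /[!in_itv]/= /andP[z0 z1] e2] :=
  @MVT _ (derive1 omega) (derive1 (derive1 omega)) c (c + 1).
- by rewrite ltrDl.
- by apply: DeriveDef; [apply: d2|rewrite derive1E]; lra.
- by apply: cont => x cx; apply: d2; lra.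
exists z; first by apply/andP; split; lra.
move: e2; have -> : c + 1 - c = 1 by ring.
rewrite mulr1 => <-; rewrite -e1 /g.
have -> : y + 1 + 1 = y + 2 by lra.
ring.
Qed.

(** Intermediate values. The hypothesis on omega'' controls its absolute value, while the second
    derivative test asks for monotone increments, hence for a constant sign. *)
Lemma constant_sign (f : R -> R) (a : R) :
  (forall x, a <= x -> {for x, continuous f}) -> (forall x, a <= x -> f x != 0) ->
  exists2 e : R, e = 1 \/ e = -1 & forall x, a <= x -> e * f x = `|f x|.
Proof.
move=> cf f0; exists (Num.sg (f a)).
  have := f0 a (lexx a); case: (ltrgtP (f a) 0) => h // _.
    by right; rewrite ltr0_sg.
  by left; rewrite gtr0_sg.
move=> x ax; have cw : {within `[a, x], continuous f}.
  apply: continuous_in_subspaceT => z /[!inE]/=.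
  by rewrite in_itv/= => /andP[az _]; exact: cf.
have [/eqP h|h] := eqVneq (Num.sg (f a)) (Num.sg (f x)).
  by rewrite (eqP h) -normrEsg.
exfalso; have [|c] := @IVT _ f a x 0 ax cw.
  move: h (f0 a (lexx a)) (f0 x ax); rewrite ge_min le_max.
  case: (ltrgtP (f a) 0) => ha; case: (ltrgtP (f x) 0) => hx//;
    rewrite ?(ltr0_sg ha) ?(ltr0_sg hx) ?(gtr0_sg ha) ?(gtr0_sg hx) ?eqxx//.
rewrite in_itv/= => /andP[ac _] fc; have := f0 c ac.
by rewrite fc eqxx.
Qed.

(** For |t| <= kappa / N the second differences of the phase lie, up to sign, between a multiple of
    |t| N^(alpha-1) and 1/N. The offset h lets one statement serve the torus (h = 0) and the line,
    where the integral over a block is an average over h of such sums. *)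
Theorem van_der_corput (alpha : R) (omega : R -> R) : 0 < alpha -> alpha <= 1 ->
  hypothesis1 alpha omega ->
  exists N0 : nat, exists kappa C : R, [/\ 0 < kappa, 0 < C &
    forall (N : nat) (x t h : R), (N0 < N)%N -> 0 <= h < 1 -> t != 0 ->
      `|t| <= kappa / N%:R ->
      `|\sum_(0 <= k < N) cos (x * ((N + k)%:R + h) + t * omega ((N + k)%:R + h))|
      <= C / Num.sqrt (`|t| * N%:R `^ (alpha - 1))].
Proof.
move=> a0 a1 [[dw cw] dcw _ [xi0 xi00 /(_ 2%N isT) [c [C [c0 C0 cC]]]]].
have dw2 (x : R) : 0 < x -> derivable (derive1 omega) x 1.
  by move=> x0; exact: ((dcw x (lt0r_neq0 x0)).1 1%N).
have cw2 (x : R) : 0 < x -> {for x, continuous (derive1n 2 omega)}.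
  move=> x0; apply: differentiable_continuous; apply/derivable1_diffP.
  exact: ((dcw x (lt0r_neq0 x0)).1 2%N).
have ea : alpha + 1 - 2%:R = alpha - 1 by lra.
have B z : xi0 <= z -> c * z `^ (alpha - 1) <= `|derive1n 2 omega z| <= C * z `^ (alpha - 1).
  move=> xz; have z0 : 0 < z by exact: lt_le_trans xz.
  by have := cC z; rewrite gtr0_norm// ea; apply.
have [e e1 eP] : exists2 e : R, e = 1 \/ e = -1 & forall x : R, xi0 <= x ->
    e * derive1n 2 omega x = `|derive1n 2 omega x|.
  apply: constant_sign => x xx; have x0 : 0 < x by exact: lt_le_trans xx.
    exact: cw2.
  rewrite -normr_gt0; apply: lt_le_trans (proj1 (andP (B x xx))).
  by rewrite mulr_gt0// powR_gt0.
(* kappa = 1/C makes the second differences at most 1/N, hence the increments vary by at most 1 over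
   N steps. The constant 13 collects 2 (1 + 4/r) + 2/r + 1 for r <= 1, and the 3 under the root
   comes from the points z <= 3 N where omega'' is taken. *)
exists (Num.truncn xi0).+3, C^-1, (13 * Num.sqrt (3 / c)); split.
- by rewrite invr_gt0.
- by rewrite mulr_gt0// sqrtr_gt0 divr_gt0.
move=> N x t h N0 /andP[h0 h1] t0 tN.
have N3 : (3 <= N)%N by apply: leq_trans N0; rewrite ltnS.
have Nr : 3 <= N%:R :> R by rewrite ler_nat.
have N00 : 0 < N%:R :> R by lra.
have Nxi : xi0 <= N%:R.
  apply: ltW; apply: (lt_le_trans (truncnS_gt xi0)); rewrite ler_nat.
  by apply: ltn_trans N0; rewrite ltnS (leqW (leqnSn _)).
have ta : 0 < `|t| by rewrite normr_gt0.
pose P := N%:R `^ (alpha - 1).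
have P0 : 0 < P by exact: powR_gt0.
have P1 : P <= 1.
  by rewrite /P -[leRHS](powRr0 N%:R); apply: ler_powR; lra.
(* With this sign the increments of the phase increase; the cosine does not see it. *)
pose sg := e * Num.sg t.
have sg1 : sg = 1 \/ sg = -1.
  rewrite /sg; case: e1 => ->; case: (sgrP t) => // h'; rewrite ?h' ?eqxx// in t0 *;
  rewrite ?mul1r ?mulN1r ?opprK; by [left|right].
pose u k := sg * (x * ((N + k)%:R + h) + t * omega ((N + k)%:R + h)).
have -> : \sum_(0 <= k < N) cos (x * ((N + k)%:R + h) + t * omega ((N + k)%:R + h)) =
   \sum_(0 <= k < N) cos (u k).
  by apply: eq_bigr => k _; rewrite /u; case: sg1 => ->; rewrite ?mul1r ?mulN1r ?cosN.
pose d k := u k.+1 - u k.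
have D k : exists2 z, (N + k)%:R <= z <= (N + k)%:R + 3 &
    d k.+1 - d k = `|t| * `|derive1n 2 omega z|.
  have y0 : 0 < (N + k)%:R + h.
    by rewrite ltr_wpDr// (lt_le_trans N00)// ler_nat leq_addr.
  have [z /andP[z1 z2] zE] := second_difference_omega y0 dw dw2.
  exists z; first by apply/andP; split; lra.
  have zx : xi0 <= z.
    by apply: (le_trans Nxi); have : N%:R <= (N + k)%:R :> R by [rewrite ler_nat leq_addr]; lra.
  have SE j : (N + j.+1)%:R = (N + j)%:R + 1 :> R by rewrite addnS natr1.
  rewrite -(eP z zx) -zE (normrEsg t) /d /u /sg !SE.
  have -> : (N + k)%:R + 1 + 1 + h = (N + k)%:R + h + 2 :> R by lra.
  have -> : (N + k)%:R + 1 + h = (N + k)%:R + h + 1 :> R by lra.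
  ring.
pose l := `|t| * (c * P / 3).
have l0 : 0 < l by rewrite mulr_gt0// !mulr_gt0// invr_gt0.
have cCle : c <= C.
  have /andP[b1 b2] := B _ Nxi; have := le_trans b1 b2.
  by rewrite ler_pM2r.
have tCP : `|t| * C <= N%:R^-1.
  rewrite -ler_pdivlMr//; apply: (le_trans tN); by rewrite mulrC.
have N1 : N%:R^-1 <= 1 :> R by rewrite invf_le1//; lra.
have l1 : l <= 1.
  have : `|t| * c * P <= `|t| * C * 1.
    by apply: ler_pM => //; rewrite ?mulr_ge0 ?(ltW c0) ?(ltW P0)// ler_wpM2l.
  by rewrite /l; nra.
have r0 : 0 < Num.sqrt l by rewrite sqrtr_gt0.
have r1 : Num.sqrt l <= 1 by rewrite -[leRHS]sqrtr1 ler_sqrt.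
have dl k : (k.+1 < N)%N -> l <= d k.+1 - d k.
  move=> kN; have [z /andP[z1 z2] ->] := D k.
  rewrite /l ler_wpM2l//.
  have kN' : k%:R + 2 <= N%:R :> R by rewrite -natrD ler_nat addn2.
  have zN : N%:R <= z.
    by apply: le_trans z1; rewrite ler_nat leq_addr.
  have /andP[b1 _] := B z (le_trans Nxi zN).
  apply: le_trans b1; rewrite -mulrA ler_pM2l//.
  have z3 : z <= 3 * N%:R by move: z2; rewrite natrD; lra.
  apply: (@le_trans _ _ ((3 * N%:R) `^ (alpha - 1))).
    have N0' : 0 <= N%:R :> R by [].
    rewrite powRM// -/P [leRHS]mulrC ler_pM2l//.
    by rewrite -[leLHS](@powR_inv1 _ 3)//; apply: ler_powR; lra.
  rewrite -(opprB 1) !powRN lef_pV2 ?posrE ?powR_gt0//; try lra.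
  by apply: ge0_ler_powR; rewrite ?nnegrE; lra.
have d1 k : (k < N)%N -> d k <= d 0%N + 1.
  move=> kN; suff : d k <= d 0%N + k%:R / N%:R.
    move=> /le_trans; apply; rewrite lerD2l ler_pdivrMr// mul1r ler_nat.
    exact: ltnW.
  elim: k kN => [|k IH] kN; first by rewrite mul0r addr0.
  have {}IH := IH (ltnW kN).
  have [z /andP[z1 z2] dE] := D k.
  have zN : N%:R <= z by apply: le_trans z1; rewrite ler_nat leq_addr.
  have /andP[_ b2] := B z (le_trans Nxi zN).
  have zP : z `^ (alpha - 1) <= 1.
    by rewrite -[leRHS](powRr0 z); apply: ler_powR; lra.
  have : `|t| * `|derive1n 2 omega z| <= N%:R^-1.
    apply: le_trans tCP; rewrite ler_wpM2l//; apply: (le_trans b2).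
    by rewrite ler_piMr// ltW.
  by rewrite -dE -natr1 mulrDl mul1r; lra.
(* The width sqrt l of the stationary zone balances 1 / r against r / l. *)
have := @second_difference_sum u N l (Num.sqrt l) l0 l1 r0 r1 dl d1.
move/le_trans; apply.
set r := Num.sqrt l in r0 r1 *.
have lE : l = r ^+ 2 by rewrite sqr_sqrtr// ltW.
apply: (@le_trans _ _ (13 / r)).
  rewrite lE; have -> : 2 * r / r ^+ 2 = 2 / r by field; rewrite gt_eqF.
  have : 1 <= r^-1 by rewrite invf_ge1.
  lra.
have -> : Num.sqrt (`|t| * N%:R `^ (alpha - 1)) = Num.sqrt (3 / c) * r.
  rewrite /r -sqrtrM ?divr_ge0// ?(ltW c0)//; congr Num.sqrt.
  by rewrite /l -/P; field; rewrite gt_eqF.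
have : 0 < Num.sqrt (3 / c) by rewrite sqrtr_gt0 divr_gt0.
set w := Num.sqrt (3 / c) => s0.
by have -> : 13 / r = 13 * w / (w * r) by field; rewrite !gt_eqF.
Qed.

End VanDerCorput.

(** * Frequency variables and the short-time Strichartz estimate *)
Section Frequency.
Context {R : realType}.
Local Notation leb := (@lebesgue_measure R).
Implicit Types (f g : R -> R) (K : spatial_domain).

(* The counting measure on Z is the image of Lebesgue measure under floor: the
   frequency integral of [f] over K is the integral of [f \o rho K] over R. *)
Definition rho K (x : R) : R :=
  match K with Torus => (Num.floor x)%:~R | Line => x end.

Lemma measurable_rho K : measurable_fun setT (rho K).
Proof.
case: K => /=; last exact: measurable_id.
apply: nondecreasing_measurable => // x y xy /=.
by rewrite ler_int; exact: le_floor.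
Qed.

Lemma Ig_ae f g : Ig f -> measurable_fun setT g -> {ae leb, forall x, f x = g x} -> Ig g.
Proof.
move=> fi mg fg; apply: Ig_lty => //.
rewrite (_ : (\int[leb]_x `|g x|%:E = \int[leb]_x `|f x|%:E)%E); first exact: lty_Ig.
apply: ae_eq_integral => //.
- by apply/measurable_EFinP; apply: measurableT_comp.
- by apply/measurable_EFinP; apply: measurableT_comp => //; exact: Ig_meas.
- by apply: filterS fg => x fg _; rewrite fg.
Qed.

Lemma ae_not_int : {ae leb, forall x : R, forall k : int, x != k%:~R}.
Proof.
have cZ : countable (range (fun k : int => k%:~R : R)).
  by apply: (card_le_trans (card_image_le _ _)); exact: countableP.
exists (range (fun k : int => k%:~R : R)); split.
- exact: countable_measurable.
- exact: countable_lebesgue_measure0.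
- by move=> x /= /existsNP[k /negP]; rewrite negbK => /eqP ->; exists k.
Qed.

(** On the torus the reflection of the integers is realised by x -> 1 - x: floor (1 - x) = - floor x
    except at integers, a null set. *)
Lemma rho_opp K f : measurable_fun setT f -> Ig (fun x => f (rho K x)) ->
  Ig (fun x => f (- rho K x)) /\
  \int[leb]_x f (- rho K x) = \int[leb]_x f (rho K x).
Proof.
have mr := measurable_rho K.
move=> mf fi; have mfN : measurable_fun setT (fun x => f (- rho K x)).
  by apply: (measurableT_comp mf); exact: measurable_funN.
case: K mr fi mfN => /= mr fi mfN; last first.
  by split; [exact: Ig_opp|exact: Int_opp].
have i1 := Ig_opp (Ig_shift 1 fi).
have e : {ae leb, forall x, f (Num.floor (- x + 1))%:~R = f (- (Num.floor x)%:~R)}.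
  apply: filterS ae_not_int => x xk; congr f; rewrite -mulrNz; congr (_%:~R).
  apply/eqP; rewrite floor_eq mulrNz intrD mulrNz.
  have /andP[h1 h2] := floor_itv x; rewrite intrD in h2.
  have := xk (Num.floor x); rewrite neq_lt => /orP[h|h]; first lra.
  by apply/andP; split; lra.
split; first exact: Ig_ae e.
rewrite -(Int_ae (Ig_meas i1) mfN e) (Int_opp (Ig_shift 1 fi)).
exact: (Int_shift 1 fi).
Qed.

Lemma rho_add K x y : rho K (x + rho K y) = rho K x + rho K y.
Proof.
case: K => //=; rewrite -intrD; congr (_%:~R).
by rewrite floorDrz// intrKfloor.
Qed.

Lemma rho_addn K x n : rho K (x + n%:R) = rho K x + n%:R.
Proof.
by case: K => //=; rewrite -[n%:R]/(n%:~R) floorDrz ?intr_int// intrKfloor intrD.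
Qed.

Lemma rho_shift K f y : Ig (fun x => f (rho K x)) ->
  Ig (fun x => f (rho K x + rho K y)) /\
  \int[leb]_x f (rho K x + rho K y) = \int[leb]_x f (rho K x).
Proof.
move=> fi; have e x : f (rho K x + rho K y) = f (rho K (x + rho K y)) by rewrite rho_add.
split; first by under eq_fun do rewrite e; exact: (Ig_shift _ fi).
by rewrite (Int_ext e) (Int_shift _ fi).
Qed.

Lemma rho_near K x : rho K x <= x < rho K x + 1.
Proof.
case: K => /=; last by apply/andP; split; lra.
by have := floor_itv x; rewrite intrD.
Qed.

Lemma rho01 K x : 0 <= x < 1 -> 0 <= rho K x < 1.
Proof.
case: K => //= h; rewrite (_ : Num.floor x = 0) ?lexx ?ltr01//.
by apply/eqP; rewrite floor_eq.
Qed.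

(** Sharp cutoff to N <= |z| < 2 N (for N > 0). The asymmetric inequalities make the dyadic blocks
    tile the frequencies, and the positive half splits into the unit cells [N + k, N + k + 1[. *)
Definition blk (N : nat) : R -> R := fun z =>
  \1_(`[N%:R, N%:R *+ 2[) z + \1_(`[N%:R, N%:R *+ 2[) (- z).

Lemma measurable_ind (a b : itv_bound R) :
  measurable_fun setT (\1_[set` Interval a b] : R -> R).
Proof. exact: measurable_indic. Qed.

Lemma indE (a b : itv_bound R) x :
  (\1_[set` Interval a b] x : R) = (x \in Interval a b)%:R.
Proof. by rewrite indicE mem_setE. Qed.

Lemma Ig_ind (a b : R) b0 b1 :
  Ig (\1_[set` Interval (BSide b0 a) (BSide b1 b)] : R -> R).
Proof. exact: integrable_indic_itv. Qed.

Lemma measurable_blk N : measurable_fun setT (blk N).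
Proof.
apply: measurable_funD; first exact: measurable_ind.
by apply: (measurableT_comp (measurable_ind _ _)); exact: oppr_measurable.
Qed.

Lemma blkN N z : blk N (- z) = blk N z.
Proof. by rewrite /blk opprK addrC. Qed.

Lemma blkE N z : (0 < N)%N -> blk N z = (N%:R <= `|z| < N%:R *+ 2)%R%:R.
Proof.
move=> N0; have n0 : 0 < N%:R :> R by rewrite ltr0n.
rewrite /blk !indE !in_itv/=.
have [z0|z0] := leP 0 z.
  rewrite (ger0_norm z0) (_ : (N%:R <= - z) = false) ?addr0//.
  by apply/negbTE; rewrite -ltNge; lra.
rewrite (ltr0_norm z0) (_ : (N%:R <= z) = false) ?add0r//.
by apply/negbTE; rewrite -ltNge; lra.
Qed.

Lemma blk_sqr N z : (0 < N)%N -> blk N z ^+ 2 = blk N z.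
Proof. by move=> N0; rewrite blkE//; case: (_ && _); rewrite ?expr1n ?expr0n. Qed.

Lemma blk_ge0 N z : 0 <= blk N z.
Proof. by rewrite /blk !indE addr_ge0. Qed.

Lemma blk_le1 N z : (0 < N)%N -> blk N z <= 1.
Proof. by move=> N0; rewrite blkE//; case: (_ && _). Qed.

Lemma Ig_ind_rho K (a b : R) : Ig (fun x => \1_(`[a, b[) (rho K x)).
Proof.
apply: (@Ig_le _ _ (\1_(`[a, b + 1]))).
- by apply: (measurableT_comp (measurable_ind _ _)); exact: measurable_rho.
- exact: Ig_ind.
- move=> x; rewrite !indE !ger0_norm// !in_itv/= ler_nat.
  have /andP[h1 h2] := rho_near K x.
  case: (boolP (a <= rho K x < b)) => [/andP[a1 a2]|_ //].
  by rewrite (_ : a <= x <= b + 1)//; apply/andP; split; lra.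
Qed.

Lemma Ig_blk K N : Ig (fun x => blk N (rho K x)).
Proof.
apply: IgD; first exact: Ig_ind_rho.
have := rho_opp (measurable_ind _ _) (Ig_ind_rho K N%:R (N%:R *+ 2)).
by case.
Qed.

Lemma rho_ge_nat K x n : (n%:R <= rho K x) = (n%:R <= x).
Proof. by case: K => //=; rewrite -[n%:R]/(n%:~R) ler_int floor_ge_int. Qed.

Lemma blk_cos_bound K N (F : R -> R) (B : R) : (0 < N)%N -> measurable_fun setT F ->
  (forall x, F (- x) = F x) -> (forall x, `|F x| <= 1) ->
  (forall h, 0 <= h < 1 -> `|\sum_(0 <= k < N) F ((N + k)%:R + h)| <= B) ->
  `|\int[leb]_x (blk N (rho K x) * F (rho K x))| <= 2 * B.
Proof.
move=> N0 mF Fe F1 FB.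
have mr := measurable_rho K.
have mFr : measurable_fun setT (fun x => F (rho K x)) by exact: measurableT_comp mF mr.
pose I (x : R) : R := \1_(`[N%:R, N%:R *+ 2[) x.
have mI : measurable_fun setT I by exact: measurable_ind.
have i1 : Ig (fun x => I (rho K x) * F (rho K x)) by apply: (IgMb (Ig_ind_rho _ _ _) mFr).
have [i2 e2] := @rho_opp K (fun z => I z * F z) (measurable_funM mI mF) i1.
have -> : \int[leb]_x (blk N (rho K x) * F (rho K x)) =
    2 * \int[leb]_x (I (rho K x) * F (rho K x)).
  rewrite (_ : 2 * _ = \int[leb]_x (I (rho K x) * F (rho K x)) +
     \int[leb]_x (I (- rho K x) * F (- rho K x))); last by rewrite e2; ring.
  rewrite -IntD//; apply: Int_ext => x.
  by rewrite Fe -mulrDl.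
rewrite normrM (ger0_norm (ler0n _ _)) ler_pM2l//.
pose U (x : R) : R := \1_(`[0, 1[) x.
have iU k : Ig (fun x => U x * F ((N + k)%:R + rho K x)).
  apply: (IgMb (Ig_ind _ _ _ _)); last by move=> x; exact: F1.
  by apply: measurableT_comp mF _; exact: measurable_funD.
have -> : \int[leb]_x (I (rho K x) * F (rho K x)) =
    \int[leb]_x (U x * \sum_(0 <= k < N) F ((N + k)%:R + rho K x)).
  have -> : \int[leb]_x (I (rho K x) * F (rho K x)) =
      \int[leb]_x \sum_(0 <= k < N) (U (x - (N + k)%:R) * F (rho K x)).
    apply: Int_ext => x; rewrite -mulr_suml; congr (_ * _).
    (* The indicator of [N, 2 N[ telescopes into indicators of unit cells. *)
    pose f k : R := ((N + k)%:R <= x)%R%:R.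
    transitivity (\sum_(0 <= k < N) - (f k.+1 - f k)).
      rewrite sumrN telescope_sumr// opprB /f addn0 addnn -muln2 natrM mulr_natr /I indE in_itv/=.
      rewrite rho_ge_nat -[N%:R *+ 2]mulr_natr -natrM ltNge rho_ge_nat -ltNge.
      case: leP => h1; case: ltP => h2; rewrite ?subr0 ?subrr//.
      have N00 : 0 <= N%:R :> R by [].
      by exfalso; move: h1; rewrite natrM; lra.
    apply: eq_bigr => k _; rewrite opprB /f /U indE in_itv/= subr_ge0 ltrBlDr addnS -natr1.
    rewrite [1 + _]addrC; case: leP => h1; case: leP => h2; rewrite ?subr0 ?subrr//.
    by exfalso; lra.
  rewrite Int_sum; last first.
    move=> k; apply: (IgMb (Ig_shift _ (Ig_ind _ _ _ _)) mFr) => x; exact: F1.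
  rewrite [RHS](Int_ext (fun x => mulr_sumr _ _ _ _)) Int_sum//.
  apply: eq_bigr => k _; rewrite -(Int_shift (N + k)%:R); last first.
    by apply: (IgMb (Ig_shift _ (Ig_ind _ _ _ _)) mFr) => x; exact: F1.
  by apply: Int_ext => x; rewrite addrK rho_addn [rho K x + _]addrC.
have -> : B = \int[leb]_x (U x * B).
  under Int_ext do rewrite mulrC.
  rewrite IntZ; last exact: Ig_ind.
  rewrite (_ : \int[leb]_x U x = 1) ?mulr1//.
  by rewrite /Rintegral /U integral_indic//= setIT lebesgue_measure_itv/= lte01 oppr0 adde0.
apply: Int_le_norm.
- under eq_fun do rewrite mulr_sumr; exact: Ig_sum.
- by under eq_fun do rewrite mulrC; apply: IgZ; exact: Ig_ind.
- move=> x; rewrite /U indE in_itv/= normrM.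
  case: (0 <= x < 1) / idP => [h|]; last by rewrite normr0 !mul0r.
  by rewrite normr1 !mul1r; apply: FB; exact: rho01.
Qed.

(* Bombieri's form of the TT* argument: the linear functional is tested against
   functions whose Gram matrix has row sums at most the stated bound. *)
Lemma bombieri n (k : nat -> R -> R) (a : nat -> R) (M G : R) :
  (forall j, L2 (k j)) ->
  (forall c : nat -> R, (\sum_(0 <= j < n) c j * a j) ^+ 2 <=
     M * n2 (fun x => \sum_(0 <= j < n) c j * k j x)) ->
  0 <= M -> 0 <= G ->
  (forall j, (j < n)%N -> \sum_(0 <= i < n) `|\int[leb]_x (k i x * k j x)| <= G) ->
  \sum_(0 <= j < n) a j ^+ 2 <= M * G.
Proof.
move=> Lk La M0 G0 H; set S := \sum_(_ <= _ < _) _.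
have S0 : 0 <= S by apply: sumr_ge0 => j _; exact: sqr_ge0.
pose g i j := \int[leb]_x (k i x * k j x).
have E : n2 (fun x => \sum_(0 <= j < n) a j * k j x) =
    \sum_(0 <= i < n) \sum_(0 <= j < n) (a i * a j * g i j).
  have ik i j : Ig (fun x => a i * a j * (k i x * k j x)).
    by apply: IgZ; exact: L2M_Ig.
  transitivity (\int[leb]_x \sum_(0 <= i < n) \sum_(0 <= j < n) (a i * a j * (k i x * k j x))).
    apply: Int_ext => x; rewrite expr2 mulr_suml; apply: eq_bigr => i _.
    by rewrite mulr_sumr; apply: eq_bigr => j _; ring.
  rewrite Int_sum; last by move=> i; apply: Ig_sum => j.
  apply: eq_bigr => i _; rewrite Int_sum//; apply: eq_bigr => j _.
  by rewrite IntZ//; exact: L2M_Ig.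
have gC i j : g i j = g j i by apply: Int_ext => x; rewrite mulrC.
have B : n2 (fun x => \sum_(0 <= j < n) a j * k j x) <= S * G.
  (* Schur's test: 2 a_i a_j <= a_i^2 + a_j^2, followed by the row sums, which equal the column sums
     by symmetry. *)
  rewrite E; apply: (@le_trans _ _ (\sum_(0 <= i < n) \sum_(0 <= j < n)
      (2^-1 * (a i ^+ 2 * `|g i j|) + 2^-1 * (a j ^+ 2 * `|g i j|)))).
    apply: ler_sum => i _; apply: ler_sum => j _.
    rewrite -mulrDr -mulrDl mulrA.
    apply: (le_trans (ler_norm _)); rewrite normrM ler_wpM2r// ler_norml.
    by have := sqr_ge0 (a i - a j); have := sqr_ge0 (a i + a j) => *; apply/andP; split; nra.
  have half : \sum_(0 <= i < n) \sum_(0 <= j < n) (a i ^+ 2 * `|g i j|) <= S * G.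
    rewrite /S mulr_suml !big_nat; apply: ler_sum => i /andP[_ ni].
    rewrite -mulr_sumr ler_wpM2l ?sqr_ge0//.
    by under eq_bigr do rewrite gC; exact: H.
  have half' : \sum_(0 <= i < n) \sum_(0 <= j < n) (2^-1 * (a i ^+ 2 * `|g i j|)) =
      2^-1 * \sum_(0 <= i < n) \sum_(0 <= j < n) (a i ^+ 2 * `|g i j|).
    by rewrite mulr_sumr; apply: eq_bigr => i _; rewrite mulr_sumr.
  under eq_bigr do rewrite big_split/=.
  rewrite big_split/= [X in _ + X]exchange_big/=.
  under [X in _ + X]eq_bigr do under eq_bigr do rewrite gC.
  by rewrite half'; lra.
(* The functional is tested at c = a, which gives S^2 <= M S G. *)
have := La a; rewrite (_ : \sum_(0 <= j < n) a j * a j = S); last first.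
  by apply: eq_bigr => j _; rewrite expr2.
have [->|Sn0] := eqVneq S 0; first by rewrite mulr_ge0.
have Sp : 0 < S by rewrite lt_def Sn0.
move=> h; rewrite -(ler_pM2l Sp) -expr2; apply: (le_trans h).
by rewrite mulrCA ler_wpM2l.
Qed.

Lemma sum_inv_sqrt n : \sum_(0 <= k < n) (Num.sqrt (k.+1%:R : R))^-1 <= 2 * Num.sqrt n%:R.
Proof.
elim: n => [|n IH]; first by rewrite big_nil mulr_ge0// sqrtr_ge0.
rewrite big_nat_recr//=; apply: (@le_trans _ _ (2 * Num.sqrt n%:R + (Num.sqrt n.+1%:R)^-1)).
  by rewrite lerD2r.
set a := Num.sqrt n%:R; set b := Num.sqrt n.+1%:R.
have b0 : 0 < b by rewrite sqrtr_gt0 ltr0n.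
have a0 : 0 <= a by exact: sqrtr_ge0.
have E : b ^+ 2 = a ^+ 2 + 1 by rewrite !sqr_sqrtr// natr1.
rewrite -(ler_pM2r b0) mulrDl mulVf ?gt_eqF//.
have : 0 <= (b - a) ^+ 2 by exact: sqr_ge0.
nra.
Qed.

Lemma sum_dist (f : nat -> R) n j : (j < n)%N ->
  \sum_(0 <= i < n) f ((i - j) + (j - i))%N =
  f 0%N + \sum_(0 <= k < j) f k.+1 + \sum_(0 <= k < n - j.+1) f k.+1.
Proof.
move=> jn; rewrite (big_cat_nat (n := j)) ?(ltnW jn)//= (big_ltn jn) subnn add0n.
rewrite addrCA !addrA; congr (_ + _ + _).
  rewrite big_nat_rev/= !big_nat; apply: eq_bigr => i /andP[_ ij].
  rewrite add0n (_ : (j - i.+1 - j)%N = 0%N); last by apply/eqP; rewrite subn_eq0 leq_subr.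
  by rewrite add0n subKn.
rewrite -{1}(add0n j.+1) big_addn; apply: eq_bigr => i _.
rewrite addnS -addSn addnK (_ : (j - _)%N = 0%N) ?addn0//.
by apply/eqP; rewrite subn_eq0 leq_addl.
Qed.

Definition cas (y : R) := cos y + sin y.

Lemma casM x y : cas x * cas y = cos (x - y) + sin (x + y).
Proof. by rewrite /cas cosB sinD; ring. Qed.

Lemma cas_le2 y : `|cas y| <= 2.
Proof.
by apply: (le_trans (ler_normD _ _)); rewrite -[leRHS]natr1 lerD ?cos_max ?sin_max.
Qed.

Lemma measurable_cos : measurable_fun setT (@cos R).
Proof. by apply: continuous_measurable_fun; exact: continuous_cos. Qed.

Lemma measurable_sin : measurable_fun setT (@sin R).
Proof. by apply: continuous_measurable_fun; exact: continuous_sin. Qed.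

Lemma measurable_cas : measurable_fun setT cas.
Proof. by apply: measurable_funD; [exact: measurable_cos|exact: measurable_sin]. Qed.

Lemma measurable_phase (omega : R -> R) (y t : R) : measurable_fun setT omega ->
  measurable_fun setT (fun z => y * z + t * omega z).
Proof.
by move=> mo; apply: measurable_funD; apply: measurable_funM.
Qed.

Definition wave N (omega : R -> R) (y t : R) : R -> R := fun z => blk N z * cas (y * z + t * omega z).

Lemma L2_wave K N (omega : R -> R) (y t : R) : (0 < N)%N -> measurable_fun setT omega ->
  L2 (fun x => wave N omega y t (rho K x)).
Proof.
move=> N0 mo; have mr := measurable_rho K.
have Lb : L2 (fun x => blk N (rho K x)).
  split; first exact: measurableT_comp (measurable_blk N) mr.
  by under eq_fun do rewrite blk_sqr//; exact: Ig_blk.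
apply: (L2Mb Lb); last by move=> x; exact: cas_le2.
apply: (measurableT_comp measurable_cas).
exact: (measurableT_comp (measurable_phase y t mo) mr).
Qed.

(** cas p cas q = cos (p - q) + sin (p + q), and the sine is odd in frequency because omega is, so
    it integrates to 0 over the symmetric block. Hence the Gram matrix depends on differences only,
    as it would for complex exponentials. *)
Lemma wave_gram K N (omega : R -> R) (y t y' t' : R) : (0 < N)%N -> measurable_fun setT omega ->
  (forall z, omega (- z) = - omega z) ->
  \int[leb]_x (wave N omega y t (rho K x) * wave N omega y' t' (rho K x)) =
  \int[leb]_x (blk N (rho K x) * cos ((y - y') * rho K x + (t - t') * omega (rho K x))).
Proof.
move=> N0 mo oo; have mr := measurable_rho K.
pose F z := blk N z * cos ((y - y') * z + (t - t') * omega z).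
pose G z := blk N z * sin ((y + y') * z + (t + t') * omega z).
have mF : measurable_fun setT (fun z => cos ((y - y') * z + (t - t') * omega z)).
  exact: (measurableT_comp measurable_cos (measurable_phase _ _ mo)).
have mG : measurable_fun setT (fun z => sin ((y + y') * z + (t + t') * omega z)).
  exact: (measurableT_comp measurable_sin (measurable_phase _ _ mo)).
have iF : Ig (fun x => F (rho K x)).
  apply: (IgMb (Ig_blk K N) (measurableT_comp mF mr)) => x; exact: cos_max.
have iG : Ig (fun x => G (rho K x)).
  apply: (IgMb (Ig_blk K N) (measurableT_comp mG mr)) => x; exact: sin_max.
have mGG : measurable_fun setT G by apply: measurable_funM => //; exact: measurable_blk.
have [iG' eG] := rho_opp mGG iG.
have G0 : \int[leb]_x G (rho K x) = 0.
  have GN x : G (- rho K x) = - G (rho K x).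
    by rewrite /G blkN oo !mulrN -opprD sinN mulrN.
  by move: eG; rewrite (Int_ext GN) IntN//; lra.
rewrite -[RHS]addr0 -G0 -IntD//; apply: Int_ext => x.
rewrite /wave mulrACA -expr2 blk_sqr// casM mulrDr /F /G.
by congr (_ * cos _ + _ * sin _); ring.
Qed.

(** Entry (i, j) of the Gram matrix is bounded by the exponential sum at time (i - j) D, uniformly
    in the points y; summing (|i - j| D)^(-1/2) along a row gives, after multiplication by D, the
    square root of the total time n D. The condition on [a] says that a_j is the value on the j-th
    wave of a linear functional of norm at most sqrt M. The common time shift [s] is arbitrary. *)
Lemma strichartz_discrete (alpha : R) (omega : R -> R) : 0 < alpha -> alpha <= 1 ->
  hypothesis1 alpha omega ->
  exists N0 : nat, exists kappa C : R, [/\ 0 < kappa, 0 < C &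
    forall K (N n : nat) (D s M : R) (y a : nat -> R), (N0 < N)%N -> 0 < D ->
      n%:R * D <= kappa / N%:R -> 0 <= M ->
      (forall c : nat -> R, (\sum_(0 <= j < n) c j * a j) ^+ 2 <=
        M * n2 (fun x => \sum_(0 <= j < n) c j * wave N omega (y j) (j%:R * D + s) (rho K x))) ->
      D * \sum_(0 <= j < n) a j ^+ 2 <=
        M * (2 * N%:R * D + C * Num.sqrt (n%:R * D / N%:R `^ (alpha - 1)))].
Proof.
move=> al0 al1 hyp; have [N0 [kappa [C [k0 C0 V]]]] := van_der_corput al0 al1 hyp.
have mo : measurable_fun setT omega.
  case: hyp => [[dw _] _ _ _]; apply: continuous_measurable_fun => x.
  by apply: differentiable_continuous; apply/derivable1_diffP.
have oo : forall z, omega (- z) = - omega z by case: hyp.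
exists N0, kappa, (8 * C); split => //; first by rewrite mulr_gt0.
move=> K N n D s M y a NN0 D0 nD M0 La.
have Np : (0 < N)%N by exact: leq_ltn_trans NN0.
have Nr : 0 < N%:R :> R by rewrite ltr0n.
pose P := N%:R `^ (alpha - 1); have P0 : 0 < P by exact: powR_gt0.
(* Bound for the entries at distance d from the diagonal: the measure 2 N of the block for d = 0,
   van der Corput's estimate otherwise. *)
pose f d : R := if d == 0%N then 2 * N%:R else 2 * C / Num.sqrt (d%:R * D * P).
have f0 d : 0 <= f d.
  by rewrite /f; case: ifP => _; rewrite ?mulr_ge0// ?divr_ge0 ?mulr_ge0 ?sqrtr_ge0// ltW.
have Lk j : L2 (fun x => wave N omega (y j) (j%:R * D + s) (rho K x)) by exact: L2_wave.
pose G := 2 * N%:R + 8 * C * Num.sqrt n%:R / Num.sqrt (D * P).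
have sDP : 0 < Num.sqrt (D * P) by rewrite sqrtr_gt0 mulr_gt0.
have fG m : \sum_(0 <= k < m) f k.+1 <= 4 * C * Num.sqrt m%:R / Num.sqrt (D * P).
  have -> : \sum_(0 <= k < m) f k.+1 =
      2 * C / Num.sqrt (D * P) * \sum_(0 <= k < m) (Num.sqrt (k.+1%:R : R))^-1.
    rewrite mulr_sumr; apply: eq_bigr => k _; rewrite /f/= -[k.+1%:R * D * P]mulrA sqrtrM//.
    by field; rewrite !gt_eqF// sqrtr_gt0 ltr0n.
  have -> : 4 * C * Num.sqrt m%:R / Num.sqrt (D * P) =
      2 * C / Num.sqrt (D * P) * (2 * Num.sqrt m%:R) by field; rewrite gt_eqF.
  by rewrite ler_wpM2l ?sum_inv_sqrt// divr_ge0 ?sqrtr_ge0// mulr_ge0// ltW.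
have sle m : (m <= n)%N -> Num.sqrt m%:R <= Num.sqrt n%:R :> R.
  by move=> mn; rewrite ler_sqrt// ler_nat.
have gG j : (j < n)%N -> \sum_(0 <= i < n) f ((i - j) + (j - i))%N <= G.
  move=> jn; rewrite (sum_dist _ jn) /G -addrA {1}/f eqxx lerD2l.
  have h1 := fG j; have h2 := fG (n - j.+1)%N.
  have s1 := sle j (ltnW jn); have s2 := sle (n - j.+1)%N (leq_subr _ _).
  have q0 : 0 < 4 * C / Num.sqrt (D * P) by rewrite divr_gt0// mulr_gt0.
  rewrite -(ler_pM2l q0) in s1; rewrite -(ler_pM2l q0) in s2.
  apply: (le_trans (lerD h1 h2)).
  have e m : 4 * C * Num.sqrt m%:R / Num.sqrt (D * P) = 4 * C / Num.sqrt (D * P) * Num.sqrt m%:R.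
    by rewrite mulrAC.
  rewrite !e (_ : 8 * C * Num.sqrt n%:R / Num.sqrt (D * P) = 2 * (4 * C / Num.sqrt (D * P) * Num.sqrt n%:R)).
    by lra.
  by field; rewrite gt_eqF.
have G0 : 0 <= G.
  rewrite addr_ge0 ?mulr_ge0// ?divr_ge0 ?mulr_ge0 ?sqrtr_ge0//; lra.
have -> : M * (2 * N%:R * D + 8 * C * Num.sqrt (n%:R * D / P)) = D * (M * G).
  have -> : Num.sqrt (n%:R * D / P) = D * Num.sqrt n%:R / Num.sqrt (D * P).
    rewrite -{2}(sqr_sqrtr (ltW D0)) !sqrtrM ?mulr_ge0 ?(ltW D0)// sqrtrV ?ltW//.
    by field; rewrite !gt_eqF// sqrtr_gt0.
  by rewrite /G; field; rewrite gt_eqF.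
rewrite ler_pM2l//; apply: (bombieri Lk La M0 G0) => j jn.
apply: le_trans (gG j jn); rewrite !big_nat; apply: ler_sum => i /andP[_ ni].
rewrite wave_gram//.
have -> : i%:R * D + s - (j%:R * D + s) = (i%:R - j%:R) * D by ring.
set t := _ * D; set d := ((i - j) + (j - i))%N; set yy := y i - y j.
have -> : f d = 2 * (f d / 2) by field.
apply: (@blk_cos_bound K N (fun z => cos (yy * z + t * omega z))) => //.
- exact: (measurableT_comp measurable_cos (measurable_phase _ _ mo)).
- by move=> z; rewrite oo !mulrN -opprD cosN.
- by move=> z; exact: cos_max.
move=> h h01; have [dij|dij] := eqVneq i j.
  rewrite /f /d dij subnn eqxx mulrAC divff// mul1r.
  apply: (le_trans (ler_norm_sum _ _ _)).
  apply: (@le_trans _ _ (\sum_(0 <= k < N) 1)); first by apply: ler_sum => k _; exact: cos_max.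
  by rewrite sumr_const_nat subn0.
have dE : `|i%:R - j%:R| = d%:R :> R.
  rewrite /d; have [ij|ji] := leqP i j.
    have -> : (i - j = 0)%N by apply/eqP; rewrite subn_eq0.
    by rewrite add0n natrB// distrC ger0_norm// subr_ge0 ler_nat.
  have -> : (j - i = 0)%N by apply/eqP; rewrite subn_eq0 ltnW.
  have ji' := ltnW ji.
  by rewrite addn0 (natrB _ ji') ger0_norm// subr_ge0 ler_nat.
have d0 : (0 < d)%N.
  by rewrite lt0n; apply: contraNneq dij => d0; rewrite -(eqr_nat R) -subr_eq0 -normr_eq0 dE d0.
have tE : `|t| = d%:R * D by rewrite normrM dE gtr0_norm.
have dn : (d <= n)%N.
  rewrite -(ler_nat R) -dE ler_norml.
  have hi : i%:R <= n%:R :> R by rewrite ler_nat ltnW.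
  have hj : j%:R <= n%:R :> R by rewrite ler_nat ltnW.
  have hi0 : 0 <= i%:R :> R by [].
  have hj0 : 0 <= j%:R :> R by [].
  by apply/andP; split; lra.
rewrite /f gtn_eqF// mulrAC -mulrA.
apply: le_trans (V N yy t h NN0 h01 _ _) _.
- by rewrite -normr_eq0 tE mulf_neq0// ?gt_eqF// ltr0n.
- by rewrite tE; apply: le_trans nD; rewrite ler_wpM2r ?(ltW D0)// ler_nat.
- rewrite tE -/P; set q := Num.sqrt _.
  have q0 : 0 < q by rewrite sqrtr_gt0 !mulr_gt0// ltr0n.
  by have -> : 2 * C * (2^-1 / q) = C / q by field; rewrite gt_eqF.
Qed.

End Frequency.

(** * Weights and the bilinear form *)
Section Weights.
Context {R : realType}.
Local Notation leb := (@lebesgue_measure R).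
Implicit Types (f g c d sg : R -> R) (K : spatial_domain) (s r z : R).

Definition wt s z : R := (1 + z ^+ 2) `^ (s / 2).

Lemma wt_base z : 1 <= 1 + z ^+ 2.
Proof. by rewrite lerDl sqr_ge0. Qed.

Lemma wt_gt0 s z : 0 < wt s z.
Proof. by apply: powR_gt0; exact: lt_le_trans (wt_base z). Qed.

Lemma wt_ge0 s z : 0 <= wt s z. Proof. exact: ltW (wt_gt0 s z). Qed.

Lemma wtD s r z : wt (s + r) z = wt s z * wt r z.
Proof.
rewrite /wt mulrDl powRD//; apply/implyP => _.
by rewrite gt_eqF// (lt_le_trans _ (wt_base z)).
Qed.

Lemma wt0 z : wt 0 z = 1. Proof. by rewrite /wt mul0r powRr0. Qed.

Lemma wtNK s z : wt (- s) z * wt s z = 1.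
Proof. by rewrite -wtD addNr wt0. Qed.

Lemma wtV s z : wt (- s) z = (wt s z)^-1.
Proof. by rewrite /wt mulNr powRN. Qed.

Lemma wt_even s z : wt s (- z) = wt s z.
Proof. by rewrite /wt sqrrN. Qed.

Lemma wt_mono s r z : s <= r -> wt s z <= wt r z.
Proof. by move=> sr; apply: ler_powR; [exact: wt_base|rewrite ler_pM2r]. Qed.

Lemma wt_ge1 s z : 0 <= s -> 1 <= wt s z.
Proof. by move=> s0; rewrite -(wt0 z); exact: wt_mono. Qed.

Lemma wt_le1 s z : s <= 0 -> wt s z <= 1.
Proof. by move=> s0; rewrite -(wt0 z); exact: wt_mono. Qed.

Lemma wt2 z : wt 2 z = 1 + z ^+ 2.
Proof. by rewrite /wt divff// powRr1// (le_trans _ (wt_base z)). Qed.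

Lemma measurable_wt s : measurable_fun setT (wt s).
Proof.
apply: (measurableT_comp (@measurable_powR R (s / 2))).
by apply: measurable_funD => //; exact: measurable_funX.
Qed.

Lemma sqr_powR_half (x s : R) : 0 <= x -> (x ^+ 2) `^ (s / 2) = x `^ s.
Proof.
by move=> x0; rewrite -powR_mulrn// -powRrM; congr (_ `^ _); field.
Qed.

Lemma wt_high s z (N : R) : 0 < N -> s <= 0 -> N <= `|z| -> wt s z <= N `^ s.
Proof.
move=> N0 s0 Nz; rewrite -(sqr_powR_half _ (ltW N0)) /wt.
have -> : s / 2 = - (- s / 2) by field.
rewrite !powRN.
have h : 0 < 1 + z ^+ 2 by exact: lt_le_trans (wt_base z).
rewrite lef_pV2 ?posrE ?powR_gt0 ?exprn_gt0//.
apply: ge0_ler_powR; rewrite ?nnegrE ?(ltW h) ?sqr_ge0//; first by lra.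
rewrite -(real_normK (num_real z)).
apply: (@le_trans _ _ (`|z| ^+ 2)); last by rewrite lerDr.
by rewrite lerXn2r ?nnegrE// ltW.
Qed.

(** On the block N^2 <= 1 + z^2 <= 5 N^2; the absolute value in the exponent of 5 covers both signs
    of r. *)
Lemma wt_block r z (N : nat) : (0 < N)%N -> blk N z != 0 ->
  wt r z <= 5 `^ (`|r| / 2) * N%:R `^ r.
Proof.
move=> N0; rewrite blkE// pnatr_eq0 eqb0 negbK => /andP[h1 h2].
have Np : 1 <= N%:R :> R by rewrite ler1n.
have Np0 : 0 < N%:R :> R by lra.
have z2 : N%:R ^+ 2 <= z ^+ 2 <= 4 * N%:R ^+ 2.
  rewrite -(real_normK (num_real z)); move: h1 h2; rewrite -mulr_natr; move: `|z| => y h1 h2.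
  by apply/andP; split; nra.
have b0 : 0 < 1 + z ^+ 2 by exact: lt_le_trans (wt_base z).
have b1 : N%:R ^+ 2 <= 1 + z ^+ 2 by move/andP: z2 => [? ?]; lra.
have b2 : 1 + z ^+ 2 <= 5 * N%:R ^+ 2 by move/andP: z2 => [? ?]; nra.
rewrite -[X in _ * X](sqr_powR_half _ (ltW Np0)).
have [r0|r0] := leP 0 r.
  rewrite ger0_norm// -powRM ?sqr_ge0// /wt.
  by apply: ge0_ler_powR; rewrite ?nnegrE ?(ltW b0) ?mulr_ge0 ?sqr_ge0//; lra.
apply: (@le_trans _ _ ((N%:R ^+ 2) `^ (r / 2))).
  rewrite /wt (_ : r / 2 = - (- r / 2)); last by field.
  rewrite !powRN lef_pV2 ?posrE ?powR_gt0 ?exprn_gt0//.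
  by apply: ge0_ler_powR; rewrite ?nnegrE ?(ltW b0) ?sqr_ge0//; lra.
rewrite ler_peMl ?powR_ge0// -[leLHS](powRr0 5).
by apply: ler_powR; rewrite ?divr_ge0//; lra.
Qed.

Lemma cvg_powR_tail (p : R) : 0 < p -> (1 + x) `^ (- p) @[x --> +oo%R] --> (0 : R).
Proof.
move=> p0; apply/cvgrPdist_le => e e0.
near=> x; rewrite sub0r normrN ger0_norm ?powR_ge0// powRN.
have A0 : 0 < e `^ (- p^-1) by exact: powR_gt0.
have xA : e `^ (- p^-1) <= x by near: x; apply: nbhs_pinfty_ge; rewrite num_real.
rewrite -[leRHS]invrK lef_pV2 ?posrE ?invr_gt0 ?powR_gt0//; last by lra.
have -> : e^-1 = (e `^ (- p^-1)) `^ p.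
  by rewrite -powRrM mulNr mulVf ?gt_eqF// powR_inv1// ltW.
by apply: ge0_ler_powR; rewrite ?nnegrE; lra.
Unshelve. all: by end_near. Qed.

Lemma Ig_powR_tail (p : R) : 1 < p -> Ig (fun x => (1 + `|x|) `^ (- p)).
Proof.
move=> p1; have p0 : 0 < p - 1 by lra.
pose f (x : R) := (1 + x) `^ (- p).
pose F (x : R) := (- (p - 1))^-1 * (1 + x) `^ (- (p - 1)).
have dF (x : R) : -1 < x -> is_derive x 1 F (f x).
  move=> x1; have x0 : 0 < 1 + x by lra.
  have d1 : is_derive x 1 (fun y : R => 1 + y) 1.
    by have := @is_deriveD _ _ _ (cst (1 : R)) id x 1 0 1 _ _; rewrite add0r; apply.
  have d2 := is_derive1_powR (- (p - 1)) x0.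
  have d3 := @is_derive1_comp _ (fun y : R => y `^ (- (p - 1))) (fun y : R => 1 + y) x _ 1 d2 d1.
  have d4 := @is_deriveZ _ _ _ _ (- (p - 1))^-1 x 1 _ d3.
  apply: (is_derive_eq d4); rewrite /GRing.scale/= mulr1 mulrA mulVf ?mul1r; last lra.
  by rewrite /f; congr (_ `^ _); lra.
have mf : measurable_fun setT (fun x : R => (1 + `|x|) `^ (- p)).
  apply: (measurableT_comp (@measurable_powR R (- p))).
  by apply: measurable_funD => //; exact: measurableT_comp.
have cF (x : R) : -1 < x -> {for x, continuous F}.
  move=> /dF d; apply: differentiable_continuous; apply/derivable1_diffP.
  by case: d.
have half : (\int[leb]_(x in `[0%R, +oo[) ((1 + `|x|) `^ (- p))%:E < +oo)%E.
  have -> : (\int[leb]_(x in `[0%R, +oo[) ((1 + `|x|) `^ (- p))%:E =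
      \int[leb]_(x in `[0%R, +oo[) (f x)%:E)%E.
    by apply: eq_integral => x; rewrite inE/= in_itv/= andbT => x0; rewrite /f ger0_norm.
  rewrite (@ge0_continuous_FTC2y _ f F 0 0); first by rewrite ltry.
  - by move=> x _; exact: powR_ge0.
  - apply: continuous_in_subspaceT => x; rewrite inE/= in_itv/= andbT => x0.
    have x1 : 0 < 1 + x by lra.
    have d1 : is_derive x 1 (fun y : R => 1 + y) 1.
      by have := @is_deriveD _ _ _ (cst (1 : R)) id x 1 0 1 _ _; rewrite add0r; apply.
    have d2 := is_derive1_powR (- p) x1.
    have d3 := @is_derive1_comp _ (fun y : R => y `^ (- p)) (fun y : R => 1 + y) x _ 1 d2 d1.
    apply: differentiable_continuous; apply/derivable1_diffP.
    by case: d3.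
  - rewrite -(mulr0 (- (p - 1))^-1); apply: cvgMr; exact: cvg_powR_tail.
  - by move=> x x0; have [] := dF x (ltac:(lra)).
  - by apply: cvg_at_right_filter; apply: cF; lra.
  - move=> x; rewrite in_itv/= andbT => x0.
    by rewrite derive1E; have [_ ->] := dF x (ltac:(lra)).
apply: Ig_lty => //.
under eq_integral do rewrite ger0_norm ?powR_ge0//.
rewrite -(setUv `[0%R, +oo[%classic) ge0_integral_setU//=; last 3 first.
- exact: measurableC.
- by rewrite setUv; exact/measurable_EFinP.
- exact/disj_setPCl.
apply: lte_add_pinfty => //.
apply: (@le_lt_trans _ _ (\int[leb]_(x in `]-oo, 0%R]) ((1 + `|x|) `^ (- p))%:E)%E).
  apply: ge0_subset_integral => //.
  - exact: measurableC.
  - by apply/measurable_EFinP; exact: measurable_funS mf.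
  - by move=> x /=; rewrite !in_itv/= andbT => /negP; rewrite -ltNge => /ltW.
have -> : (\int[leb]_(x in `]-oo, 0%R]) ((1 + `|x|) `^ (- p))%:E =
    \int[leb]_(x in `[0%R, +oo[) ((1 + `|x|) `^ (- p))%:E)%E.
  rewrite integral_mkcond -ge0_int_opp; last 2 first.
  - apply/(measurable_restrictT _ _).1; first exact: measurable_itv.
    by apply/measurable_EFinP; exact: measurable_funTS mf.
  - by move=> x; rewrite patchE; case: ifP => // _; rewrite lee_fin powR_ge0.
  rewrite [RHS]integral_mkcond; apply: eq_integral => x _.
  by rewrite !patchE !mem_setE !in_itv/= andbT oppr_le0 normrN.
exact: half.
Qed.

(** Comparison with (1 + |x|)^(-2s): from |x| <= |rho x| + 1 one gets (1 + |x|)^2 <= 8 (1 + (rho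
    x)^2). *)
Lemma Ig_wt K s : 2^-1 < s -> Ig (fun x => wt (- (2 * s)) (rho K x)).
Proof.
move=> s2; have p1 : 1 < 2 * s by lra.
apply: (@Ig_le _ _ (fun x => 8 `^ s * (1 + `|x|) `^ (- (2 * s)))).
- exact: (measurableT_comp (measurable_wt _) (measurable_rho K)).
- by apply: IgZ; exact: Ig_powR_tail.
move=> x; rewrite (ger0_norm (wt_ge0 _ _)).
rewrite [leRHS]ger0_norm; last by rewrite mulr_ge0 ?powR_ge0.
have /andP[h1 h2] := rho_near K x; set z := rho K x in h1 h2 *.
have a0 : 0 < 1 + `|x| by rewrite ltr_pwDl.
have e : (1 + `|x|) `^ (2 * s) = ((1 + `|x|) ^+ 2) `^ s.
  by rewrite -(sqr_powR_half _ (ltW a0)); congr (_ `^ _); field.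
have b0 : 0 <= 1 + z ^+ 2 by exact: le_trans (wt_base z).
rewrite wtV powRN e -[leLHS]mul1r ler_pdivrMr ?wt_gt0// mulrAC.
rewrite ler_pdivlMr ?powR_gt0 ?exprn_gt0// mul1r /wt (_ : 2 * s / 2 = s); last by field.
rewrite -powRM//.
apply: ge0_ler_powR; rewrite ?nnegrE ?sqr_ge0 ?mulr_ge0//; first by lra.
have : `|x| <= `|z| + 1.
  rewrite ler_norml; have := ler_norm z; have := ler_norm (- z); rewrite normrN => *.
  by apply/andP; split; lra.
have key (a b : R) : 0 <= a -> 0 <= b -> a <= b + 1 -> (1 + a) ^+ 2 <= 8 * (1 + b ^+ 2).
  by move=> a1 b1 ab; have := sqr_ge0 (b - 1); nra.
by rewrite -(real_normK (num_real z)); exact: key.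
Qed.

Definition nr f : R := Num.sqrt (n2 f).

Lemma nr_ge0 f : 0 <= nr f. Proof. exact: sqrtr_ge0. Qed.

Lemma sqr_nr f : nr f ^+ 2 = n2 f. Proof. by rewrite sqr_sqrtr// n2_ge0. Qed.

(** Cauchy-Schwarz against the weight of exponent - s, which is square integrable exactly because s
    > 1/2. This is the embedding of H^s into the functions with integrable transform. *)
Lemma L1_weight K s c : 2^-1 < s -> measurable_fun setT c ->
  L2 (fun x => wt s (rho K x) * c x) ->
  Ig c /\ \int[leb]_x `|c x| <=
    nr (fun x => wt (- s) (rho K x)) * nr (fun x => wt s (rho K x) * c x).
Proof.
move=> s2 mc Lc; have mr := @measurable_rho R K.
have Lw : L2 (fun x => wt (- s) (rho K x)).
  split; first exact: (measurableT_comp (measurable_wt _) mr).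
  rewrite (_ : (fun x => _) = (fun x => wt (- (2 * s)) (rho K x))); first exact: Ig_wt.
  by apply/funext => x; rewrite expr2 -wtD; congr (wt _ _); ring.
have e x : wt (- s) (rho K x) * `|wt s (rho K x) * c x| = `|c x|.
  by rewrite normrM (ger0_norm (wt_ge0 _ _)) mulrA wtNK mul1r.
have i : Ig (fun x => `|c x|).
  by have := L2M_Ig Lw (L2_abs Lc); under eq_fun do rewrite e.
split.
  by apply: (Ig_le mc i) => x; rewrite normr_id.
rewrite -(Int_ext e); apply: (le_trans (ler_norm _)).
by have := CS_abs Lw (L2_abs Lc); rewrite n2_abs.
Qed.

Lemma measurable_int2 (F : R -> R -> R) :
  measurable_fun setT (fun p : R * R => F p.1 p.2) -> (forall x, Ig (F x)) ->
  measurable_fun setT (fun x => \int[leb]_y F x y).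
Proof.
move=> mF iF; have pos (G : R -> R -> R) :
    measurable_fun setT (fun p : R * R => G p.1 p.2) -> (forall x y, 0 <= G x y) ->
    measurable_fun setT (fun x => \int[leb]_y G x y).
  move=> mG G0; rewrite (_ : (fun x => _) = fine \o (fun x => \int[leb]_y (G x y)%:E)%E)//.
  by apply: measurableT_comp => //; exact: measurable_int_y.
have -> : (fun x => \int[leb]_y F x y) =
    (fun x => \int[leb]_y Num.max (F x y) 0 - \int[leb]_y Num.max (- F x y) 0).
  apply/funext => x; have mFx := Ig_meas (iF x).
  rewrite -IntB.
  - by apply: Int_ext => y; have [h|h] := leP (F x y) 0; [rewrite max_l|rewrite max_r]; lra.
  - apply: (Ig_le _ (iF x)); first exact: measurable_maxr.
    by move=> y; rewrite ger0_norm ?le_max ?lexx ?orbT// ge_max normr_ge0 ler_norm.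
  - apply: (Ig_le _ (iF x)); first by apply: measurable_maxr => //; exact: measurable_funN.
    by move=> y; rewrite ger0_norm ?le_max ?lexx ?orbT// ge_max normr_ge0 -normrN ler_norm.
apply: measurable_funB; apply: pos.
- exact: measurable_maxr.
- by move=> x y; rewrite le_max lexx orbT.
- by apply: measurable_maxr => //; exact: measurable_funN.
- by move=> x y; rewrite le_max lexx orbT.
Qed.

Lemma rhoN K (x : R) : rho K (- rho K x) = - rho K x.
Proof. by case: K => //=; rewrite -mulrNz intrKfloor. Qed.

Lemma L2_rho_opp K sg : measurable_fun setT sg -> L2 (fun x => sg (rho K x)) ->
  L2 (fun x => sg (- rho K x)) /\ n2 (fun x => sg (- rho K x)) = n2 (fun x => sg (rho K x)).
Proof.
move=> ms [_ i]; have mr := @measurable_rho R K.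
have [i' e] := @rho_opp R K (fun z => sg z ^+ 2) (measurable_funX _ ms) i.
split; last exact: e.
by split => //; apply: (measurableT_comp ms); exact: measurable_funN.
Qed.

Lemma L2_rho_add K sg y : measurable_fun setT sg -> L2 (fun x => sg (rho K x)) ->
  L2 (fun x => sg (rho K x + rho K y)) /\
  n2 (fun x => sg (rho K x + rho K y)) = n2 (fun x => sg (rho K x)).
Proof.
move=> ms [_ i]; have mr := @measurable_rho R K.
have [i' e] := @rho_shift R K (fun z => sg z ^+ 2) y i.
split; last exact: e.
by split => //; apply: (measurableT_comp ms); exact: measurable_funD.
Qed.

(* [dbl (ht K f) u w] is the Hartley transform of [f x * cas (x * u)] at [w]: the
   kernel through which the square of a function acts on [f]; see [ht_mul_cas] and
   [pairing_sqr]. *)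
Definition dbl sg (u w : R) : R :=
  2^-1 * (sg (u - w) + sg (w - u) + sg (u + w) - sg (- u - w)).

Lemma dblC sg u w : dbl sg u w = dbl sg w u.
Proof. by rewrite /dbl [w + u]addrC [- w - u]addrC; ring. Qed.

Lemma nr_triangle f g : L2 f -> L2 g -> nr (fun x => f x + g x) <= nr f + nr g.
Proof. exact: sqrt_n2D. Qed.

Lemma nrZ (a : R) f : L2 f -> nr (fun x => a * f x) = `|a| * nr f.
Proof. by move=> Lf; rewrite /nr n2Z// sqrtrM ?sqr_ge0// sqrtr_sqr. Qed.

Lemma nrN f : nr (fun x => - f x) = nr f.
Proof. by congr Num.sqrt; apply: Int_ext => x; rewrite sqrrN. Qed.

Lemma nr_le f g : L2 f -> L2 g -> (forall x, `|f x| <= `|g x|) -> nr f <= nr g.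
Proof. by move=> Lf Lg fg; rewrite ler_sqrt ?n2_ge0//; exact: n2_le. Qed.

(** Each of the four terms is a translate of sg or of its reflection and has the same L^2 norm; four
    times 1/2 gives the factor 2. *)
Lemma L2_dbl K sg y : measurable_fun setT sg -> L2 (fun x => sg (rho K x)) ->
  L2 (fun x => dbl sg (rho K y) (rho K x)) /\
  nr (fun x => dbl sg (rho K y) (rho K x)) <= 2 * nr (fun x => sg (rho K x)).
Proof.
move=> ms Ls.
have mo : measurable_fun setT (fun z => sg (- z)).
  by apply: (measurableT_comp ms); exact: oppr_measurable.
have [Lo eo] := L2_rho_opp ms Ls.
have [L1 e1] := L2_rho_add (- rho K y) mo Lo.
have [L2' e2] := L2_rho_add (- rho K y) ms Ls.
have [L3 e3] := L2_rho_add y ms Ls.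
have [L4 e4] := L2_rho_add y mo Lo.
rewrite rhoN in L1 e1 L2' e2.
have E : (fun x => dbl sg (rho K y) (rho K x)) =
   (fun x => 2^-1 * (sg (- (rho K x - rho K y)) + (sg (rho K x - rho K y) +
      (sg (rho K x + rho K y) + - sg (- (rho K x + rho K y)))))).
  apply/funext => x; rewrite /dbl opprB !opprD [rho K y + _]addrC [- rho K y - _]addrC.
  by rewrite [rho K y + rho K x]addrC; ring.
have LA := L2D L3 (L2N L4); have LB := L2D L2' LA; have LC := L2D L1 LB.
rewrite E; split; first exact: L2Z.
rewrite nrZ// ger0_norm ?invr_ge0// ler_pdivrMl// mulrA -natrM.
apply: (le_trans (nr_triangle L1 LB)).
apply: (@le_trans _ _ (nr (fun x => sg (rho K x)) + (nr (fun x => sg (rho K x)) +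
   (nr (fun x => sg (rho K x)) + nr (fun x => sg (rho K x)))))); last by lra.
rewrite {1}/nr e1 eo lerD2l; apply: (le_trans (nr_triangle L2' LA)).
rewrite {1}/nr e2 lerD2l; apply: (le_trans (nr_triangle L3 (L2N L4))).
by rewrite nrN {1 2}/nr e3 e4 eo.
Qed.

(** [Q K c c (ht K f)] is 2 pi times the integral over K of f v^2, where v is the inverse transform
    of c: the nonlinearity is expressed by a trilinear form, without convolutions of complex
    transforms. *)
Definition Qin K d sg (u : R) : R := \int[leb]_x (d x * dbl sg u (rho K x)).
Definition Q K c d sg : R := (2 * pi)^-1 * \int[leb]_x (c x * Qin K d sg (rho K x)).

Lemma Qin_bound K d sg y : measurable_fun setT sg -> L2 (fun x => sg (rho K x)) -> L2 d ->
  `|Qin K d sg (rho K y)| <= 2 * (nr d * nr (fun x => sg (rho K x))).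
Proof.
move=> ms Ls Ld; have [L1 n1] := L2_dbl y ms Ls.
apply: (le_trans (CS_abs Ld L1)); rewrite mulrCA ler_wpM2l//; exact: nr_ge0.
Qed.

Lemma measurable_dbl2 K sg : measurable_fun setT sg ->
  measurable_fun setT (fun p : R * R => dbl sg (rho K p.1) (rho K p.2)).
Proof.
move=> ms; have mr := @measurable_rho R K.
have m1 : measurable_fun setT (fun p : R * R => rho K p.1) by exact: measurableT_comp mr _.
have m2 : measurable_fun setT (fun p : R * R => rho K p.2) by exact: measurableT_comp mr _.
apply: measurable_funM => //; apply: measurable_funB; last first.
  by apply: (measurableT_comp ms); apply: measurable_funB => //; exact: measurable_funN.
apply: measurable_funD; last by apply: (measurableT_comp ms); exact: measurable_funD.
by apply: measurable_funD; apply: (measurableT_comp ms); exact: measurable_funB.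
Qed.

Lemma measurable_Qin K d sg : measurable_fun setT sg -> L2 (fun x => sg (rho K x)) -> L2 d ->
  measurable_fun setT (fun x => Qin K d sg (rho K x)).
Proof.
move=> ms Ls Ld; apply: (measurable_int2 (F := fun x y => d y * dbl sg (rho K x) (rho K y))).
  apply: measurable_funM; last exact: measurable_dbl2.
  by case: Ld => md _; exact: measurableT_comp md _.
by move=> x; apply: L2M_Ig => //; have [] := L2_dbl x ms Ls.
Qed.

Lemma Ig_Q K c d sg : measurable_fun setT sg -> L2 (fun x => sg (rho K x)) -> L2 d -> Ig c ->
  Ig (fun x => c x * Qin K d sg (rho K x)).
Proof.
move=> ms Ls Ld ic; apply: (IgMb ic (measurable_Qin ms Ls Ld)) => x.
exact: (Qin_bound x ms Ls Ld).
Qed.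

(** Frequency form of the estimate of the integral of v w f by the sup norm of v and the L^2 norms
    of w and f; integrability of c replaces boundedness of v. The constants combine to 2 / (2 pi) <=
    1. *)
Lemma Q_bound K c d sg : measurable_fun setT sg -> L2 (fun x => sg (rho K x)) -> L2 d -> Ig c ->
  `|Q K c d sg| <= (\int[leb]_x `|c x|) * (nr d * nr (fun x => sg (rho K x))).
Proof.
move=> ms Ls Ld ic; rewrite /Q normrM ger0_norm ?invr_ge0 ?mulr_ge0 ?pi_ge0//.
have p2 := @pi_ge2 R; rewrite ler_pdivrMl; last by lra.
apply: (@le_trans _ _ (\int[leb]_x (2 * (nr d * nr (fun x => sg (rho K x))) * `|c x|))).
  apply: Int_le_norm; [exact: Ig_Q|by apply: IgZ; exact: Ig_abs|move=> x].
  rewrite normrM mulrC ler_wpM2r//; exact: Qin_bound.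
rewrite IntZ; last exact: Ig_abs.
rewrite [leRHS]mulrA [X in _ <= X]mulrC mulrA -[X in X * _ <= _]mulrA [X in _ <= X * _]mulrC.
have i0 : 0 <= \int[leb]_x `|c x| by exact: Int_ge0.
have n0 : 0 <= nr d * nr (fun x => sg (rho K x)) by rewrite mulr_ge0 ?nr_ge0.
have := mulr_ge0 i0 n0; nra.
Qed.

Lemma Q_sum K c d n (e : nat -> R) (sg : nat -> R -> R) :
  (forall j, measurable_fun setT (sg j)) -> (forall j, L2 (fun x => sg j (rho K x))) ->
  L2 d -> Ig c ->
  Q K c d (fun z => \sum_(0 <= j < n) e j * sg j z) = \sum_(0 <= j < n) e j * Q K c d (sg j).
Proof.
move=> ms Ls Ld ic.
have iD j x : Ig (fun y => d y * dbl (sg j) (rho K x) (rho K y)).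
  by apply: L2M_Ig => //; have [] := L2_dbl x (ms j) (Ls j).
have E x : Qin K d (fun z => \sum_(0 <= j < n) e j * sg j z) (rho K x) =
    \sum_(0 <= j < n) e j * Qin K d (sg j) (rho K x).
  transitivity (\int[leb]_y \sum_(0 <= j < n) (e j * (d y * dbl (sg j) (rho K x) (rho K y)))).
    apply: Int_ext => y; rewrite /dbl -!big_split/= -sumrB !mulr_sumr.
    by apply: eq_bigr => j _; ring.
  rewrite Int_sum; last by move=> j; apply: IgZ.
  by apply: eq_bigr => j _; rewrite IntZ.
transitivity ((2 * pi)^-1 * \int[leb]_x \sum_(0 <= j < n) (e j * (c x * Qin K d (sg j) (rho K x)))).
  congr (_ * _); apply: Int_ext => x; rewrite E mulr_sumr.
  by apply: eq_bigr => j _; ring.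
rewrite Int_sum; last by move=> j; apply: IgZ; exact: Ig_Q.
rewrite mulr_sumr; apply: eq_bigr => j _; rewrite IntZ; last exact: Ig_Q.
by rewrite /Q; ring.
Qed.

Lemma Q_Dl K c c' d sg : measurable_fun setT sg -> L2 (fun x => sg (rho K x)) -> L2 d ->
  Ig c -> Ig c' -> Q K (fun x => c x + c' x) d sg = Q K c d sg + Q K c' d sg.
Proof.
move=> ms Ls Ld ic ic'; rewrite /Q -mulrDr -IntD; [|exact: Ig_Q|exact: Ig_Q].
by congr (_ * _); apply: Int_ext => x; rewrite mulrDl.
Qed.

Lemma Q_Dr K c d d' sg : measurable_fun setT sg -> L2 (fun x => sg (rho K x)) ->
  L2 d -> L2 d' -> Ig c -> Q K c (fun x => d x + d' x) sg = Q K c d sg + Q K c d' sg.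
Proof.
move=> ms Ls Ld Ld' ic; rewrite /Q -mulrDr -IntD; [|exact: Ig_Q|exact: Ig_Q].
congr (_ * _); apply: Int_ext => x; rewrite -mulrDr; congr (_ * _).
have iD g : L2 g -> Ig (fun y => g y * dbl sg (rho K x) (rho K y)).
  by move=> Lg; apply: L2M_Ig => //; have [] := L2_dbl x ms Ls.
rewrite /Qin -IntD; [|exact: iD|exact: iD].
by apply: Int_ext => y; rewrite mulrDl.
Qed.

(** Fubini and the symmetry of [dbl]; the bound on sg makes the double integral absolutely
    convergent. *)
Lemma Q_sym K c d sg (M : R) : measurable_fun setT sg -> (forall z, `|sg z| <= M) ->
  Ig c -> Ig d -> Q K c d sg = Q K d c sg.
Proof.
move=> ms sM ic id; congr (_ * _).
pose F x y := c x * (d y * dbl sg (rho K x) (rho K y)).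
have M0 : 0 <= M by exact: le_trans (sM 0).
have dM x y : `|dbl sg x y| <= 2 * M.
  rewrite /dbl normrM ger0_norm ?invr_ge0// ler_pdivrMl//.
  have := sM (x - y); have := sM (y - x); have := sM (x + y); have := sM (- x - y).
  rewrite !ler_norml => /andP[? ?] /andP[? ?] /andP[? ?] /andP[? ?].
  by apply/andP; split; lra.
have mF : measurable_fun setT (fun p : R * R => F p.1 p.2).
  have mc : measurable_fun setT (fun p : R * R => c p.1) by exact: measurableT_comp (Ig_meas ic) _.
  have md : measurable_fun setT (fun p : R * R => d p.2) by exact: measurableT_comp (Ig_meas id) _.
  by apply: measurable_funM => //; apply: measurable_funM => //; exact: measurable_dbl2.
have [] := @Fubini_prod R F (fun x => 2 * M * `|c x|) (fun y => `|d y|) mF.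
- by apply: IgZ; exact: Ig_abs.
- exact: Ig_abs.
- move=> x y; rewrite /F normrM [`|d y * _|]normrM.
  have -> : 2 * M * `|c x| * `|d y| = `|c x| * (`|d y| * (2 * M)) by ring.
  by rewrite !ler_wpM2l.
have iD (g : R -> R) x : Ig g -> Ig (fun y => g y * dbl sg (rho K x) (rho K y)).
  move=> ig; apply: (IgMb ig _ (fun y => dM _ _)).
  exact: (measurableT_comp (measurable_dbl2 K ms) (measurable_pair1 x)).
move=> _ _ e; transitivity (\int[leb]_x \int[leb]_y F x y).
  by apply: Int_ext => x; rewrite /F (IntZ _ (iD d x id)).
rewrite e; apply: Int_ext => y.
rewrite /F (_ : (\int[leb]_x (c x * (d y * dbl sg (rho K x) (rho K y)))) =
    \int[leb]_x (d y * (c x * dbl sg (rho K y) (rho K x)))).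
  by rewrite (IntZ _ (iD c y ic)).
by apply: Int_ext => x; rewrite dblC; ring.
Qed.

Lemma dbl_low sg (N u w : R) : (forall z, `|z| < N -> sg z = 0) ->
  `|u| < N / 2 -> `|w| < N / 2 -> dbl sg u w = 0.
Proof.
move=> s0; rewrite !ltr_norml => /andP[u1 u2] /andP[w1 w2].
have z1 : `|u - w| < N by rewrite ltr_norml; apply/andP; split; lra.
have z2 : `|w - u| < N by rewrite ltr_norml; apply/andP; split; lra.
have z3 : `|u + w| < N by rewrite ltr_norml; apply/andP; split; lra.
have z4 : `|- u - w| < N by rewrite ltr_norml; apply/andP; split; lra.
by rewrite /dbl (s0 _ z1) (s0 _ z2) (s0 _ z3) (s0 _ z4) !addr0 subr0 mulr0.
Qed.

(** Two frequencies below N/2 have sums and differences below N, so [dbl sg] vanishes on the product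
    of the low parts, and one factor may always be taken in its high part. This replaces a
    paraproduct decomposition; the factor 2 counts the two positions of the high factor. *)
Lemma Q_high K c sg (M N : R) : measurable_fun setT sg -> (forall z, `|sg z| <= M) ->
  L2 (fun x => sg (rho K x)) -> (forall z, `|z| < N -> sg z = 0) -> Ig c -> L2 c ->
  `|Q K c c sg| <= 2 * (\int[leb]_x `|c x|) *
    (nr (fun x => c x * \1_[set z | N / 2 <= `|z|] (rho K x)) * nr (fun x => sg (rho K x))).
Proof.
move=> ms sM Ls s0 ic Lc.
pose h x : R := \1_[set z | N / 2 <= `|z|] (rho K x).
pose hi x := c x * h x; pose lo x := c x * (1 - h x).
have mh : measurable_fun setT h.
  have mset : measurable [set z : R | N / 2 <= `|z|].
    rewrite (_ : [set _ | _] = ~` `]- (N / 2), N / 2[%classic).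
      by apply: measurableC; exact: measurable_itv.
    apply/seteqP; split=> z /=; rewrite in_itv/= -ltr_norml leNgt; by move/negP.
  have mi : measurable_fun setT (\1_[set z : R | N / 2 <= `|z|] : R -> R).
    exact: measurable_indic.
  exact: measurableT_comp mi (@measurable_rho R K).
have h01 x : h x = 0 \/ h x = 1 by rewrite /h indicE; case: (_ \in _); [right|left].
have h1 x : `|h x| <= 1 by case: (h01 x) => ->; rewrite ?normr0 ?normr1.
have m1h : measurable_fun setT (fun x => 1 - h x) by exact: measurable_funB.
have h1' x : `|1 - h x| <= 1.
  by case: (h01 x) => ->; rewrite ?subr0 ?subrr ?normr0 ?normr1.
have ihi : Ig hi by exact: IgMb mh h1.
have ilo : Ig lo by exact: IgMb m1h h1'.
have Lhi : L2 hi by exact: L2Mb mh h1.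
have Llo : L2 lo by exact: L2Mb m1h h1'.
have -> : Q K c c sg = Q K c hi sg + Q K lo hi sg.
  have E : c = (fun x => hi x + lo x) by apply/funext => x; rewrite /hi /lo; ring.
  have E1 : Q K c c sg = Q K hi c sg + Q K lo c sg by rewrite {1}E; exact: (Q_Dl ms).
  have E2 : Q K lo c sg = Q K lo hi sg + Q K lo lo sg by rewrite [in LHS]E; exact: (Q_Dr ms).
  have alg (p q r a b e : R) : p = q + r -> r = a + b -> q = e -> b = 0 -> p = e + a.
    by move=> -> -> -> ->; rewrite addr0.
  apply: alg E1 E2 (Q_sym K ms sM ihi ic) _.
  rewrite /Q (_ : \int[leb]_x _ = 0) ?mulr0//.
  rewrite -[RHS](Int0 (R := R)); apply: Int_ext => x; rewrite /lo.
  case: (h01 x) => hx; rewrite hx ?subrr ?mulr0 ?mul0r// subr0 mulr1.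
  rewrite (_ : Qin _ _ _ _ = 0) ?mulr0// -[RHS](Int0 (R := R)); apply: Int_ext => y.
  case: (h01 y) => hy; rewrite hy ?subrr ?mulr0 ?mul0r// subr0 mulr1.
  have lt z : h z = 0 -> `|rho K z| < N / 2.
    rewrite /h indicE; case: (boolP (_ \in _)) => [_ /eqP|]; first by rewrite oner_eq0.
    by rewrite notin_setE/= => /negP; rewrite -ltNge.
  by rewrite (dbl_low s0 (lt _ hx) (lt _ hy)) mulr0.
apply: (le_trans (ler_normD _ _)).
have b1 := Q_bound ms Ls Lhi ic; have b2 := Q_bound ms Ls Lhi ilo.
have n0 : 0 <= nr hi * nr (fun x => sg (rho K x)) by rewrite mulr_ge0 ?nr_ge0.
have lec : \int[leb]_x `|lo x| <= \int[leb]_x `|c x|.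
  by apply: Int_le; [exact: Ig_abs|exact: Ig_abs|move=> x; rewrite normrM ler_piMr].
move: b1 b2 (ler_wpM2r n0 lec); rewrite -/hi -/h -mulrA.
move: (nr hi * _) (Q _ _ _ _) (Q _ _ _ _) (\int[leb]_x _) (\int[leb]_x _).
by clear; move=> *; lra.
Qed.

End Weights.

(** * Uniformly continuous functions of time *)
Section TimeCalculus.
Context {R : realType}.
Local Notation leb := (@lebesgue_measure R).
Implicit Types (f g H : R -> R) (a b e d t : R).

Definition ucont_on a b f := forall e, 0 < e -> exists2 d, 0 < d &
  forall t u, a <= t <= b -> a <= u <= b -> `|t - u| < d -> `|f t - f u| <= e.

Lemma ucont_within a b f : ucont_on a b f -> {within `[a, b], continuous f}.
Proof.
move=> uf; apply/subspace_continuousP => x /=; rewrite in_itv/= => xab.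
apply/cvgrPdist_le => e e0; have [d d0 H] := uf e e0.
rewrite near_withinE; near=> t => /=; rewrite in_itv/= => tab.
apply: H => //; near: t; exact: cvgr_dist_lt.
Unshelve. all: by end_near. Qed.

Lemma ucont_sub a b a' b' f : a <= a' -> b' <= b -> ucont_on a b f -> ucont_on a' b' f.
Proof.
move=> aa bb uf e /uf[d d0 H]; exists d => // t u /andP[t1 t2] /andP[u1 u2] tu.
by apply: H => //; apply/andP; split; lra.
Qed.

Lemma ucont_int a b f : ucont_on a b f -> leb.-integrable `[a, b] (EFin \o f).
Proof.
by move=> /ucont_within cf; apply: continuous_compact_integrable => //; exact: segment_compact.
Qed.

Lemma ucontN a b f : ucont_on a b f -> ucont_on a b (fun x => - f x).
Proof.
move=> uf e /uf[d d0 h]; exists d => // t u tab uab tu.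
by rewrite -opprD normrN; exact: h.
Qed.

Lemma ucontD a b f g : ucont_on a b f -> ucont_on a b g -> ucont_on a b (fun x => f x + g x).
Proof.
move=> uf ug e e0; have e2 : 0 < e / 2 by lra.
have [d1 d10 h1] := uf _ e2; have [d2 d20 h2] := ug _ e2.
exists (Num.min d1 d2); first by rewrite lt_min d10.
move=> t u tab uab; rewrite lt_min => /andP[t1 t2].
rewrite opprD addrACA; apply: (le_trans (ler_normD _ _)).
by have := h1 t u tab uab t1; have := h2 t u tab uab t2; lra.
Qed.

Lemma Rint_cat a b c f : a <= b -> b <= c -> leb.-integrable `[a, c] (EFin \o f) ->
  \int[leb]_(x in `[a, c]) f x = \int[leb]_(x in `[a, b]) f x + \int[leb]_(x in `[b, c]) f x.
Proof.
move=> ab bc fi.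
have := @Rintegral_itvB R f (BLeft a) (BRight c) b fi; rewrite !bnd_simp => /(_ ab bc) h.
have e : \int[leb]_(x in `]b, c]) f x = \int[leb]_(x in `[b, c]) f x.
  apply: Rintegral_itv_obnd_cbnd.
  by apply: integrableS fi => //; apply: subset_itvr; rewrite bnd_simp.
by rewrite -e -h addrC subrK.
Qed.

Lemma Rint_le_cst a b f e : a <= b -> leb.-integrable `[a, b] (EFin \o f) ->
  (forall x, a <= x <= b -> `|f x| <= e) -> `|\int[leb]_(x in `[a, b]) f x| <= e * (b - a).
Proof.
move=> ab fi fe; apply: (le_trans (le_normr_Rintegral _ fi)) => //.
have ci : leb.-integrable `[a, b] (EFin \o cst e).
  by apply: continuous_compact_integrable; [exact: segment_compact|exact: continuous_subspaceT (@cst_continuous _ _ _)].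
apply: (@le_trans _ _ (\int[leb]_(x in `[a, b]) cst e x)).
  apply: le_Rintegral => //; first exact: integrable_norm.
rewrite Rintegral_cst//= lebesgue_measure_itv/= lte_fin.
by case: ltP => h; rewrite //= mulr0 mulr_ge0 ?subr_ge0// (le_trans _ (fe a _)) ?lexx.
Qed.

(** The interval is cut into n pieces shorter than d and the increments are added. This replaces the
    statement that a vanishing derivative implies constancy when increments can be estimated but no
    derivative is at hand. *)
Lemma locally_flat a b H : a <= b ->
  (forall e, 0 < e -> exists2 d, 0 < d & forall t u, a <= t -> t <= u -> u <= b ->
     u - t < d -> `|H u - H t| <= e * (u - t)) -> H b = H a.
Proof.
move=> ab hH; apply/eqP; rewrite -subr_eq0 -normr_le0; apply/ler_addgt0Pr => e e0.
rewrite add0r.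
have [->|nab] := eqVneq a b; first by rewrite subrr normr0 ltW.
have ba : 0 < b - a by rewrite subr_gt0 lt_neqAle nab.
have e1 : 0 < e / (b - a) by rewrite divr_gt0.
have [d d0 hd] := hH _ e1.
pose n := (Num.truncn ((b - a) / d)).+1.
have n0 : 0 < n%:R :> R by rewrite ltr0n.
have nd : (b - a) / n%:R < d.
  rewrite ltr_pdivrMr// mulrC -ltr_pdivrMr//; exact: truncnS_gt.
pose t k := a + k%:R * ((b - a) / n%:R).
have q0 : 0 < (b - a) / n%:R by rewrite divr_gt0.
have tn : t n = b by rewrite /t mulrC divfK ?gt_eqF// addrC subrK.
have t0 : t 0%N = a by rewrite /t mul0r addr0.
rewrite -{1}tn -{1}t0 -(telescope_sumr (fun k => H (t k)))//.
apply: (le_trans (ler_norm_sum _ _ _)).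
apply: (@le_trans _ _ (\sum_(0 <= k < n) (e / (b - a) * ((b - a) / n%:R)))).
  rewrite !big_nat; apply: ler_sum => k /andP[_ kn].
  have tS : t k.+1 - t k = (b - a) / n%:R by rewrite /t -natr1; ring.
  have kb : t k.+1 <= b.
    rewrite -tn /t lerD2l ler_wpM2r ?(ltW q0)// ler_nat//.
  rewrite -tS; apply: hd => //; last by rewrite tS.
    by rewrite /t lerDl mulr_ge0 ?(ltW q0).
  by rewrite -subr_ge0 tS ltW.
rewrite sumr_const_nat subn0 -[_ *+ n]mulr_natr.
suff -> : e / (b - a) * ((b - a) / n%:R) * n%:R = e by [].
by field; rewrite !gt_eqF.
Qed.

Lemma Rint_ge0 a b f : (forall x, a <= x <= b -> 0 <= f x) ->
  0 <= \int[leb]_(x in `[a, b]) f x.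
Proof. by move=> h; apply: Rintegral_ge0 => x /=; rewrite in_itv/=; exact: h. Qed.

Lemma Rint_cst a b (m : R) : a <= b -> \int[leb]_(x in `[a, b]) m = m * (b - a).
Proof.
move=> ab; rewrite Rintegral_cst//= lebesgue_measure_itv/= lte_fin.
case: ltP => h //=.
by have -> : a = b by [lra]; rewrite subrr.
Qed.

Lemma ucont_cst a b (m : R) : ucont_on a b (fun=> m).
Proof. by move=> e e0; exists 1 => // *; rewrite subrr normr0 ltW. Qed.

Lemma ucont_bounded a b f : ucont_on a b f -> exists M, forall x, a <= x <= b -> `|f x| <= M.
Proof.
have [ab|ba] := leP a b; last by exists 0 => x; lra.
move=> /ucont_within/(@continuous_compact _ _ f `[a, b]).
move=> /(_ (@segment_compact _ _ _))/compact_bounded[M [_ /(_ (M + 1))]].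
rewrite ltrDl ltr01 => /(_ isT) h; exists (M + 1) => x xab; apply: h; exists x => //=.
Qed.

Lemma ucontM a b f g : ucont_on a b f -> ucont_on a b g -> ucont_on a b (fun x => f x * g x).
Proof.
move=> uf ug e e0.
have [M hM] := ucont_bounded uf; have [M' hM'] := ucont_bounded ug.
pose m := `|M| + `|M'| + 1.
have m0 : 0 < m by rewrite /m; have := normr_ge0 M; have := normr_ge0 M'; lra.
have e1 : 0 < e / (2 * m) by rewrite divr_gt0// mulr_gt0.
have [d1 d10 h1] := uf _ e1; have [d2 d20 h2] := ug _ e1.
exists (Num.min d1 d2); first by rewrite lt_min d10.
move=> t u tab uab; rewrite lt_min => /andP[t1 t2].
have -> : f t * g t - f u * g u = (f t - f u) * g t + f u * (g t - g u) by ring.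
apply: (le_trans (ler_normD _ _)); rewrite !normrM.
have a1 := h1 t u tab uab t1; have a2 := h2 t u tab uab t2.
have b1 : `|g t| <= m by apply: (le_trans (hM' _ tab)); rewrite /m; have := ler_norm M'; have := normr_ge0 M; lra.
have b2 : `|f u| <= m by apply: (le_trans (hM _ uab)); rewrite /m; have := ler_norm M; have := normr_ge0 M'; lra.
have q1 : `|f t - f u| * `|g t| <= e / (2 * m) * m by apply: ler_pM.
have q2 : `|f u| * `|g t - g u| <= m * (e / (2 * m)) by apply: ler_pM.
have q : e / (2 * m) * m = e / 2 by field; rewrite gt_eqF.
by move: q1 q2; rewrite [m * _]mulrC q; lra.
Qed.

Lemma ucontZ a b (m : R) f : ucont_on a b f -> ucont_on a b (fun x => m * f x).
Proof. by move=> uf; apply: ucontM => //; exact: ucont_cst. Qed.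

Lemma ucontB a b f g : ucont_on a b f -> ucont_on a b g -> ucont_on a b (fun x => f x - g x).
Proof. by move=> uf ug; apply: ucontD => //; exact: ucontN. Qed.

Lemma ucont_sum a b (J : Type) (l : seq J) (F : J -> R -> R) :
  (forall j, ucont_on a b (F j)) -> ucont_on a b (fun x => \sum_(j <- l) F j x).
Proof.
move=> h; elim: l => [|j l ih].
  by move=> e e0; exists 1 => // *; rewrite !big_nil subrr normr0 ltW.
move=> e /(ucontD (h j) ih)[d d0 H]; exists d => // t u *; rewrite !big_cons; exact: H.
Qed.

Lemma Rint_D a b f g : ucont_on a b f -> ucont_on a b g ->
  \int[leb]_(x in `[a, b]) (f x + g x) =
  \int[leb]_(x in `[a, b]) f x + \int[leb]_(x in `[a, b]) g x.
Proof. by move=> /ucont_int uf /ucont_int ug; rewrite RintegralD. Qed.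

Lemma Rint_B a b f g : ucont_on a b f -> ucont_on a b g ->
  \int[leb]_(x in `[a, b]) (f x - g x) =
  \int[leb]_(x in `[a, b]) f x - \int[leb]_(x in `[a, b]) g x.
Proof. by move=> /ucont_int uf /ucont_int ug; rewrite RintegralB. Qed.

Lemma Rint_Z a b (m : R) f : ucont_on a b f ->
  \int[leb]_(x in `[a, b]) (m * f x) = m * \int[leb]_(x in `[a, b]) f x.
Proof. by move=> /ucont_int uf; rewrite RintegralZl. Qed.

Lemma Rint_sum a b (J : Type) (l : seq J) (F : J -> R -> R) :
  (forall j, ucont_on a b (F j)) ->
  \int[leb]_(x in `[a, b]) (\sum_(j <- l) F j x) =
  \sum_(j <- l) \int[leb]_(x in `[a, b]) F j x.
Proof.
move=> h; elim: l => [|j l ih].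
  have [ab|ba] := leP a b; last by rewrite set_itv_ge ?Rintegral_set0 ?big_nil// bnd_simp -ltNge.
  rewrite big_nil -[RHS](mul0r (b - a)) -Rint_cst//.
  by apply: eq_Rintegral => x _; rewrite big_nil.
rewrite big_cons -ih -Rint_D//; last exact: ucont_sum.
by apply: eq_Rintegral => x _; rewrite big_cons.
Qed.

Lemma Rint_le a b f g : ucont_on a b f -> ucont_on a b g ->
  (forall x, a <= x <= b -> f x <= g x) ->
  \int[leb]_(x in `[a, b]) f x <= \int[leb]_(x in `[a, b]) g x.
Proof.
move=> /ucont_int uf /ucont_int ug h; exact: le_Rintegral. Qed.

(** The variance of f on [a, b] is nonnegative; m below is the mean value. *)
Lemma Rint_CS a b f : a <= b -> ucont_on a b f ->
  (\int[leb]_(x in `[a, b]) f x) ^+ 2 <= (b - a) * \int[leb]_(x in `[a, b]) (f x ^+ 2).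
Proof.
move=> ab uf; set I := \int[leb]_(x in `[a, b]) f x.
have uff : ucont_on a b (fun x => f x ^+ 2) by exact: ucontM.
have [ba|nab] := eqVneq (b - a) 0.
  have -> : I = 0.
    apply/eqP; rewrite -normr_le0.
    have [M hM] := ucont_bounded uf.
    by have := Rint_le_cst ab (ucont_int uf) hM; rewrite ba mulr0.
  by rewrite ba mul0r expr0n.
have d0 : 0 < b - a by rewrite lt_neqAle eq_sym nab subr_ge0.
set m := I / (b - a).
have : 0 <= \int[leb]_(x in `[a, b]) ((f x ^+ 2 - (2 * m) * f x) + m ^+ 2).
  apply: Rint_ge0 => x _; have -> : f x ^+ 2 - 2 * m * f x + m ^+ 2 = (f x - m) ^+ 2 by ring.
  exact: sqr_ge0.
rewrite Rint_D; [|by apply: ucontB => //; exact: ucontZ|exact: ucont_cst].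
rewrite Rint_B//; last exact: ucontZ.
rewrite Rint_Z// Rint_cst//; set J := \int[leb]_(x in `[a, b]) (f x ^+ 2) => h.
have := mulr_ge0 (ltW d0) h; rewrite -/I.
have -> : (b - a) * (J - 2 * m * I + m ^+ 2 * (b - a)) = (b - a) * J - I ^+ 2.
  by rewrite /m; field.
by rewrite subr_ge0.
Qed.

End TimeCalculus.

(** * The evolution equation on the frequency side *)
Section Evolution.
Context {R : realType}.
Local Notation leb := (@lebesgue_measure R).
Implicit Types (c d sg : R -> R) (K : spatial_domain) (t u e z a b : R).

(** The coefficient c is a function of the real variable that precedes [rho], whereas the symbol sg
    is a function of the frequency itself. *)
Definition freq_pair K c sg : R := \int[leb]_x (c x * sg (rho K x)).

(** One constant bounds both the values and the support. Continuity may fail at finitely many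
    points, so that sharp dyadic cutoffs belong to the class. *)
Definition symbol_class sg := measurable_fun setT sg /\
  exists2 M : R, (forall z, `|sg z| <= M /\ (M < `|z| -> sg z = 0)) &
  exists l : seq R, forall z, z \notin l -> {for z, continuous sg}.

(** The frequency side of C([0,T] : H^s), with the uniform continuity that compactness of [0,T]
    provides. *)
Definition weighted_continuous K (s T : R) (c : R -> R -> R) :=
  (forall t, 0 <= t <= T -> measurable_fun setT (c t) /\
    L2 (fun x => wt s (rho K x) * c t x)) /\
  (forall e, 0 < e -> exists2 dl : R, 0 < dl & forall t u : R, 0 <= t <= T -> 0 <= u <= T ->
    `|t - u| < dl -> nr (fun x => wt s (rho K x) * (c t x - c u x)) <= e).

(* The equation on the Hartley side, tested against the symbol [sg]: as cas' (y) =
   cas (- y), the multipliers i omega and i xi become multiplication by omega(xi),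
   resp. xi, followed by reflection of the frequency. *)
Definition evolves K (omega : R -> R) (T : R) (c : R -> R -> R) :=
  forall sg, symbol_class sg -> forall t0 t, 0 <= t0 -> t0 <= t -> t <= T ->
    freq_pair K (c t) sg - freq_pair K (c t0) sg =
    \int[leb]_(tau in `[t0, t]) (freq_pair K (c tau) (fun z => omega z * sg (- z))
       - Q K (c tau) (c tau) (fun z => - z * sg (- z))).

Lemma freq_pair_bound K c sg : L2 c -> L2 (fun x => sg (rho K x)) ->
  `|freq_pair K c sg| <= nr c * nr (fun x => sg (rho K x)).
Proof. exact: CS_abs. Qed.

Lemma freq_pairBl K c d sg : L2 c -> L2 d -> L2 (fun x => sg (rho K x)) ->
  freq_pair K (fun x => c x - d x) sg = freq_pair K c sg - freq_pair K d sg.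
Proof.
move=> hc hd hs; rewrite -IntB; [|exact: L2M_Ig|exact: L2M_Ig].
by apply: Int_ext => x; rewrite mulrBl.
Qed.

Lemma freq_pairBr K c sg sg' : L2 c -> L2 (fun x => sg (rho K x)) ->
  L2 (fun x => sg' (rho K x)) ->
  freq_pair K c (fun z => sg z - sg' z) = freq_pair K c sg - freq_pair K c sg'.
Proof.
move=> hc hs hs'; rewrite -IntB; [|exact: L2M_Ig|exact: L2M_Ig].
by apply: Int_ext => x; rewrite mulrBr.
Qed.

Lemma freq_pair_sum K c n (e : nat -> R) (sg : nat -> R -> R) : L2 c ->
  (forall j, L2 (fun x => sg j (rho K x))) ->
  freq_pair K c (fun z => \sum_(0 <= j < n) e j * sg j z) =
  \sum_(0 <= j < n) e j * freq_pair K c (sg j).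
Proof.
move=> hc hs; rewrite /freq_pair.
transitivity (\sum_(0 <= j < n) \int[leb]_x (e j * (c x * sg j (rho K x)))); last first.
  by apply: eq_bigr => j _; rewrite IntZ//; exact: L2M_Ig.
rewrite -Int_sum; last by move=> j; apply: IgZ; exact: L2M_Ig.
apply: Int_ext => x; rewrite mulr_sumr; apply: eq_bigr => j _; ring.
Qed.

Lemma Q_B K c sg sg' : measurable_fun setT sg -> measurable_fun setT sg' ->
  L2 (fun x => sg (rho K x)) -> L2 (fun x => sg' (rho K x)) -> L2 c -> Ig c ->
  Q K c c (fun z => sg z - sg' z) = Q K c c sg - Q K c c sg'.
Proof.
move=> ms ms' hs hs' hc ic.
pose e (j : nat) : R := if j == 0%N then 1 else -1; pose f (j : nat) := if j == 0%N then sg else sg'.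
have mf j : measurable_fun setT (f j) by rewrite /f; case: (j == 0)%N.
have Lf j : L2 (fun x => f j (rho K x)) by rewrite /f; case: (j == 0)%N.
have -> : (fun z => sg z - sg' z) = (fun z => \sum_(0 <= j < 2) e j * f j z).
  by apply/funext => z; rewrite !big_nat_recr//= big_nil add0r mul1r mulN1r.
by rewrite (Q_sum 2 e mf Lf hc ic) 2?big_nat_recr//= big_nil add0r mul1r mulN1r.
Qed.

(** * Continuous families of coefficients *)

Section Family.
Variables (K : spatial_domain) (s T : R) (c : R -> R -> R).
Hypothesis s12 : 2^-1 < s.
Hypothesis hc : weighted_continuous K s T c.

Let s0 : 0 <= s. Proof. by apply: le_trans (ltW s12); rewrite invr_ge0. Qed.

Let X t := fun x => wt s (rho K x) * c t x.

Lemma wcont_L2 t : 0 <= t <= T -> L2 (c t) /\ nr (c t) <= nr (X t).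
Proof.
move=> tT; have [mc lX] := hc.1 t tT.
have le x : `|c t x| <= `|X t x|.
  by rewrite /X normrM ger0_norm ?wt_ge0// ler_peMl// wt_ge1.
have lc : L2 (c t) by exact: L2_le le.
by split=> //; exact: nr_le.
Qed.

Lemma wcont_L2B t u : 0 <= t <= T -> 0 <= u <= T ->
  L2 (fun x => c t x - c u x) /\
  nr (fun x => c t x - c u x) <= nr (fun x => wt s (rho K x) * (c t x - c u x)).
Proof.
move=> tT uT; have [l1 _] := wcont_L2 tT; have [l2 _] := wcont_L2 uT.
have l3 : L2 (fun x => c t x - c u x) by exact: L2B.
have l4 : L2 (fun x => wt s (rho K x) * (c t x - c u x)).
  have := L2B (hc.1 t tT).2 (hc.1 u uT).2.
  by under eq_fun do rewrite -mulrBr.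
split=> //; apply: nr_le => // x.
by rewrite normrM ger0_norm ?wt_ge0// ler_peMl// wt_ge1.
Qed.

(** The constant of the embedding of H^s into the functions with integrable transform. *)
Definition wnorm : R := nr (fun x : R => wt (- s) (rho K x)).

Lemma wcont_L1 t : 0 <= t <= T -> Ig (c t) /\ \int[leb]_x `|c t x| <= wnorm * nr (X t).
Proof. by move=> tT; have [mc lX] := hc.1 t tT; exact: L1_weight. Qed.

Lemma wcont_L1B t u : 0 <= t <= T -> 0 <= u <= T ->
  Ig (fun x => c t x - c u x) /\
  \int[leb]_x `|c t x - c u x| <= wnorm * nr (fun x => wt s (rho K x) * (c t x - c u x)).
Proof.
move=> tT uT; apply: L1_weight => //.
  by have [[]] := wcont_L2B tT uT.
have := L2B (hc.1 t tT).2 (hc.1 u uT).2.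
by under eq_fun do rewrite -mulrBr.
Qed.

Lemma wcont_bounded : exists2 B : R, 0 < B & forall t, 0 <= t <= T -> nr (X t) <= B.
Proof.
have : ucont_on 0 T (fun t => nr (X t)).
  move=> e e0; have [dl dl0 h] := hc.2 e e0; exists dl => // t u tT uT tu.
  have key t' u' : 0 <= t' <= T -> 0 <= u' <= T -> `|t' - u'| < dl ->
      nr (X t') <= nr (X u') + e.
    move=> tT' uT' tu'; apply: le_trans (_ : nr (fun x => X u' x + (X t' x - X u' x)) <= _).
      rewrite le_eqVlt; apply/orP; left; apply/eqP; congr nr.
      by apply/funext => x; rewrite addrC subrK.
    apply: le_trans; first apply: nr_triangle.
    - exact: (hc.1 u' uT').2.
    - exact: L2B (hc.1 t' tT').2 (hc.1 u' uT').2.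
    rewrite lerD2l; apply: le_trans (h _ _ tT' uT' tu').
    by under eq_fun do rewrite -mulrBr.
  have k1 := key t u tT uT tu; have k2 : nr (X u) <= nr (X t) + e.
    by apply: key => //; rewrite distrC.
  by rewrite ler_norml; apply/andP; split; lra.
move=> /ucont_bounded[M hM]; exists (`|M| + 1); first by rewrite ltr_wpDl.
move=> t tT; have := hM t tT; rewrite ger0_norm ?nr_ge0// => h.
by apply: (le_trans h); have := ler_norm M; lra.
Qed.

Lemma wcont_diff e : 0 < e -> exists2 dl : R, 0 < dl & forall t u : R, 0 <= t <= T -> 0 <= u <= T ->
  `|t - u| < dl -> nr (fun x => c t x - c u x) <= e /\ \int[leb]_x `|c t x - c u x| <= e.
Proof.
move=> e0; have w0 : 0 <= wnorm := nr_ge0 _.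
have e1 : 0 < e / (1 + wnorm) by rewrite divr_gt0// ltr_pwDl.
have [dl dl0 h] := hc.2 _ e1; exists dl => // t u tT uT tu.
have h1 := h t u tT uT tu.
have q : e / (1 + wnorm) * (1 + wnorm) = e by rewrite divfK// gt_eqF// ltr_pwDl.
have q' : e / (1 + wnorm) <= e by rewrite -{2}q ler_peMr ?(ltW e1)// lerDl.
split; first by apply: le_trans q'; apply: le_trans h1; exact: (wcont_L2B tT uT).2.
apply: le_trans (wcont_L1B tT uT).2 _; rewrite -q mulrC.
by apply: ler_pM => //; rewrite ?nr_ge0// lerDr.
Qed.

(** * Pairings with a symbol that is Lipschitz in time *)

Section MovingSymbol.
Variables (a b P : R) (sg : R -> R -> R).
Hypotheses (a0 : 0 <= a) (bT : b <= T) (P0 : 0 <= P).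
Hypothesis ms : forall t, measurable_fun setT (sg t).
Hypothesis ls : forall t, L2 (fun x => sg t (rho K x)).
Hypothesis bs : forall t, a <= t <= b -> nr (fun x => sg t (rho K x)) <= P.
Hypothesis cs : forall t u : R, a <= t <= b -> a <= u <= b ->
  nr (fun x => sg t (rho K x) - sg u (rho K x)) <= P * `|t - u|.

Let abT t : a <= t <= b -> 0 <= t <= T.
Proof. by move=> /andP[h1 h2]; rewrite (le_trans a0 h1) (le_trans h2 bT). Qed.

Let small e : 0 < e -> exists2 dl : R, 0 < dl & forall t u : R, `|t - u| < dl -> P * `|t - u| <= e.
Proof.
move=> e0; exists (e / (1 + P)); first by rewrite divr_gt0// ltr_pwDl.
move=> t u; rewrite ltr_pdivlMr ?ltr_pwDl// => h.
by apply: le_trans (ltW h); rewrite mulrC ler_wpM2l// lerDr.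
Qed.

Lemma freq_pair_moving t u : a <= t <= b -> a <= u <= b ->
  `|freq_pair K (c t) (sg t) - freq_pair K (c u) (sg u)| <=
    nr (fun x => c t x - c u x) * P + nr (X u) * (P * `|t - u|).
Proof.
move=> tab uab.
have [l1 n1] := wcont_L2 (abT tab); have [l2 nn2] := wcont_L2 (abT uab).
have -> : freq_pair K (c t) (sg t) - freq_pair K (c u) (sg u) =
   freq_pair K (fun x => c t x - c u x) (sg t) +
   freq_pair K (c u) (fun z => sg t z - sg u z).
  by rewrite freq_pairBl// freq_pairBr//; ring.
apply: (le_trans (ler_normD _ _)); apply: lerD.
  apply: le_trans (freq_pair_bound _ _) _ => //; first exact: L2B.
  by apply: ler_wpM2l; rewrite ?nr_ge0// bs.
apply: le_trans (freq_pair_bound _ _) _ => //; first exact: L2B.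
by apply: ler_pM; rewrite ?nr_ge0// cs.
Qed.

Lemma ucont_freq_pair : ucont_on a b (fun t => freq_pair K (c t) (sg t)).
Proof.
move=> e e0; have [B B0 hB] := wcont_bounded.
have e1 : 0 < e / 2 / (1 + P) by rewrite !divr_gt0// ltr_pwDl.
have e2 : 0 < e / 2 / B by rewrite !divr_gt0.
have [d1 d10 h1] := wcont_diff e1; have [d2 d20 h2] := small e2.
exists (Num.min d1 d2); first by rewrite lt_min d10.
move=> t u tab uab; rewrite lt_min => /andP[tu1 tu2].
apply: le_trans (freq_pair_moving tab uab) _.
have [k1 _] := h1 _ _ (abT tab) (abT uab) tu1; have k2 := h2 _ _ tu2.
have p0 : 0 <= P * `|t - u| by rewrite mulr_ge0.
have -> : e = e / 2 / (1 + P) * (1 + P) + B * (e / 2 / B).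
  by field; rewrite !gt_eqF// ltr_pwDl.
apply: lerD; apply: ler_pM; rewrite ?nr_ge0 ?lerDr//; exact: hB (abT uab).
Qed.

(** Telescoping in the three arguments: two terms carry the difference of c, the third that of the
    symbol. Each is estimated by [Q_bound] and receives one third of e. *)
Lemma ucont_Q : ucont_on a b (fun t => Q K (c t) (c t) (sg t)).
Proof.
move=> e e0; have [B B0 hB] := wcont_bounded.
have w0 : 0 <= wnorm := nr_ge0 _.
pose V := (1 + wnorm) * B.
have V0 : 0 < V by rewrite mulr_gt0// ltr_pwDl.
have VB : B <= V by rewrite /V ler_peMl ?(ltW B0)// lerDl.
have e1 : 0 < e / 3 / (V * (1 + P)) by rewrite !divr_gt0// mulr_gt0// ltr_pwDl.
have e2 : 0 < e / 3 / (V * V) by rewrite !divr_gt0// mulr_gt0.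
have [d1 d10 h1] := wcont_diff e1; have [d2 d20 h2] := small e2.
exists (Num.min d1 d2); first by rewrite lt_min d10.
move=> t u tab uab; rewrite lt_min => /andP[tu1 tu2].
have [k1 k1'] := h1 _ _ (abT tab) (abT uab) tu1; have k2 := h2 _ _ tu2.
have [l1 n1] := wcont_L2 (abT tab); have [l2 nn2] := wcont_L2 (abT uab).
have [i1 m1] := wcont_L1 (abT tab); have [i2 m2] := wcont_L1 (abT uab).
have [l3 n3] := wcont_L2B (abT tab) (abT uab); have [i3 m3] := wcont_L1B (abT tab) (abT uab).
have nB v : a <= v <= b -> nr (X v) <= V by move=> vab; apply: le_trans VB; exact: hB (abT vab).
have wB v : a <= v <= b -> wnorm * nr (X v) <= V.
  by move=> vab; apply: ler_pM; rewrite ?nr_ge0 ?lerDr//; exact: hB (abT vab).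
have -> : Q K (c t) (c t) (sg t) - Q K (c u) (c u) (sg u) =
   Q K (fun x => c t x - c u x) (c t) (sg t) + Q K (c u) (fun x => c t x - c u x) (sg t)
   + Q K (c u) (c u) (fun z => sg t z - sg u z).
  rewrite Q_B//.
  have := @Q_Dl R K (fun x => c t x - c u x) (c u) (c t) (sg t) (ms t) (ls t) l1 i3 i2.
  have := @Q_Dr R K (c u) (fun x => c t x - c u x) (c u) (sg t) (ms t) (ls t) l3 l2 i2.
  have -> : (fun x => c t x - c u x + c u x) = c t by apply/funext => x; rewrite subrK.
  have alg (x y v p q r : R) : p = q + r -> x = y + p -> x - v = y + q + (r - v).
    by move=> -> ->; ring.
  exact: alg.
have i0 f : 0 <= \int[leb]_x `|f x| by exact: Int_ge0.
have -> : e = e / 3 / (V * (1 + P)) * (V * (1 + P)) + V * (e / 3 / (V * (1 + P)) * (1 + P))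
   + V * (V * (e / 3 / (V * V))).
  by field; rewrite !gt_eqF// ltr_pwDl.
have P1 : P <= 1 + P by rewrite lerDr.
apply: (le_trans (ler_normD _ _)); apply: lerD; first (apply: (le_trans (ler_normD _ _)); apply: lerD).
- apply: le_trans (Q_bound _ _ _ _) _ => //.
  apply: ler_pM; rewrite ?i0 ?mulr_ge0 ?nr_ge0//; apply: ler_pM; rewrite ?nr_ge0//.
    exact: le_trans n1 (nB _ tab).
  exact: le_trans (bs tab) P1.
- apply: le_trans (Q_bound _ _ _ _) _ => //.
  apply: ler_pM; rewrite ?i0 ?mulr_ge0 ?nr_ge0//.
    exact: le_trans m2 (wB _ uab).
  apply: ler_pM; rewrite ?nr_ge0//; exact: le_trans (bs tab) P1.
- apply: le_trans (Q_bound _ _ _ _) _ => //; [exact: measurable_funB|exact: L2B|].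
  apply: ler_pM; rewrite ?i0 ?mulr_ge0 ?nr_ge0//.
    exact: le_trans m2 (wB _ uab).
  apply: ler_pM; rewrite ?nr_ge0//; first exact: le_trans nn2 (nB _ uab).
  exact: le_trans (cs tab uab) k2.
Qed.

End MovingSymbol.
End Family.
End Evolution.

(** * Duhamel's formula on the frequency side *)

Section Duhamel.
Context {R : realType}.
Local Notation leb := (@lebesgue_measure R).
Implicit Types (c d sg : R -> R) (K : spatial_domain) (t u e z a b y : R).

(** The rotation law that replaces e^(i(y+b)) = e^(iy) e^(ib): cas (- y) is the derivative of cas at
    y. *)
Lemma cas_add y b : cas (y + b) = cas y * cos b + cas (- y) * sin b.
Proof. by rewrite /cas cosD sinD cosN sinN; ring. Qed.

Lemma sin_le_id y : `|sin y| <= `|y|.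
Proof.
have [y0|y0] := eqVneq y 0; first by rewrite y0 sin0 normr0.
have key (x : R) : 0 < x -> `|sin x| <= x.
  move=> x0; have [] := @MVT R sin cos 0 x x0.
    by apply: continuous_subspaceT => z; exact: continuous_sin.
  move=> z _; rewrite sin0 !subr0 => ->; rewrite normrM (gtr0_norm x0).
  by rewrite ler_piMl ?(ltW x0)// ler_norml cos_geN1 cos_le1.
have [h|h] := ltP 0 y; first by rewrite (gtr0_norm h) key.
by have := key (- y); rewrite sinN normrN (ler0_norm h); apply; rewrite lt_neqAle eq_sym oppr_eq0 y0 oppr_ge0.
Qed.

Lemma one_sub_cosE y : 1 - cos y = sin (y / 2) ^+ 2 *+ 2.
Proof.
have -> : cos y = cos (y / 2 + y / 2) by congr cos; field.
by rewrite cosD -{1}(cos2Dsin2 (y / 2)); ring.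
Qed.

Lemma one_sub_cos_le y : `|1 - cos y| <= y ^+ 2.
Proof.
rewrite one_sub_cosE.
have := sin_le_id (y / 2); rewrite -(ler_pXn2r (n := 2)) ?nnegrE// !real_normK ?num_real//.
rewrite ger0_norm ?mulrn_wge0 ?sqr_ge0//; have -> : (y / 2) ^+ 2 = y ^+ 2 / 4 by field.
by rewrite -mulr_natr; have := sqr_ge0 y; lra.
Qed.

Lemma one_sub_cos_le1 y : `|1 - cos y| <= `|y|.
Proof.
rewrite one_sub_cosE ger0_norm ?mulrn_wge0 ?sqr_ge0//.
have h := sin_le_id (y / 2); have h1 : `|sin (y / 2)| <= 1 by rewrite ler_norml sin_geN1 sin_le1.
rewrite -(real_normK (num_real (sin _))).
have : `|sin (y / 2)| ^+ 2 <= `|sin (y / 2)| by rewrite expr2 ler_piMl.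
move: h; rewrite normrM [`|2^-1|]ger0_norm// -mulr_natr; lra.
Qed.

Lemma sin_sub_id_le y : `|sin y - y| <= y ^+ 2.
Proof.
have key (x : R) : 0 < x -> `|sin x - x| <= x ^+ 2.
  move=> x0; have [] := @MVT R (fun x => sin x - x) (fun x => cos x - 1) 0 x x0.
    by apply: continuous_subspaceT => z; apply: cvgB; [exact: continuous_sin|exact: cvg_id].
  move=> z; rewrite in_itv/= => /andP[z0 zx].
  rewrite sin0 !subr0 => ->; rewrite normrM (gtr0_norm x0) expr2 ler_wpM2r ?(ltW x0)//.
  rewrite distrC; apply: le_trans (one_sub_cos_le1 z) _.
  by rewrite gtr0_norm// ltW.
have [h|h|<-] := ltgtP 0 y; last by rewrite sin0 subrr normr0 expr0n.
  exact: key.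
have := key (- y); rewrite sinN sqrrN -opprD normrN oppr_gt0; exact.
Qed.

Lemma is_derive_cas y : is_derive y 1 (cas : R -> R) (cas (- y)).
Proof.
have h : is_derive y 1 (fun y : R => cos y + sin y) (- sin y + cos y) by exact: is_deriveD.
by rewrite /cas cosN sinN addrC.
Qed.

Lemma continuous_cas : continuous (cas : R -> R).
Proof. by move=> z; apply: cvgD; [exact: continuous_cos|exact: continuous_sin]. Qed.

Lemma cas_lip a b : `|cas a - cas b| <= 2 * `|a - b|.
Proof.
wlog ab : a b / b < a => [h|].
  have [e|e|->] := ltgtP a b; last by rewrite !subrr !normr0 mulr0.
    by rewrite distrC [`|a - b|]distrC; exact: h.
  exact: h.
have [] := @MVT R cas (fun y => cas (- y)) b a ab.
- by move=> y _; exact: is_derive_cas.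
- exact: continuous_subspaceT continuous_cas.
by move=> y _ ->; rewrite normrM ler_wpM2r// cas_le2.
Qed.

Lemma cas_taylor y b : `|cas (y + b) - cas y - b * cas (- y)| <= 4 * b ^+ 2.
Proof.
rewrite cas_add.
have -> : cas y * cos b + cas (- y) * sin b - cas y - b * cas (- y) =
   - (cas y * (1 - cos b)) + cas (- y) * (sin b - b) by ring.
apply: (le_trans (ler_normD _ _)); rewrite normrN !normrM.
have := ler_pM (normr_ge0 _) (normr_ge0 _) (cas_le2 y) (one_sub_cos_le b).
have := ler_pM (normr_ge0 _) (normr_ge0 _) (cas_le2 (- y)) (sin_sub_id_le b).
lra.
Qed.

Lemma continuous_ind (a b x : R) : x != a -> x != b ->
  {for x, continuous (\1_(`[a, b[) : R -> R)}.
Proof.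
move=> xa xb.
suff H : \forall y \near x, (\1_(`[a, b[) : R -> R) x = \1_(`[a, b[) y.
  by apply: cvg_trans (near_eq_cvg H) _; exact: cvg_cst.
have H1 : \forall y \near x, (a <= y) = (a <= x).
  have [h|h] := ltP x a.
    by apply: filterS (lt_nbhsl h) => y ya; apply/negbTE; rewrite -ltNge.
  have h' : a < x by rewrite lt_neqAle eq_sym xa.
  by apply: filterS (lt_nbhsr h') => y /ltW.
have H2 : \forall y \near x, (y < b) = (x < b).
  have [h|h] := ltP x b; first by apply: filterS (lt_nbhsl h) => y ->.
  have h' : b < x by rewrite lt_neqAle eq_sym xb.
  by apply: filterS (lt_nbhsr h') => y /ltW yb; apply/negbTE; rewrite -leNgt.
by apply: filterS2 H1 H2 => y y1 y2; rewrite !indE !in_itv/= y1 y2.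
Qed.

Lemma continuous_blk N z : z \notin [:: N%:R; - N%:R; N%:R *+ 2; - (N%:R *+ 2)] ->
  {for z, continuous (blk N : R -> R)}.
Proof.
rewrite !inE !negb_or => /and4P[h1 h2 h3 h4]; apply: cvgD; first exact: continuous_ind.
apply: (@cvg_comp _ _ _ -%R (\1_(`[N%:R, N%:R *+ 2[) : R -> R) _ (nbhs (- z))).
  exact: opp_continuous.
by apply: continuous_ind; rewrite eqr_oppLR.
Qed.

Lemma continuous_wt r : continuous (wt r : R -> R).
Proof.
move=> z; apply: (@cvg_comp _ _ _ (fun z => 1 + z ^+ 2) (fun y => y `^ (r / 2)) _ (nbhs (1 + z ^+ 2))).
  by apply: cvgD; [exact: cvg_cst|exact: exprn_continuous].
apply: (@differentiable_continuous R R R (1 + z ^+ 2) (fun y => y `^ (r / 2))).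
apply/derivable1_diffP.
by apply: derivable_powR; rewrite in_itv/= andbT; exact: lt_le_trans (wt_base z).
Qed.

Lemma nr_blk K N sg k : (0 < N)%N -> measurable_fun setT sg -> 0 <= k ->
  (forall z, `|sg z| <= k * blk N z) -> L2 (fun x => sg (rho K x)) /\
  nr (fun x => sg (rho K x)) <= k * nr (fun x : R => blk N (rho K x)).
Proof.
move=> N0 mg k0 hk; have mr := @measurable_rho R K.
have Lb : L2 (fun x : R => blk N (rho K x)).
  split; first exact: measurableT_comp (measurable_blk N) mr.
  by under eq_fun do rewrite blk_sqr//; exact: Ig_blk.
have Lk : L2 (fun x : R => k * blk N (rho K x)) by exact: L2Z.
have le x : `|sg (rho K x)| <= `|k * blk N (rho K x)|.
  by rewrite [leRHS]ger0_norm ?mulr_ge0 ?blk_ge0// hk.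
have Ls : L2 (fun x => sg (rho K x)) by apply: L2_le Lk le; exact: measurableT_comp mg mr.
split=> //; rewrite -[in leRHS](ger0_norm k0) -nrZ//; exact: nr_le.
Qed.

Variables (K : spatial_domain) (N : nat) (r : R) (omega : R -> R) (Om : R).
Hypothesis N0 : (0 < N)%N.
Hypothesis om : continuous omega.
Hypothesis omN : forall z, omega (- z) = - omega z.
Hypothesis omB : forall z, blk N z != 0 -> `|omega z| <= Om.

Let mo : measurable_fun setT omega. Proof. exact: continuous_measurable_fun. Qed.

(** [freq_pair K c (kw y t)] is 2 pi times the value at y of P_N J^r applied to the free evolution,
    during the time t, of the function with transform c. *)
Definition kw y t : R -> R := fun z => wt r z * wave N omega y t z.

Let m : R := 5 `^ (`|r| / 2) * N%:R `^ r.
Let nb : R := nr (fun x : R => blk N (rho K x)).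

Let m0 : 0 <= m. Proof. by rewrite mulr_ge0// powR_ge0. Qed.

Let Om0 : 0 <= Om.
Proof.
have : blk N (N%:R : R) != 0.
  by rewrite blkE// pnatr_eq0 eqb0 negbK ger0_norm// lexx /= mulr2n ltrDl ltr0n N0.
by move=> /omB; apply: le_trans.
Qed.

Lemma wt_blk z : wt r z * blk N z <= m * blk N z.
Proof.
have [->|nz] := eqVneq (blk N z) 0; first by rewrite !mulr0.
by rewrite ler_wpM2r ?blk_ge0// wt_block.
Qed.

Lemma measurable_wave y t : measurable_fun setT (wave N omega y t).
Proof.
apply: measurable_funM; first exact: measurable_blk.
exact: measurableT_comp (measurable_cas) (measurable_phase y t mo).
Qed.

Lemma measurable_kw y t : measurable_fun setT (kw y t).
Proof. by apply: measurable_funM; [exact: measurable_wt|exact: measurable_wave]. Qed.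

Lemma kw_le z k w : `|w| <= k -> `|wt r z * (blk N z * w)| <= m * k * blk N z.
Proof.
move=> wk; have k0 : 0 <= k := le_trans (normr_ge0 _) wk.
rewrite mulrA normrM ger0_norm ?mulr_ge0 ?wt_ge0 ?blk_ge0// [m * k * _]mulrAC.
by apply: ler_pM; rewrite ?mulr_ge0 ?wt_ge0 ?blk_ge0// wt_blk.
Qed.

Lemma kw_bound y t z : `|kw y t z| <= m * 2 * blk N z.
Proof. by rewrite /kw /wave; apply: kw_le; exact: cas_le2. Qed.

Lemma kw_lip y t u z : `|kw y t z - kw y u z| <= m * (2 * (Om * `|t - u|)) * blk N z.
Proof.
have [b0|nz] := eqVneq (blk N z) 0.
  by rewrite /kw /wave b0 !mul0r !mulr0 subrr normr0.
rewrite /kw /wave -mulrBr -mulrBr; apply: kw_le.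
apply: le_trans (cas_lip _ _) _; rewrite ler_wpM2l//.
have -> : y * z + t * omega z - (y * z + u * omega z) = omega z * (t - u) by ring.
by rewrite normrM ler_wpM2r// omB.
Qed.

(** The derivative of kw in t is omega z * kw y t (- z), because cas' (p) = cas (- p) and the phase
    is odd in z. This is the linear term that [evolves] produces for the symbol kw. *)
Lemma kw_taylor y t u z :
  `|kw y t z - kw y u z - (t - u) * (omega z * kw y u (- z))|
    <= m * (4 * (Om * `|t - u|) ^+ 2) * blk N z.
Proof.
have [b0|nz] := eqVneq (blk N z) 0.
  by rewrite /kw /wave blkN b0 !mul0r !mulr0 !subr0 normr0.
rewrite /kw /wave blkN wt_even omN.
have -> : y * - z + u * - omega z = - (y * z + u * omega z) by ring.
have -> : y * z + t * omega z = (y * z + u * omega z) + omega z * (t - u) by ring.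
set p := y * z + u * omega z; set h := omega z * (t - u).
have -> : wt r z * (blk N z * cas (p + h)) - wt r z * (blk N z * cas p) -
    (t - u) * (omega z * (wt r z * (blk N z * cas (- p)))) =
    wt r z * (blk N z * (cas (p + h) - cas p - h * cas (- p))) by rewrite /h; ring.
apply: kw_le; apply: le_trans (cas_taylor _ _) _; rewrite ler_wpM2l//.
rewrite -(real_normK (num_real h)) lerXn2r ?nnegrE ?mulr_ge0//.
by rewrite /h normrM ler_wpM2r// omB.
Qed.

Lemma blk_supp z : N%:R *+ 2 <= `|z| -> blk N z = 0 :> R.
Proof. by move=> h; rewrite blkE// ltNge h andbF. Qed.

Lemma blk_supp_low z : `|z| < N%:R -> blk N z = 0 :> R.
Proof. by move=> h; rewrite blkE// leNgt h. Qed.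

Lemma symbol_class_kw y t : symbol_class (kw y t).
Proof.
split; first exact: measurable_kw.
exists (Num.max (m * 2) (N%:R *+ 2)).
  move=> z; split.
    apply: le_trans (kw_bound y t z) _.
    by rewrite le_max ler_piMr ?mulr_ge0// blk_le1.
  by rewrite gt_max => /andP[_ /ltW h]; rewrite /kw /wave blk_supp// mul0r mulr0.
exists [:: N%:R; - N%:R; N%:R *+ 2; - (N%:R *+ 2)] => z zl.
apply: cvgM; first exact: continuous_wt.
apply: cvgM; first exact: continuous_blk.
apply: (@cvg_comp _ _ _ (fun z => y * z + t * omega z) cas _ (nbhs (y * z + t * omega z))); last exact: continuous_cas.
by apply: cvgD; apply: cvgM; [exact: cvg_cst|exact: cvg_id|exact: cvg_cst|exact: om].
Qed.

Lemma kw_nr y t : L2 (fun x => kw y t (rho K x)) /\ nr (fun x => kw y t (rho K x)) <= m * 2 * nb.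
Proof. by apply: nr_blk => //; [exact: measurable_kw|exact: mulr_ge0|exact: kw_bound]. Qed.

(** [Lkw] and [dkw] are the two symbols that [evolves] associates with [kw], one from the operator L
    and one from the derivative of the nonlinearity. *)
Definition Lkw y t z := omega z * kw y t (- z).
Definition dkw y t z := - z * kw y t (- z).

Lemma measurable_kwN y t : measurable_fun setT (fun z => kw y t (- z)).
Proof. by apply: (measurableT_comp (measurable_kw y t)); exact: oppr_measurable. Qed.

Lemma Lkw_nr y t : L2 (fun x => Lkw y t (rho K x)) /\
  nr (fun x => Lkw y t (rho K x)) <= Om * (m * 2) * nb.
Proof.
apply: nr_blk => //; rewrite ?mulr_ge0//.
  by apply: measurable_funM => //; exact: measurable_kwN.
move=> z; have [b0|nz] := eqVneq (blk N z) 0.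
  by rewrite /Lkw /kw /wave blkN b0 !mul0r !mulr0 normr0.
rewrite /Lkw normrM -[in leRHS]mulrA; apply: ler_pM => //; first exact: omB.
by have := kw_bound y t (- z); rewrite blkN.
Qed.

Lemma Lkw_lip y t u :
  nr (fun x => Lkw y t (rho K x) - Lkw y u (rho K x)) <= Om * (m * (2 * (Om * `|t - u|))) * nb.
Proof.
apply: (@nr_blk K N (fun z => Lkw y t z - Lkw y u z) _ N0 _ _ _).2; rewrite ?mulr_ge0//.
  by apply: measurable_funB; apply: measurable_funM => //; exact: measurable_kwN.
move=> z; have [b0|nz] := eqVneq (blk N z) 0.
  by rewrite /Lkw /kw /wave blkN b0 !mul0r !mulr0 subrr normr0.
rewrite /Lkw -mulrBr normrM -[in leRHS]mulrA; apply: ler_pM => //; first exact: omB.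
by have := kw_lip y t u (- z); rewrite blkN.
Qed.

Lemma blk_id z : `|z| * blk N z <= N%:R *+ 2 * blk N z.
Proof.
have [h|h] := leP `|z| (N%:R *+ 2); first by rewrite ler_wpM2r ?blk_ge0.
by rewrite blk_supp ?mulr0// ltW.
Qed.

Lemma measurable_dkw y t : measurable_fun setT (dkw y t).
Proof. by apply: measurable_funM; [exact: oppr_measurable|exact: measurable_kwN]. Qed.

Lemma dkw_bound y t z : `|dkw y t z| <= N%:R *+ 2 * (m * 2) * blk N z.
Proof.
rewrite /dkw normrM normrN.
have := kw_bound y t (- z); rewrite blkN => h.
apply: (@le_trans _ _ (`|z| * (m * 2 * blk N z))); first by rewrite ler_wpM2l.
have -> : `|z| * (m * 2 * blk N z) = m * 2 * (`|z| * blk N z) by ring.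
rewrite [_ * (m * 2)]mulrC -[in leRHS]mulrA ler_wpM2l ?mulr_ge0//; exact: blk_id.
Qed.

Lemma dkw_nr y t : L2 (fun x => dkw y t (rho K x)) /\
  nr (fun x => dkw y t (rho K x)) <= N%:R *+ 2 * (m * 2) * nb.
Proof.
apply: nr_blk => //; rewrite ?mulr_ge0//; first exact: measurable_dkw.
exact: dkw_bound.
Qed.

Lemma dkw_lip y t u :
  nr (fun x => dkw y t (rho K x) - dkw y u (rho K x)) <=
  N%:R *+ 2 * (m * (2 * (Om * `|t - u|))) * nb.
Proof.
apply: (@nr_blk K N (fun z => dkw y t z - dkw y u z) _ N0 _ _ _).2; rewrite ?mulr_ge0//.
  by apply: measurable_funB; exact: measurable_dkw.
move=> z; rewrite /dkw -mulrBr normrM normrN.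
have := kw_lip y t u (- z); rewrite blkN; set k := m * _ => h.
have k0 : 0 <= k by rewrite /k !mulr_ge0.
apply: (@le_trans _ _ (`|z| * (k * blk N z))); first by rewrite ler_wpM2l.
have -> : `|z| * (k * blk N z) = k * (`|z| * blk N z) by ring.
rewrite [_ * k]mulrC -[in leRHS]mulrA ler_wpM2l//; exact: blk_id.
Qed.


Section Formula.
Variables (s T : R) (c : R -> R -> R).
Hypothesis s12 : 2^-1 < s.
Hypothesis hc : weighted_continuous K s T c.
Hypothesis ec : evolves K omega T c.

Let nb0 : 0 <= nb. Proof. exact: nr_ge0. Qed.

(** A single constant above those of all the symbol bounds. *)
Let P : R := 1 + Om * (m * 2) * nb + Om * (m * (2 * Om)) * nb + N%:R *+ 2 * (m * 2) * nb +
   N%:R *+ 2 * (m * (2 * Om)) * nb + m * (4 * Om ^+ 2) * nb.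

Let Pbounds : [/\ 1 <= P, Om * (m * 2) * nb <= P, Om * (m * (2 * Om)) * nb <= P,
   N%:R *+ 2 * (m * 2) * nb <= P & N%:R *+ 2 * (m * (2 * Om)) * nb <= P /\ m * (4 * Om ^+ 2) * nb <= P].
Proof.
have h1 : 0 <= Om * (m * 2) * nb by rewrite !mulr_ge0.
have h2 : 0 <= Om * (m * (2 * Om)) * nb by rewrite !mulr_ge0.
have h3 : 0 <= N%:R *+ 2 * (m * 2) * nb by rewrite !mulr_ge0.
have h4 : 0 <= N%:R *+ 2 * (m * (2 * Om)) * nb by rewrite !mulr_ge0.
have h5 : 0 <= m * (4 * Om ^+ 2) * nb by rewrite !mulr_ge0// sqr_ge0.
by rewrite /P; split; [..|split]; lra.
Qed.

Lemma ucont_Qdkw y t1 a b : 0 <= a -> b <= T ->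
  ucont_on a b (fun tau => Q K (c tau) (c tau) (dkw y (t1 - tau))).
Proof.
move=> a0 bT; have [P1 Pa Pb Pc [Pd Pe]] := Pbounds.
apply: (@ucont_Q R K s T c s12 hc a b P (fun tau => dkw y (t1 - tau))) => //.
- by apply: le_trans P1.
- by move=> t; exact: measurable_dkw.
- by move=> t; exact: (dkw_nr _ _).1.
- by move=> t _; exact: le_trans (dkw_nr _ _).2 Pc.
- move=> t u _ _; apply: le_trans (dkw_lip _ _ _) _.
  have -> : t1 - t - (t1 - u) = - (t - u) by ring.
  rewrite normrN.
  have -> : N%:R *+ 2 * (m * (2 * (Om * `|t - u|))) * nb =
    N%:R *+ 2 * (m * (2 * Om)) * nb * `|t - u| by ring.
  by rewrite ler_wpM2r.
Qed.

Lemma ucont_fpLkw y t1 a b : 0 <= a -> b <= T ->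
  ucont_on a b (fun tau => freq_pair K (c tau) (Lkw y t1)).
Proof.
move=> a0 bT; have [P1 Pa Pb Pc [Pd Pe]] := Pbounds.
apply: (@ucont_freq_pair R K s T c s12 hc a b P (fun tau => Lkw y t1)) => //.
- by apply: le_trans P1.
- by move=> t; exact: (Lkw_nr _ _).1.
- by move=> t _; exact: le_trans (Lkw_nr _ _).2 Pa.
- move=> t u _ _; under eq_fun do rewrite subrr.
  by rewrite (_ : nr _ = 0) ?mulr_ge0 ?(le_trans _ P1)// /nr /n2 /= -[RHS]sqrtr0 -[in RHS]Int0; congr Num.sqrt; apply: Int_ext => x; rewrite expr0n.
Qed.

(** Along the moving symbol [kw y (t1 - u)] the linear terms cancel to first order, so the
    increments of the function H below are small compared with the length of the time interval, and
    [locally_flat] gives H t1 = H a. *)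
Theorem duhamel y a t1 : 0 <= a -> a <= t1 -> t1 <= T ->
  freq_pair K (c t1) (kw y 0) = freq_pair K (c a) (kw y (t1 - a)) -
  \int[leb]_(tau in `[a, t1]) Q K (c tau) (c tau) (dkw y (t1 - tau)).
Proof.
move=> a0 at1 t1T; have [P1 Pa Pb Pc [Pd Pe]] := Pbounds.
pose q tau := Q K (c tau) (c tau) (dkw y (t1 - tau)).
have uq a' b' : 0 <= a' -> b' <= T -> ucont_on a' b' q by exact: ucont_Qdkw.
pose H u := freq_pair K (c u) (kw y (t1 - u)) + \int[leb]_(tau in `[a, u]) q tau.
suff HH : H t1 = H a.
  have i0 : \int[leb]_(tau in `[a, a]) q tau = 0.
    apply/eqP; rewrite -normr_le0; have := @Rint_le_cst R a a q `|q a| (lexx a) (ucont_int (uq a a a0 (le_trans at1 t1T))).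
    by rewrite subrr mulr0; apply => x xa; rewrite (le_anti xa).
  move: HH; rewrite /H subrr i0 addr0 -/q => <-; by rewrite addrK.
apply: locally_flat => // e e0.
have [B B0 hB] := wcont_bounded hc.
have w0 : 0 <= wnorm K s := nr_ge0 _.
have P0 : 0 < P by exact: lt_le_trans P1.
pose V := (1 + wnorm K s) * (B * (1 + B)) * P.
have B1 : 0 < 1 + B by lra.
have V0 : 0 < V by rewrite !mulr_gt0// ltr_pwDl.
have V1 : B * P <= V.
  rewrite /V ler_wpM2r ?(ltW P0)//; apply: (@le_trans _ _ (B * (1 + B))).
    by rewrite ler_peMr ?(ltW B0)// lerDl (ltW B0).
  by rewrite ler_peMl ?mulr_ge0 ?addr_ge0 ?(ltW B0)// lerDl.
have V2 : wnorm K s * B * (B * P) <= V.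
  rewrite /V mulrA ler_wpM2r ?(ltW P0)// -mulrA; apply: ler_pM => //.
  - by rewrite mulr_ge0// (ltW B0).
  - by rewrite lerDr.
  - by rewrite ler_wpM2l ?(ltW B0)// lerDr.
have e1 : 0 < e / 4 / P by rewrite !divr_gt0.
have [d1 d10 h1] := wcont_diff s12 hc e1.
exists (Num.min d1 (e / 4 / V)); first by rewrite lt_min d10 !divr_gt0.
move=> t u a_t tu ut1; rewrite lt_min => /andP[tu1 tu2].
have t0 : 0 <= t := le_trans a0 a_t; have uT : u <= T := le_trans ut1 t1T.
have tT : 0 <= t <= T by rewrite t0 (le_trans tu uT).
have Vtu : V * (u - t) <= e / 4 by rewrite mulrC -ler_pdivlMr// ltW.
have ut0 : 0 <= u - t by rewrite subr_ge0.
have nut : `|u - t| = u - t by rewrite ger0_norm.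
have mid v : t <= v <= u -> 0 <= v <= T by move=> /andP[v1 v2]; rewrite (le_trans t0 v1) (le_trans v2 uT).
have uuT : 0 <= u <= T by apply: mid; rewrite tu lexx.
have [lt nt] := wcont_L2 s12 hc tT; have [lu nu] := wcont_L2 s12 hc uuT.
set kt := kw y (t1 - t); set ku := kw y (t1 - u).
have lkt : L2 (fun x => kt (rho K x)) := (kw_nr _ _).1.
have lku : L2 (fun x => ku (rho K x)) := (kw_nr _ _).1.
(* The integrand of [evolves] on [t, u], with the symbol frozen at its value for the time u. *)
pose I1 tau := freq_pair K (c tau) (Lkw y (t1 - u)) - Q K (c tau) (c tau) (dkw y (t1 - u)).
have E1 : freq_pair K (c u) ku - freq_pair K (c t) ku = \int[leb]_(tau in `[t, u]) I1 tau.
  by apply: ec => //; exact: symbol_class_kw.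
have uI1 : ucont_on t u I1.
  apply: ucontB; first exact: ucont_fpLkw.
  have := @ucont_Q R K s T c s12 hc t u P (fun tau => dkw y (t1 - u)).
  apply => //; first exact: ltW.
  - by move=> ?; exact: measurable_dkw.
  - by move=> ?; exact: (dkw_nr _ _).1.
  - by move=> ? _; exact: le_trans (dkw_nr _ _).2 Pc.
  - move=> v w _ _; apply: le_trans (dkw_lip _ _ _) _; rewrite subrr normr0 !mulr0 mul0r.
    by rewrite mulr_ge0// ltW.
have uqtu : ucont_on t u q by exact: uq.
pose J tau := (I1 tau + q tau) - freq_pair K (c t) (Lkw y (t1 - t)).
have uJ : ucont_on t u J by apply: ucontB; [exact: ucontD|exact: ucont_cst].
(* The increment of c with the symbol frozen, plus the increment of the symbol with c frozen at t;
   the first-order part of the latter goes under the integral, its Taylor remainder stays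
   outside. *)
have EH : H u - H t = \int[leb]_(tau in `[t, u]) J tau +
   freq_pair K (c t) (fun z => (ku z - kt z) - (t - u) * (omega z * kt (- z))).
  rewrite /H (@Rint_cat _ a t u q a_t tu (ucont_int (uq a u a0 uT))).
  rewrite /J Rint_B; [|exact: ucontD|exact: ucont_cst].
  rewrite Rint_D// Rint_cst// -E1.
  have L2L : L2 (fun x => Lkw y (t1 - t) (rho K x)) := (Lkw_nr _ _).1.
  have -> : freq_pair K (c t) (fun z => (ku z - kt z) - (t - u) * (omega z * kt (- z))) =
     (freq_pair K (c t) ku - freq_pair K (c t) kt) - (t - u) * freq_pair K (c t) (Lkw y (t1 - t)).
    rewrite (@freq_pairBr R K (c t) (fun z => ku z - kt z) (fun z => (t - u) * Lkw y (t1 - t) z))//; last 2 first.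
    - exact: L2B.
    - exact: L2Z.
    rewrite freq_pairBr//; congr (_ - _).
    by rewrite -IntZ; [apply: Int_ext => x; ring|exact: L2M_Ig].
  move: (freq_pair K (c u) ku) (freq_pair K (c t) ku) (freq_pair K (c t) kt) => x1 x2 x3.
  move: (freq_pair K (c t) (Lkw y (t1 - t))) => x4.
  move: (\int[leb]_(tau in `[a, t]) q tau) (\int[leb]_(tau in `[t, u]) q tau) => x5 x6.
  by ring.
rewrite EH.
have b1 : `|freq_pair K (c t) (fun z => (ku z - kt z) - (t - u) * (omega z * kt (- z)))| <= e / 4 * (u - t).
  have hm : measurable_fun setT (fun z => (ku z - kt z) - (t - u) * (omega z * kt (- z))).
    apply: measurable_funB; first by apply: measurable_funB; exact: measurable_kw.
    by apply: measurable_funM => //; apply: measurable_funM => //; exact: measurable_kwN.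
  have hk : 0 <= m * (4 * (Om * `|t - u|) ^+ 2) by rewrite !mulr_ge0// sqr_ge0.
  have hb z : `|(ku z - kt z) - (t - u) * (omega z * kt (- z))| <=
      m * (4 * (Om * `|t - u|) ^+ 2) * blk N z.
    have := kw_taylor y (t1 - u) (t1 - t) z.
    by have -> : t1 - u - (t1 - t) = t - u by ring.
  have [l n] := @nr_blk K N _ _ N0 hm hk hb.
  apply: le_trans (freq_pair_bound lt l) _.
  apply: (@le_trans _ _ (B * (P * (u - t) ^+ 2))).
    apply: ler_pM; rewrite ?nr_ge0//; first exact: le_trans nt (hB _ tT).
    apply: le_trans n _; rewrite distrC nut.
    have -> : m * (4 * (Om * (u - t)) ^+ 2) * nb = m * (4 * Om ^+ 2) * nb * (u - t) ^+ 2 by ring.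
    by rewrite ler_wpM2r ?sqr_ge0.
  rewrite expr2 !mulrA ler_wpM2r//; apply: le_trans Vtu; by rewrite ler_wpM2r.
(* Three comparisons: c at tau with c at t, the linear symbol at u with that at t, the nonlinear
   symbol at tau with that at u. *)
have b2 tau : t <= tau <= u -> `|J tau| <= 3 * (e / 4).
  move=> tut; have tauT := mid _ tut; have /andP[ttau tauu] := tut.
  have [ltau ntau] := wcont_L2 s12 hc tauT; have [itau mtau] := wcont_L1 s12 hc tauT.
  have d_tau : `|tau - t| < d1.
    by apply: le_lt_trans tu1; rewrite ger0_norm ?subr_ge0// lerD2r.
  have [k1 _] := h1 _ _ tauT tT d_tau.
  have Lu := @Lkw_nr y (t1 - u); have Lt := @Lkw_nr y (t1 - t).
  have -> : J tau = freq_pair K (fun x => c tau x - c t x) (Lkw y (t1 - u)) +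
     freq_pair K (c t) (fun z => Lkw y (t1 - u) z - Lkw y (t1 - t) z) +
     Q K (c tau) (c tau) (fun z => dkw y (t1 - tau) z - dkw y (t1 - u) z).
    rewrite freq_pairBl//; [|exact: Lu.1]; rewrite freq_pairBr//; [|exact: Lu.1|exact: Lt.1].
    rewrite Q_B//; [|exact: measurable_dkw|exact: measurable_dkw|exact: (dkw_nr _ _).1|exact: (dkw_nr _ _).1].
    rewrite /J /I1 /q.
    move: (Q K (c tau) (c tau) (dkw y (t1 - tau))) (Q K (c tau) (c tau) (dkw y (t1 - u))) => x1 x2.
    move: (freq_pair K (c tau) (Lkw y (t1 - u))) (freq_pair K (c t) (Lkw y (t1 - u))) => x3 x4.
    by move: (freq_pair K (c t) (Lkw y (t1 - t))) => x5; ring.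
  have -> : 3 * (e / 4) = e / 4 + e / 4 + e / 4 by ring.
  apply: (le_trans (ler_normD _ _)); apply: lerD; first (apply: (le_trans (ler_normD _ _)); apply: lerD).
  - apply: le_trans (freq_pair_bound _ Lu.1) _; first exact: L2B.
    have -> : e / 4 = e / 4 / P * P by rewrite divfK// gt_eqF.
    by apply: ler_pM; rewrite ?nr_ge0//; exact: le_trans Lu.2 Pa.
  - apply: le_trans (freq_pair_bound lt _) _; first exact: L2B Lu.1 Lt.1.
    apply: le_trans Vtu; apply: (@le_trans _ _ (B * (P * (u - t)))); last by rewrite mulrA ler_wpM2r.
    apply: ler_pM; rewrite ?nr_ge0//; first exact: le_trans nt (hB _ tT).
    apply: le_trans (Lkw_lip _ _ _) _.
    have -> : t1 - u - (t1 - t) = - (u - t) by ring.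
    rewrite normrN nut.
    have -> : Om * (m * (2 * (Om * (u - t)))) * nb = Om * (m * (2 * Om)) * nb * (u - t) by ring.
    by rewrite ler_wpM2r.
  - apply: le_trans (Q_bound _ _ _ _) _ => //.
    + by apply: measurable_funB; exact: measurable_dkw.
    + exact: L2B (dkw_nr _ _).1 (dkw_nr _ _).1.
    apply: le_trans Vtu; apply: (@le_trans _ _ (wnorm K s * B * (B * (P * (u - t))))); last first.
      by rewrite [B * (P * _)]mulrA [_ * (_ * (u - t))]mulrA ler_wpM2r.
    apply: ler_pM; rewrite ?Int_ge0 ?mulr_ge0 ?nr_ge0//.
      by apply: le_trans mtau _; rewrite ler_wpM2l// hB.
    apply: ler_pM; rewrite ?nr_ge0//; first exact: le_trans ntau (hB _ tauT).
    apply: le_trans (dkw_lip _ _ _) _.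
    have -> : t1 - tau - (t1 - u) = u - tau by ring.
    rewrite ger0_norm ?subr_ge0//.
    have -> : N%:R *+ 2 * (m * (2 * (Om * (u - tau)))) * nb =
      N%:R *+ 2 * (m * (2 * Om)) * nb * (u - tau) by ring.
    apply: ler_pM => //; rewrite ?subr_ge0 ?lerD2l ?lerN2//.
    by rewrite !mulr_ge0.
apply: (le_trans (ler_normD _ _)).
have b3 := Rint_le_cst tu (ucont_int uJ) b2.
by lra.
Qed.

End Formula.
End Duhamel.

(** * Square integrability in time of dyadic blocks *)
Section Blocks.
Context {R : realType}.
Local Notation leb := (@lebesgue_measure R).
Implicit Types (c d sg : R -> R) (K : spatial_domain) (t u e z a b y : R).

Lemma bounded_on_block (omega : R -> R) N : (0 < N)%N -> continuous omega ->
  exists Om : R, forall z, blk N z != 0 -> `|omega z| <= Om.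
Proof.
move=> N0 om.
have /(@continuous_compact _ _ omega `[- (N%:R *+ 2), N%:R *+ 2]) :
    {within `[- (N%:R *+ 2), N%:R *+ 2], continuous omega} by exact: continuous_subspaceT.
move=> /(_ (@segment_compact _ _ _))/compact_bounded[M [_ /(_ (M + 1))]].
rewrite ltrDl ltr01 => /(_ isT) h; exists (M + 1) => z nz; apply: h; exists z => //=.
rewrite in_itv/= -ler_norml; move: nz; rewrite blkE// pnatr_eq0 eqb0 negbK.
by move=> /andP[_ /ltW].
Qed.

Variables (K : spatial_domain) (omega : R -> R) (s T r B : R) (c : R -> R -> R).
Hypothesis om : continuous omega.
Hypothesis omN : forall z, omega (- z) = - omega z.
Hypothesis s12 : 2^-1 < s.
Hypothesis hc : weighted_continuous K s T c.
Hypothesis ec : evolves K omega T c.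
Hypothesis B0 : 0 < B.
Hypothesis hB : forall t, 0 <= t <= T -> nr (fun x => wt s (rho K x) * c t x) <= B.

Let s0 : 0 <= s. Proof. by apply: le_trans (ltW s12); rewrite invr_ge0. Qed.
Let mo : measurable_fun setT omega. Proof. exact: continuous_measurable_fun. Qed.

Lemma L2_sum_wave N n (e y t : nat -> R) : (0 < N)%N ->
  L2 (fun x => \sum_(0 <= j < n) e j * wave N omega (y j) (t j) (rho K x)).
Proof. by move=> N0; apply: L2_sum => j; apply: L2Z; exact: L2_wave. Qed.

(** Cauchy-Schwarz, with one copy of blk = blk^2 given to the data and one to the waves; N^(r-s) is
    the ratio of the two weights on the block. The statement has the form that [strichartz_discrete]
    requires. *)
Lemma linear_part N n (e y t : nat -> R) a : (0 < N)%N -> 0 <= a <= T ->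
  (\sum_(0 <= j < n) e j * freq_pair K (c a) (kw N r omega (y j) (t j))) ^+ 2 <=
  (5 `^ (`|r - s| / 2) * N%:R `^ (r - s) * B) ^+ 2 *
   n2 (fun x => \sum_(0 <= j < n) e j * wave N omega (y j) (t j) (rho K x)).
Proof.
move=> N0 aT; have [lc _] := wcont_L2 s12 hc aT; have [mc lX] := hc.1 a aT.
have mr := @measurable_rho R K.
rewrite -freq_pair_sum//; last by move=> j; exact: (kw_nr _ _ _ _ _ _).1.
pose g x := wt s (rho K x) * c a x * (wt (r - s) (rho K x) * blk N (rho K x)).
set F := fun x => \sum_(0 <= j < n) _ * wave _ _ _ _ _.
have LF : L2 F by exact: L2_sum_wave.
have mb : measurable_fun setT (fun x : R => wt (r - s) (rho K x) * blk N (rho K x)).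
  apply: measurable_funM; apply: measurableT_comp mr.
    exact: measurable_wt.
  exact: measurable_blk.
have bb (x : R) : `|wt (r - s) (rho K x) * blk N (rho K x)| <= 5 `^ (`|r - s| / 2) * N%:R `^ (r - s).
  rewrite ger0_norm ?mulr_ge0 ?wt_ge0 ?blk_ge0//; apply: le_trans (wt_blk _ N0 _) _.
  by rewrite ler_piMr ?mulr_ge0 ?powR_ge0 ?blk_le1.
have Lg : L2 g by apply: L2Mb bb.
have -> : freq_pair K (c a) (fun z => \sum_(0 <= j < n) e j * kw N r omega (y j) (t j) z) =
   \int[leb]_x (g x * F x).
  apply: Int_ext => x; rewrite /g /F /kw !mulr_sumr; apply: eq_bigr => j _.
  rewrite /wave; set z := rho K x; have <- : wt s z * wt (r - s) z = wt r z.
    by rewrite -wtD; congr wt; ring.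
  by rewrite -{1}[blk N z]blk_sqr//; ring.
apply: le_trans (CS Lg LF) _; rewrite ler_wpM2r ?n2_ge0// -sqr_nr.
rewrite lerXn2r ?nnegrE ?nr_ge0 ?mulr_ge0 ?powR_ge0 ?(ltW B0)//.
have k0 : 0 <= 5 `^ (`|r - s| / 2) * N%:R `^ (r - s) :> R by rewrite mulr_ge0 ?powR_ge0.
apply: (@le_trans _ _ (nr (fun x => 5 `^ (`|r - s| / 2) * N%:R `^ (r - s) * (wt s (rho K x) * c a x)))).
  apply: nr_le => //; first exact: L2Z.
  by move=> x; rewrite /g normrM mulrC [leRHS]normrM (ger0_norm k0) ler_wpM2r.
by rewrite nrZ// (ger0_norm k0) ler_wpM2l// hB.
Qed.

(** [Q_high] applies because the symbol lives at |z| >= N: the factor with frequency at least N/2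
    gives (N/2)^(-s), the derivative gives 2 N, and the other factor, integrable in frequency, gives
    [wnorm K s * B]. The result is one power of N worse than the linear part. *)
Lemma nonlinear_part N n (e y t : nat -> R) a : (0 < N)%N -> 0 <= a <= T ->
  (\sum_(0 <= j < n) e j * Q K (c a) (c a) (dkw N r omega (y j) (t j))) ^+ 2 <=
  (2 * (wnorm K s * B) * ((2 `^ s * N%:R `^ (- s) * B) *
      (N%:R *+ 2 * (5 `^ (`|r| / 2) * N%:R `^ r)))) ^+ 2 *
   n2 (fun x => \sum_(0 <= j < n) e j * wave N omega (y j) (t j) (rho K x)).
Proof.
move=> N0 aT; have [lc nc] := wcont_L2 s12 hc aT; have [mc lX] := hc.1 a aT.
have [ic m1c] := wcont_L1 s12 hc aT.
have mr := @measurable_rho R K.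
pose F z := \sum_(0 <= j < n) e j * wave N omega (y j) (t j) z.
have mF : measurable_fun setT F.
  by apply: measurable_sum => j; apply: measurable_funM => //; exact: measurable_wave.
have LF : L2 (fun x => F (rho K x)) by exact: L2_sum_wave.
rewrite -Q_sum//; last 2 first.
- by move=> j; exact: measurable_dkw.
- by move=> j; exact: (dkw_nr _ _ _ _ _ _).1.
set sg := fun z => \sum_(0 <= j < n) _ * dkw _ _ _ _ _ _.
have msg : measurable_fun setT sg.
  by apply: measurable_sum => j; apply: measurable_funM => //; exact: measurable_dkw.
set m := 5 `^ (`|r| / 2) * N%:R `^ r.
have m0 : 0 <= m by rewrite mulr_ge0 ?powR_ge0.
have sgE z : sg z = - z * (wt r z * blk N z) * F (- z).
  rewrite /sg /F mulr_sumr; apply: eq_bigr => j _.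
  by rewrite /dkw /kw /wave blkN wt_even -{1}[blk N z]blk_sqr//; ring.
have sgF z : `|sg z| <= N%:R *+ 2 * m * `|F (- z)|.
  rewrite sgE normrM ler_wpM2r// normrM normrN [X in _ * X]ger0_norm ?mulr_ge0 ?wt_ge0 ?blk_ge0//.
  have h := wt_blk r N0 z; have h' := blk_id N0 z.
  apply: (@le_trans _ _ (`|z| * (m * blk N z))); first by rewrite ler_wpM2l.
  have -> : `|z| * (m * blk N z) = m * (`|z| * blk N z) by ring.
  rewrite [_ * m]mulrC ler_wpM2l//; apply: le_trans h' _.
  by rewrite ler_piMr// blk_le1.
have [LFo nFo] := L2_rho_opp mF LF.
have k0 : 0 <= N%:R *+ 2 * m by rewrite mulr_ge0.
have Lsg : L2 (fun x => sg (rho K x)).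
  apply: L2_le (L2Z (N%:R *+ 2 * m) LFo) _; first exact: measurableT_comp msg mr.
  by move=> x; rewrite [leRHS]normrM (ger0_norm k0).
have nsg : nr (fun x => sg (rho K x)) <= N%:R *+ 2 * m * nr (fun x => F (rho K x)).
  apply: (@le_trans _ _ (nr (fun x => N%:R *+ 2 * m * F (- rho K x)))).
    apply: nr_le => //; first exact: L2Z.
    by move=> x; rewrite [leRHS]normrM (ger0_norm k0).
  by rewrite nrZ// (ger0_norm k0) ler_wpM2l// /nr nFo.
have bsg z : `|sg z| <= \sum_(0 <= j < n) `|e j| * (N%:R *+ 2 * (m * 2)).
  apply: le_trans (ler_norm_sum _ _ _) _; apply: ler_sum => j _.
  rewrite normrM ler_wpM2l//; apply: le_trans (dkw_bound _ _ N0 _ _ _) _.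
  by rewrite ler_piMr ?mulr_ge0 ?blk_le1.
have lsg z : `|z| < N%:R -> sg z = 0.
  by move=> h; rewrite sgE blk_supp_low// !mulr0 mul0r.
have := @Q_high R K (c a) sg _ N%:R msg bsg Lsg lsg ic lc.
set ind := fun x => _ * \1_ _ _.
move=> h; rewrite -(real_normK (num_real (Q _ _ _ _))) -sqr_nr -exprMn.
have N0' : 0 < N%:R / 2 :> R by rewrite divr_gt0// ltr0n.
have hm : measurable_fun setT (\1_[set z : R | N%:R / 2 <= `|z|] : R -> R).
  apply: measurable_indic; have -> : [set z : R | N%:R / 2 <= `|z|] = (fun z : R => `|z|) @^-1` `[N%:R / 2, +oo[.
    by apply/seteqP; split => z /=; rewrite in_itv/= andbT.
  rewrite -[X in measurable X]setTI; apply: normr_measurable => //; exact: measurable_itv.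
have nind : nr ind <= 2 `^ s * N%:R `^ (- s) * B.
  have k1 : 0 <= 2 `^ s * N%:R `^ (- s) :> R by rewrite mulr_ge0 ?powR_ge0.
  apply: (@le_trans _ _ (nr (fun x => 2 `^ s * N%:R `^ (- s) * (wt s (rho K x) * c a x)))); last first.
    by rewrite nrZ// (ger0_norm k1) ler_wpM2l// hB.
  apply: nr_le; [|exact: L2Z|move=> x].
    apply: (L2Mb (M := 1) lc); first exact: measurableT_comp hm mr.
    by move=> x; rewrite indicE; case: (_ \in _); rewrite ?normr1 ?normr0.
  rewrite /ind indicE; case: (boolP (_ \in _)) => /= [|_]; last by rewrite mulr0 normr0.
  rewrite inE/= mulr1 => Nz.
  rewrite mulrA [leRHS]normrM -[leLHS]mul1r ler_wpM2r// ger0_norm ?mulr_ge0 ?wt_ge0//.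
  have -> : 2 `^ s * N%:R `^ (- s) = (N%:R / 2) `^ (- s) :> R.
    rewrite powRM ?invr_ge0// mulrC; congr (_ * _).
    by rewrite -[2^-1]powR_inv1// -powRrM; congr powR; ring.
  rewrite -[leLHS](@wtNK R s (rho K x)) ler_wpM2r ?wt_ge0//.
  by apply: wt_high => //; rewrite oppr_le0.
rewrite lerXn2r ?nnegrE ?mulr_ge0 ?nr_ge0 ?powR_ge0 ?(ltW B0)//; last first.
apply: le_trans h _; rewrite -[leRHS]mulrA -[(_ * _) * nr _]mulrA.
apply: ler_pM; rewrite ?mulr_ge0 ?Int_ge0 ?nr_ge0//.
  by rewrite ler_wpM2l//; apply: le_trans m1c _; rewrite ler_wpM2l ?nr_ge0// hB.
by apply: ler_pM; rewrite ?nr_ge0.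
Qed.


(** Each sample is split by Duhamel's formula started at the left end a of the piece. The extra
    power of N in the nonlinear part is compensated by the length kappa / N of the piece, so both
    parts obey the same bound. *)
Lemma block_sum alpha : 0 < alpha -> alpha <= 1 -> hypothesis1 alpha omega ->
  exists N0 : nat, exists kappa C C' : R, [/\ 0 < kappa, 0 <= C, 0 <= C' &
    forall (N n : nat) (D a : R) (y : nat -> R), (N0 < N)%N -> 0 < D ->
      n%:R * D <= kappa / N%:R -> 0 <= a -> a + n%:R * D <= T ->
      D * \sum_(0 <= j < n) freq_pair K (c (a + j%:R * D)) (kw N r omega (y j) 0) ^+ 2
      <= C * (N%:R `^ (r - s)) ^+ 2 * (2 * N%:R * D + C' * N%:R `^ (- (alpha / 2)))].
Proof.
move=> al0 al1 h1; have [N0 [kappa [C0 [ka0 C00 strich]]]] := strichartz_discrete al0 al1 h1.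
pose Cl := 5 `^ (`|r - s| / 2) * B; pose Cn := 2 * (wnorm K s * B) * (2 `^ s * B * (2 * 5 `^ (`|r| / 2))).
exists N0, kappa, (2 * (Cl ^+ 2 + (kappa * Cn) ^+ 2)), (C0 * Num.sqrt kappa); split => //.
- by rewrite mulr_ge0// addr_ge0// sqr_ge0.
- by rewrite mulr_ge0 ?sqrtr_ge0// ltW.
move=> N n D a y NN D0 nD a0 aT.
have Np : (0 < N)%N by exact: leq_ltn_trans NN.
have Np' : 0 < N%:R :> R by rewrite ltr0n.
have [Om omB] := bounded_on_block Np om.
have nD0 : 0 <= n%:R * D by rewrite mulr_ge0 ?ler0n// ltW.
pose t j := a + j%:R * D.
have t_le j : (j < n)%N -> t j <= a + n%:R * D.
  by move=> jn; rewrite lerD2l ler_wpM2r ?(ltW D0)// ler_nat ltnW.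
have a_le j : a <= t j by rewrite lerDl mulr_ge0 ?ler0n// ltW.
pose lin j := freq_pair K (c a) (kw N r omega (y j) (j%:R * D)).
pose q j tau := Q K (c tau) (c tau) (dkw N r omega (y j) (t j - tau)).
pose nl j := \int[leb]_(tau in `[a, t j]) q j tau.
have aE j : (j < n)%N -> freq_pair K (c (t j)) (kw N r omega (y j) 0) = lin j - nl j.
  move=> jn; rewrite (@duhamel R K N r omega Om Np om omN omB s T c s12 hc ec (y j) a (t j) a0 (a_le j)).
    by rewrite /lin /nl; congr (freq_pair _ _ (kw _ _ _ _ _) - _); rewrite /t; ring.
  exact: le_trans (t_le j jn) aT.
have uq j a' b' : 0 <= a' -> b' <= T -> ucont_on a' b' (q j).
  by move=> a'0 b'T; exact: (@ucont_Qdkw R K N r omega Om Np om omB s T c s12 hc (y j) (t j) a' b' a'0 b'T).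
set W := 2 * N%:R * D + C0 * Num.sqrt (n%:R * D / N%:R `^ (alpha - 1)).
(* Here n D is replaced by its largest value kappa / N, and kappa N^(-1) / N^(alpha-1) = kappa
   N^(-alpha). *)
set W' := 2 * N%:R * D + C0 * Num.sqrt kappa * N%:R `^ (- (alpha / 2)).
have W0 : 0 <= W by rewrite addr_ge0 ?mulr_ge0 ?sqrtr_ge0 ?(ltW D0) ?(ltW C00)// ler0n.
have WW : W <= W'.
  rewrite lerD2l -[leRHS]mulrA ler_wpM2l ?(ltW C00)//.
  apply: (@le_trans _ _ (Num.sqrt (kappa * N%:R `^ (- alpha)))).
    rewrite ler_sqrt; last by rewrite mulr_ge0 ?(ltW ka0)// powR_ge0.
    have -> : N%:R `^ (- alpha) = N%:R^-1 / N%:R `^ (alpha - 1) :> R.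
      rewrite -powRN -[N%:R^-1]powR_inv1 ?ler0n// -powRD.
        by congr powR; ring.
      by rewrite (gt_eqF Np') implybT.
    by rewrite mulrA ler_wpM2r// invr_ge0 powR_ge0.
  rewrite sqrtrM ?(ltW ka0)// ler_wpM2l ?sqrtr_ge0//.
  have -> : N%:R `^ (- alpha) = (N%:R `^ (- (alpha / 2))) ^+ 2 :> R.
    by rewrite -powR_mulrn ?powR_ge0// -powRrM; congr powR; field.
  by rewrite sqrtr_sqr ger0_norm// powR_ge0.
have Slin : D * \sum_(0 <= j < n) lin j ^+ 2 <= (Cl * N%:R `^ (r - s)) ^+ 2 * W.
  apply: (strich K N n D 0 _ y lin) => //; first exact: sqr_ge0.
  move=> e; under [X in _ <= _ * n2 X]eq_fun => x do under eq_bigr => j _ do rewrite addr0.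
  have -> : Cl * N%:R `^ (r - s) = 5 `^ (`|r - s| / 2) * N%:R `^ (r - s) * B by rewrite /Cl; ring.
  apply: linear_part => //; rewrite a0/=; apply: le_trans aT; by rewrite lerDl.
have Sq tau : 0 <= tau <= T -> D * \sum_(0 <= j < n) q j tau ^+ 2 <=
    (Cn * (N%:R * N%:R `^ (r - s))) ^+ 2 * W.
  move=> tauT; apply: (strich K N n D (a - tau) _ y (q ^~ tau)) => //; first exact: sqr_ge0.
  move=> e.
  have -> : Cn * (N%:R * N%:R `^ (r - s)) = 2 * (wnorm K s * B) * ((2 `^ s * N%:R `^ (- s) * B) *
      (N%:R *+ 2 * (5 `^ (`|r| / 2) * N%:R `^ r))).
    rewrite powRD; last by rewrite (gt_eqF Np') implybT.
    by rewrite /Cn -mulr_natr; ring.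
  have -> : (fun x => \sum_(0 <= j < n) e j * wave N omega (y j) (j%:R * D + (a - tau)) (rho K x)) =
     (fun x => \sum_(0 <= j < n) e j * wave N omega (y j) (t j - tau) (rho K x)).
    apply/funext => x; apply: eq_bigr => j _; congr (_ * wave _ _ _ _ _); rewrite /t; ring.
  exact: nonlinear_part.
set b := a + n%:R * D.
have ab : a <= b by rewrite lerDl.
have Snl : D * \sum_(0 <= j < n) nl j ^+ 2 <= (kappa * Cn * N%:R `^ (r - s)) ^+ 2 * W.
  (* Cauchy-Schwarz in time, then the integral is extended from [a, t j] to [a, b]. The domain no
     longer depends on j, so the discrete estimate applies at each fixed tau, with shift a - tau,
     also when t j < tau. *)
  have hj j : (j < n)%N -> nl j ^+ 2 <= n%:R * D * \int[leb]_(tau in `[a, b]) (q j tau ^+ 2).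
    move=> jn; have tb := t_le j jn; have tT := le_trans tb aT.
    have u2 a' b' : 0 <= a' -> b' <= T -> ucont_on a' b' (fun tau => q j tau ^+ 2).
      by move=> h h'; apply: ucontM; exact: uq.
    apply: le_trans (Rint_CS (a_le j) (uq j _ _ a0 tT)) _; apply: ler_pM.
    - by rewrite subr_ge0.
    - by apply: Rint_ge0 => x _; exact: sqr_ge0.
    - by rewrite lerBlDl.
    rewrite (@Rint_cat _ a (t j) b _ (a_le j) tb (ucont_int (u2 _ _ a0 aT))) lerDl.
    by apply: Rint_ge0 => x _; exact: sqr_ge0.
  have u2 j : ucont_on a b (fun tau => q j tau ^+ 2) by apply: ucontM; exact: uq.
  apply: (@le_trans _ _ (n%:R * D * \int[leb]_(tau in `[a, b]) (D * \sum_(0 <= j < n) q j tau ^+ 2))).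
    rewrite Rint_Z; last exact: ucont_sum.
    rewrite Rint_sum// mulrCA ler_wpM2l ?(ltW D0)// mulr_sumr.
    by rewrite !big_nat; apply: ler_sum => j /andP[_ jn]; exact: hj.
  apply: (@le_trans _ _ (n%:R * D * ((Cn * (N%:R * N%:R `^ (r - s))) ^+ 2 * W * (n%:R * D)))).
    rewrite ler_wpM2l//.
    have -> : n%:R * D = b - a by rewrite /b addrAC subrr add0r.
    rewrite -[leRHS]Rint_cst//; apply: Rint_le => //.
    - by apply: ucontZ; exact: ucont_sum.
    - exact: ucont_cst.
    move=> x /andP[ax xb]; apply: Sq; rewrite (le_trans a0 ax); exact: le_trans xb aT.
  have -> : (kappa * Cn * N%:R `^ (r - s)) ^+ 2 * W =
    (Cn * (N%:R * N%:R `^ (r - s))) ^+ 2 * W * (kappa / N%:R) ^+ 2.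
    by field; rewrite gt_eqF.
  rewrite mulrCA -expr2; apply: ler_wpM2l; first by rewrite mulr_ge0 ?sqr_ge0.
  by rewrite lerXn2r ?nnegrE ?divr_ge0 ?(ltW ka0)// ltW.
apply: (@le_trans _ _ (D * \sum_(0 <= j < n) (2 * lin j ^+ 2 + 2 * nl j ^+ 2))).
  rewrite ler_wpM2l ?(ltW D0)// !big_nat; apply: ler_sum => j /andP[_ jn].
  rewrite -/(t j) aE//; have := sqr_ge0 (lin j + nl j); nra.
rewrite big_split/= -!mulr_sumr mulrDr.
apply: (@le_trans _ _ (2 * (Cl ^+ 2 + (kappa * Cn) ^+ 2) * N%:R `^ (r - s) ^+ 2 * W)).
  have -> : 2 * (Cl ^+ 2 + (kappa * Cn) ^+ 2) * N%:R `^ (r - s) ^+ 2 * W =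
    2 * ((Cl * N%:R `^ (r - s)) ^+ 2 * W) + 2 * ((kappa * Cn * N%:R `^ (r - s)) ^+ 2 * W) by ring.
  by rewrite ![D * (2 * _)]mulrCA; apply: lerD; rewrite ler_wpM2l.
by rewrite ler_wpM2l// !mulr_ge0 ?sqr_ge0// addr_ge0 ?sqr_ge0.
Qed.

(** Up to the factor 2 pi, the sup norm over x of the block P_N J^r of the function whose transform
    is c t. *)
Definition freq_sup N t : R :=
  sup [set `|freq_pair K (c t) (kw N r omega y 0)| | y in [set: R]].

Let bl N : R := 5 `^ (`|r| / 2) * N%:R `^ r * 2 * nr (fun x : R => blk N (rho K x)).

Let bl0 N : 0 <= bl N. Proof. by rewrite !mulr_ge0 ?powR_ge0 ?nr_ge0. Qed.

Let fp_le N d y : (0 < N)%N -> L2 d -> `|freq_pair K d (kw N r omega y 0)| <= nr d * bl N.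
Proof.
move=> N0 ld; have [l n] := kw_nr K r N0 om y 0.
by apply: le_trans (freq_pair_bound ld l) _; rewrite ler_wpM2l ?nr_ge0.
Qed.

Let fp_has_sup N t : (0 < N)%N -> 0 <= t <= T ->
  has_sup [set `|freq_pair K (c t) (kw N r omega y 0)| | y in [set: R]].
Proof.
move=> N0 tT; split; first by exists `|freq_pair K (c t) (kw N r omega 0 0)|; exists 0.
by exists (nr (c t) * bl N) => _ [y _ <-]; apply: fp_le => //; exact: (wcont_L2 s12 hc tT).1.
Qed.

Lemma freq_sup_ge N t y : (0 < N)%N -> 0 <= t <= T ->
  `|freq_pair K (c t) (kw N r omega y 0)| <= freq_sup N t.
Proof. by move=> N0 tT; apply: ub_le_sup; [exact: (fp_has_sup N0 tT).2|exists y]. Qed.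

Lemma freq_sup_ge0 N t : (0 < N)%N -> 0 <= t <= T -> 0 <= freq_sup N t.
Proof. by move=> N0 tT; apply: le_trans (freq_sup_ge 0 N0 tT). Qed.

Lemma freq_sup_near N t e : (0 < N)%N -> 0 <= t <= T -> 0 < e ->
  exists y, freq_sup N t <= `|freq_pair K (c t) (kw N r omega y 0)| + e.
Proof.
move=> N0 tT e0; have [_ [y _ <-] h] := sup_adherent e0 (fp_has_sup N0 tT).
by exists y; move: h; rewrite /freq_sup; set S := sup _ => h; lra.
Qed.

Lemma ucont_freq_sup N : (0 < N)%N -> ucont_on 0 T (freq_sup N).
Proof.
move=> N0 e e0.
have e1 : 0 < e / (1 + bl N) by rewrite divr_gt0// ltr_pwDl.
have [dl dl0 h] := wcont_diff s12 hc e1; exists dl => // t u tT uT tu.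
have key t' u' : 0 <= t' <= T -> 0 <= u' <= T -> `|t' - u'| < dl ->
    freq_sup N t' <= freq_sup N u' + e.
  move=> tT' uT' tu'; apply: ge_sup; first exact: (fp_has_sup N0 tT').1.
  move=> _ [y _ <-]; have [l1 _] := wcont_L2 s12 hc tT'; have [l2 _] := wcont_L2 s12 hc uT'.
  have lk := (kw_nr K r N0 om y 0).1.
  have -> : freq_pair K (c t') (kw N r omega y 0) = freq_pair K (c u') (kw N r omega y 0) +
     freq_pair K (fun x => c t' x - c u' x) (kw N r omega y 0).
    by rewrite freq_pairBl//; ring.
  apply: (le_trans (ler_normD _ _)); apply: lerD; first exact: freq_sup_ge.
  apply: le_trans (fp_le _ N0 (L2B l1 l2)) _.
  have [h' _] := h _ _ tT' uT' tu'.
  have -> : e = e / (1 + bl N) * (1 + bl N) by rewrite divfK// gt_eqF// ltr_pwDl.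
  by apply: ler_pM; rewrite ?nr_ge0// lerDr.
have k1 := key t u tT uT tu; have k2 : freq_sup N u <= freq_sup N t + e.
  by apply: key => //; rewrite distrC.
by rewrite ler_norml; apply/andP; split; lra.
Qed.

Lemma Rint_pieces f a D n : 0 <= D -> ucont_on a (a + n%:R * D) f ->
  \int[leb]_(x in `[a, a + n%:R * D]) f x =
  \sum_(0 <= j < n) \int[leb]_(x in `[a + j%:R * D, a + j.+1%:R * D]) f x.
Proof.
move=> D0; elim: n => [|n ih] uf.
  rewrite big_nil mul0r addr0; apply/eqP; rewrite -normr_le0.
  have ufa : ucont_on a a f by apply: ucont_sub uf; rewrite ?mul0r ?addr0.
  have := @Rint_le_cst R a a f `|f a| (lexx a) (ucont_int ufa).
  by rewrite subrr mulr0; apply => x xa; rewrite (le_anti xa).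
have le1 : a + n%:R * D <= a + n.+1%:R * D by rewrite lerD2l ler_wpM2r// ler_nat.
have le0 : a <= a + n%:R * D by rewrite lerDl mulr_ge0.
rewrite (@Rint_cat _ a (a + n%:R * D) _ _ le0 le1 (ucont_int uf)) big_nat_recr//= ih//.
exact: ucont_sub uf.
Qed.

(** A Riemann sum on each of about N pieces. The step D is taken so small that the diagonal term 2 N
    D is at most N^(-alpha/2) and that [freq_sup] varies by at most e during one step. *)
Theorem freq_sup_int alpha : 0 < alpha -> alpha <= 1 -> hypothesis1 alpha omega -> 0 < T ->
  exists N0 : nat, exists2 C : R, 0 <= C & forall N, (N0 < N)%N ->
    \int[leb]_(t in `[0, T]) (freq_sup N t ^+ 2) <=
    C * (N%:R `^ (r - s)) ^+ 2 * (N%:R * N%:R `^ (- (alpha / 2))).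
Proof.
move=> al0 al1 h1 T0; have [N0 [ka [C [C' [ka0 C0 C'0 hblock]]]]] := block_sum al0 al1 h1.
exists N0, ((T / ka + 1) * (2 * C * (1 + C')) + 1).
  by rewrite !(addr_ge0, mulr_ge0)// ?invr_ge0 ltW.
move=> N NN; have Np : (0 < N)%N by exact: leq_ltn_trans NN.
have Np' : 0 < N%:R :> R by rewrite ltr0n.
set X := N%:R `^ (- (alpha / 2)); set Y := (N%:R `^ (r - s)) ^+ 2.
have X0 : 0 < X by exact: powR_gt0.
have Y0 : 0 < Y by rewrite exprn_gt0// powR_gt0.
(* Number of pieces: their length T / m is at most ka / N, and m <= (T / ka + 1) N. *)
pose m := (Num.truncn (T * N%:R / ka)).+1.
have m0 : 0 < m%:R :> R by rewrite ltr0n.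
pose L := T / m%:R.
have L0 : 0 < L by rewrite divr_gt0.
have mL : m%:R * L = T by rewrite mulrC divfK// gt_eqF.
have Lk : L <= ka / N%:R.
  have h : T * N%:R / ka < m%:R by exact: truncnS_gt.
  by rewrite ler_pdivlMr// /L mulrAC ler_pdivrMr// mulrC [ka * _]mulrC; apply: ltW; move: h; rewrite ltr_pdivrMr// mulrC.
have mN : m%:R <= (T / ka + 1) * N%:R.
  rewrite -natr1 mulrDl mul1r; apply: lerD; last by rewrite ler1n.
  have -> : T / ka * N%:R = T * N%:R / ka by ring.
  have q0 : 0 <= T * N%:R / ka by rewrite divr_ge0 ?mulr_ge0 ?(ltW T0) ?(ltW ka0).
  by have /andP[] := truncn_itv q0.
pose P := Y * (N%:R * X).
have P0 : 0 < P by apply: mulr_gt0 => //; exact: mulr_gt0.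
(* Tolerance for the sampling error: its contribution 8 e^2 T to the integral is at most the target
   P. *)
pose e := Num.min 1 (P / (8 * T)).
have e0 : 0 < e by rewrite lt_min ltr01/= divr_gt0// mulr_gt0.
have e2 : 8 * e ^+ 2 * T <= P.
  have h : e <= P / (8 * T) by rewrite /e ge_min lexx orbT.
  have h' : e <= 1 by rewrite /e ge_min lexx.
  have : e ^+ 2 <= P / (8 * T) by apply: le_trans h; rewrite expr2 ler_piMl// ltW.
  by rewrite ler_pdivlMr ?mulr_gt0// => h2; apply: le_trans h2; rewrite le_eqVlt; apply/orP; left; apply/eqP; ring.
have uM := ucont_freq_sup Np.
have [dl dl0 hdl] := uM e e0.
pose n := (Num.truncn (L / Num.min dl (X / (2 * N%:R)))).+1.
have n0 : 0 < n%:R :> R by rewrite ltr0n.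
have mi0 : 0 < Num.min dl (X / (2 * N%:R)) by rewrite lt_min dl0 divr_gt0// mulr_gt0.
pose D := L / n%:R.
have D0 : 0 < D by rewrite divr_gt0.
have Dmin : D < Num.min dl (X / (2 * N%:R)).
  by rewrite /D ltr_pdivrMr// mulrC -ltr_pdivrMr//; exact: truncnS_gt.
have nD : n%:R * D = L by rewrite mulrC divfK// gt_eqF.
move: Dmin; rewrite lt_min => /andP[Ddl DX].
have DX' : 2 * N%:R * D <= X by rewrite mulrC -ler_pdivlMr ?mulr_gt0// ltW.
have uM2 : ucont_on 0 T (fun t => freq_sup N t ^+ 2) by exact: ucontM.
have piece k : (k < m)%N -> \int[leb]_(t in `[k%:R * L, k.+1%:R * L]) (freq_sup N t ^+ 2) <=
    2 * (C * Y * ((1 + C') * X)) + 8 * e ^+ 2 * L.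
  move=> km.
  have kL0 : 0 <= k%:R * L by rewrite mulr_ge0// ltW.
  have kL1 : k.+1%:R * L = k%:R * L + n%:R * D by rewrite nD -natr1 mulrDl mul1r.
  have kT : k%:R * L + n%:R * D <= T.
    by rewrite -kL1 -mL ler_wpM2r ?(ltW L0)// ler_nat.
  have tin j : (j <= n)%N -> 0 <= k%:R * L + j%:R * D <= T.
    move=> jn; apply/andP; split.
      by rewrite addr_ge0// mulr_ge0 ?ler0n// ltW.
    by apply: le_trans kT; rewrite lerD2l ler_wpM2r ?(ltW D0)// ler_nat.
  (* A near-maximiser for each sample. Beyond j = n the time may leave [0,T], hence the guarded
     choice with 0 as default. *)
  have [y hy] : exists y : nat -> R, forall j, (j <= n)%N -> freq_sup N (k%:R * L + j%:R * D) <=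
      `|freq_pair K (c (k%:R * L + j%:R * D)) (kw N r omega (y j) 0)| + e.
    have hh : forall j, exists y : R, (j <= n)%N -> freq_sup N (k%:R * L + j%:R * D) <=
      `|freq_pair K (c (k%:R * L + j%:R * D)) (kw N r omega y 0)| + e.
      move=> j; have [jn|jn] := leqP j n; last by exists 0.
      by have [y hy] := freq_sup_near Np (tin j jn) e0; exists y.
    by have [y hy] := boolp.choice hh; exists y.
  set a_ := fun j => freq_pair K (c (k%:R * L + j%:R * D)) (kw N r omega (y j) 0).
  have hb := hblock N n D (k%:R * L) y NN D0 (eq_ind_r (fun z => z <= _) Lk nD) kL0 kT.
  rewrite kL1 Rint_pieces ?(ltW D0)//; last exact: ucont_sub uM2.
  apply: (@le_trans _ _ (\sum_(0 <= j < n) (2 * a_ j ^+ 2 + 8 * e ^+ 2) * D)).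
    rewrite !big_nat; apply: ler_sum => j /andP[_ jn].
    have jS : k%:R * L + j.+1%:R * D - (k%:R * L + j%:R * D) = D by rewrite -natr1; ring.
    have t1 := tin j (ltnW jn); have t2 := tin j.+1 jn.
    have jle : k%:R * L + j%:R * D <= k%:R * L + j.+1%:R * D by rewrite -subr_ge0 jS ltW.
    rewrite -[X in _ <= _ * X]jS -Rint_cst//; apply: Rint_le.
    - by apply: ucont_sub uM2; [case/andP: t1|case/andP: t2].
    - exact: ucont_cst.
    move=> x /andP[x1 x2].
    have xT : 0 <= x <= T.
      by case/andP: t1 => t10 _; case/andP: t2 => _ t2T; rewrite (le_trans t10 x1) (le_trans x2 t2T).
    have near : `|x - (k%:R * L + j%:R * D)| < dl.
      by rewrite ger0_norm ?subr_ge0//; apply: le_lt_trans Ddl; rewrite -[leRHS]jS lerD2r.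
    have hM := hdl _ _ xT t1 near; have hyj := hy j (ltnW jn).
    have M0 := freq_sup_ge0 Np xT.
    have bd : freq_sup N x <= `|a_ j| + 2 * e.
      move: hM; rewrite ler_norml => /andP[_]; move: hyj; rewrite -/(a_ j).
      by move: (freq_sup N x) (freq_sup N _) => p q; lra.
    have : freq_sup N x ^+ 2 <= (`|a_ j| + 2 * e) ^+ 2.
      by rewrite lerXn2r ?nnegrE// (le_trans M0 bd).
    rewrite -(real_normK (num_real (a_ j))) => h; apply: (le_trans h).
    have sq (p q : R) : (p + 2 * q) ^+ 2 <= 2 * p ^+ 2 + 8 * q ^+ 2.
      by have := sqr_ge0 (p - 2 * q); nra.
    exact: sq.
  rewrite -mulr_suml big_split/= -mulr_sumr mulrDl; apply: lerD.
    have -> : 2 * (\sum_(0 <= i < n) a_ i ^+ 2) * D = 2 * (D * \sum_(0 <= i < n) a_ i ^+ 2) by ring.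
    rewrite ler_wpM2l//; apply: le_trans hb _.
    rewrite ler_wpM2l ?mulr_ge0 ?(ltW Y0)//.
    by rewrite [leRHS]mulrDl mul1r lerD2r.
  by rewrite sumr_const_nat subn0 -[_ *+ n]mulr_natr -mulrA nD.
have -> : \int[leb]_(t in `[0, T]) (freq_sup N t ^+ 2) =
   \sum_(0 <= k < m) \int[leb]_(t in `[k%:R * L, k.+1%:R * L]) (freq_sup N t ^+ 2).
  have := @Rint_pieces (fun t => freq_sup N t ^+ 2) 0 L m (ltW L0).
  rewrite add0r mL => -> //; by apply: eq_bigr => k _; rewrite !add0r.
apply: (@le_trans _ _ (\sum_(0 <= k < m) (2 * (C * Y * ((1 + C') * X)) + 8 * e ^+ 2 * L))).
  by rewrite !big_nat; apply: ler_sum => k /andP[_]; exact: piece.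
rewrite sumr_const_nat subn0 -[_ *+ m]mulr_natr mulrDl.
have -> : 8 * e ^+ 2 * L * m%:R = 8 * e ^+ 2 * T by rewrite -mL; ring.
have -> : ((T / ka + 1) * (2 * C * (1 + C')) + 1) * Y * (N%:R * X) =
  2 * (C * Y * ((1 + C') * X)) * ((T / ka + 1) * N%:R) + P by rewrite /P; ring.
apply: lerD => //; apply: ler_wpM2l mN.
apply: mulr_ge0 => //; apply: mulr_ge0; apply: mulr_ge0; rewrite ?addr_ge0//; exact: ltW.
Qed.

End Blocks.

(** * Smooth functions *)
Section Smooth.
Context {R : realType}.
Implicit Types (f g q : R -> R) (x y l h : R).

(** An explicit quadratic remainder gives the derivatives of flat functions at 0 and of integrals
    depending on a parameter. *)
Lemma is_derive_quad f x l (C : R) : (forall h, `|f (x + h) - f x - h * l| <= C * h ^+ 2) ->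
  is_derive x 1 f l.
Proof.
move=> H; have C0 : 0 <= C.
  by have := H 1; rewrite expr1n mulr1; apply: le_trans.
have key : h^-1 *: (f (h *: 1 + x) - f x) @[h --> 0^'] --> l.
  apply/cvgrPdist_le => e e0; near=> h.
  have h0 : h != 0 by near: h; exact: nbhs_dnbhs_neq.
  rewrite /GRing.scale/= mulr1 -(ler_pM2r (x := `|h|)) ?normr_gt0// -normrM.
  have -> : (l - h^-1 * (f (h + x) - f x)) * h = - (f (x + h) - f x - h * l).
    by rewrite [h + x]addrC; field.
  rewrite normrN; apply: le_trans (H h) _; rewrite -(real_normK (num_real h)) expr2 mulrA ler_wpM2r//.
  apply: (@le_trans _ _ ((C + 1) * `|h|)); first by rewrite ler_wpM2r// lerDl.
  rewrite mulrC -ler_pdivlMr ?ltr_pwDr//; near: h.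
  apply: dnbhs0_le; rewrite divr_gt0// ltr_pwDr//.
by apply: DeriveDef; [apply/cvg_ex; exists l|exact: cvg_lim].
Unshelve. all: by end_near. Qed.

(** Asks for n successive derivatives and leaves the continuity of the last one aside; [smooth]
    takes all n, which restores it. *)
Fixpoint Ck n f : Prop :=
  if n is n'.+1 then (forall x, derivable f x 1) /\ Ck n' (derive1 f) else True.

Definition smooth f := forall n, Ck n f.

Lemma smoothE f : smooth f <-> forall n x, derivable (derive1n n f) x 1.
Proof.
split=> [sf n x|sf n]; last first.
  elim: n f sf => [//|n ih] f sf /=; split; first exact: (sf 0%N).
  by apply: ih => m x; rewrite -derive1Sn; exact: sf.
have := sf n.+1; elim: n f {sf} => [|n ih] f; first by case.
by move=> [_ h]; rewrite derive1Sn; exact: ih.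
Qed.

Lemma smooth_derivable f x : smooth f -> derivable f x 1.
Proof. by move=> /(_ 1%N)[h _]; exact: h. Qed.

Lemma smooth_derive1 f : smooth f -> smooth (derive1 f).
Proof. by move=> sf n; have [_] := sf n.+1. Qed.

Lemma smooth_derive1n f n : smooth f -> smooth (derive1n n f).
Proof. by move=> sf; elim: n => // n ih; rewrite derive1nS; exact: smooth_derive1. Qed.

Lemma derivable_continuous f : (forall x, derivable f x 1) -> continuous f.
Proof. by move=> df x; apply: differentiable_continuous; apply/derivable1_diffP. Qed.

Lemma smooth_continuous f : smooth f -> continuous f.
Proof. by move=> sf; apply: derivable_continuous => x; exact: smooth_derivable. Qed.

Lemma Ck_le n f : Ck n.+1 f -> Ck n f.
Proof. by elim: n f => [//|n ih] f /= [df h]; split=> //; exact: ih. Qed.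

Lemma derive1P f g : (forall x, is_derive x 1 f (g x)) -> (forall x, derivable f x 1) /\ derive1 f = g.
Proof.
move=> h; split=> [x|]; first by case: (h x).
by apply/funext => x; rewrite derive1E; case: (h x).
Qed.

Lemma derive1_is f x : derivable f x 1 -> is_derive x 1 f (derive1 f x).
Proof. by move=> df; rewrite derive1E; exact: DeriveDef. Qed.

Lemma CkD n f g : Ck n f -> Ck n g -> Ck n (fun x => f x + g x).
Proof.
elim: n f g => [//|n ih] f g [df cf] [dg cg].
have [d e] : (forall x, derivable (fun x => f x + g x) x 1) /\
    derive1 (fun x => f x + g x) = (fun x => derive1 f x + derive1 g x).
  by apply: derive1P => x; apply: is_deriveD; exact: derive1_is.
by split=> //; rewrite e; exact: ih.
Qed.

Lemma CkM n f g : Ck n f -> Ck n g -> Ck n (fun x => f x * g x).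
Proof.
elim: n f g => [//|n ih] f g cf cg; have [df cf'] := cf; have [dg cg'] := cg.
have [d e] : (forall x, derivable (fun x => f x * g x) x 1) /\
    derive1 (fun x => f x * g x) = (fun x => f x * derive1 g x + g x * derive1 f x).
  by apply: derive1P => x; apply: is_deriveM; exact: derive1_is.
split=> //; rewrite e; apply: CkD; apply: ih => //; exact: Ck_le.
Qed.

Lemma Ck_comp n f g : Ck n f -> Ck n g -> Ck n (fun x => f (g x)).
Proof.
elim: n f g => [//|n ih] f g [df cf] cg; have [dg cg'] := cg.
have [d e] : (forall x, derivable (fun x => f (g x)) x 1) /\
    derive1 (fun x => f (g x)) = (fun x => derive1 f (g x) * derive1 g x).
  apply: derive1P => x.
  exact: (@is_derive1_comp _ f g x _ _ (derive1_is (df (g x))) (derive1_is (dg x))).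
split=> //; rewrite e; apply: CkM => //; apply: ih => //; exact: Ck_le.
Qed.

Lemma smoothD f g : smooth f -> smooth g -> smooth (fun x => f x + g x).
Proof. by move=> sf sg n; exact: CkD. Qed.

Lemma smoothM f g : smooth f -> smooth g -> smooth (fun x => f x * g x).
Proof. by move=> sf sg n; exact: CkM. Qed.

Lemma smooth_comp f g : smooth f -> smooth g -> smooth (fun x => f (g x)).
Proof. by move=> sf sg n; exact: Ck_comp. Qed.

(** Induction on the order for all members at once: a family whose derivatives are built from the
    family itself is smooth. It is applied to constants, to cos and sin, to flat functions and to
    integrals against cas. *)
Lemma smooth_family (I : Type) (F : I -> R -> R) :
  (forall i, (forall x, derivable (F i) x 1) /\
     forall n, (forall j, Ck n (F j)) -> Ck n (derive1 (F i))) -> forall i, smooth (F i).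
Proof.
move=> H i n; elim: n i => [//|n ih] i; have [d h] := H i; split=> //; exact: h.
Qed.

Lemma smooth_cst (a : R) : smooth (fun=> a).
Proof.
have H (i : R) : smooth (fun=> i).
  apply: (smooth_family (F := fun (i : R) (_ : R) => i)) => {}i.
  have [d ->] : (forall x, derivable (fun _ : R => i) x 1) /\ derive1 (fun=> i) = (fun _ : R => (0 : R)).
    by apply: derive1P => x; exact: is_derive_cst.
  by split=> // n; exact.
exact: H.
Qed.

Lemma smooth_id : smooth id.
Proof.
case=> [//|n]; have [d e] : (forall x : R, derivable id x 1) /\ derive1 id = (fun _ : R => (1 : R)).
  by apply: derive1P => x; exact: is_derive_id.
by split=> //; rewrite e; exact: smooth_cst.
Qed.

Lemma smoothN f : smooth f -> smooth (fun x => - f x).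
Proof.
move=> sf; under eq_fun do rewrite -mulN1r; apply: smoothM => //; exact: smooth_cst.
Qed.

Lemma smoothB f g : smooth f -> smooth g -> smooth (fun x => f x - g x).
Proof. by move=> sf sg; apply: smoothD => //; exact: smoothN. Qed.

Lemma smoothZ a f : smooth f -> smooth (fun x => a * f x).
Proof. by move=> sf; apply: smoothM => //; exact: smooth_cst. Qed.

Lemma smooth_cos_sin : smooth (@cos R) /\ smooth (@sin R).
Proof.
pose F (b : bool) := if b then @cos R else @sin R.
suff H b : smooth (F b) by split; [exact: (H true)|exact: (H false)].
move: b; apply: smooth_family => -[].
  have [d e] : (forall x, derivable (@cos R) x 1) /\ derive1 (@cos R) = (fun x => -1 * sin x).
    by apply: derive1P => x; rewrite mulN1r; exact: is_derive_cos.
  split=> // n h; rewrite /F e; apply: CkM (h false); exact: smooth_cst.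
have [d e] : (forall x, derivable (@sin R) x 1) /\ derive1 (@sin R) = cos.
  by apply: derive1P => x; exact: is_derive_sin.
by split=> // n h; rewrite /F e; exact: (h true).
Qed.

(* The functions y^-m exp(-1/y) for y > 0, extended by 0: they span a space that is
   stable under differentiation, and [flat 0] yields all the bump functions. *)
Definition flat (m : nat) y : R := if 0 < y then y^-1 ^+ m * expR (- y^-1) else 0.

(** x / n <= e^(x/n), raised to the power n. *)
Lemma powM_expRN (n : nat) x : (0 < n)%N -> 0 <= x -> x ^+ n * expR (- x) <= n%:R ^+ n.
Proof.
move=> n0 x0; have n0' : 0 < n%:R :> R by rewrite ltr0n.
rewrite expRN ler_pdivrMr ?expR_gt0//.
have -> : expR x = expR (x / n%:R) ^+ n.
  by rewrite -expRM_natl; congr expR; field; rewrite gt_eqF.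
rewrite -exprMn lerXn2r ?nnegrE ?mulr_ge0 ?expR_ge0//.
rewrite -ler_pdivrMl// mulrC; apply: le_trans (expR_ge1Dx _); by rewrite lerDr.
Qed.

Lemma flat_ge0 m y : 0 <= flat m y.
Proof. by rewrite /flat; case: ifP => // y0; rewrite mulr_ge0 ?expR_ge0// exprn_ge0// invr_ge0 ltW. Qed.

Lemma flat_gt0 m y : 0 < y -> 0 < flat m y.
Proof. by rewrite /flat => y0; rewrite y0 mulr_gt0 ?expR_gt0// exprn_gt0// invr_gt0. Qed.

Lemma flat_le0 m y : y <= 0 -> flat m y = 0.
Proof. by rewrite /flat ltNge => ->. Qed.

Lemma is_derive_flat m y : is_derive y 1 (flat m) (- m%:R * flat m.+1 y + flat m.+2 y).
Proof.
have [y0|y0|<-] := ltgtP 0 y.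
- have y_n0 : y != 0 by rewrite gt_eqF.
  have du : is_derive y 1 (fun y : R => y^-1) (- y ^- 2).
    have := @is_deriveV R id y 1 1 y_n0 (is_derive_id _ _).
    by rewrite /GRing.scale/= mulr1.
  have dX : is_derive y 1 (fun y : R => y^-1 ^+ m) (m%:R * y^-1 ^+ m.-1 * (- y ^- 2)).
    have -> : (fun y : R => y^-1 ^+ m) = (fun y : R => y^-1) ^+ m by apply/funext => z; rewrite exprfctE.
    exact: is_deriveX.
  have dE : is_derive y 1 (fun y : R => expR (- y^-1)) (expR (- y^-1) * y ^- 2).
    have := @is_derive1_comp R expR (fun y => - y^-1) y _ _ (is_derive_expR _) (is_deriveN du).
    by rewrite opprK.
  have H := is_deriveM dX dE.
  apply: (near_eq_is_derive (f := (fun y : R => y^-1 ^+ m) * (fun y : R => expR (- y^-1)))).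
    by near=> z; rewrite /flat ifT//; near: z; exact: lt_nbhsr.
  apply: is_derive_eq H _; rewrite /flat y0 /GRing.scale/=.
  case: m {dX} => [|m]; first by rewrite !mul0r; field.
  by rewrite -[m.+1.-1]/m !exprS; field.
- rewrite !flat_le0 ?(ltW y0)// mulr0 addr0.
  have H0 : is_derive y 1 (fun _ : R => (0 : R)) 0 by exact: is_derive_cst.
  apply: near_eq_is_derive H0; near=> z; rewrite flat_le0//; apply/ltW; near: z; exact: lt_nbhsl.
(* At 0 from the right, h^(-m) e^(-1/h) <= (m+2)^(m+2) h^2, by [powM_expRN] with exponent m + 2 at
   the point 1/h. *)
- rewrite !flat_le0// mulr0 addr0; apply: (@is_derive_quad _ _ _ (m.+2%:R ^+ m.+2)) => h.
  rewrite add0r [flat m 0]flat_le0// subr0 mulr0 subr0.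
  have [h0|h0] := leP h 0; first by rewrite flat_le0// normr0 mulr_ge0 ?sqr_ge0// exprn_ge0 ?ler0n.
  rewrite ger0_norm ?flat_ge0// /flat h0.
  have -> : h^-1 ^+ m * expR (- h^-1) = (h^-1 ^+ m.+2 * expR (- h^-1)) * h ^+ 2.
    by rewrite !exprS; field; rewrite gt_eqF.
  by rewrite ler_wpM2r ?sqr_ge0// powM_expRN// invr_ge0 ltW.
Unshelve. all: by end_near. Qed.

Lemma smooth_flat m : smooth (flat m).
Proof.
move: m; apply: smooth_family => m.
have [d e] := derive1P (is_derive_flat m).
by split=> // n h; rewrite e; apply: CkD => //; apply: CkM => //; exact: smooth_cst.
Qed.

End Smooth.

(** * The Hartley transform of test functions *)
Section SpaceFrequency.
Context {R : realType}.
Local Notation leb := (@lebesgue_measure R).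
Implicit Types (f g c phi : R -> R) (K : spatial_domain) (x z t : R).

(** Integrals over K become integrals over R with this factor, so that the torus and the line share
    the lemmas on [Ig] and [L2]. *)
Definition chi K : R -> R := \1_(dom K).

Lemma measurable_dom K : measurable (dom K : set R).
Proof. by case: K => /=; [exact: measurable_itv|exact: measurableT]. Qed.

Lemma measurable_chi K : measurable_fun setT (chi K).
Proof. exact: measurable_indic (measurable_dom K). Qed.

Lemma chi_le1 K x : `|chi K x| <= 1.
Proof. by rewrite /chi indicE; case: (_ \in _); rewrite ?normr1 ?normr0. Qed.

Lemma chi_sqr K x : chi K x ^+ 2 = chi K x.
Proof. by rewrite /chi indicE; case: (_ \in _); rewrite ?expr1n ?expr0n. Qed.

Lemma chi_in K x : x \in dom K -> chi K x = 1. Proof. by rewrite /chi indicE => ->. Qed.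

Lemma chi_out K x : x \notin dom K -> chi K x = 0.
Proof. by rewrite /chi indicE => /negbTE ->. Qed.

Lemma restrict_chi K f : f \_ (dom K) = (fun x => chi K x * f x).
Proof.
apply/funext => x; rewrite patchE; case: ifPn => h; first by rewrite chi_in// mul1r.
by rewrite chi_out// mul0r.
Qed.

Lemma integral_spaceE K f : integral_space K f = \int[leb]_x (chi K x * f x).
Proof. by rewrite /integral_space Rintegral_mkcond restrict_chi. Qed.

Lemma measurable_chiM K f : measurable_fun (dom K) f -> measurable_fun setT (fun x => chi K x * f x).
Proof.
by move=> mf; rewrite -restrict_chi; apply/(measurable_restrictT _ (measurable_dom K)).
Qed.

Lemma Lp_norm2 K f : measurable_fun (dom K) f -> (Lp_norm K 2%:E f < +oo)%E ->
  L2 (fun x => chi K x * f x) /\ Lp_norm K 2%:E f = (nr (fun x => chi K x * f x))%:E.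
Proof.
move=> mf; have mcf := measurable_chiM mf.
have E : Lp_norm K 2%:E f = ((\int[leb]_x `|(chi K x * f x) ^+ 2|%:E) `^ 2^-1)%E.
  rewrite /Lp_norm restrict_chi unlock; congr (_ `^ _)%E; apply: eq_integral => x _ /=.
  by rewrite -[X in _ `^ X]/(2%:R) powR_mulrn// normrX.
rewrite E => h.
have ig : Ig (fun x => (chi K x * f x) ^+ 2).
  apply: Ig_lty; first exact: measurable_funX.
  move: h; have : (0 <= \int[leb]_x `|(chi K x * f x) ^+ 2|%:E)%E by apply: integral_ge0 => x _; rewrite lee_fin.
  by case: (\int[leb]_x _)%E => [r| |]// _; rewrite ?ltry// poweRyr// invr_neq0.
split; first by split.
rewrite /nr /n2; have -> : (\int[leb]_x `|(chi K x * f x) ^+ 2|%:E)%E = (n2 (fun x => chi K x * f x))%:E.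
  by rewrite /n2 IntE//; apply: eq_integral => x _; rewrite ger0_norm// sqr_ge0.
by rewrite poweR_EFin powR12_sqrt// n2_ge0.
Qed.

Lemma pickle_inv_inj (C : countType) m n (k : C) :
  pickle_inv m = Some k -> pickle_inv n = Some k -> m = n.
Proof.
move=> hm hn; have := pickle_invK (T := C) m; rewrite hm /= => <-.
by have := pickle_invK (T := C) n; rewrite hn.
Qed.

(** Both sides are split along an enumeration of the integers: the atom k has counting measure 1,
    and the cell [k, k + 1[, on which floor is constant, has length 1. *)
Lemma ge0_integral_freq K (f : R -> \bar R) : measurable_fun setT f -> (forall x, 0 <= f x)%E ->
  (match K with
  | Torus => \int[counting]_(xi in range (fun k : int => k%:~R : R)) f xi
  | Line => \int[leb]_(xi in setT) f xi
  end = \int[leb]_x f (rho K x))%E.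
Proof.
case: K => //= mf f0.
pose F1 (n : nat) : set R := [set x | exists2 k : int, pickle_inv n = Some k & x = k%:~R].
pose F2 (n : nat) : set R := [set x | pickle_inv n = Some (Num.floor x)].
have E1 : range (fun k : int => k%:~R : R) = \bigcup_n F1 n.
  apply/seteqP; split => [_ [k _ <-]|x [n _ [k _ ->]]]; last by exists k.
  by exists (pickle k) => //; exists k => //; exact: pickleK_inv.
have E2 : [set: R] = \bigcup_n F2 n.
  apply/seteqP; split => // x _; exists (pickle (Num.floor x)) => //; exact: pickleK_inv.
have F1E n : F1 n = if pickle_inv n is Some k then [set (k : int)%:~R] else set0.
  apply/seteqP; rewrite /F1; split => x /=; case: pickle_inv => [k|].
  - by case=> k' [->].
  - by case.
  - by move=> ->; exists k.
  - by [].
have F2E n : F2 n = if pickle_inv n is Some k then `[(k : int)%:~R, k%:~R + 1[%classic else set0.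
  apply/seteqP; rewrite /F2; split => x /=; case: pickle_inv => [k|]//=.
  - by case=> ->; rewrite in_itv/= ge_floor -(intrD _ _ 1) floorD1_gt.
  - by rewrite in_itv/= => h; congr Some; apply/esym/floor_def; rewrite intrD.
rewrite E1 E2 !ge0_integral_bigcup//; last 6 first.
- by move=> n; rewrite F2E; case: pickle_inv.
- by apply: measurable_funTS; apply: measurableT_comp mf _; exact: (@measurable_rho R Torus).
- move=> m n _ _ [x [hm hn]].
  have {}hm : pickle_inv m = Some (Num.floor x) by exact: hm.
  have {}hn : pickle_inv n = Some (Num.floor x) by exact: hn.
  exact: pickle_inv_inj hm hn.
- by move=> n; rewrite F1E; case: pickle_inv.
- exact: measurable_funTS.
- move=> m n _ _ [x [/= [k hm ->] [k' hn /eqP]]]; rewrite eqr_int => /eqP kk; rewrite -kk in hn.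
  exact: pickle_inv_inj hm hn.
apply: eq_eseriesr => n _; rewrite F1E F2E; case: pickle_inv => [k|]; last by rewrite !integral_set0.
have -> : (\int[leb]_(x in `[(k : int)%:~R, (k%:~R + 1)%R[) f (rho Torus x) =
   \int[leb]_(x in `[k%:~R, (k%:~R + 1)%R[) (cst (f k%:~R) x))%E.
  apply: eq_integral => x; rewrite inE/= in_itv/= => h.
  by congr f; congr intr; apply: floor_def; rewrite intrD.
rewrite (eq_integral (cst (f (k : int)%:~R)) f); last by move=> x; rewrite inE => ->.
rewrite !integral_cst//= lebesgue_measure_itv/= lte_fin ltrDl ltr01.
rewrite /counting asboolT// fset_set1 finmap.cardfs1 -EFinD addrAC subrr add0r//.
Qed.

Lemma integral_freqE K f : measurable_fun setT f -> integral_freq K f = \int[leb]_x f (rho K x).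
Proof.
move=> mf; rewrite /Rintegral.
have -> : (\int[leb]_x (f (rho K x))%:E = \int[leb]_x ((EFin \o f)^\+ (rho K x)) - \int[leb]_x ((EFin \o f)^\- (rho K x)))%E.
  by rewrite integralE; congr (_ - _)%E; apply: eq_integral => x _; rewrite ?funeposE ?funenegE.
have mf' : measurable_fun setT (EFin \o f) by exact/measurable_EFinP.
rewrite -!ge0_integral_freq//; [|exact: measurable_funeneg|exact: measurable_funepos].
by case: K; rewrite /integral_freq /Rintegral integralE.
Qed.

Definition ht K f z : R := \int[leb]_x (chi K x * f x * cas (x * z)).

(** The inverse Hartley transform. The coefficient c is a function of the real variable xi; only the
    kernel sees the frequency [rho K xi]. *)
Definition psi K c x : R := (2 * pi)^-1 * \int[leb]_xi (c xi * cas (x * rho K xi)).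


Lemma measurable_cas_prod : measurable_fun setT (fun p : R * R => cas (p.2 * p.1)).
Proof. by apply: (measurableT_comp measurable_cas); apply: measurable_funM. Qed.

Lemma Ig_ht K f z : Ig (fun x => chi K x * f x) -> Ig (fun x => chi K x * f x * cas (x * z)).
Proof.
move=> fi; apply: (IgMb (M := 2) fi); last by move=> x; exact: cas_le2.
by apply: (measurableT_comp measurable_cas); apply: measurable_funM.
Qed.

Lemma measurable_ht K f : Ig (fun x => chi K x * f x) -> measurable_fun setT (ht K f).
Proof.
move=> fi; apply: (measurable_int2 (F := fun z x => chi K x * f x * cas (x * z))); last by move=> z; exact: Ig_ht.
apply: measurable_funM; last exact: measurable_cas_prod.
exact: (measurableT_comp (Ig_meas fi) measurable_snd).
Qed.

Lemma ht_bound K f z : Ig (fun x => chi K x * f x) ->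
  `|ht K f z| <= 2 * \int[leb]_x `|chi K x * f x|.
Proof.
move=> fi; rewrite -IntZ; last exact: Ig_abs.
apply: Int_le_norm; first exact: Ig_ht; first by apply: IgZ; exact: Ig_abs.
by move=> x; rewrite normrM mulrC ler_wpM2r// cas_le2.
Qed.

Lemma htD K f g z : Ig (fun x => chi K x * f x) -> Ig (fun x => chi K x * g x) ->
  ht K (fun x => f x + g x) z = ht K f z + ht K g z.
Proof.
move=> fi gi; rewrite /ht -IntD; [|exact: Ig_ht|exact: Ig_ht].
by apply: Int_ext => x; ring.
Qed.

Lemma htZ K f (a : R) z : Ig (fun x => chi K x * f x) -> ht K (fun x => a * f x) z = a * ht K f z.
Proof.
move=> fi; rewrite /ht -IntZ; last exact: Ig_ht.
by apply: Int_ext => x; ring.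
Qed.

Lemma Int_rho_odd K f : measurable_fun setT f -> Ig (fun x => f (rho K x)) ->
  (forall z, f (- z) = - f z) -> \int[leb]_x f (rho K x) = 0.
Proof.
move=> mf fi fo; have [_ h] := rho_opp mf fi; move: h.
under Int_ext do rewrite fo; rewrite IntN//; set I := \int[leb]_x _ => h; lra.
Qed.

Lemma test_smooth K phi : test_space K phi -> smooth phi.
Proof. by move=> [h _]; apply/smoothE. Qed.

Lemma smooth_measurable f : smooth f -> measurable_fun setT f.
Proof. by move=> sf; apply: continuous_measurable_fun; exact: smooth_continuous. Qed.

Lemma continuous_bounded f (a b : R) : continuous f -> exists2 B : R, 0 <= B & forall x, a <= x <= b -> `|f x| <= B.
Proof.
move=> cf.
have [ab|ba] := leP a b; last by exists 0 => // x; lra.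
have /(@continuous_compact _ _ f `[a, b]) : {within `[a, b], continuous f} by exact: continuous_subspaceT.
move=> /(_ (@segment_compact _ _ _))/compact_bounded[M [_ /(_ (M + 1))]].
rewrite ltrDl ltr01 => /(_ isT) h.
have h' x : a <= x <= b -> `|f x| <= M + 1 by move=> xab; apply: h; exists x.
by exists (M + 1) => //; apply: le_trans (h' a _); rewrite ?lexx.
Qed.

Lemma dom_bound x : x \in dom Torus -> 0 <= x < 2 * pi.
Proof. by rewrite inE/= in_itv. Qed.

Lemma test_bound K phi : test_space K phi -> exists B M : R, [/\ 0 <= B, 0 <= M &
  forall x, `|chi K x * phi x| <= B * \1_(`[- M, M]) x].
Proof.
move=> tp; have cp := smooth_continuous (test_smooth tp).
have [M M0 hM] : exists2 M : R, 0 <= M & forall x, M < `|x| -> chi K x * phi x = 0.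
  case: K tp => [tp|[_ [M hM]]].
    exists (2 * pi); first by rewrite mulr_ge0// pi_ge0.
    move=> x h; rewrite chi_out ?mul0r//; apply/negP => /dom_bound/andP[x0 xp].
    by move: h; rewrite ger0_norm// ltNge (ltW xp).
  by exists `|M| => // x h; rewrite hM ?mulr0//; apply: le_lt_trans h; exact: ler_norm.
have [B B0 hB] := continuous_bounded (- M) M cp.
exists B, M; split=> // x; rewrite indE in_itv/=; have [h|h] := boolP (- M <= x <= M).
  rewrite mulr1 normrM; apply: le_trans (hB _ h); by rewrite ler_piMl// chi_le1.
by rewrite hM ?normr0 ?mulr0// ltNge ler_norml.
Qed.

Lemma test_Ig K phi : test_space K phi -> Ig (fun x => chi K x * phi x).
Proof.
move=> tp; have [B [M [B0 M0 h]]] := test_bound tp.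
have ib : Ig (fun x => B * (\1_(`[- M, M]) x : R)) by apply: IgZ; exact: Ig_ind.
apply: Ig_le ib _; last by move=> x; apply: le_trans (h x) (ler_norm _).
apply: measurable_funM; [exact: measurable_chi|exact: smooth_measurable (test_smooth tp)].
Qed.

Lemma test_L2 K phi : test_space K phi -> L2 (fun x => chi K x * phi x).
Proof.
move=> tp; have [B [M [B0 M0 h]]] := test_bound tp; have ip := test_Ig tp.
split; first exact: Ig_meas ip.
apply: (IgMb (M := B) ip); first exact: Ig_meas ip.
move=> x; apply: le_trans (h x) _; rewrite indE ler_piMr//; by case: (_ \in _).
Qed.

Lemma periodic_derive1 f (p : R) : periodic f p -> (forall x, derivable f x 1) -> periodic (derive1 f) p.
Proof.
move=> pf df x; rewrite !derive1E.
have H : is_derive x 1 (fun x => f (x + p)) ('D_1 f (x + p)).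
  have d : is_derive (x + p) 1 f ('D_1 f (x + p)) by exact: DeriveDef (df _) _.
  have := @is_derive1_comp R f (fun x => x + p) x _ _ d (is_deriveD (is_derive_id _ _) (is_derive_cst _ _ _)).
  by rewrite addr0 mulr1.
have e : (fun x => f (x + p)) = f by apply/funext => y; exact: pf.
by rewrite e in H; case: H => _ <-.
Qed.

Lemma test_derive1 K phi : test_space K phi -> test_space K (derive1 phi).
Proof.
move=> tp; have sp := test_smooth tp; split.
  by apply/smoothE; exact: smooth_derive1.
case: K tp => -[_]; first by move=> pp; apply: periodic_derive1 => // x; exact: smooth_derivable.
move=> [M hM]; exists M => x Mx; rewrite derive1E.
have -> : 'D_1 phi x = 'D_1 (fun=> 0) x.
  apply: near_eq_derive; near=> y; apply: hM; near: y.
  by apply: (cvgr_gt `|x|) => //; exact: norm_continuous.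
by have [_] := @is_derive_cst R R R 0 x 1.
Unshelve. all: by end_near. Qed.

Lemma testD K phi f : test_space K phi -> test_space K f -> test_space K (fun x => phi x + f x).
Proof.
move=> tp tf; split; first by apply/smoothE; apply: smoothD; [exact: test_smooth tp|exact: test_smooth tf].
case: K tp tf => -[_ p1] [_ p2]; first by move=> x; rewrite p1 p2.
move: p1 p2 => [M1 h1] [M2 h2]; exists (Num.max M1 M2) => x; rewrite gt_max => /andP[a b].
by rewrite h1// h2// addr0.
Qed.

Lemma testZ K (a : R) phi : test_space K phi -> test_space K (fun x => a * phi x).
Proof.
move=> tp; split; first by apply/smoothE; apply: smoothZ; exact: test_smooth tp.
case: K tp => -[_ p1]; first by move=> x; rewrite p1.
by move: p1 => [M1 h1]; exists M1 => x a1; rewrite h1// mulr0.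
Qed.

Lemma Int_itv f (a b : R) : \int[leb]_(x in `[a, b]) f x = \int[leb]_x (\1_(`[a, b]) x * f x).
Proof.
rewrite Rintegral_mkcond; apply: Int_ext => x; rewrite patchE indicE.
by case: (_ \in _); rewrite ?mul1r ?mul0r.
Qed.

Lemma FTC_itv f F (a b : R) : a <= b -> continuous f -> (forall x, is_derive x 1 F (f x)) ->
  \int[leb]_(x in `[a, b]) f x = F b - F a.
Proof.
rewrite le_eqVlt => /orP[/eqP ->|ab] cf dF.
  by rewrite subrr set_itv1 Rintegral_set1.
have cF : continuous F by apply: derivable_continuous => x; case: (dF x).
rewrite /Rintegral (@continuous_FTC2 R f F a b ab)//.
- exact: continuous_subspaceT.
- split; first by move=> x _; case: (dF x).
  + by apply: cvg_at_right_filter; exact: cF.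
  + by apply: cvg_at_left_filter; exact: cF.
- by move=> x _; rewrite derive1E; case: (dF x).
Qed.

(** The boundary terms cancel by periodicity on the torus and vanish by compact support on the
    line. *)
Lemma int_deriv_zero K f F : continuous f -> (forall x, is_derive x 1 F (f x)) ->
  match K with Torus => F (2 * pi) = F 0 | Line => exists M : R, forall x, M < `|x| -> F x = 0 /\ f x = 0 end ->
  \int[leb]_x (chi K x * f x) = 0.
Proof.
move=> cf dF; case: K => [FF|[M hM]].
  rewrite -integral_spaceE /integral_space/= Rintegral_itv_bndo_bndc.
    by rewrite (FTC_itv _ cf dF) ?FF ?subrr// mulr_ge0// pi_ge0.
  apply: (@integrableS _ _ _ leb `[0, 2 * pi]) => //.
    by apply: subset_itvl; rewrite bnd_simp.
  apply: continuous_compact_integrable; first exact: segment_compact.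
  exact: continuous_subspaceT.
pose m := `|M| + 1.
have m0 : 0 <= m by rewrite addr_ge0.
have mM x : m <= `|x| -> M < `|x|.
  by apply: lt_le_trans; rewrite /m; apply: le_lt_trans (ler_norm M) _; rewrite ltrDl.
have -> : \int[leb]_x (chi Line x * f x) = \int[leb]_(x in `[- m, m]) f x.
  rewrite Int_itv; apply: Int_ext => x; rewrite /chi indicT mul1r indE in_itv/= -ler_norml.
  by have [h|h] := leP `|x| m; rewrite ?mul1r// mul0r; apply: (hM x _).2; apply: mM; exact: ltW.
have mm : - m <= m by lra.
rewrite (FTC_itv mm cf dF).
have m1 : m <= `|m| by exact: ler_norm.
have m2 : m <= `|- m| by rewrite normrN.
by rewrite (hM m (mM _ m1)).1 (hM (- m) (mM _ m2)).1 subrr.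
Qed.

End SpaceFrequency.

(** * Derivatives, multipliers and products under the Hartley transform *)

Section Transform.
Context {R : realType}.
Local Notation leb := (@lebesgue_measure R).
Implicit Types (f g c phi : R -> R) (K : spatial_domain) (x z t s : R).

Lemma cas_2pi_rho x : cas (2 * pi * rho Torus x) = 1.
Proof.
rewrite /= /cas; set m := Num.floor x.
have c1 : cos (2 * pi * m%:~R) = 1 :> R.
  by rewrite -(cos_2pi_int _ m) mulrC subrr cos0.
have : sin (2 * pi * m%:~R) ^+ 2 = 0 :> R.
  by have := cos2Dsin2 (2 * pi * m%:~R : R); rewrite c1 expr1n => h; lra.
by move/eqP; rewrite sqrf_eq0 => /eqP ->; rewrite c1 addr0.
Qed.

Lemma is_derive_casM z x : is_derive x 1 (fun x => cas (x * z)) (z * cas (- (x * z))).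
Proof.
have d : is_derive x 1 (fun x : R => x * z) z.
  apply: (@is_derive_quad _ _ _ _ 0) => h; rewrite mul0r.
  by have -> : (x + h) * z - x * z - h * z = 0 by [ring]; rewrite normr0.
have := @is_derive1_comp R cas (fun x => x * z) x _ _ (is_derive_cas _) d.
by rewrite mulrC.
Qed.

(** Integration by parts; the reflection comes from cas' (p) = cas (- p). The statement concerns
    frequencies [rho K x], for which cas (2 pi z) = 1 on the torus, so that the boundary terms
    cancel. *)
Lemma ht_derive1 K phi x : test_space K phi ->
  ht K (derive1 phi) (rho K x) = - rho K x * ht K phi (- rho K x).
Proof.
move=> tp; have sp := test_smooth tp; set z := rho K x.
pose F y := phi y * cas (y * z); pose dF y := phi y * (z * cas (- (y * z))) + cas (y * z) * derive1 phi y.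
have dFP (y : R) : is_derive y 1 F (dF y).
  have h1 : is_derive y 1 phi (derive1 phi y) by apply: derive1_is; exact: smooth_derivable.
  exact: (is_deriveM h1 (is_derive_casM z y)).
have ccas (w : R) : continuous (fun y : R => cas (y * w)).
  by apply: derivable_continuous => y; case: (is_derive_casM w y).
have ccasN : continuous (fun y : R => cas (- (y * z))).
  move=> u; have := ccas (- z) u.
  by rewrite (_ : (fun y : R => cas (y * - z)) = (fun y : R => cas (- (y * z))))//; apply/funext => v; rewrite mulrN.
have cdF : continuous dF.
  move=> y; apply: cvgD; apply: cvgM.
  - exact: smooth_continuous sp _.
  - apply: cvgM; first exact: cvg_cst.
    exact: ccasN.
  - exact: ccas.
  - exact: smooth_continuous (smooth_derive1 sp) _.
have h0 : \int[leb]_y (chi K y * dF y) = 0.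
  apply: (int_deriv_zero cdF dFP); rewrite /F /dF /z; case: K tp {F dF dFP cdF ccasN z} => tp.
    have [_ pp] := tp; rewrite cas_2pi_rho mul0r.
    have -> : phi (2 * pi) = phi 0 by rewrite -[in LHS](add0r (2 * pi)) pp.
    by rewrite /cas cos0 sin0 addr0.
  have [_ [M hM]] := tp; have [_ [M' hM']] := test_derive1 tp.
  exists (Num.max M M') => y; rewrite gt_max => /andP[a b].
  by rewrite hM// hM'// !mul0r mulr0 addr0.
have e1 : Ig (fun y => chi K y * derive1 phi y * cas (y * z)) by apply: Ig_ht; exact: test_Ig (test_derive1 tp).
have e2 : Ig (fun y => chi K y * phi y * cas (y * - z)) by apply: Ig_ht; exact: test_Ig.
apply/eqP; rewrite mulNr -addr_eq0 -IntZ// -IntD//; last exact: IgZ.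
rewrite -h0; apply/eqP; apply: Int_ext => y; rewrite /dF mulrN; ring.
Qed.

Lemma ht_derive2 K phi x : test_space K phi ->
  ht K (derive1 (derive1 phi)) (rho K x) = - rho K x ^+ 2 * ht K phi (rho K x).
Proof.
move=> tp; rewrite ht_derive1; last exact: test_derive1.
by rewrite -{2}rhoN ht_derive1// rhoN opprK; ring.
Qed.

(** The operator 1 - (d/dx)^2 preserves test functions and multiplies the transform by 1 + z^2; k
    applications give the weight of exponent 2 k. *)
Lemma ht_decay_nat K (k : nat) phi : test_space K phi ->
  exists2 C : R, 0 <= C & forall x, wt (2 * k%:R) (rho K x) * `|ht K phi (rho K x)| <= C.
Proof.
elim: k phi => [|k ih] phi tp.
  exists (2 * \int[leb]_x `|chi K x * phi x|); first by rewrite mulr_ge0// Int_ge0.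
  by move=> x; rewrite mulr0 wt0 mul1r ht_bound//; exact: test_Ig.
have t2 : test_space K (fun x => -1 * derive1 (derive1 phi) x).
  by apply: testZ; do 2 apply: test_derive1.
have [C C0 hC] := ih _ (testD tp t2); exists C => // x.
have -> : 2 * k.+1%:R = 2 * k%:R + 2 :> R by rewrite -[k.+1%:R]natr1; ring.
rewrite wtD wt2 -mulrA; apply: le_trans (hC x).
rewrite ler_wpM2l ?wt_ge0// htD ?htZ; try exact: test_Ig.
  rewrite ht_derive2//.
  have -> : ht K phi (rho K x) + -1 * (- rho K x ^+ 2 * ht K phi (rho K x)) = (1 + rho K x ^+ 2) * ht K phi (rho K x) by ring.
  by rewrite normrM ger0_norm// addr_ge0// sqr_ge0.
by apply: test_Ig; do 2 apply: test_derive1.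
Qed.

(** The weight on the right is integrable; its exponent is written - (2 * 1) to match [Ig_wt] with s
    = 1. *)
Lemma ht_decay K (p : R) phi : test_space K phi ->
  exists2 C : R, 0 <= C & forall x, wt p (rho K x) * `|ht K phi (rho K x)| <= C * wt (- (2 * 1)) (rho K x).
Proof.
move=> tp; pose k := (Num.truncn (`|p| + 2)).+1.
have kp : `|p| + 2 <= k%:R by apply: ltW; exact: truncnS_gt.
have [C C0 hC] := ht_decay_nat k tp; exists C => // x.
have -> : wt p (rho K x) = wt (p + 2) (rho K x) * wt (- (2 * 1)) (rho K x).
  by rewrite -wtD; congr wt; ring.
rewrite mulrAC ler_wpM2r ?wt_ge0//; apply: le_trans (hC x).
rewrite ler_wpM2r//; apply: wt_mono.
by have := ler_norm p; have := normr_ge0 p; lra.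
Qed.

Lemma Ig_wt_ht K p phi : test_space K phi ->
  Ig (fun x => wt p (rho K x) * ht K phi (rho K x)) /\ L2 (fun x => wt p (rho K x) * ht K phi (rho K x)).
Proof.
move=> tp; have [C C0 hC] := ht_decay p tp.
have m : measurable_fun setT (fun x => wt p (rho K x) * ht K phi (rho K x)).
  apply: (measurableT_comp (f := fun z => wt p z * ht K phi z) _ (@measurable_rho R K)).
  by apply: measurable_funM; [exact: measurable_wt|apply: measurable_ht; exact: test_Ig].
have i1 : Ig (fun x : R => wt (- (2 * 1)) (rho K x)) by apply: Ig_wt; rewrite invf_lt1// ltr1n.
have i2 : Ig (fun x => wt p (rho K x) * ht K phi (rho K x)).
  apply: Ig_le m (IgZ C i1) _ => x; rewrite normrM (ger0_norm (wt_ge0 _ _)).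
  by apply: le_trans (hC x) (ler_norm _).
split=> //; split=> //; apply: (IgMb (M := C) i2 m) => x.
rewrite normrM (ger0_norm (wt_ge0 _ _)); apply: le_trans (hC x) _.
by rewrite ler_piMr// wt_le1// oppr_le0 mulr1.
Qed.

(** The even part of the Hartley transform is the real part of the Fourier transform, and its odd
    part is minus the imaginary part. *)
Lemma fourierE K phi xi : Ig (fun x => chi K x * phi x) ->
  fourier K phi xi = Complex (2^-1 * (ht K phi xi + ht K phi (- xi))) (- (2^-1 * (ht K phi xi - ht K phi (- xi)))).
Proof.
move=> ip; rewrite /fourier !integral_spaceE; congr Complex.
  rewrite -IntD; [|exact: Ig_ht|exact: Ig_ht]; rewrite -IntZ; last by apply: IgD; exact: Ig_ht.
  by apply: Int_ext => x; rewrite /= /cas mulrN cosN sinN; field.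
rewrite -IntB; [|exact: Ig_ht|exact: Ig_ht]; rewrite -IntZ; last by apply: IgB; exact: Ig_ht.
rewrite -IntN; last by apply: IgZ; apply: IgB; exact: Ig_ht.
by apply: Int_ext => x; rewrite /= /cas mulrN cosN sinN; field.
Qed.

(** Taking the real part symmetrises the integrand in frequency, and the symmetrised function has
    the same integral as h itself. *)
Lemma multiplier_half K (m : R -> R[i]) phi x (h : R -> R) : measurable_fun setT h ->
  Ig (fun y => h (rho K y)) ->
  (forall xi, complex.Re (m xi * fourier K phi xi * cis (x * xi)) = 2^-1 * (h xi + h (- xi))) ->
  multiplier K m phi x = (2 * pi)^-1 * \int[leb]_y h (rho K y).
Proof.
move=> mh ih E; rewrite /multiplier; congr (_ * _).
have -> : (fun xi => complex.Re (m xi * fourier K phi xi * cis (x * xi))) = (fun xi => 2^-1 * (h xi + h (- xi))).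
  exact/funext.
have [ih' e] := rho_opp mh ih.
rewrite integral_freqE; last first.
  apply: measurable_funM => //; apply: measurable_funD => //.
  by apply: measurableT_comp mh _; exact: oppr_measurable.
rewrite IntZ ?IntD ?e//; last exact: IgD.
by field.
Qed.

Lemma multiplier_JE K s phi x : test_space K phi ->
  multiplier K (fun xi => J_symbol s (- xi)) phi x =
  psi K (fun y => wt s (rho K y) * ht K phi (rho K y)) x.
Proof.
move=> tp; have ip := test_Ig tp; have [i1 _] := Ig_wt_ht s tp.
have mcx : measurable_fun setT (fun z => cas (x * z)).
  by apply: (measurableT_comp measurable_cas); exact: measurable_funM.
apply: (@multiplier_half K _ phi x (fun z => wt s z * ht K phi z * cas (x * z))).
- by apply: measurable_funM => //; apply: measurable_funM; [exact: measurable_wt|exact: measurable_ht].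
- apply: (IgMb (M := 2) i1) => [|y]; last exact: cas_le2.
  exact: (measurableT_comp mcx (@measurable_rho R K)).
- move=> xi; rewrite fourierE// /cis /J_symbol /= -/(wt s (- xi)) !wt_even.
  have -> : cas (x * - xi) = cos (x * xi) - sin (x * xi) by rewrite /cas mulrN cosN sinN.
  by rewrite /cas; field.
Qed.

(** The transpose has symbol - i omega. Multiplication by i interchanges the even and odd parts of
    the Hartley transform up to sign, which appears as a reflection of the frequency. *)
Lemma multiplier_LE K (omega : R -> R) phi x : test_space K phi -> measurable_fun setT omega ->
  (forall z, omega (- z) = - omega z) ->
  Ig (fun y => omega (rho K y) * ht K phi (- rho K y)) ->
  multiplier K (fun xi => L_symbol omega (- xi)) phi x =
  psi K (fun y => omega (rho K y) * ht K phi (- rho K y)) x.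
Proof.
move=> tp mo oo i1; have ip := test_Ig tp.
have mcx : measurable_fun setT (fun z => cas (x * z)).
  by apply: (measurableT_comp measurable_cas); exact: measurable_funM.
apply: (@multiplier_half K _ phi x (fun z => omega z * ht K phi (- z) * cas (x * z))).
- apply: measurable_funM => //; apply: measurable_funM => //.
  by apply: (measurableT_comp (measurable_ht ip)); exact: oppr_measurable.
- apply: (IgMb (M := 2) i1) => [|y]; last exact: cas_le2.
  exact: (measurableT_comp mcx (@measurable_rho R K)).
- move=> xi; rewrite fourierE// /cis /L_symbol /= oo opprK.
  have -> : cas (x * - xi) = cos (x * xi) - sin (x * xi) by rewrite /cas mulrN cosN sinN.
  by rewrite /cas; field.
Qed.

Lemma Ig_psi K c x : Ig c -> Ig (fun xi => c xi * cas (x * rho K xi)).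
Proof.
move=> ic; apply: (IgMb (M := 2) ic) => [|y]; last exact: cas_le2.
apply: (measurableT_comp measurable_cas); apply: measurable_funM => //; exact: measurable_rho.
Qed.

Lemma two_pi_gt0 : 0 < 2 * pi :> R. Proof. by rewrite mulr_gt0// pi_gt0. Qed.

Lemma psi_bound K c x : Ig c -> `|psi K c x| <= pi^-1 * \int[leb]_x `|c x|.
Proof.
move=> ic; rewrite /psi normrM ger0_norm ?invr_ge0 ?(ltW two_pi_gt0)//.
have -> : pi^-1 * \int[leb]_x `|c x| = (2 * pi)^-1 * (2 * \int[leb]_x `|c x|).
  by rewrite invfM [2^-1 * _]mulrC -mulrA mulKf.
rewrite ler_wpM2l ?invr_ge0 ?(ltW two_pi_gt0)// -IntZ; last exact: Ig_abs.
apply: Int_le_norm; [exact: Ig_psi|by apply: IgZ; exact: Ig_abs|].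
by move=> y; rewrite normrM mulrC ler_wpM2r// cas_le2.
Qed.

Lemma measurable_psi K c : Ig c -> measurable_fun setT (psi K c).
Proof.
move=> ic; apply: measurable_funM => //.
apply: (measurable_int2 (F := fun x xi => c xi * cas (x * rho K xi))); last by move=> x; exact: Ig_psi.
apply: measurable_funM; first exact: (measurableT_comp (Ig_meas ic) measurable_snd).
apply: (measurableT_comp measurable_cas); apply: measurable_funM => //.
exact: (measurableT_comp (@measurable_rho R K) measurable_snd).
Qed.

(** Fubini: the kernel being symmetric, [psi] is (2 pi)^-1 times the transpose of the Hartley
    transform. *)
Lemma pairing K f c : Ig (fun x => chi K x * f x) -> Ig c ->
  \int[leb]_x (chi K x * f x * psi K c x) = (2 * pi)^-1 * \int[leb]_xi (c xi * ht K f (rho K xi)).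
Proof.
move=> fi ic; pose F x xi := chi K x * f x * c xi * cas (x * rho K xi).
have mF : measurable_fun setT (fun p : R * R => F p.1 p.2).
  apply: measurable_funM; first apply: measurable_funM.
  - exact: (measurableT_comp (Ig_meas fi) measurable_fst).
  - exact: (measurableT_comp (Ig_meas ic) measurable_snd).
  apply: (measurableT_comp measurable_cas); apply: measurable_funM => //.
  exact: (measurableT_comp (@measurable_rho R K) measurable_snd).
have bF x y : `|F x y| <= 2 * `|chi K x * f x| * `|c y|.
  by rewrite /F normrM [`|_ * c y|]normrM mulrC mulrA ler_wpM2r// ler_wpM2r// cas_le2.
have [i1 i2 E] := @Fubini_prod R F _ _ mF (IgZ 2 (Ig_abs fi)) (Ig_abs ic) bF.
transitivity ((2 * pi)^-1 * \int[leb]_x \int[leb]_y F x y).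
  rewrite -IntZ//; apply: Int_ext => x; rewrite mulrCA; congr (_ * _).
  by rewrite -IntZ; [apply: Int_ext => y; rewrite /F; ring|exact: Ig_psi].
congr (_ * _); rewrite E; apply: Int_ext => y; rewrite -IntZ; last exact: Ig_ht.
by apply: Int_ext => x; rewrite /F; ring.
Qed.

(** cas p cas q is half of cas (p - q) + cas (q - p) + cas (p + q) - cas (- p - q). *)
Lemma ht_mul_cas K f u w : Ig (fun x => chi K x * f x) ->
  ht K (fun x => f x * cas (x * u)) w = dbl (ht K f) u w.
Proof.
move=> fi; rewrite /dbl.
have i z := Ig_ht z fi.
have i2 : Ig (fun x => chi K x * f x * cas (x * (u - w)) + chi K x * f x * cas (x * (w - u))) by exact: IgD.
have i3 := IgD i2 (i (u + w)).
rewrite -IntD// -IntD// -IntB// -IntZ; last exact: IgB.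
apply: Int_ext => x.
have -> : chi K x * (f x * cas (x * u)) * cas (x * w) = chi K x * f x * (cas (x * u) * cas (x * w)) by ring.
rewrite casM /cas.
have -> : x * (w - u) = - (x * (u - w)) by ring.
have -> : x * (- u - w) = - (x * (u + w)) by ring.
by rewrite !cosN !sinN -mulrBr -mulrDr; field.
Qed.

(** [pairing] is used twice: with the function f * psi, and inside its transform with f * cas (x u),
    whose own transform is [dbl]. *)
Lemma pairing_sqr K f c : Ig (fun x => chi K x * f x) -> Ig c -> 
  \int[leb]_x (chi K x * (psi K c x ^+ 2 * f x)) = (2 * pi)^-1 * Q K c c (ht K f).
Proof.
move=> fi ic.
have fpi : Ig (fun x => chi K x * (f x * psi K c x)).
  under eq_fun do rewrite mulrA.
  apply: (IgMb fi (measurable_psi K ic)) => x; exact: psi_bound.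
transitivity (\int[leb]_x (chi K x * (f x * psi K c x) * psi K c x)).
  by apply: Int_ext => x; ring.
rewrite pairing// /Q; congr (_ * _).
have ich : Ig (fun xi => c xi * ht K (fun x => f x * psi K c x) (rho K xi)).
  apply: (IgMb ic) => [|y]; last exact: ht_bound.
  exact: (measurableT_comp (measurable_ht fpi) (@measurable_rho R K)).
have E xi : Qin K c (ht K f) (rho K xi) = 2 * pi * ht K (fun x => f x * psi K c x) (rho K xi).
  have fci : Ig (fun x => chi K x * (f x * cas (x * rho K xi))).
    under eq_fun do rewrite mulrA.
    exact: Ig_ht.
  have -> : ht K (fun x => f x * psi K c x) (rho K xi) =
      \int[leb]_x (chi K x * (f x * cas (x * rho K xi)) * psi K c x).
    by apply: Int_ext => x; ring.
  rewrite pairing// mulrA mulfV ?mul1r ?gt_eqF ?two_pi_gt0//.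
  by apply: Int_ext => y; congr (_ * _); rewrite ht_mul_cas.
have -> : \int[leb]_x (c x * Qin K c (ht K f) (rho K x)) =
    2 * pi * \int[leb]_xi (c xi * ht K (fun x => f x * psi K c x) (rho K xi)).
  by rewrite -IntZ//; apply: Int_ext => xi; rewrite E mulrCA.
by rewrite mulrA mulVf ?mul1r ?gt_eqF ?two_pi_gt0.
Qed.

End Transform.

(** * Bessel's inequality and inversion *)
Section Bessel.
Context {R : realType}.
Local Notation leb := (@lebesgue_measure R).
Implicit Types (f g c phi : R -> R) (K : spatial_domain) (x z t s : R).

(** Monotone convergence along weights W n that increase to 1. On the torus these are cutoffs, on
    the line the damping factors of the Poisson kernel. *)
Lemma L2_trunc (F : R -> R) (W : nat -> R -> R) (B : R) : measurable_fun setT F ->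
  (forall n, measurable_fun setT (W n)) -> (forall n x, 0 <= W n x) ->
  (forall x m n, (m <= n)%N -> W m x <= W n x) ->
  (forall x, W ^~ x @ \oo --> (1 : R)) ->
  (forall n, Ig (fun x => F x ^+ 2 * W n x) /\ \int[leb]_x (F x ^+ 2 * W n x) <= B) ->
  L2 F /\ n2 F <= B.
Proof.
move=> mF mW W0 ndW cW h.
have mF2 : measurable_fun setT (fun x => F x ^+ 2) by exact: measurable_funX.
have B0 : 0 <= B by apply: le_trans (h 0%N).2; apply: Int_ge0 => x; rewrite mulr_ge0 ?sqr_ge0.
pose g n x := (F x ^+ 2 * W n x)%:E.
have mg n : measurable_fun setT (g n) by apply/measurable_EFinP; exact: measurable_funM.
have g0 n x : setT x -> (0 <= g n x)%E by move=> _; rewrite lee_fin mulr_ge0 ?sqr_ge0.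
have ndg x : setT x -> {homo g^~ x : m n / (m <= n)%N >-> (m <= n)%E}.
  by move=> _ m n mn; rewrite lee_fin ler_wpM2l ?sqr_ge0// ndW.
have cv : (\int[leb]_x g n x)%E @[n --> \oo] --> (\int[leb]_x limn (g^~ x))%E.
  exact: cvg_monotone_convergence.
have lg x : limn (g^~ x) = (F x ^+ 2)%:E.
  apply/cvg_lim => //; apply/cvg_EFin; first by near=> n.
  by rewrite -[X in _ --> X]mulr1; apply: cvgM; [exact: cvg_cst|exact: cW].
have le : (\int[leb]_x (F x ^+ 2)%:E <= B%:E)%E.
  have -> : (\int[leb]_x (F x ^+ 2)%:E = \int[leb]_x limn (g^~ x))%E.
    by apply: eq_integral => x _; rewrite lg.
  rewrite -(cvg_lim _ cv)//; apply: lime_le; first by apply/cvg_ex; eexists; exact: cv.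
  by near=> n; rewrite /g -IntE; [rewrite lee_fin; exact: (h n).2|exact: (h n).1].
have ig : Ig (fun x => F x ^+ 2).
  apply: Ig_lty => //; apply: le_lt_trans (ltry B); apply: le_trans le.
  rewrite le_eqVlt; apply/orP; left; apply/eqP.
  by apply: eq_integral => x _; rewrite ger0_norm// sqr_ge0.
split; first by split.
by rewrite -lee_fin /n2 IntE.
Unshelve. all: by end_near. Qed.

Lemma Int_ind (a b : R) : a <= b -> \int[leb]_x \1_(`[a, b[) x = b - a :> R.
Proof.
move=> ab; rewrite /Rintegral integral_indic//= setIT lebesgue_measure_itv/= lte_fin.
by case: ltP => // h; rewrite (le_anti (introT andP (conj ab h))) subrr.
Qed.

Lemma test_one : test_space Torus (fun=> 1 : R).
Proof. by split; [apply/smoothE; exact: smooth_cst|move=> x]. Qed.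

Let one_Ig : Ig (fun x => chi Torus x * 1 : R) := test_Ig test_one.

(** At a nonzero frequency the derivative rule applies: the derivative of 1 is 0, so the frequency
    times the transform of 1 vanishes. *)
Lemma ht_one x : ht Torus (fun=> 1) (rho Torus x) = if rho Torus x == 0 then 2 * pi else 0.
Proof.
case: eqVneq => [->|z0].
  rewrite /ht; under Int_ext do rewrite mulr0 /cas cos0 sin0 addr0 mulr1 mulr1.
  by rewrite /chi Int_ind ?subr0// ltW// two_pi_gt0.
have := ht_derive1 (- rho Torus x) test_one.
have -> : derive1 (fun _ : R => 1 : R) = (fun=> 0 : R).
  by apply/funext => y; rewrite derive1E; case: (is_derive_cst (1 : R) y 1).
rewrite rhoN opprK {1}/ht; under Int_ext do rewrite mulr0 mul0r.
by rewrite Int0 => /esym/eqP; rewrite mulf_eq0 (negbTE z0) => /eqP.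
Qed.

Lemma rho_sub K x y : exists u, rho K x - rho K y = rho K u.
Proof. by exists (x + rho K (- rho K y)); rewrite rho_add rhoN. Qed.

Lemma dbl_ht_one x y : dbl (ht Torus (fun=> 1)) (rho Torus y) (rho Torus x) =
  2 * pi * (rho Torus x == rho Torus y)%:R.
Proof.
have e (u v : R) : ht Torus (fun=> 1) (rho Torus u - rho Torus v) = if rho Torus u - rho Torus v == 0 then 2 * pi else 0.
  by have [w ->] := rho_sub Torus u v; exact: ht_one.
have E (u v : R) (w := rho Torus u + rho Torus v) : ht Torus (fun=> 1) w = if w == 0 then 2 * pi else 0.
  by rewrite /w -rho_add ht_one.
rewrite /dbl !e E.
have -> : - rho Torus y - rho Torus x = rho Torus (- rho Torus y) + rho Torus (- rho Torus x) by rewrite !rhoN.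
rewrite E !rhoN -opprD oppr_eq0 addrK.
rewrite !subr_eq0 [rho Torus y == _]eq_sym; case: eqP => _; rewrite ?mulr1 ?mulr0 ?addr0 ?mulr0//.
by field.
Qed.

(** Orthogonality on the torus: the transform of cas (k x) is 2 pi at the integer k and 0 at the
    others, and the cell of k has length 1. *)
Lemma ht_psi_torus (g : R -> R) y : Ig (fun xi => g (rho Torus xi)) ->
  ht Torus (psi Torus (fun xi => g (rho Torus xi))) (rho Torus y) = g (rho Torus y).
Proof.
move=> ig; have i1 : Ig (fun x => chi Torus x * cas (x * rho Torus y)).
  by have := Ig_ht (rho Torus y) one_Ig; under eq_fun do rewrite mulr1.
transitivity (\int[leb]_x (chi Torus x * cas (x * rho Torus y) * psi Torus (fun xi => g (rho Torus xi)) x)).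
  by apply: Int_ext => x; ring.
rewrite pairing//.
transitivity ((2 * pi)^-1 * \int[leb]_xi (2 * pi * g (rho Torus y) * \1_(`[rho Torus y, rho Torus y + 1[) xi)).
  congr (_ * _); apply: Int_ext => xi.
  have -> : (fun x => cas (x * rho Torus y)) = (fun x => 1 * cas (x * rho Torus y)) by apply/funext => x; rewrite mul1r.
  rewrite ht_mul_cas// dbl_ht_one indE in_itv/=.
  have -> : (rho Torus y <= xi < rho Torus y + 1) = (rho Torus xi == rho Torus y).
    apply/idP/eqP => [h|<-]; last exact: rho_near.
    by rewrite /= /rho; congr intr; apply: floor_def; rewrite intrD.
  by case: eqP => [->|_]; rewrite ?mulr1 ?mulr0// mulrC.
rewrite IntZ; last exact: Ig_ind.
rewrite Int_ind ?lerDl// addrAC subrr add0r.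
by rewrite mulr1 mulKf// gt_eqF// two_pi_gt0.
Qed.

Definition cut (n : nat) z : R := \1_(`[- n%:R, n%:R]) z.

Lemma measurable_cut n : measurable_fun setT (cut n). Proof. exact: measurable_ind. Qed.

Lemma cutE n z : cut n z = (`|z| <= n%:R)%R%:R.
Proof. by rewrite /cut indE in_itv/= ler_norml. Qed.

Lemma Ig_cut K n : Ig (fun x => cut n (rho K x)).
Proof.
have m1 : measurable_fun setT (fun x => cut n (rho K x)).
  exact: (measurableT_comp (measurable_cut n) (@measurable_rho R K)).
apply: (Ig_le m1 (Ig_ind_rho K (- n%:R) (n%:R + 1))) => x.
rewrite /cut !indE !in_itv/=; have [/andP[h1 h2]|h] := boolP (- n%:R <= rho K x <= n%:R); last by rewrite normr0.
by rewrite h1 (le_lt_trans h2) ?ltrDl.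
Qed.

Lemma cut_sqr n z : cut n z ^+ 2 = cut n z.
Proof. by rewrite cutE; case: (_ <= _)%R; rewrite ?expr1n ?expr0n. Qed.

Lemma cvg_cut z : cut ^~ z @ \oo --> (1 : R).
Proof.
apply: cvg_near_cst; near=> n; rewrite cutE.
have -> // : `|z| <= n%:R; near: n; exact: nbhs_infty_ger.
Unshelve. all: by end_near. Qed.

(** For the truncated transform c, |c|^2 = 2 pi <f, psi c> and |psi c|^2 = |c|^2 / (2 pi).
    Cauchy-Schwarz gives |c|^2 <= 2 pi |f|^2 for every truncation. *)
Lemma bessel_torus f : Ig (fun x => chi Torus x * f x) -> L2 (fun x => chi Torus x * f x) ->
  L2 (fun x => ht Torus f (rho Torus x)) /\
  n2 (fun x => ht Torus f (rho Torus x)) <= 2 * pi * n2 (fun x => chi Torus x * f x).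
Proof.
move=> fi f2; have mr := @measurable_rho R Torus; have mh := measurable_ht fi.
apply: (@L2_trunc _ (fun n x => cut n (rho Torus x))) => //.
- exact: measurableT_comp mh mr.
- by move=> n; exact: (measurableT_comp (measurable_cut n) mr).
- move=> x m n mn; rewrite !cutE ler_nat; case: (leP `|_| m%:R) => //= h.
  by rewrite (le_trans h) ?ler_nat.
- by move=> x; exact: cvg_cut.
move=> n; pose g z := ht Torus f z * cut n z; pose c x := g (rho Torus x).
have hb z : `|ht Torus f z| <= 2 * \int[leb]_x `|chi Torus x * f x| by exact: ht_bound.
have mg : measurable_fun setT g by apply: measurable_funM => //; exact: measurable_cut.
have mc : measurable_fun setT c by exact: measurableT_comp mg mr.
have ic : Ig c.
  have := IgMb (Ig_cut Torus n) (measurableT_comp mh mr) (fun x => hb _).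
  by under eq_fun do rewrite mulrC.
have gb z : `|g z| <= 2 * \int[leb]_x `|chi Torus x * f x|.
  apply: le_trans (hb z); rewrite /g normrM ler_piMr// cutE.
  by case: (`|z| <= n%:R)%R; rewrite ?normr1 ?normr0.
have l2c : L2 c by split=> //; apply: (IgMb ic mc) => x; exact: gb.
have E : (fun x => ht Torus f (rho Torus x) ^+ 2 * cut n (rho Torus x)) = (fun x => c x ^+ 2).
  by apply/funext => x; rewrite /c /g exprMn cut_sqr.
rewrite E; split; first exact: l2c.2.
rewrite -/(n2 c).
have mpsi := measurable_psi Torus ic.
have lp : L2 (fun x => chi Torus x * psi Torus c x).
  have l1 : L2 (chi Torus : R -> R) by have := test_L2 test_one; under eq_fun do rewrite mulr1.
  by apply: (L2Mb l1 mpsi) => x; exact: psi_bound.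
have ip : Ig (fun x => chi Torus x * psi Torus c x).
  have l1 : Ig (chi Torus : R -> R) by have := one_Ig; under eq_fun do rewrite mulr1.
  by apply: (IgMb l1 mpsi) => x; exact: psi_bound.
have N1 : n2 c = 2 * pi * \int[leb]_x (chi Torus x * f x * (chi Torus x * psi Torus c x)).
  have -> : \int[leb]_x (chi Torus x * f x * (chi Torus x * psi Torus c x)) = \int[leb]_x (chi Torus x * f x * psi Torus c x).
    by apply: Int_ext => x; rewrite -[in RHS](chi_sqr Torus x); ring.
  rewrite pairing// mulVKf ?gt_eqF ?two_pi_gt0//; apply: Int_ext => x.
  by rewrite /c /g exprMn cut_sqr; ring.
have N2 : n2 (fun x => chi Torus x * psi Torus c x) = (2 * pi)^-1 * n2 c.
  transitivity (\int[leb]_x (chi Torus x * psi Torus c x * psi Torus c x)).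
    by apply: Int_ext => x; rewrite exprMn chi_sqr; ring.
  rewrite pairing//; congr (_ * _); apply: Int_ext => x.
  by rewrite (ht_psi_torus (g := g))// expr2.
have := CS f2 lp; rewrite N2 => cs.
have n0 := n2_ge0 c; have p0 := @two_pi_gt0 R.
have [->|nz] := eqVneq (n2 c) 0; first by rewrite mulr_ge0 ?(ltW p0)// n2_ge0.
have npos : 0 < n2 c by rewrite lt_neqAle eq_sym nz.
have h2 : n2 c ^+ 2 <= 2 * pi * n2 (fun x => chi Torus x * f x) * n2 c.
  rewrite [in leLHS]N1 exprMn; apply: (@le_trans _ _ ((2 * pi) ^+ 2 * (n2 (fun x => chi Torus x * f x) * ((2 * pi)^-1 * n2 c)))).
    by rewrite ler_wpM2l ?sqr_ge0.
  have alg (p a b : R) : p != 0 -> p ^+ 2 * (a * (p^-1 * b)) = p * a * b by move=> pn; field.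
  by rewrite alg// gt_eqF.
by move: h2; rewrite expr2 ler_pM2r.
Qed.

End Bessel.

(** * Poisson kernel, Bessel's inequality and inversion on the line *)

Section Poisson.
Context {R : realType}.
Local Notation leb := (@lebesgue_measure R).
Implicit Types (f g c phi : R -> R) (x z t u e : R).

Definition damp e x : R := expR (- (e * `|x|)).
(* The Poisson kernel: the Hartley transform of [damp e]. *)
Definition poisson e u : R := 2 * e / (e ^+ 2 + u ^+ 2).

Lemma damp_ge0 e x : 0 <= damp e x. Proof. exact: expR_ge0. Qed.

Lemma damp_le1 e x : 0 < e -> damp e x <= 1.
Proof. by move=> e0; rewrite /damp -expR0 ler_expR oppr_le0 mulr_ge0// ltW. Qed.

Lemma measurable_damp e : measurable_fun setT (damp e).
Proof.
apply: (measurableT_comp (@measurable_expR R)); apply: (measurableT_comp (@oppr_measurable R setT)).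
by apply: measurable_funM => //; exact: normr_measurable.
Qed.

(** (e |x|)^2 exp (- e |x|) <= 4 bounds the damping factor by a multiple of 1 / (1 + x^2). *)
Lemma Ig_damp e : 0 < e -> Ig (damp e).
Proof.
move=> e0; have i1 : Ig (fun x : R => wt (- (2 * 1)) (rho Line x)) by apply: Ig_wt; rewrite invf_lt1// ltr1n.
apply: Ig_le (measurable_damp e) (IgZ (1 + 4 / e ^+ 2) i1) _ => x.
rewrite ger0_norm ?damp_ge0// ger0_norm ?mulr_ge0 ?wt_ge0 ?addr_ge0 ?divr_ge0 ?sqr_ge0//=.
rewrite mulr1 wtV wt2 ler_pdivlMr ?(lt_le_trans ltr01 (wt_base x))// mulrDr mulr1 lerD ?damp_le1//.
rewrite ler_pdivlMr ?exprn_gt0// /damp.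
have := @powM_expRN R 2 (e * `|x|) isT (mulr_ge0 (ltW e0) (normr_ge0 x)).
rewrite exprMn real_normK ?num_real// => h.
have -> : expR (- (e * `|x|)) * x ^+ 2 * e ^+ 2 = e ^+ 2 * x ^+ 2 * expR (- (e * `|x|)) by ring.
by apply: le_trans h _; rewrite -natrX.
Qed.

Lemma poisson_den e u : 0 < e -> 0 < e ^+ 2 + u ^+ 2.
Proof. by move=> e0; rewrite ltr_pwDl ?exprn_gt0// sqr_ge0. Qed.

Lemma is_derive_damped (a b u x : R) :
  is_derive x 1 (fun x => expR (a * x) * (b * sin (u * x) + a * cos (u * x)))
   (expR (a * x) * ((a * b - a * u) * sin (u * x) + (b * u + a ^+ 2) * cos (u * x))).
Proof.
have dl (k : R) : is_derive x 1 (fun x : R => k * x) k.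
  apply: (@is_derive_quad _ _ _ _ 0) => h; rewrite mul0r.
  by have -> : k * (x + h) - k * x - h * k = 0 by [ring]; rewrite normr0.
have dE : is_derive x 1 (fun x : R => expR (a * x)) (expR (a * x) * a).
  exact: (@is_derive1_comp R expR (fun x => a * x) x _ _ (is_derive_expR _) (dl a)).
have dS : is_derive x 1 (fun x : R => sin (u * x)) (cos (u * x) * u).
  exact: (@is_derive1_comp R sin (fun x => u * x) x _ _ (is_derive_sin _) (dl u)).
have dC : is_derive x 1 (fun x : R => cos (u * x)) (- sin (u * x) * u).
  exact: (@is_derive1_comp R cos (fun x => u * x) x _ _ (is_derive_cos _) (dl u)).
have dB := is_deriveD (is_deriveM (is_derive_cst b x 1) dS) (is_deriveM (is_derive_cst a x 1) dC).
have H := is_deriveM dE dB.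
apply: is_derive_eq H _; rewrite /GRing.scale/= !fctE /cst; ring.
Qed.

Lemma DCT_cut f : Ig f -> \int[leb]_x (cut n x * f x) @[n --> \oo] --> \int[leb]_x f x.
Proof.
move=> fi; have mf := Ig_meas fi.
have le n x : `|cut n x * f x| <= `|f x|.
  by rewrite normrM ler_piMl// cutE; case: (`|x| <= n%:R)%R; rewrite ?normr1 ?normr0.
have mc n : measurable_fun setT (fun x => cut n x * f x) by apply: measurable_funM => //; exact: measurable_cut.
have cv : {ae leb, forall x, (fun n => cut n x * f x) @ \oo --> f x}.
  apply: aeW => x; rewrite -[X in _ --> X]mul1r; apply: cvgM; [exact: cvg_cut|exact: cvg_cst].
by have [] := @DCT R (fun n x => cut n x * f x) f (fun x => `|f x|) mc mf (Ig_abs fi) le cv.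
Qed.

Lemma cvg_expRN e : 0 < e -> expR (- (e * n%:R)) @[n --> \oo] --> (0 : R).
Proof.
move=> e0; apply/cvgrPdist_le => d d0; near=> n.
rewrite sub0r normrN ger0_norm ?expR_ge0//.
have n0 : 0 < n%:R :> R by rewrite ltr0n; near: n; exists 1%N.
have en : 0 < e * n%:R by rewrite mulr_gt0.
have := @powM_expRN R 1 (e * n%:R) isT (ltW en); rewrite !expr1 => h.
apply: (@le_trans _ _ (e * n%:R)^-1); first by rewrite -[leRHS]mul1r ler_pdivlMr// mulrC.
rewrite invf_ple ?posrE// -ler_pdivrMl//; near: n; exact: nbhs_infty_ger.
Unshelve. all: by end_near. Qed.

(** [F a] is an explicit primitive of e^(a x) cos (u x) when a^2 = e^2; a = - e serves to the right
    of 0 and a = e to the left, on [- n, n] with n tending to infinity. *)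
Lemma Int_damp_cos e u : 0 < e -> \int[leb]_x (damp e x * cos (u * x)) = poisson e u.
Proof.
move=> e0; have d0 := poisson_den u e0; set d := e ^+ 2 + u ^+ 2 in d0 *.
pose F (a : R) x := d^-1 * (expR (a * x) * (u * sin (u * x) + a * cos (u * x))).
have dF (a x : R) : a ^+ 2 = e ^+ 2 -> is_derive x 1 (F a) (expR (a * x) * cos (u * x)).
  move=> a2; have := is_deriveM (is_derive_cst d^-1 x 1) (is_derive_damped a u u x).
  rewrite /GRing.scale/= mulr0 addr0 => H; apply: is_derive_eq H _.
  rewrite /cst a2 subrr mul0r add0r -expr2 -/d [u ^+ 2 + _]addrC -/d mulrCA; congr (_ * _).
  by rewrite mulrA mulVf ?mul1r// gt_eqF.
have cf (a : R) : continuous (fun x => expR (a * x) * cos (u * x)).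
  move=> x; apply: cvgM.
    apply: (@cvg_comp _ _ _ (fun x => a * x) expR _ (nbhs (a * x))); last exact: continuous_expR.
    by apply: cvgM; [exact: cvg_cst|exact: cvg_id].
  apply: (@cvg_comp _ _ _ (fun x => u * x) cos _ (nbhs (u * x))); last exact: continuous_cos.
  by apply: cvgM; [exact: cvg_cst|exact: cvg_id].
have cg : continuous (fun x => damp e x * cos (u * x)).
  move=> x; apply: cvgM.
    apply: (@cvg_comp _ _ _ (fun x => - (e * `|x|)) expR _ (nbhs (- (e * `|x|)))); last exact: continuous_expR.
    by apply: cvgN; apply: cvgM; [exact: cvg_cst|exact: norm_continuous].
  apply: (@cvg_comp _ _ _ (fun x => u * x) cos _ (nbhs (u * x))); last exact: continuous_cos.
  by apply: cvgM; [exact: cvg_cst|exact: cvg_id].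
have In n : \int[leb]_(x in `[- n%:R, n%:R]) (damp e x * cos (u * x)) = F (- e) n%:R - F (- e) 0 + (F e 0 - F e (- n%:R)).
  have n0 : 0 <= n%:R :> R by exact: ler0n.
  rewrite (@Rint_cat _ (- n%:R) 0 n%:R) ?oppr_le0//; last first.
    by apply: continuous_compact_integrable; [exact: segment_compact|exact: continuous_subspaceT].
  rewrite addrC; congr (_ + _).
    rewrite -(FTC_itv n0 (cf (- e)) (fun x => dF (- e) x (sqrrN e))).
    apply: eq_Rintegral => x; rewrite inE/= in_itv/= => /andP[x0 _].
    by rewrite /damp ger0_norm// mulNr.
  have nn0 : - n%:R <= 0 :> R by rewrite oppr_le0.
  rewrite -(FTC_itv nn0 (cf e) (fun x => dF e x erefl)).
  apply: eq_Rintegral => x; rewrite inE/= in_itv/= => /andP[_ x0].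
  by rewrite /damp ler0_norm// mulrN opprK.
have ig : Ig (fun x => damp e x * cos (u * x)).
  apply: (IgMb (M := 1) (Ig_damp e0)) => [|x]; last by rewrite ler_norml cos_geN1 cos_le1.
  by apply: (measurableT_comp measurable_cos); exact: measurable_funM.
have c1 := DCT_cut ig.
have c2 : \int[leb]_x (cut n x * (damp e x * cos (u * x))) @[n --> \oo] --> poisson e u.
  have E n : \int[leb]_x (cut n x * (damp e x * cos (u * x))) =
      poisson e u + expR (- (e * n%:R)) * (2 * d^-1 * (u * sin (u * n%:R) - e * cos (u * n%:R))).
    rewrite /cut -Int_itv In /F /poisson -/d !mulr0 sin0 cos0 !mulr0 !mulr1 expR0 !add0r.
    by rewrite !mulrN cosN sinN !mulNr; ring.
  have k0 : 0 < 2 * d^-1 * (`|u| + e) by rewrite !mulr_gt0 ?invr_gt0// ltr_wpDl.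
  apply/cvgrPdist_le => a a0; have ak0 := divr_gt0 a0 k0; near=> n; rewrite E opprD addrA subrr sub0r normrN normrM.
  rewrite ger0_norm ?expR_ge0//.
  apply: (@le_trans _ _ (expR (- (e * n%:R)) * (2 * d^-1 * (`|u| + e)))).
    rewrite ler_wpM2l ?expR_ge0// normrM ger0_norm ?mulr_ge0 ?invr_ge0 ?(ltW d0)//.
    rewrite ler_wpM2l ?mulr_ge0 ?invr_ge0 ?(ltW d0)//.
    apply: (le_trans (ler_normB _ _)); rewrite !normrM (gtr0_norm e0); apply: lerD.
      by rewrite ler_piMr// ler_norml sin_geN1 sin_le1.
    by rewrite ler_piMr ?(ltW e0)// ler_norml cos_geN1 cos_le1.
  rewrite -ler_pdivlMr//; near: n.
  have := @cvgr_le _ _ _ _ _ _ (cvg_expRN e0) (a / (2 * d^-1 * (`|u| + e))).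
  exact.
exact: (cvg_unique _ c1 c2).
Unshelve. all: by end_near. Qed.

Lemma Ig_poisson e : 0 < e -> Ig (poisson e) /\ \int[leb]_u poisson e u = 2 * pi.
Proof.
move=> e0.
have i1 : (\int[leb]_x ((oneDsqr x)^-1%:E) = pi%:E :> \bar R)%E.
  rewrite (@ge0_symfun_integralT R (fun x => (oneDsqr x)^-1)).
  - have -> : [set x : R | 0 <= x] = `[0%R, +oo[%classic by apply/seteqP; split => x /=; rewrite in_itv/= andbT.
    by rewrite integral0y_oneDsqr -EFinM; congr EFin; field.
  - by move=> x; rewrite invr_ge0 (le_trans ler01)// oneDsqr_ge1.
  - exact: continuous_oneDsqrV.
  - by move=> x; rewrite /oneDsqr /= sqrrN.
have m1 : measurable_fun setT (fun x : R => (oneDsqr x)^-1).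
  by apply: continuous_measurable_fun; exact: continuous_oneDsqrV.
have p1 (x : R) : 0 <= (oneDsqr x)^-1 by rewrite invr_ge0 (le_trans ler01)// oneDsqr_ge1.
have g1 : Ig (fun x : R => (oneDsqr x)^-1).
  apply: Ig_lty => //.
  have -> : (\int[leb]_x `|(oneDsqr x)^-1|%:E = \int[leb]_x (oneDsqr x)^-1%:E)%E.
    by apply: eq_integral => x _; rewrite ger0_norm.
  by rewrite i1 ltry.
have v1 : \int[leb]_x (oneDsqr x)^-1 = pi :> R by rewrite /Rintegral i1.
have ei : 0 < e^-1 by rewrite invr_gt0.
have E : poisson e = (fun u => 2 * e^-1 * (oneDsqr (e^-1 * u + 0))^-1).
  apply/funext => u; rewrite /poisson /oneDsqr addr0; field.
  by rewrite !gt_eqF ?poisson_den//; have := poisson_den u e0.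
have g2 := Ig_affine 0 ei g1.
rewrite E; split; first exact: IgZ.
have := @Int_affine R e^-1 0 _ ei g1; rewrite v1 invrK => E2.
by rewrite IntZ// E2 mulrA divfK ?gt_eqF.
Qed.


Lemma poisson_ge0 e u : 0 < e -> 0 <= poisson e u.
Proof. by move=> e0; rewrite divr_ge0 ?mulr_ge0 ?(ltW e0)// ltW// poisson_den. Qed.

Lemma measurable_poisson e : 0 < e -> measurable_fun setT (poisson e).
Proof. by move=> /Ig_poisson[/Ig_meas]. Qed.

Lemma Ig_damp_cas e (a b : R) : 0 < e -> Ig (fun x => damp e x * cas (a * x + b)).
Proof.
move=> e0; apply: (IgMb (M := 2) (Ig_damp e0)) => [|x]; last exact: cas_le2.
by apply: (measurableT_comp measurable_cas); apply: measurable_funD => //; exact: measurable_funM.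
Qed.

Lemma damp_cas_cas e x y : 0 < e ->
  \int[leb]_xi (damp e xi * cas (x * xi) * cas (y * xi)) = poisson e (x - y).
Proof.
move=> e0; rewrite -Int_damp_cos//.
have i (f : R -> R) (a : R) : measurable_fun setT f -> (forall x, `|f x| <= 1) -> Ig (fun xi => damp e xi * f (a * xi)).
  move=> mf hf; apply: (IgMb (M := 1) (Ig_damp e0)) => [|z]; last exact: hf.
  by apply: (measurableT_comp mf); exact: measurable_funM.
have ic := i cos (x - y) measurable_cos (fun x => ltac:(rewrite ler_norml cos_geN1 cos_le1; done)).
have is_ := i sin (x + y) measurable_sin (fun x => ltac:(rewrite ler_norml sin_geN1 sin_le1; done)).
have z0 : \int[leb]_xi (damp e xi * sin ((x + y) * xi)) = 0.
  by apply: Int_odd => // xi; rewrite /damp normrN mulrN sinN mulrN.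
rewrite -[RHS]addr0 -z0 -IntD//; apply: Int_ext => xi.
by rewrite -mulrA casM -mulrBl -mulrDl mulrDr.
Qed.

(** Abel means of the inversion formula are Poisson means of f. *)
Lemma damp_ht e f x : 0 < e -> Ig f ->
  \int[leb]_xi (damp e xi * cas (x * xi) * ht Line f xi) = \int[leb]_y (f y * poisson e (x - y)).
Proof.
move=> e0 fi; have ic : Ig (fun xi => damp e xi * cas (x * xi)).
  by have := Ig_damp_cas x 0 e0; under eq_fun do rewrite addr0.
have chi1 y : chi Line y = 1 :> R by rewrite /chi indicT.
have fi' : Ig (fun x => chi Line x * f x) by under eq_fun do rewrite chi1 mul1r.
have := @pairing R Line f _ fi' ic; rewrite /= => h.
have ip : Ig (fun y => chi Line y * f y * psi Line (fun xi => damp e xi * cas (x * xi)) y).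
  by apply: (IgMb fi' (measurable_psi Line ic)) => y; exact: psi_bound.
transitivity (2 * pi * \int[leb]_y (chi Line y * f y * psi Line (fun xi => damp e xi * cas (x * xi)) y)).
  by rewrite h mulVKf// gt_eqF// two_pi_gt0.
rewrite -IntZ//; apply: Int_ext => y; rewrite chi1 mul1r /psi /= damp_cas_cas//.
by rewrite mulrCA mulVKf// gt_eqF// two_pi_gt0.
Qed.

Lemma chi_Line f : (fun x => chi Line x * f x) = f.
Proof. by apply/funext => x; rewrite /chi indicT mul1r. Qed.

Lemma Int_poisson e x : 0 < e -> Ig (fun y => poisson e (x - y)) /\ \int[leb]_y poisson e (x - y) = 2 * pi.
Proof.
move=> e0; have [ip vp] := Ig_poisson e0.
have E : (fun y => poisson e (x - y)) = (fun y => poisson e (y + - x)).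
  by apply/funext => y; rewrite /poisson; congr (_ / (_ + _)); rewrite -sqrrN opprB.
rewrite E; split; first exact: Ig_shift.
by rewrite (@Int_shift R (- x) (poisson e) ip).
Qed.

(** The damped integral of |ht f|^2 is the double integral of f(x) f(y) poisson e (x - y). The
    kernel is nonnegative of mass 2 pi, so 2 f(x) f(y) <= f(x)^2 + f(y)^2 bounds it by 2 pi n2 f,
    uniformly in e. *)
Lemma bessel_line f : Ig f -> L2 f ->
  L2 (ht Line f) /\ n2 (ht Line f) <= 2 * pi * n2 f.
Proof.
move=> fi f2; have fi' : Ig (fun x => chi Line x * f x) by rewrite chi_Line.
have mh := measurable_ht fi'; have p0 := @two_pi_gt0 R.
pose ee (n : nat) : R := n.+1%:R^-1.
have ee0 n : 0 < ee n by rewrite invr_gt0 ltr0n.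
apply: (@L2_trunc _ _ (fun n => damp (ee n))) => //.
- by move=> n; exact: measurable_damp.
- by move=> n x; exact: damp_ge0.
- move=> x m n mn; rewrite /damp ler_expR lerN2 ler_wpM2r//.
  by rewrite lef_pV2 ?posrE ?ltr0n// ler_nat.
- move=> x; rewrite -expR0 /damp -[0 in X in _ --> X]oppr0 -(mul0r `|x|).
  apply: (@cvg_comp _ _ _ (fun n => - (ee n * `|x|)) expR _ (nbhs (- (0 * `|x|)))); last exact: continuous_expR.
  by apply: cvgN; apply: cvgM; [exact: cvg_harmonic|exact: cvg_cst].
move=> n; set e := ee n; have e0 : 0 < e := ee0 n.
have hb z : `|ht Line f z| <= 2 * \int[leb]_x `|chi Line x * f x| by exact: ht_bound.
pose c xi := damp e xi * ht Line f xi.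
have ic : Ig c by apply: (IgMb (Ig_damp e0) mh) => x; exact: hb.
have igF : Ig (fun x => ht Line f x ^+ 2 * damp e x).
  have := IgMb ic mh hb; under eq_fun do rewrite /c mulrAC -mulrA -expr2.
  by rewrite (_ : (fun x => damp e x * ht Line f x ^+ 2) = (fun x => ht Line f x ^+ 2 * damp e x))//; apply/funext => x; rewrite mulrC.
split=> //.
pose q x := \int[leb]_y (f y * poisson e (x - y)).
have psic x : 2 * pi * psi Line c x = q x.
  rewrite /psi mulVKf ?gt_eqF// /q -damp_ht//; apply: Int_ext => xi; rewrite /c; ring.
have E : \int[leb]_x (ht Line f x ^+ 2 * damp e x) = \int[leb]_x (f x * q x).
  have := @pairing R Line f c fi' ic; rewrite /= => h.
  have ip : Ig (fun x => f x * psi Line c x).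
    by apply: (IgMb fi (measurable_psi Line ic)) => x; exact: psi_bound.
  transitivity (2 * pi * \int[leb]_x (f x * psi Line c x)).
    have -> : \int[leb]_x (f x * psi Line c x) = \int[leb]_x (chi Line x * f x * psi Line c x).
      by apply: Int_ext => x; rewrite /chi indicT mul1r.
    rewrite h mulVKf ?gt_eqF//; apply: Int_ext => x; rewrite /c; ring.
  by rewrite -IntZ//; apply: Int_ext => x; rewrite mulrCA psic.
have mq : measurable_fun setT q.
  have -> : q = (fun x => 2 * pi * psi Line c x) by apply/funext => x; rewrite psic.
  by apply: measurable_funM => //; exact: measurable_psi.
have qb x : `|q x| <= 2 * pi * (pi^-1 * \int[leb]_x `|c x|).
  by rewrite -psic normrM gtr0_norm// ler_wpM2l ?(ltW p0)// psi_bound.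
have ifq : Ig (fun x => f x * q x) by exact: IgMb qb.
have mp := measurable_poisson e0.
have mF : measurable_fun setT (fun p : R * R => f p.1 ^+ 2 * poisson e (p.2 - p.1)).
  apply: measurable_funM; first exact: (measurableT_comp (Ig_meas f2.2) measurable_fst).
  by apply: (measurableT_comp mp); exact: measurable_funB.
have [j1 j2 J] : [/\ Ig (fun y => \int[leb]_x (f y ^+ 2 * poisson e (x - y))),
    Ig (fun x => \int[leb]_y (f y ^+ 2 * poisson e (x - y))) &
    \int[leb]_y (\int[leb]_x (f y ^+ 2 * poisson e (x - y))) = \int[leb]_x (\int[leb]_y (f y ^+ 2 * poisson e (x - y)))].
  apply: (@Fubini_real R (fun y x => f y ^+ 2 * poisson e (x - y))) => //.
  have [ip vp] := Ig_poisson e0.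
  have -> : (\int[leb]_y \int[leb]_x `|f y ^+ 2 * poisson e (x - y)|%:E = \int[leb]_y `|2 * pi * f y ^+ 2|%:E)%E.
    apply: eq_integral => y _; have ipy := Ig_shift (- y) ip.
    rewrite -(IntE (Ig_abs (IgZ (f y ^+ 2) ipy))); congr EFin.
    transitivity (\int[leb]_x (f y ^+ 2 * poisson e (x + - y))).
      by apply: Int_ext => x; rewrite ger0_norm// mulr_ge0 ?sqr_ge0// poisson_ge0.
    rewrite (IntZ _ ipy) (@Int_shift R (- y) (poisson e) ip) vp mulrC ger0_norm//.
    by rewrite mulr_ge0 ?sqr_ge0// (ltW p0).
  by apply: lty_Ig; apply: IgZ; exact: f2.2.
have pb u : `|poisson e u| <= 2 / e.
  clear -e0; rewrite ger0_norm ?poisson_ge0// /poisson ler_pdivrMr ?poisson_den//.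
  have -> : 2 / e * (e ^+ 2 + u ^+ 2) = 2 * e + 2 / e * u ^+ 2 by field; rewrite gt_eqF.
  by rewrite lerDl mulr_ge0 ?sqr_ge0// divr_ge0// ltW.
have fp x : Ig (fun y => f y ^+ 2 * poisson e (x - y)).
  have [ip _] := Int_poisson x e0.
  by apply: (IgMb (M := 2 / e) f2.2 (Ig_meas ip)) => y; exact: pb.
have pt x : f x * q x <= 2^-1 * (f x ^+ 2 * (2 * pi)) + 2^-1 * \int[leb]_y (f y ^+ 2 * poisson e (x - y)).
  have [ip vp] := Int_poisson x e0.
  have i1 : Ig (fun y => 2^-1 * f x ^+ 2 * poisson e (x - y)) by exact: IgZ.
  have i2 : Ig (fun y => 2^-1 * (f y ^+ 2 * poisson e (x - y))) by apply: IgZ; exact: fp.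
  have i3 : Ig (fun y => f y * poisson e (x - y)).
    by apply: (IgMb (M := 2 / e) fi (Ig_meas ip)) => y; exact: pb.
  have -> : 2^-1 * (f x ^+ 2 * (2 * pi)) = \int[leb]_y (2^-1 * f x ^+ 2 * poisson e (x - y)).
    by rewrite (IntZ _ ip) vp; clear; ring.
  rewrite -(IntZ 2^-1 (fp x)) -(IntD i1 i2) /q -(IntZ (f x) i3); apply: Int_le; [exact: IgZ i3|exact: IgD i1 i2|move=> y].
  have pp := poisson_ge0 (x - y) e0.
  have : 0 <= (f x - f y) ^+ 2 * poisson e (x - y) by rewrite mulr_ge0// sqr_ge0.
  move: (poisson e (x - y)) (f x) (f y) => p u v h; clear -h.
  rewrite -subr_ge0.
  have -> : 2^-1 * u ^+ 2 * p + 2^-1 * (v ^+ 2 * p) - u * (v * p) = 2^-1 * ((u - v) ^+ 2 * p) by field.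
  by rewrite mulr_ge0.
have if2 : Ig (fun x => f x ^+ 2 * (2 * pi)) by under eq_fun do rewrite mulrC; apply: IgZ; exact: f2.2.
rewrite E; apply: (@le_trans _ _ (\int[leb]_x (2^-1 * (f x ^+ 2 * (2 * pi)) + 2^-1 * \int[leb]_y (f y ^+ 2 * poisson e (x - y))))).
  exact: Int_le ifq (IgD (IgZ _ if2) (IgZ _ j2)) pt.
rewrite (IntD (IgZ _ if2) (IgZ _ j2)) (IntZ _ if2) (IntZ _ j2) -J.
have -> : \int[leb]_y \int[leb]_x (f y ^+ 2 * poisson e (x - y)) = 2 * pi * n2 f.
  rewrite -IntZ; last exact: f2.2; apply: Int_ext => y.
  have [ip vp] := Ig_poisson e0.
  rewrite IntZ; last exact: (Ig_shift (- y) ip).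
  by rewrite (@Int_shift R (- y) (poisson e) ip) vp mulrC.
have -> : \int[leb]_x (f x ^+ 2 * (2 * pi)) = 2 * pi * n2 f.
  by rewrite -IntZ; [apply: Int_ext => x; rewrite mulrC|exact: f2.2].
by move: (n2 f) => m; clear; lra.
Qed.

(** The damped integrals a n have two limits: the undamped integral, by dominated convergence as the
    transform of a test function is integrable, and 2 pi phi x, as the Poisson kernel of parameter 1
    / (n + 1) concentrates at x. *)
Lemma inversion_line phi x : test_space Line phi -> psi Line (fun y => ht Line phi (rho Line y)) x = phi x.
Proof.
move=> tp; have ip : Ig phi by have := test_Ig tp; rewrite chi_Line.
have [ih _] := Ig_wt_ht 0 tp; have {}ih : Ig (ht Line phi).
  by move: ih; under eq_fun do rewrite wt0 mul1r.
pose ee (n : nat) : R := n.+1%:R^-1.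
have ee0 n : 0 < ee n by rewrite invr_gt0 ltr0n.
have eec : ee n @[n --> \oo] --> (0 : R) by exact: cvg_harmonic.
have cphi := smooth_continuous (test_smooth tp).
have [Bd Bd0 hBd] : exists2 B : R, 0 <= B & forall y, `|phi y| <= B.
  have [B [M [B0 M0 h]]] := test_bound tp; exists B => // y.
  have := h y; rewrite /chi indicT mul1r => h'; apply: (le_trans h').
  by rewrite indE ler_piMr//; case: (_ \in _).
have [ip1 vp1] := @Ig_poisson 1 ltr01.
pose a n := \int[leb]_xi (damp (ee n) xi * cas (x * xi) * ht Line phi xi).
have c1 : a n @[n --> \oo] --> \int[leb]_xi (cas (x * xi) * ht Line phi xi).
  have mc : measurable_fun setT (fun xi => cas (x * xi)).
    by apply: (measurableT_comp measurable_cas); exact: measurable_funM.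
  have mh := Ig_meas ih.
  have m1 n : measurable_fun setT (fun xi => damp (ee n) xi * cas (x * xi) * ht Line phi xi).
    by do 2 apply: measurable_funM => //; exact: measurable_damp.
  have m2 : measurable_fun setT (fun xi => cas (x * xi) * ht Line phi xi) by exact: measurable_funM.
  have le n xi : `|damp (ee n) xi * cas (x * xi) * ht Line phi xi| <= 2 * `|ht Line phi xi|.
    rewrite normrM ler_wpM2r// normrM -[leRHS]mul1r ler_pM ?cas_le2//.
    by rewrite ger0_norm ?damp_ge0// damp_le1.
  have cv : {ae leb, forall xi, (fun n => damp (ee n) xi * cas (x * xi) * ht Line phi xi) @ \oo --> cas (x * xi) * ht Line phi xi}.
    apply: aeW => xi; rewrite -[X in _ --> X]mul1r.
    under eq_fun do rewrite -mulrA.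
    apply: cvgM; last exact: cvg_cst.
    rewrite -expR0 /damp -[0 in X in _ --> X]oppr0 -(mul0r `|xi|).
    apply: (@cvg_comp _ _ _ (fun n => - (ee n * `|xi|)) expR _ (nbhs (- (0 * `|xi|)))); last exact: continuous_expR.
    by apply: cvgN; apply: cvgM; [exact: cvg_harmonic|exact: cvg_cst].
  by have [] := @DCT R _ _ _ m1 m2 (IgZ 2 (Ig_abs ih)) le cv.
have aE n : a n = \int[leb]_v (phi (ee n * v + x) * poisson 1 v).
  rewrite /a damp_ht//.
  have := @Int_affine R (ee n) x (fun y => phi y * poisson (ee n) (x - y)) (ee0 n) _.
  have ipp : Ig (fun y => phi y * poisson (ee n) (x - y)).
    have [ipx _] := Int_poisson x (ee0 n).
    under eq_fun do rewrite mulrC.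
    exact: (IgMb (M := Bd) ipx (Ig_meas ip)).
  move=> /(_ ipp) h; rewrite -[LHS](mulKf (x := (ee n)^-1)) ?invr_eq0 ?gt_eqF// -h invrK -IntZ; last first.
    exact: (Ig_affine x (ee0 n) ipp).
  apply: Int_ext => v; rewrite mulrCA; congr (_ * _); rewrite /poisson.
  have -> : x - (ee n * v + x) = - (ee n * v) by ring.
  have e_n0 : ee n != 0 by rewrite gt_eqF.
  have vv : 1 + v ^+ 2 != 0 :> R by rewrite gt_eqF// ltr_pwDl// sqr_ge0.
  have -> : ee n ^+ 2 + (- (ee n * v)) ^+ 2 = ee n ^+ 2 * (1 + v ^+ 2) by ring.
  rewrite expr1n; field; by rewrite vv.
have c2 : a n @[n --> \oo] --> 2 * pi * phi x.
  have mphi : measurable_fun setT phi by exact: Ig_meas ip.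
  have m1 n : measurable_fun setT (fun v => phi (ee n * v + x) * poisson 1 v).
    apply: measurable_funM; last exact: Ig_meas ip1.
    by apply: (measurableT_comp mphi); apply: measurable_funD => //; exact: measurable_funM.
  have m2 : measurable_fun setT (fun v => phi x * poisson 1 v) by apply: measurable_funM => //; exact: Ig_meas ip1.
  have le n v : `|phi (ee n * v + x) * poisson 1 v| <= Bd * poisson 1 v.
    by rewrite normrM [`|poisson 1 v|]ger0_norm ?poisson_ge0// ler_wpM2r// poisson_ge0.
  have cv : {ae leb, forall v, (fun n => phi (ee n * v + x) * poisson 1 v) @ \oo --> phi x * poisson 1 v}.
    apply: aeW => v; apply: cvgM; last exact: cvg_cst.
    apply: (@cvg_comp _ _ _ (fun n => ee n * v + x) phi _ (nbhs x)); last exact: cphi.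
    have h : (fun n => ee n * v + x) @ \oo --> 0 * v + x.
      by apply: cvgD; [apply: cvgM => //; exact: cvg_cst|exact: cvg_cst].
    by rewrite mul0r add0r in h.
  have [_] := @DCT R _ _ _ m1 m2 (IgZ Bd ip1) le cv.
  under eq_fun do rewrite -aE.
  by rewrite IntZ// vp1 [phi x * _]mulrC.
have h : \int[leb]_xi (cas (x * xi) * ht Line phi xi) = 2 * pi * phi x by exact: (cvg_unique _ c1 c2).
rewrite /psi /= -[RHS](mulKf (x := 2 * pi)) ?gt_eqF ?two_pi_gt0// -h; congr (_ * _).
by apply: Int_ext => xi; rewrite mulrC.
Qed.

End Poisson.

(** * Inversion on the torus by Dirichlet sums *)

Section TorusInversion.
Context {R : realType}.
Local Notation leb := (@lebesgue_measure R).
Implicit Types (f g c phi : R -> R) (K : spatial_domain) (x y z t u : R).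

Lemma smooth_lip f (a b : R) : smooth f -> exists2 L : R, 0 <= L &
  forall x y, a <= x <= b -> a <= y <= b -> `|f x - f y| <= L * `|x - y|.
Proof.
move=> sf; have [L L0 hL] := continuous_bounded a b (smooth_continuous (smooth_derive1 sf)).
exists L => // x y.
wlog yx : x y / y < x => [h xab yab|].
  have [e|e|->] := ltgtP x y; last by rewrite !subrr !normr0 mulr0.
    by rewrite distrC [`|x - y|]distrC; exact: h.
  exact: h.
move=> /andP[ax xb] /andP[ay yb].
have [] := @MVT R f (derive1 f) y x yx.
- by move=> z _; apply: derive1_is; exact: smooth_derivable.
- exact: continuous_subspaceT (smooth_continuous sf).
move=> z; rewrite in_itv/= => /andP[yz zx] ->; rewrite normrM ler_wpM2r// hL//.
by rewrite (le_trans ay (ltW yz)) (le_trans (ltW zx) xb).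
Qed.

(** sin u = 2 sin (u/2) cos (u/2), sin (u/2) >= (u/2) cos (u/2) and cos (u/2) >= cos (U/2). *)
Lemma sin_lower (U u : R) : 0 <= u -> u <= U -> U < pi -> u * cos (U / 2) ^+ 2 <= sin u.
Proof.
move=> u0 uU Upi; have p0 := pi_gt0 R.
have -> : sin u = 2 * (sin (u / 2) * cos (u / 2)).
  by rewrite (_ : u = u / 2 + u / 2) ?sinD; [rewrite -splitr; ring|field].
have c1 : cos (U / 2) <= cos (u / 2).
  have := @ltr_cos R (u / 2) (U / 2); rewrite !in_itv/= => h.
  have hu : 0 <= u / 2 <= pi by apply/andP; split; lra.
  have hU : 0 <= U / 2 <= pi by apply/andP; split; lra.
  by rewrite leNgt -(leNgt (cos (U / 2))) le_eqVlt; have [->|ne] := eqVneq u U; rewrite ?eqxx// (h hu hU); apply/orP; right; rewrite ltr_pM2r ?invr_gt0// lt_neqAle ne.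
have c0 : 0 <= cos (U / 2) by apply: cos_ge0_pihalf; apply/andP; split; lra.
have s1 : u / 2 * cos (u / 2) <= sin (u / 2) by apply: mulr_cos_le_sin; lra.
move: c1 c0 s1; move: (cos (U / 2)) (cos (u / 2)) (sin (u / 2)) => a b s h1 h2 h3.
have : a ^+ 2 <= b ^+ 2 by rewrite lerXn2r ?nnegrE// (le_trans h2).
have : u / 2 * b * b <= s * b by rewrite ler_wpM2r// (le_trans h2).
nra.
Qed.

(** What summation by parts leaves of the cutoff in a Dirichlet sum; it is supported at distance at
    most 1 from n and from - n. *)
Definition edge n z : R := cut n z - cut n (z + 1).

Lemma edge_le n z : `|edge n z| <= \1_(`[n%:R - 1, n%:R + 1[) z + \1_(`[-1, 1[) (z + n%:R).
Proof.
rewrite /edge !cutE !indE !in_itv/= (ler_norml z) (ler_norml (z + 1)).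
have n0 : 0 <= n%:R :> R by exact: ler0n.
case: (leP (- n%:R) z) => h1; case: (leP z n%:R) => h2; case: (leP (- n%:R) (z + 1)) => h3;
  case: (leP (z + 1) n%:R) => h4; rewrite /= ?subrr ?normr0 ?addr_ge0 ?ler0n ?subr0 ?sub0r ?normrN ?normr1//; try lra.
- have -> : (n%:R - 1 <= z) by lra.
  have -> : (z < n%:R + 1) by lra.
  by rewrite /= lerDl ler0n.
- have -> : (-1 <= z + n%:R) by lra.
  have -> : (z + n%:R < 1) by lra.
  by rewrite /= lerDr ler0n.
Qed.

Lemma Ig_edge_bound K n : Ig (fun x => \1_(`[n%:R - 1, n%:R + 1[) (rho K x) + \1_(`[-1, 1[) (rho K x + n%:R) : R) /\
  \int[leb]_x (\1_(`[n%:R - 1, n%:R + 1[) (rho K x) + \1_(`[-1, 1[) (rho K x + n%:R)) =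
  2 * \int[leb]_x (\1_(`[-1, 1[) (rho K x)) :> R.
Proof.
have i0 : Ig (fun x => \1_(`[-1, 1[) (rho K x) : R) by exact: Ig_ind_rho.
have i1 : Ig (fun x => \1_(`[n%:R - 1, n%:R + 1[) (rho K x) : R) by exact: Ig_ind_rho.
have i2 : Ig (fun x => \1_(`[-1, 1[) (rho K x + n%:R) : R).
  by have := Ig_shift n%:R i0; under eq_fun do rewrite rho_addn.
split; first exact: IgD.
rewrite IntD//; have -> : \int[leb]_x \1_(`[-1, 1[) (rho K x + n%:R) = \int[leb]_x \1_(`[-1, 1[) (rho K x) :> R.
  rewrite -(Int_shift n%:R i0); apply: Int_ext => x; by rewrite rho_addn.
have -> : \int[leb]_x \1_(`[n%:R - 1, n%:R + 1[) (rho K x) = \int[leb]_x \1_(`[-1, 1[) (rho K x) :> R.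
  rewrite -(Int_shift n%:R i1); apply: Int_ext => x; rewrite rho_addn !indE !in_itv/=.
  by rewrite [n%:R - 1]addrC lerD2r [n%:R + 1]addrC ltrD2r.
by rewrite mulr2n mulrDl mul1r.
Qed.


Lemma measurable_edge n : measurable_fun setT (edge n).
Proof.
apply: measurable_funB; first exact: measurable_cut.
by apply: (measurableT_comp (measurable_cut n)); exact: measurable_funD.
Qed.

Lemma edge_le1 n z : `|edge n z| <= 1.
Proof. by rewrite /edge !cutE; case: (`|z| <= _)%R; case: (`|z + 1| <= _)%R; rewrite ?subrr ?subr0 ?sub0r ?normrN ?normr0 ?normr1. Qed.

Lemma Ig_edge K n : Ig (fun x => edge n (rho K x)).
Proof.
have [i _] := Ig_edge_bound K n; apply: Ig_le i _.
  exact: (measurableT_comp (measurable_edge n) (@measurable_rho R K)).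
by move=> x; apply: le_trans (edge_le _ _) (ler_norm _).
Qed.

(** The edges have bounded L^2 norm and move to infinity, while the part of H under them has norm
    tending to 0; Cauchy-Schwarz concludes. This plays the role of the Riemann-Lebesgue lemma for
    Dirichlet sums. *)
Lemma edge_tail K (H : R -> R) : measurable_fun setT H -> L2 (fun x => H (rho K x)) ->
  \int[leb]_x (edge n (rho K x) * H (rho K x)) @[n --> \oo] --> (0 : R).
Proof.
move=> mH H2; have mr := @measurable_rho R K.
have mE n : measurable_fun setT (fun x : R => edge n (rho K x)).
  exact: measurableT_comp (measurable_edge n) mr.
have le n : L2 (fun x : R => edge n (rho K x)).
  by split=> //; apply: (IgMb (M := 1) (Ig_edge K n) (mE n)) => x; exact: edge_le1.
pose C : R := 2 * \int[leb]_x \1_(`[-1, 1[) (rho K x).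
have nE n : n2 (fun x : R => edge n (rho K x)) <= C.
  have [i E] := Ig_edge_bound K n; rewrite /C -E; apply: Int_le => //; first exact: (le n).2.
  move=> x; apply: le_trans (edge_le n (rho K x)); rewrite -(real_normK (num_real (edge _ _))).
  by rewrite expr2 ler_piMr// edge_le1.
pose g n x := `|edge n (rho K x)| * H (rho K x).
have lg n : L2 (g n).
  have m1 : measurable_fun setT (fun x : R => `|edge n (rho K x)|) by exact: measurableT_comp.
  have := L2Mb (M := 1) H2 m1 (fun x => _); rewrite /g; under eq_fun do rewrite mulrC.
  by apply => x; rewrite normr_id edge_le1.
have cg : n2 (g n) @[n --> \oo] --> (0 : R).
  have bd n x : `|g n x ^+ 2| <= H (rho K x) ^+ 2.
    rewrite ger0_norm ?sqr_ge0// /g exprMn ler_piMl ?sqr_ge0//.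
    by rewrite expr_le1// edge_le1.
  have cv : {ae leb, forall x, (fun n => g n x ^+ 2) @ \oo --> (0 : R)}.
    apply: aeW => x.
    have h : g n x @[n --> \oo] --> `|1 - 1| * H (rho K x).
      apply: cvgM; last exact: cvg_cst.
      by apply: cvg_norm; apply: cvgB; exact: cvg_cut.
    rewrite subrr normr0 mul0r in h.
    have -> : (fun n => g n x ^+ 2) = (fun n => g n x * g n x) by apply/funext => n; rewrite expr2.
    by rewrite -[X in _ --> X](mul0r (0 : R)); exact: cvgM.
  have mg n : measurable_fun setT (fun x => g n x ^+ 2) by exact: Ig_meas (lg n).2.
  have [_] := @DCT R (fun n x => g n x ^+ 2) (fun=> 0) _ mg (measurable_cst _) H2.2 bd cv.
  by rewrite Int0.
have C0 : 0 <= C by apply: le_trans (nE 0%N); exact: n2_ge0.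
have cC : C * n2 (g n) @[n --> \oo] --> (0 : R).
  by rewrite -[X in _ --> X](mulr0 C); apply: cvgM => //; exact: cvg_cst.
apply/cvgrPdist_le => e e0; have ee0 : 0 < e ^+ 2 by exact: exprn_gt0.
near=> n; rewrite sub0r normrN.
have -> : \int[leb]_x (edge n (rho K x) * H (rho K x)) = \int[leb]_x (edge n (rho K x) * g n x).
  apply: Int_ext => x; rewrite /g mulrA; congr (_ * _); rewrite /edge !cutE.
  by case: (`|_| <= _)%R; case: (`|_ + 1| <= _)%R; rewrite ?subrr ?subr0 ?sub0r ?normrN ?normr0 ?normr1 ?mulr1 ?mul0r.
rewrite -(ler_pXn2r (n := 2)) ?nnegrE ?(ltW e0)// real_normK ?num_real//.
apply: le_trans (CS (le n) (lg n)) _; apply: (@le_trans _ _ (C * n2 (g n))); first by rewrite ler_wpM2r ?n2_ge0.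
near: n; exact: (cvgr_le _ cC).
Unshelve. all: by end_near. Qed.

(** The inverse written as y |y|^(-2), whose measurability follows from that of powers. *)
Definition cinv y : R := y * (y ^+ 2) `^ (-1).

Lemma cinvE y : cinv y = y^-1.
Proof.
rewrite /cinv; have [->|y0] := eqVneq y 0; first by rewrite mul0r invr0.
by rewrite powR_inv1 ?sqr_ge0// expr2 invfM mulrA mulfV// mul1r.
Qed.

Lemma measurable_inv : measurable_fun setT (fun y : R => y^-1).
Proof.
rewrite -(_ : cinv = (fun y : R => y^-1)); last by apply/funext => y; exact: cinvE.
apply: measurable_funM => //; apply: (measurableT_comp (@measurable_powR R (-1))).
exact: measurable_funX.
Qed.

(** * Convergence to 0 of the Dirichlet sums at a zero of the function *)

Section AtPoint.
Variables (f : R -> R) (x0 : R).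
Hypotheses (tf : test_space Torus f) (f0 : f x0 = 0) (x00 : 0 < x0) (x01 : x0 < 2 * pi).

(** The quotient by the denominator of the Dirichlet kernel. It is bounded on the period because f
    vanishes at x0, and Bessel's inequality for it makes the Dirichlet sums of f at x0 tend to 0. *)
Let G y : R := f y / sin ((y - x0) / 2).

Let mG : measurable_fun setT G.
Proof.
apply: measurable_funM; first exact: smooth_measurable (test_smooth tf).
apply: (measurableT_comp measurable_inv); apply: (measurableT_comp measurable_sin).
by apply: measurable_funM => //; exact: measurable_funB.
Qed.

(** As x0 is interior to the period, |y - x0| / 2 stays below some U < pi; for x0 = 0 the sine would
    vanish again at the other end 2 pi. *)
Let sinG : exists2 C : R, 0 < C & forall y, y \in dom Torus -> C * `|y - x0| <= `|sin ((y - x0) / 2)|.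
Proof.
pose U := Num.max x0 (2 * pi - x0) / 2.
have Upi : U < pi by rewrite /U ltr_pdivrMr// [pi * 2]mulrC gt_max x01 gtrBl x00.
have U0 : 0 < U by rewrite divr_gt0// lt_max x00.
have c0 : 0 < cos (U / 2) by apply: cos_gt0_pihalf; apply/andP; split; lra.
exists (cos (U / 2) ^+ 2 / 2); first by rewrite divr_gt0// exprn_gt0.
move=> y /dom_bound/andP[y0 yp].
have aU : `|y - x0| / 2 <= U.
  rewrite /U ler_wpM2r ?invr_ge0// ler_norml le_max; apply/andP; split.
    by have : x0 <= Num.max x0 (2 * pi - x0) by [rewrite le_max lexx]; move: (Num.max _ _) => w; lra.
  by rewrite lerD2r (ltW yp) orbT.
have -> : `|sin ((y - x0) / 2)| = `|sin (`|y - x0| / 2)|.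
  by case: (ger0P (y - x0)) => // _; rewrite mulNr sinN normrN.
apply: le_trans (ler_norm _); have := sin_lower (U := U) _ aU Upi.
have -> : cos (U / 2) ^+ 2 / 2 * `|y - x0| = `|y - x0| / 2 * cos (U / 2) ^+ 2 by field.
by apply; rewrite divr_ge0.
Qed.

Let fG y : y \in dom Torus -> f y = sin ((y - x0) / 2) * G y.
Proof.
move=> yd; rewrite /G mulrCA; have [->|yx] := eqVneq y x0; first by rewrite f0 mul0r.
rewrite mulfV ?mulr1//; have [C C0 hC] := sinG; have := hC y yd.
apply: contraTneq => ->; rewrite normr0 -ltNge mulr_gt0// normr_gt0 subr_eq0//.
Qed.

Let bG : exists M : R, forall y, `|chi Torus y * G y| <= M * chi Torus y.
Proof.
have [C C0 hC] := sinG; have [L L0 hL] := smooth_lip 0 (2 * pi) (test_smooth tf).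
exists (L / C) => y; have [yd|yd] := boolP (y \in dom Torus); last by rewrite chi_out// mul0r mulr0 normr0.
rewrite chi_in// mul1r mulr1 /G.
have [->|yx] := eqVneq y x0; first by rewrite f0 mul0r normr0 divr_ge0// ltW.
have yx0 : 0 < `|y - x0| by rewrite normr_gt0 subr_eq0.
have s0 : 0 < `|sin ((y - x0) / 2)| by apply: lt_le_trans (hC y yd); exact: mulr_gt0.
rewrite normrM normfV ler_pdivrMr//.
have /andP[y0 yp] := dom_bound yd.
have := hL y x0; rewrite f0 subr0 y0 (ltW yp) (ltW x00) (ltW x01) => /(_ isT isT) h.
apply: (le_trans h); apply: (@le_trans _ _ (L / C * (C * `|y - x0|))).
  by rewrite mulrA divfK ?gt_eqF.
by rewrite ler_wpM2l ?hC// divr_ge0// ltW.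
Qed.

Let GL2 (w : R -> R) : measurable_fun setT w -> (forall y, `|w y| <= 1) ->
  Ig (fun y => chi Torus y * (G y * w y)) /\ L2 (fun y => chi Torus y * (G y * w y)).
Proof.
move=> mw hw; have [M hM] := bG.
have l1 : L2 (chi Torus : R -> R) by have := test_L2 (@test_one R); under eq_fun do rewrite mulr1.
have i1 : Ig (chi Torus : R -> R) by have := test_Ig (@test_one R); under eq_fun do rewrite mulr1.
have mm : measurable_fun setT (fun y => chi Torus y * (G y * w y)).
  by apply: measurable_funM; [exact: measurable_chi|exact: measurable_funM].
have le y : `|chi Torus y * (G y * w y)| <= `|M * chi Torus y|.
  rewrite mulrA normrM; apply: le_trans (le_trans (hM y) (ler_norm _)).
  by rewrite ler_piMr.
by split; [exact: Ig_le (IgZ M i1) le|exact: L2_le (L2Z M l1) le].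
Qed.

Let H z : R := \int[leb]_y (chi Torus y * G y * sin ((y - x0) * (z + 2^-1))).

Let wc y : R := cos ((y - x0) / 2).
Let ws y : R := sin ((y - x0) / 2).

Let mwc : measurable_fun setT wc.
Proof. by apply: (measurableT_comp measurable_cos); apply: measurable_funM => //; exact: measurable_funB. Qed.

Let mws : measurable_fun setT ws.
Proof. by apply: (measurableT_comp measurable_sin); apply: measurable_funM => //; exact: measurable_funB. Qed.

Let Gc := GL2 mwc (fun y => ltac:(rewrite ler_norml cos_geN1 cos_le1; done)).
Let Gs := GL2 mws (fun y => ltac:(rewrite ler_norml sin_geN1 sin_le1; done)).

Let HE z : H z =
  2^-1 * ((cos (x0 * z) - sin (x0 * z)) * ht Torus (fun y => G y * wc y) z
   - (cos (x0 * z) + sin (x0 * z)) * ht Torus (fun y => G y * wc y) (- z)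
   + (cos (x0 * z) + sin (x0 * z)) * ht Torus (fun y => G y * ws y) z
   + (cos (x0 * z) - sin (x0 * z)) * ht Torus (fun y => G y * ws y) (- z)).
Proof.
have [ic _] := Gc; have [is_ _] := Gs.
rewrite /ht -!IntZ; try exact: Ig_ht.
have j1 k w g : Ig (fun y => chi Torus y * g y) -> Ig (fun y => k * (chi Torus y * g y * cas (y * w))).
  by move=> ig; apply: IgZ; exact: Ig_ht.
have i1 := IgB (j1 (cos (x0 * z) - sin (x0 * z)) z _ ic) (j1 (cos (x0 * z) + sin (x0 * z)) (- z) _ ic).
have i2 := IgD i1 (j1 (cos (x0 * z) + sin (x0 * z)) z _ is_).
have i3 := IgD i2 (j1 (cos (x0 * z) - sin (x0 * z)) (- z) _ is_).
rewrite -IntB -?IntD; try by [exact: j1|].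
rewrite -IntZ//; apply: Int_ext => y; rewrite /wc /ws /cas.
have -> : (y - x0) * (z + 2^-1) = (y * z - x0 * z) + (y - x0) / 2 by ring.
rewrite !mulrN !cosN !sinN sinD cosB sinB.
by move: (cos _) (sin _) (cos (y * z)) (sin (y * z)) (cos (x0 * z)) (sin (x0 * z)) => *; field.
Qed.

Let LH : measurable_fun setT H /\ L2 (fun x => H (rho Torus x)).
Proof.
have [ic lc] := Gc; have [is_ ls] := Gs.
have mr := @measurable_rho R Torus.
have mHz (w : R -> R) (b : R) : measurable_fun setT w -> (forall z, `|w z| <= 2) ->
   forall F, measurable_fun setT F -> L2 (fun x => F (rho Torus x)) ->
   L2 (fun x => w (rho Torus x) * F (rho Torus x)).
  move=> mw hw F mF LF; have := L2Mb LF (measurableT_comp mw mr) (fun x => hw _).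
  by under eq_fun do rewrite mulrC.
have mcx : measurable_fun setT (fun z => cos (x0 * z)) by apply: (measurableT_comp measurable_cos); exact: measurable_funM.
have msx : measurable_fun setT (fun z => sin (x0 * z)) by apply: (measurableT_comp measurable_sin); exact: measurable_funM.
have b1 (z : R) : `|cos (x0 * z) - sin (x0 * z)| <= 2.
  apply: (le_trans (ler_normB _ _)).
  have h1 : `|cos (x0 * z)| <= 1 by rewrite ler_norml cos_geN1 cos_le1.
  have h2 : `|sin (x0 * z)| <= 1 by rewrite ler_norml sin_geN1 sin_le1.
  by move: h1 h2; set a := `|cos _|; set b := `|sin _|; lra.
have b2 (z : R) : `|cos (x0 * z) + sin (x0 * z)| <= 2 by exact: cas_le2.
have [l1 _] := bessel_torus ic lc; have [l2 _] := bessel_torus is_ ls.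
have m1 := measurable_ht ic; have m2 := measurable_ht is_.
have mN (F : R -> R) : measurable_fun setT F -> measurable_fun setT (fun z => F (- z)).
  by move=> mF; apply: (measurableT_comp mF); exact: oppr_measurable.
have [l1N _] := L2_rho_opp m1 l1; have [l2N _] := L2_rho_opp m2 l2.
have mb1 := measurable_funB mcx msx; have mb2 := measurable_funD mcx msx.
have E : H = (fun z => 2^-1 * ((cos (x0 * z) - sin (x0 * z)) * ht Torus (fun y => G y * wc y) z
   - (cos (x0 * z) + sin (x0 * z)) * ht Torus (fun y => G y * wc y) (- z)
   + (cos (x0 * z) + sin (x0 * z)) * ht Torus (fun y => G y * ws y) z
   + (cos (x0 * z) - sin (x0 * z)) * ht Torus (fun y => G y * ws y) (- z))).
  by apply/funext => z; exact: HE.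
split.
  rewrite E; apply: measurable_funM => //; apply: measurable_funD; last first.
    by apply: measurable_funM => //; exact: mN.
  apply: measurable_funD; last exact: measurable_funM.
  apply: measurable_funB; first exact: measurable_funM.
  by apply: measurable_funM => //; exact: mN.
have E' : (fun x => H (rho Torus x)) = (fun x => (fun z => 2^-1 * ((cos (x0 * z) - sin (x0 * z)) * ht Torus (fun y => G y * wc y) z
   - (cos (x0 * z) + sin (x0 * z)) * ht Torus (fun y => G y * wc y) (- z)
   + (cos (x0 * z) + sin (x0 * z)) * ht Torus (fun y => G y * ws y) z
   + (cos (x0 * z) - sin (x0 * z)) * ht Torus (fun y => G y * ws y) (- z))) (rho Torus x)).
  by apply/funext => x; rewrite E.
rewrite E'; apply: L2Z; apply: L2D; [apply: L2D; [apply: L2B|]|].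
- exact: (mHz _ 0 mb1 b1 _ m1 l1).
- exact: (mHz _ 0 mb2 b2 _ (mN _ m1) l1N).
- exact: (mHz _ 0 mb2 b2 _ m2 l2).
- exact: (mHz _ 0 mb1 b1 _ (mN _ m2) l2N).
Qed.

(** 2 sin (w/2) cos (k w) = sin ((k + 1/2) w) - sin ((k - 1/2) w) with w = y - x0; a unit shift of
    the second sum leaves only the edges of the cutoff. *)
Let dirichlet n y : y \in dom Torus ->
  f y * \int[leb]_xi (cut n (rho Torus xi) * cas (x0 * rho Torus xi) * cas (y * rho Torus xi)) =
  2^-1 * \int[leb]_xi (G y * (edge n (rho Torus xi) * sin ((y - x0) * (rho Torus xi + 2^-1)))).
Proof.
move=> yd; have mr := @measurable_rho R Torus.
have ib (h : R -> R) : measurable_fun setT h -> (forall z, `|h z| <= 1) -> forall m : R -> R, Ig (fun xi => m (rho Torus xi)) ->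
   Ig (fun xi => m (rho Torus xi) * h (rho Torus xi)).
  move=> mh hh m im; apply: (IgMb im) => [|x]; last exact: hh.
  exact: measurableT_comp mh mr.
have mlin (a b : R) : measurable_fun setT (fun z : R => a * (z + b)).
  by apply: measurable_funM => //; exact: measurable_funD.
have msl (a b : R) : measurable_fun setT (fun z : R => sin (a * (z + b))) by exact: measurableT_comp measurable_sin (mlin a b).
have mcl (a b : R) : measurable_fun setT (fun z : R => cos (a * (z + b))) by exact: measurableT_comp measurable_cos (mlin a b).
have s1 (z : R) : `|sin z| <= 1 by rewrite ler_norml sin_geN1 sin_le1.
have c1 (z : R) : `|cos z| <= 1 by rewrite ler_norml cos_geN1 cos_le1.
have ic := Ig_cut Torus n (R := R).
have E1 : \int[leb]_xi (cut n (rho Torus xi) * cas (x0 * rho Torus xi) * cas (y * rho Torus xi)) =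
   \int[leb]_xi (cut n (rho Torus xi) * cos ((y - x0) * (rho Torus xi + 0))).
  have z0 : \int[leb]_xi (cut n (rho Torus xi) * sin ((y + x0) * (rho Torus xi + 0))) = 0.
    apply: (@Int_rho_odd R Torus (fun z => cut n z * sin ((y + x0) * (z + 0)))).
    - by apply: measurable_funM; [exact: measurable_cut|exact: msl].
    - exact: (ib _ (msl (y + x0) 0) (fun z => s1 _)).
    - by move=> z; rewrite !addr0 !cutE normrN mulrN sinN mulrN.
  rewrite -[RHS]addr0 -[X in _ = _ + X]z0 -IntD; last 2 first.
  - exact: (ib _ (mcl (y - x0) 0) (fun z => c1 _)).
  - exact: (ib _ (msl (y + x0) 0) (fun z => s1 _)).
  apply: Int_ext => xi; rewrite -mulrA [cas _ * _]mulrC casM !addr0 -mulrBl -mulrDl; ring.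
pose b (w : R) := sin ((y - x0) * w).
have ip := ib _ (msl (y - x0) 2^-1) (fun z => s1 _) _ ic.
have im := ib _ (msl (y - x0) (- 2^-1)) (fun z => s1 _) _ ic.
have E2 : sin ((y - x0) / 2) * \int[leb]_xi (cut n (rho Torus xi) * cos ((y - x0) * (rho Torus xi + 0))) =
  2^-1 * (\int[leb]_xi (cut n (rho Torus xi) * sin ((y - x0) * (rho Torus xi + 2^-1))) -
     \int[leb]_xi (cut n (rho Torus xi) * sin ((y - x0) * (rho Torus xi + - 2^-1)))).
  rewrite -IntZ; last exact: (ib _ (mcl (y - x0) 0) (fun z => c1 _)).
  rewrite -IntB// -IntZ; last exact: IgB.
  apply: Int_ext => xi; rewrite addr0.
  have -> : (y - x0) * (rho Torus xi + 2^-1) = (y - x0) * rho Torus xi + (y - x0) / 2 by ring.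
  have -> : (y - x0) * (rho Torus xi + - 2^-1) = (y - x0) * rho Torus xi - (y - x0) / 2 by ring.
  by rewrite sinD sinB; field.
have E3 : \int[leb]_xi (cut n (rho Torus xi) * sin ((y - x0) * (rho Torus xi + - 2^-1))) =
   \int[leb]_xi (cut n (rho Torus xi + 1) * sin ((y - x0) * (rho Torus xi + 2^-1))).
  rewrite -(Int_shift 1 im); apply: Int_ext => xi.
  by rewrite -[1]/(1%:R) rho_addn; congr (_ * sin (_ * _)); field.
have im' : Ig (fun xi => cut n (rho Torus xi + 1) * sin ((y - x0) * (rho Torus xi + 2^-1))).
  have := Ig_shift 1 im; congr Ig; apply/funext => xi.
  by rewrite -[1]/(1%:R) rho_addn; congr (_ * sin (_ * _)); field.
have ie : Ig (fun xi => edge n (rho Torus xi) * sin ((y - x0) * (rho Torus xi + 2^-1))).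
  have := IgB ip im'; congr Ig; apply/funext => xi; rewrite /edge; ring.
have E4 : \int[leb]_xi (edge n (rho Torus xi) * sin ((y - x0) * (rho Torus xi + 2^-1))) =
  \int[leb]_xi (cut n (rho Torus xi) * sin ((y - x0) * (rho Torus xi + 2^-1))) -
  \int[leb]_xi (cut n (rho Torus xi + 1) * sin ((y - x0) * (rho Torus xi + 2^-1))).
  by rewrite -IntB//; apply: Int_ext => xi; rewrite /edge; ring.
rewrite E1 fG// mulrAC E2 E3 -E4 IntZ//.
by rewrite -mulrA [_ * G y]mulrC.
Qed.

(** The partial sums tend to the full series by dominated convergence and to 0 by [edge_tail]. *)
Lemma psi_ht_vanish : psi Torus (fun xi => ht Torus f (rho Torus xi)) x0 = 0.
Proof.
have mr := @measurable_rho R Torus; have ft := test_Ig tf; have mh := measurable_ht ft.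
have [ih _] := Ig_wt_ht 0 tf.
have {}ih : Ig (fun xi => ht Torus f (rho Torus xi)) by move: ih; under eq_fun do rewrite wt0 mul1r.
have ihc := Ig_psi Torus x0 ih.
have mcx : measurable_fun setT (fun xi : R => cas (x0 * rho Torus xi)).
  by apply: (measurableT_comp measurable_cas); exact: measurable_funM.
have mcut n : measurable_fun setT (fun xi : R => cut n (rho Torus xi)) by exact: measurableT_comp (measurable_cut n) mr.
pose a n := \int[leb]_xi (cut n (rho Torus xi) * (ht Torus f (rho Torus xi) * cas (x0 * rho Torus xi))).
have c1 : a n @[n --> \oo] --> \int[leb]_xi (ht Torus f (rho Torus xi) * cas (x0 * rho Torus xi)).
  have le n xi : `|cut n (rho Torus xi) * (ht Torus f (rho Torus xi) * cas (x0 * rho Torus xi))| <= `|ht Torus f (rho Torus xi) * cas (x0 * rho Torus xi)|.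
    by rewrite normrM ler_piMl// cutE; case: (`|_| <= n%:R)%R; rewrite ?normr1 ?normr0.
  have cv : {ae leb, forall xi, (fun n => cut n (rho Torus xi) * (ht Torus f (rho Torus xi) * cas (x0 * rho Torus xi))) @ \oo --> ht Torus f (rho Torus xi) * cas (x0 * rho Torus xi)}.
    by apply: aeW => xi; rewrite -[X in _ --> X]mul1r; apply: cvgM; [exact: cvg_cut|exact: cvg_cst].
  by have [] := @DCT R _ _ _ (fun n => measurable_funM (mcut n) (Ig_meas ihc)) (Ig_meas ihc) (Ig_abs ihc) le cv.
have [mH lH] := LH.
have [M hM] := bG.
have ic1 : Ig (chi Torus : R -> R) by have := test_Ig (@test_one R); under eq_fun do rewrite mulr1.
have aE n : a n = 2^-1 * \int[leb]_xi (edge n (rho Torus xi) * H (rho Torus xi)).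
  have icc : Ig (fun xi => cut n (rho Torus xi) * cas (x0 * rho Torus xi)) by exact: Ig_psi (Ig_cut _ _).
  transitivity (2 * pi * \int[leb]_y (chi Torus y * f y * psi Torus (fun xi => cut n (rho Torus xi) * cas (x0 * rho Torus xi)) y)).
    rewrite pairing// mulVKf ?gt_eqF ?two_pi_gt0//; apply: Int_ext => xi; ring.
  rewrite -IntZ; last by apply: (IgMb ft (measurable_psi Torus icc)) => y; exact: psi_bound.
  pose F y xi := chi Torus y * G y * (edge n (rho Torus xi) * sin ((y - x0) * (rho Torus xi + 2^-1))).
  have mF : measurable_fun setT (fun p : R * R => F p.1 p.2).
    apply: measurable_funM; first apply: measurable_funM.
    - exact: (measurableT_comp (@measurable_chi R Torus) measurable_fst).
    - exact: (measurableT_comp mG measurable_fst).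
    have mr2 := measurableT_comp mr (@measurable_snd _ _ R R).
    apply: measurable_funM; first exact: (measurableT_comp (measurable_edge n) mr2).
    apply: (measurableT_comp measurable_sin); apply: measurable_funM; first exact: measurable_funB.
    exact: measurable_funD.
  have bF y xi : `|F y xi| <= (M * chi Torus y) * `|edge n (rho Torus xi)|.
    rewrite /F normrM; apply: ler_pM => //.
    by rewrite normrM ler_piMr// ler_norml sin_geN1 sin_le1.
  have [iFF _ fub] := @Fubini_prod R F _ _ mF (IgZ M ic1) (Ig_abs (Ig_edge Torus n)) bF.
  have iF y : Ig (F y).
    apply: IgZ; apply: (IgMb (M := 1) (Ig_edge Torus n)) => [|xi]; last by rewrite ler_norml sin_geN1 sin_le1.
    apply: (measurableT_comp measurable_sin); apply: measurable_funM; first exact: measurable_cst.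
    exact: measurable_funD mr (measurable_cst _).
  transitivity (2^-1 * \int[leb]_y \int[leb]_xi F y xi).
    rewrite -(IntZ _ iFF).
    apply: Int_ext => y; rewrite /psi mulrCA (mulVKf (lt0r_neq0 two_pi_gt0)).
    have [yd|yd] := boolP (y \in dom Torus); last first.
      rewrite /F (chi_out yd) !mul0r; under Int_ext do rewrite !mul0r.
      by rewrite Int0 mulr0.
    rewrite /F (chi_in yd) mul1r (dirichlet n yd); congr (_ * _); apply: Int_ext => xi.
    by rewrite mul1r.
  rewrite fub; congr (_ * _); apply: Int_ext => xi.
  rewrite /H -IntZ; last first.
    apply: (IgMb (M := 1) (f := fun y => chi Torus y * G y)).
    - apply: Ig_le (IgZ M ic1) _; first exact: measurable_funM (@measurable_chi R Torus) mG.
      by move=> y; apply: le_trans (hM y) (ler_norm _).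
    - apply: (measurableT_comp measurable_sin); apply: measurable_funM; last exact: measurable_cst.
      by apply: measurable_funB.
    - by move=> y; rewrite ler_norml sin_geN1 sin_le1.
  by apply: Int_ext => y; rewrite /F; ring.
have c2 : a n @[n --> \oo] --> (0 : R).
  rewrite (_ : a = fun n => 2^-1 * \int[leb]_xi (edge n (rho Torus xi) * H (rho Torus xi))); last by apply/funext => n; exact: aE.
  by rewrite -[X in _ --> X](mulr0 2^-1); apply: cvgM; [exact: cvg_cst|exact: edge_tail].
have h : \int[leb]_xi (ht Torus f (rho Torus xi) * cas (x0 * rho Torus xi)) = 0 by exact: (cvg_unique _ c1 c2).
by rewrite /psi h mulr0.
Qed.

End AtPoint.

(** Subtracting the constant phi x creates a zero at x; for the constant function 1 the inversion is
    explicit. *)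
Lemma inversion_torus phi x : test_space Torus phi -> 0 < x -> x < 2 * pi ->
  psi Torus (fun xi => ht Torus phi (rho Torus xi)) x = phi x.
Proof.
move=> tp x0 xp; have t1 := @test_one R.
have tf : test_space Torus (fun y => phi y + (- phi x) * 1) by apply: testD => //; exact: testZ.
have e0 : phi x + (- phi x) * 1 = 0 by rewrite mulr1 subrr.
have h := psi_ht_vanish tf e0 x0 xp.
have ih (g : R -> R) : test_space Torus g -> Ig (fun xi => ht Torus g (rho Torus xi)).
  by move=> tg; have [ih _] := Ig_wt_ht 0 tg; move: ih; under eq_fun do rewrite wt0 mul1r.
have E : psi Torus (fun xi => ht Torus (fun y => phi y + (- phi x) * 1) (rho Torus xi)) x =
   psi Torus (fun xi => ht Torus phi (rho Torus xi)) x - phi x * psi Torus (fun xi => ht Torus (fun=> 1) (rho Torus xi)) x.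
  have i1 := Ig_psi Torus x (ih _ tp); have i2 := Ig_psi Torus x (ih _ t1).
  rewrite /psi mulrCA -mulrBr; congr (_ * _).
  rewrite -[X in _ = _ - X](IntZ _ i2) -(IntB i1 (IgZ _ i2)).
  apply: Int_ext => xi; rewrite htD ?htZ; [ring|exact: test_Ig t1|exact: test_Ig|apply: test_Ig; exact: testZ].
move/eqP: h; rewrite E subr_eq0 => /eqP ->.
suff -> : psi Torus (fun xi => ht Torus (fun=> 1) (rho Torus xi)) x = 1 by rewrite mulr1.
rewrite /psi.
have -> : \int[leb]_xi (ht Torus (fun=> 1) (rho Torus xi) * cas (x * rho Torus xi)) = \int[leb]_xi (2 * pi * \1_(`[0, 1[) xi).
  apply: Int_ext => xi; rewrite ht_one indE in_itv/=.
  have -> : (0 <= xi < 1) = (rho Torus xi == 0).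
    apply/idP/eqP => [h|h].
      by rewrite /= (_ : Num.floor xi = 0)//; apply: floor_def; rewrite add0r.
    by have := @rho_near R Torus xi; rewrite h add0r.
  rewrite -[(Num.floor xi)%:~R]/(rho Torus xi); case: eqP => [->|_]; last by rewrite mul0r mulr0.
  by rewrite mulr0 /cas cos0 sin0 addr0 !mulr1.
rewrite IntZ; last exact: Ig_ind.
by rewrite Int_ind// subr0 mulr1 mulVf// gt_eqF// two_pi_gt0.
Qed.

(** The point 0 of the torus is left out, which is harmless under an integral. *)
Lemma inversion K phi : test_space K phi -> forall x, x \in dom K -> x != 0 \/ K = Line ->
  psi K (fun xi => ht K phi (rho K xi)) x = phi x.
Proof.
case: K => tp x; last by move=> _ _; exact: inversion_line.
move=> /dom_bound/andP[x0 xp] [xn|//].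
by apply: inversion_torus => //; rewrite lt_neqAle eq_sym xn.
Qed.

Lemma bessel K f : Ig (fun x => chi K x * f x) -> L2 (fun x => chi K x * f x) ->
  L2 (fun x => ht K f (rho K x)) /\
  n2 (fun x => ht K f (rho K x)) <= 2 * pi * n2 (fun x => chi K x * f x).
Proof. by case: K => fi f2; [exact: bessel_torus|move: fi f2; rewrite chi_Line; exact: bessel_line]. Qed.

End TorusInversion.

(** * Density and separation *)
Section SymbolDensity.
Context {R : realType}.
Local Notation leb := (@lebesgue_measure R).
Implicit Types (f g c phi sg : R -> R) (K : spatial_domain) (x y z t u : R).

(** Lebesgue differentiation: the primitives of the truncations of F vanish identically, hence so do
    their derivatives, equal to the truncations almost everywhere. *)
Lemma ae0_of_intervals (F : R -> R) :
  (forall n : nat, Ig (fun x => \1_(`[- n%:R, n%:R[) x * F x)) ->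
  (forall a b : R, \int[leb]_x (\1_(`[a, b[) x * F x) = 0) ->
  {ae leb, forall x, F x = 0}.
Proof.
move=> iF zF.
have zn n : {ae leb, forall x : R, \1_(`[- n%:R, n%:R[) x * F x = 0}.
  have li : locally_integrable [set: R] (fun x => \1_(`[- n%:R, n%:R[) x * F x).
    by apply: open_integrable_locally; [exact: openT|exact: iF].
  pose G (x : R) := \int[leb]_(t in `]-oo, x]) (\1_(`[- n%:R, n%:R[) t * F t).
  have G0 x : G x = 0.
    rewrite /G -Rintegral_itv_bndo_bndc; last first.
      by exact: integrableS (iF n).
    rewrite Rintegral_mkcond -[RHS](zF (- n%:R) (Num.min n%:R x)).
    apply: Int_ext => y; rewrite patchE mem_setE in_itv/= !indE !in_itv/= lt_min andbA.
    by case: (y < x)%R; rewrite ?andbT ?andbF ?mul0r.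
  have iNy y : leb.-integrable `]-oo, y] (EFin \o (fun x => \1_(`[- n%:R, n%:R[) x * F x)).
    by apply: (integrableS measurableT _ (@subsetT _ _) (iF n)); exact: measurable_itv.
  have H := FTC1Ny iNy li.
  apply: filterS H => x [_].
  by rewrite -[X in (X^`())%classic]/G (_ : G = fun=> 0) ?derive1_cst//; apply/funext.
have := ae_foralln zn; apply: filterS => x h.
have [n xn] : exists n : nat, `|x| < n%:R by exists (Num.bound `|x|); exact: archi_boundP.
have := h n; rewrite indE in_itv/= (_ : (_ <= _ < _) = true) ?mul1r//.
by move: xn; rewrite ltr_norml => /andP[/ltW -> ->].
Qed.

Section CompactSymbol.
Variables (M : R) (sg : R -> R).
Hypotheses (ms : measurable_fun setT sg) (hs : forall z, `|sg z| <= M /\ (M < `|z| -> sg z = 0)).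

Let M0 : 0 <= M. Proof. by have [h _] := hs 0; exact: le_trans h. Qed.

Lemma symbol_le_cut : exists n : nat, forall z, `|sg z| <= M * cut n z.
Proof.
exists (Num.bound M) => z; have [h1 h2] := hs z; rewrite cutE.
case: (leP `|z|) => h; first by rewrite mulr1.
rewrite h2 ?normr0 ?mulr0//; apply: lt_trans h.
exact: archi_boundP.
Qed.

Lemma Ig_symbol K : Ig (fun x => sg (rho K x)).
Proof.
have [n h] := symbol_le_cut; apply: Ig_le (IgZ M (Ig_cut K n)) _.
  exact: measurableT_comp ms (@measurable_rho R K).
by move=> x; apply: le_trans (h _) (ler_norm _).
Qed.

Lemma L2_symbol K : L2 (fun x => sg (rho K x)).
Proof.
have m1 := measurableT_comp ms (@measurable_rho R K); split => //=.
have := IgMb (Ig_symbol K) m1 (fun x => (hs (rho K x)).1).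
by under eq_fun do rewrite -expr2.
Qed.

Lemma wt_symbol_le (q z : R) : 0 <= q -> wt q z * `|sg z| <= (1 + M ^+ 2) `^ (q / 2) * M.
Proof.
move=> q0; have [h1 h2] := hs z.
have [h|h] := ltP M `|z|; first by rewrite h2// normr0 mulr0 mulr_ge0// powR_ge0.
apply: ler_pM => //; first exact: wt_ge0.
rewrite /wt; apply: ge0_ler_powR.
- by rewrite divr_ge0.
- by rewrite nnegrE addr_ge0// sqr_ge0.
- by rewrite nnegrE addr_ge0// sqr_ge0.
by rewrite lerD2l -[z ^+ 2]real_normK ?num_real// lerXn2r ?nnegrE.
Qed.

Lemma L2_wt_symbol K p : L2 (fun x => wt p (rho K x) * sg (rho K x)).
Proof.
pose S := (1 + M ^+ 2) `^ (`|p| / 2) * M; have mr := @measurable_rho R K.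
have [n hn] := symbol_le_cut.
have LC : L2 (fun x => S * cut n (rho K x)).
  apply: L2Z; split; first exact: measurableT_comp (measurable_cut n) mr.
  by have := Ig_cut K n (R := R); under eq_fun do rewrite -cut_sqr.
have S0 : 0 <= S by rewrite mulr_ge0// powR_ge0.
apply: L2_le _ LC _ => [|x].
  by apply: measurable_funM; [exact: measurableT_comp (measurable_wt p) mr|exact: measurableT_comp ms mr].
rewrite normrM [leRHS]normrM (ger0_norm S0) (ger0_norm (wt_ge0 _ _)).
have h1 : wt p (rho K x) * `|sg (rho K x)| <= S.
  apply: le_trans (wt_symbol_le (rho K x) (normr_ge0 p)); rewrite ler_wpM2r//.
  by apply: wt_mono; exact: ler_norm.
have := hn (rho K x); rewrite cutE; case: (`|rho K x| <= n%:R)%R => h2; first by rewrite normr1 mulr1.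
by move: h2; rewrite mulr0 normr_le0 => /eqP ->; rewrite !normr0 !mulr0.
Qed.

End CompactSymbol.

(** Differentiation in x brings down the factor e * xi and changes the sign of the argument of cas.
    The integrals indexed by a bounded compactly supported symbol and a sign e thus form a family to
    which [smooth_family] applies. *)
Lemma smooth_cas_transform K sg (M : R) : measurable_fun setT sg ->
  (forall z, `|sg z| <= M /\ (M < `|z| -> sg z = 0)) -> smooth (psi K (fun xi => sg (rho K xi))).
Proof.
pose I := {p : (R -> R) * R | [/\ measurable_fun setT p.1,
   exists M : R, forall z, `|p.1 z| <= M /\ (M < `|z| -> p.1 z = 0) & p.2 = 1 \/ p.2 = -1]}.
pose F (i : I) x := \int[leb]_xi ((sval i).1 (rho K xi) * cas (x * ((sval i).2 * rho K xi))).
move=> ms hs.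
have i0P : [/\ measurable_fun setT sg, exists M : R, forall z, `|sg z| <= M /\ (M < `|z| -> sg z = 0) & (1 : R) = 1 \/ (1 : R) = -1].
  by split => //; [exists M|left].
suff H i : smooth (F i).
  rewrite (_ : psi _ _ = fun x => (2 * pi)^-1 * F (exist _ (sg, 1) i0P) x); first exact: smoothZ.
  by apply/funext => x; rewrite /psi /F/=; congr (_ * _); apply: Int_ext => xi; rewrite mul1r.
apply: smooth_family => {}i.
case: i => [[s e] /= iP]; have [/= mi [Mi hi] ei] := iP; set i : I := exist _ (s, e) iP.
have Ii (t : R -> R) : measurable_fun setT t -> (forall z, `|t z| <= Mi /\ (Mi < `|z| -> t z = 0)) ->
    forall a b : R, Ig (fun xi => t (rho K xi) * cas (a * (b * rho K xi))).
  move=> mt ht' a b; apply: (IgMb (Ig_symbol mt ht' K) _ (M := 2)) => [|xi]; last exact: cas_le2.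
  apply: (measurableT_comp measurable_cas); apply: measurable_funM => //; apply: measurable_funM => //.
  exact: measurable_rho.
pose s' z := e * (z * s z).
have ms' : measurable_fun setT s' by apply: measurable_funM => //; exact: measurable_funM.
have e1 : `|e| = 1 by case: ei => ->; rewrite ?normrN normr1.
have Mi0 : 0 <= Mi by have [h _] := hi 0; exact: le_trans h.
have hs' z : `|s' z| <= Mi * Mi /\ (Mi < `|z| -> s' z = 0).
  have [h1 h2] := hi z; split; last by move=> /h2; rewrite /s' => ->; rewrite !mulr0.
  rewrite /s' normrM e1 mul1r normrM; have [h|h] := leP `|z| Mi; first exact: ler_pM.
  by rewrite h2// normr0 mulr0 mulr_ge0.
have hs2 : exists M : R, forall z, `|s' z| <= M /\ (M < `|z| -> s' z = 0).
  exists (Num.max Mi (Mi * Mi)) => z; have [h1 h2] := hs' z.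
  by rewrite le_max h1 orbT; split => //; rewrite gt_max => /andP[/h2].
have jP : [/\ measurable_fun setT s', exists M : R, forall z, `|s' z| <= M /\ (M < `|z| -> s' z = 0) & - e = 1 \/ - e = -1].
  by split => //; case: ei => ->; [right|left; rewrite opprK].
pose j : I := exist _ (s', - e) jP.
have d x : is_derive x 1 (F i) (F j x).
  have i1 a : Ig (fun xi => s (rho K xi) * cas (a * (e * rho K xi))) by exact: Ii.
  have iA : Ig (fun xi => `|s (rho K xi)|) by exact: Ig_abs (Ig_symbol mi hi K).
  have i2 : Ig (fun xi => s' (rho K xi) * cas (x * (- e * rho K xi))).
    have [M' hM'] := hs2; apply: (IgMb (Ig_symbol ms' hM' K) _ (M := 2)) => [|xi]; last exact: cas_le2.
    apply: (measurableT_comp measurable_cas); apply: measurable_funM => //; apply: measurable_funM => //.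
    exact: measurable_rho.
  apply: (is_derive_quad (C := 4 * Mi ^+ 2 * \int[leb]_xi `|s (rho K xi)|)) => h.
  rewrite /F/= -(IntB (i1 _) (i1 _)) -(IntZ h i2) -IntB; [|exact: IgB|exact: IgZ].
  rewrite mulrAC -IntZ//; apply: Int_le_norm => [||xi].
  - by apply: IgB; [exact: IgB|exact: IgZ].
  - exact: IgZ.
  have [h1 h2] := hi (rho K xi); have [hM|hM] := leP `|rho K xi| Mi; last by rewrite /s' h2// normr0 !(mul0r, mulr0) subrr subr0 normr0.
  have := cas_taylor (x * (e * rho K xi)) (h * (e * rho K xi)).
  rewrite -mulrDl => T.
  rewrite (_ : _ - _ - _ = s (rho K xi) * (cas ((x + h) * (e * rho K xi)) - cas (x * (e * rho K xi)) - h * (e * rho K xi) * cas (- (x * (e * rho K xi))))); last first.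
    have -> : x * (- e * rho K xi) = - (x * (e * rho K xi)) by ring.
    rewrite /s'; ring.
  rewrite normrM mulrC ler_wpM2r//; apply: le_trans T _.
  rewrite !exprMn -[e ^+ 2]real_normK ?num_real// e1 expr1n mul1r -[leRHS]mulrA (ler_wpM2l (ler0n _ 4))// [leRHS]mulrC ler_wpM2l ?sqr_ge0//.
  by rewrite -[_ ^+ 2]real_normK ?num_real// lerXn2r ?nnegrE.
have [dd E] := derive1P d.
by split => // n hn; rewrite E; exact: hn.
Qed.


Lemma ae_notin (l : seq R) : {ae leb, forall x, x \notin l}.
Proof.
elim: l => [|a l ih]; first exact: aeW.
have ha : {ae leb, forall x : R, x != a}.
  exists [set a]; split => [//||x /=]; first exact: lebesgue_measure_set1.
  by move/negP; rewrite negbK => /eqP.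
by apply: filterS2 ha ih => x h1 h2; rewrite inE negb_or h1.
Qed.

(** Normalised by bump 0 = 1: by inversion its transform has integral 2 pi, and its rescalings form
    an approximate identity in frequency. *)
Let bump x := (flat 0 1)^-1 * flat 0 (1 - x ^+ 2) : R.

Let bump_smooth : smooth bump.
Proof.
apply: smoothM; first exact: smooth_cst; apply: smooth_comp; first exact: smooth_flat.
by apply: smoothB; [exact: smooth_cst|apply: smoothM; exact: smooth_id].
Qed.

Let bump_supp x : 1 < `|x| -> bump x = 0.
Proof.
move=> h; have x1 : 1 <= x ^+ 2 by rewrite -[x ^+ 2]real_normK ?num_real// exprn_ege1// ltW.
by rewrite /bump [flat 0 (1 - _)]flat_le0 ?mulr0// subr_le0.
Qed.

Let bump_test : test_space Line bump.
Proof. by split; [apply/smoothE|exists 1 => x; exact: bump_supp]. Qed.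

Let ht_bump_even y : ht Line bump (- y) = ht Line bump y.
Proof.
have i := Ig_ht (- y) (test_Ig bump_test).
rewrite /ht -(Int_opp i); apply: Int_ext => x; congr (_ * _ * cas _); last by rewrite mulrNN.
by rewrite /bump sqrrN.
Qed.

Let Ig_ht_bump q : Ig (fun z => wt q z * `|ht Line bump z|).
Proof.
have [h _] := Ig_wt_ht q bump_test; have := Ig_abs h.
by congr Ig; apply/funext => z; rewrite normrM ger0_norm ?wt_ge0.
Qed.

Let Int_ht_bump : Ig (ht Line bump) /\ \int[leb]_z ht Line bump z = 2 * pi.
Proof.
have [h _] := Ig_wt_ht 0 bump_test; split; first by move: h; under eq_fun do rewrite wt0 mul1r.
have := inversion_line 0 bump_test; rewrite /psi {2}/bump expr0n subr0 mulVf ?gt_eqF ?flat_gt0//.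
move/(canRL (mulVKf (lt0r_neq0 (two_pi_gt0 (R := R))))); rewrite mulr1 => <-.
by apply: Int_ext => z; rewrite mul0r /cas cos0 sin0 addr0 mulr1.
Qed.

(** Peetre's inequality, from 1 + (u - w)^2 <= 2 (1 + u^2) (1 + w^2). *)
Lemma wt_peetre q u w : 0 <= q -> wt q (u - w) <= 2 `^ (q / 2) * (wt q u * wt q w).
Proof.
move=> q0; have b x : 0 <= 1 + x ^+ 2 by rewrite addr_ge0// sqr_ge0.
rewrite /wt -powRM// -powRM// ?mulr_ge0//; apply: ge0_ler_powR.
- by rewrite divr_ge0.
- by rewrite nnegrE.
- by rewrite nnegrE !mulr_ge0.
have := sqr_ge0 (u + w); have : 0 <= u ^+ 2 * w ^+ 2 by rewrite mulr_ge0 ?sqr_ge0.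
have := sqr_ge0 u; have := sqr_ge0 w; nra.
Qed.

Section LineApproximation.
Variables (M : R) (sg : R -> R) (l : seq R).
Hypotheses (ms : measurable_fun setT sg) (hs : forall z, `|sg z| <= M /\ (M < `|z| -> sg z = 0)).
Hypothesis cs : forall z, z \notin l -> {for z, continuous sg}.

(** The inverse transform of sg, cut off at scale n + 1. It is a test function, and its transform
    averages sg against the transform of [bump] at scale 1 / (n + 1). *)
Let appr (n : nat) x := bump (n.+1%:R^-1 * x + 0) * psi Line sg x.

Let appr_test n : test_space Line (appr n).
Proof.
split; last first.
  exists n.+1%:R => x h; rewrite /appr bump_supp ?mul0r// addr0 normrM ger0_norm ?invr_ge0//.
  by rewrite mulrC ltr_pdivlMr// mul1r.
apply/smoothE; apply: smoothM; last exact: (smooth_cas_transform Line ms hs).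
apply: smooth_comp => //; apply: smoothD; last exact: smooth_cst.
by apply: smoothM; [exact: smooth_cst|exact: smooth_id].
Qed.

Let isg : Ig sg. Proof. exact: (Ig_symbol ms hs Line). Qed.

Let ht_appr n z : ht Line (appr n) z =
  (2 * pi)^-1 * \int[leb]_y (sg (n.+1%:R^-1 * y + z) * ht Line bump y).
Proof.
pose N : R := n.+1%:R; have N0 : 0 < N by rewrite ltr0n.
pose bn x := bump (N^-1 * x + 0).
have htL f y : ht Line f y = \int[leb]_x (f x * cas (x * y)).
  by rewrite /ht; apply: Int_ext => x; rewrite (congr1 (fun h => h x) (chi_Line f)).
have hb y : ht Line bn y = N * ht Line bump (N * y).
  have i : Ig (fun x => bump x * cas (x * (N * y))).
    by have := Ig_ht (N * y) (test_Ig bump_test); congr Ig; apply/funext => x; rewrite (congr1 (fun h => h x) (chi_Line bump)).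
  have Ni0 : 0 < N^-1 by rewrite invr_gt0.
  rewrite !htL -[N in N * \int[leb]__ _]invrK -(Int_affine 0 Ni0 i); apply: Int_ext => x.
  rewrite /bn addr0; congr (_ * cas _); rewrite mulrACA mulVf ?mul1r//; exact: lt0r_neq0.
have ib : Ig bump by have := test_Ig bump_test; rewrite chi_Line.
have ibn : Ig bn by apply: Ig_affine; rewrite ?invr_gt0.
have ibc : Ig (fun x => chi Line x * (bn x * cas (x * z))).
  rewrite chi_Line; apply: (IgMb (M := 2) ibn) => [|x]; last exact: cas_le2.
  by apply: (measurableT_comp measurable_cas); exact: measurable_funM.
transitivity (\int[leb]_x (chi Line x * (bn x * cas (x * z)) * psi Line sg x)).
  by apply: Int_ext => x; rewrite /appr -/N -/(bn x); ring.
apply: (etrans (pairing ibc isg)); apply: (congr1 (fun y => (2 * pi)^-1 * y)).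
have [ihb _] := Int_ht_bump.
have mz : measurable_fun setT (fun y => sg (N^-1 * y + z)).
  by apply: (measurableT_comp ms); apply: measurable_funD => //; exact: measurable_funM.
have ig : Ig (fun y => sg (N^-1 * y + z) * ht Line bump y).
  by have := IgMb ihb mz (fun y => (hs _).1); congr Ig; apply/funext => y; rewrite mulrC.
transitivity (\int[leb]_w (N * (sg (N^-1 * (N * w + - (N * z)) + z) * ht Line bump (N * w + - (N * z))))).
  apply: Int_ext => w; rewrite ht_mul_cas; last by rewrite chi_Line.
  have -> : N^-1 * (N * w + - (N * z)) + z = w by field; exact: lt0r_neq0.
  have e1 : ht Line bn (w - z) = ht Line bn (z - w) by rewrite !hb -opprB mulrN ht_bump_even.
  have e2 : ht Line bn (- z - w) = ht Line bn (z + w) by rewrite !hb -opprD mulrN ht_bump_even.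
  have hw : N * ht Line bump (N * w - N * z) = ht Line bn (w - z) by rewrite hb mulrBr.
  rewrite [in RHS]mulrCA hw /dbl [rho _ _]/= e1 e2 -e1.
  rewrite (_ : _ + _ + _ - _ = ht Line bn (w - z) * 2); last by ring.
  by rewrite [_ * 2]mulrC mulKf.
rewrite (IntZ N (Ig_affine (- (N * z)) N0 ig)) (Int_affine (- (N * z)) N0 ig) mulVKf//.
exact: lt0r_neq0.
Qed.


Let ht_appr_cvg z : z \notin l -> ht Line (appr n) z @[n --> \oo] --> sg z.
Proof.
move=> zl; have [ihb Ihb] := Int_ht_bump; have mhb := Ig_meas ihb.
have mz n : measurable_fun setT (fun y => sg (n.+1%:R^-1 * y + z) * ht Line bump y).
  apply: measurable_funM => //; apply: (measurableT_comp ms).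
  by apply: measurable_funD => //; exact: measurable_funM.
have le n y : `|sg (n.+1%:R^-1 * y + z) * ht Line bump y| <= M * `|ht Line bump y|.
  by rewrite normrM ler_wpM2r//; have [] := hs (n.+1%:R^-1 * y + z).
have cv : {ae leb, forall y, (fun n => sg (n.+1%:R^-1 * y + z) * ht Line bump y) @ \oo --> sg z * ht Line bump y}.
  apply: aeW => y; apply: cvgM; last exact: cvg_cst.
  have c0 : (fun n => n.+1%:R^-1 * y + z : R) @ \oo --> z.
    rewrite -[X in _ --> X]add0r -[X in _ --> X + _](mul0r y); apply: cvgD; last exact: cvg_cst.
    by apply: cvgM; [exact: cvg_harmonic|exact: cvg_cst].
  exact: (cvg_comp _ sg c0 (cs zl)).
have [_ H] := @DCT R _ _ _ mz (measurable_funM (measurable_cst (sg z)) mhb) (IgZ M (Ig_abs ihb)) le cv.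
rewrite (_ : (fun n => ht Line (appr n) z) = (fun n => (2 * pi)^-1 * \int[leb]_y (sg (n.+1%:R^-1 * y + z) * ht Line bump y))); last by apply/funext => n; exact: ht_appr.
rewrite -[sg z](mulKf (lt0r_neq0 (two_pi_gt0 (R := R)))); apply: cvgM; first exact: cvg_cst.
by move: H; rewrite (IntZ (sg z) ihb) Ihb mulrC.
Qed.

(** Uniformly in n: Peetre's inequality shares the weight between sg, of compact support, and the
    transform of [bump], of rapid decay. *)
Let ht_appr_decay q : 0 <= q -> exists2 C : R, 0 <= C & forall n z, wt q z * `|ht Line (appr n) z| <= C.
Proof.
move=> q0; pose S := (1 + M ^+ 2) `^ (q / 2) * M.
have M0 : 0 <= M by have [h _] := hs 0; exact: le_trans h.
have S0 : 0 <= S by rewrite mulr_ge0// powR_ge0.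
have iq := Ig_ht_bump q; have [ihb _] := Int_ht_bump.
exists (2 `^ (q / 2) * S * \int[leb]_y (wt q y * `|ht Line bump y|)).
  by rewrite !mulr_ge0 ?powR_ge0//; apply: Int_ge0 => y; rewrite mulr_ge0 ?wt_ge0.
move=> n z.
have mz : measurable_fun setT (fun y => sg (n.+1%:R^-1 * y + z)).
  by apply: (measurableT_comp ms); apply: measurable_funD => //; exact: measurable_funM.
have ig : Ig (fun y => sg (n.+1%:R^-1 * y + z) * ht Line bump y).
  by have := IgMb ihb mz (fun y => (hs _).1); congr Ig; apply/funext => y; rewrite mulrC.
have p1 : `|(2 * pi)^-1 : R| <= 1.
  rewrite ger0_norm ?invr_ge0 ?(ltW two_pi_gt0)// invf_le1 ?two_pi_gt0//.
  by have := @pi_ge2 R; lra.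
rewrite ht_appr normrM mulrCA.
apply: (@le_trans _ _ (wt q z * `|\int[leb]_y (sg (n.+1%:R^-1 * y + z) * ht Line bump y)|)).
  by rewrite ler_piMl// mulr_ge0 ?wt_ge0.
rewrite -[wt q z]ger0_norm ?wt_ge0// -normrM -IntZ// -IntZ//; apply: Int_le_norm => [||y]; [exact: IgZ|exact: IgZ|].
rewrite normrM ger0_norm ?wt_ge0// normrM.
have h1 := wt_symbol_le hs (n.+1%:R^-1 * y + z) q0.
have h2 := wt_peetre (n.+1%:R^-1 * y + z) (n.+1%:R^-1 * y) q0.
have h3 : wt q (n.+1%:R^-1 * y) <= wt q y.
  rewrite /wt; apply: ge0_ler_powR; rewrite ?divr_ge0 ?nnegrE ?addr_ge0 ?sqr_ge0//.
  rewrite lerD2l exprMn ler_piMl ?sqr_ge0// exprn_ile1 ?invr_ge0// invf_le1 ?ltr0n// ler1n//.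
rewrite [X in wt q X](_ : _ = z) in h2; last by ring.
apply: (@le_trans _ _ (2 `^ (q / 2) * (wt q (n.+1%:R^-1 * y + z) * wt q y) * (`|sg (n.+1%:R^-1 * y + z)| * `|ht Line bump y|))).
  rewrite ler_wpM2r ?mulr_ge0//; apply: (le_trans h2).
  by rewrite ler_wpM2l ?powR_ge0// [n.+1%:R^-1 * y + z]addrC ler_wpM2l ?wt_ge0.
rewrite (_ : _ * _ * _ = 2 `^ (q / 2) * (wt q y * `|ht Line bump y|) * (wt q (n.+1%:R^-1 * y + z) * `|sg (n.+1%:R^-1 * y + z)|)); last by ring.
rewrite [leRHS]mulrAC ler_wpM2l// !mulr_ge0 ?powR_ge0 ?wt_ge0//.
Qed.

(** Convergence holds off the finite set l, hence almost everywhere, and the uniform decay of order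
    |p| + 1 leaves the integrable weight of exponent -2 as a dominating function. *)
Lemma symbol_approx_line p : exists2 phi : nat -> R -> R, (forall n, test_space Line (phi n)) &
  n2 (fun z => wt p z * (ht Line (phi n) z - sg z)) @[n --> \oo] --> (0 : R).
Proof.
exists appr => //; pose q := `|p| + 1.
have q0 : 0 <= q by rewrite addr_ge0.
have [C C0 hC] := ht_appr_decay q0; pose S := (1 + M ^+ 2) `^ (q / 2) * M.
have ih n : Ig (appr n) by have := test_Ig (appr_test n); rewrite chi_Line.
have mh n : measurable_fun setT (ht Line (appr n)) by apply: measurable_ht; rewrite chi_Line.
have mD n : measurable_fun setT (fun z => (wt p z * (ht Line (appr n) z - sg z)) ^+ 2).
  apply: measurable_funX; apply: measurable_funM; [exact: measurable_wt|exact: measurable_funB].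
have le n z : `|(wt p z * (ht Line (appr n) z - sg z)) ^+ 2| <= (C + S) ^+ 2 * wt (- (2 * 1)) z.
  have M0 : 0 <= M by have [h _] := hs 0; exact: le_trans h.
  have S0 : 0 <= S by rewrite mulr_ge0// powR_ge0.
  have -> : wt (- (2 * 1)) z = wt (- 1) z ^+ 2 by rewrite expr2 -wtD; congr wt; ring.
  rewrite ger0_norm ?sqr_ge0// -exprMn -[leLHS]real_normK ?num_real// lerXn2r ?nnegrE ?mulr_ge0 ?addr_ge0 ?wt_ge0//.
  have pq : wt p z <= wt q z * wt (- 1) z by rewrite -wtD; apply: wt_mono; rewrite /q addrK ler_norm.
  rewrite normrM ger0_norm ?wt_ge0//; apply: (le_trans (ler_wpM2r _ pq)) => //.
  rewrite mulrAC ler_wpM2r ?wt_ge0//; apply: (le_trans (ler_wpM2l (wt_ge0 q z) (ler_normB _ _))).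
  rewrite mulrDr lerD//; exact: (wt_symbol_le hs).
have cv : {ae leb, forall z, (fun n => (wt p z * (ht Line (appr n) z - sg z)) ^+ 2) @ \oo --> (0 : R)}.
  have := ae_notin l; apply: filterS => z zl.
  have h : (fun n => wt p z * (ht Line (appr n) z - sg z)) @ \oo --> wt p z * (sg z - sg z).
    by apply: cvgM; [exact: cvg_cst|apply: cvgB; [exact: ht_appr_cvg|exact: cvg_cst]].
  rewrite (_ : (0 : R) = (wt p z * (sg z - sg z)) * (wt p z * (sg z - sg z))); first by under eq_fun do rewrite expr2; apply: cvgM.
  by rewrite subrr !mulr0.
have i1 := @Ig_wt R Line 1 _; have {}i1 : Ig (fun z : R => wt (- (2 * 1)) z) by apply: i1; lra.
have [_] := @DCT R _ _ _ mD (measurable_cst (0 : R)) (IgZ ((C + S) ^+ 2) i1) le cv.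
by rewrite Int0.
Qed.

End LineApproximation.

Lemma periodic_psi_torus c : periodic (psi Torus c) (2 * pi).
Proof.
move=> x; rewrite /psi; congr (_ * _); apply: Int_ext => xi; congr (_ * _).
have c1 : cos (2 * pi * rho Torus xi) = 1 :> R.
  by rewrite -(cos_2pi_int _ (Num.floor xi)) mulrC subrr cos0.
have s0 : sin (2 * pi * rho Torus xi) = 0 :> R by have := cas_2pi_rho xi; rewrite /cas c1; lra.
by rewrite mulrDl cas_add c1 s0 mulr1 mulr0 addr0.
Qed.

(** On the torus the inverse transform of sg is a trigonometric polynomial, hence itself a test
    function, and its transform agrees with sg at the integers. *)
Lemma symbol_approx K p sg : symbol_class sg -> exists2 phi : nat -> R -> R, (forall n, test_space K (phi n)) &
  n2 (fun x => wt p (rho K x) * (ht K (phi n) (rho K x) - sg (rho K x))) @[n --> \oo] --> (0 : R).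
Proof.
move=> [ms [M hs [l cs]]]; case: K; last exact: (symbol_approx_line ms hs cs).
exists (fun=> psi Torus (fun xi => sg (rho Torus xi))).
  move=> _; split; last exact: periodic_psi_torus.
  by apply/smoothE; exact: smooth_cas_transform ms hs.
rewrite (_ : (fun n => _) = cst 0); first exact: cvg_cst.
apply/funext => _ /=; rewrite /n2 -[RHS](Int0 (R := R)); apply: Int_ext => x.
by rewrite ht_psi_torus ?subrr ?mulr0 ?expr0n//; exact: Ig_symbol ms hs _.
Qed.

End SymbolDensity.

(** * Separation by test functions and the transform of L^2 functions *)

Section Separation.
Context {R : realType}.
Local Notation leb := (@lebesgue_measure R).
Implicit Types (f g c phi sg : R -> R) (K : spatial_domain) (x y z t u : R).

Lemma cvg_of_geometric (a : nat -> R) (B q : R) : 0 <= q -> q < 1 ->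
  (forall k, `|a k.+1 - a k| <= B * q ^+ k) ->
  cvgn a /\ forall k, `|a k| <= `|a 0%N| + B / (1 - q).
Proof.
move=> q0 q1 h; have nq : `|q| < 1 by rewrite ger0_norm.
have B0 : 0 <= B by have := le_trans (normr_ge0 _) (h 0%N); rewrite expr0 mulr1.
have aE n : a n = a 0%N + series (fun k => a k.+1 - a k) n.
  by rewrite seriesEnat/= telescope_sumr// subrKC.
have gE n : series (geometric B q) n <= B / (1 - q).
  rewrite geometric_seriesE ?lt_eqF//= ler_wpM2r ?invr_ge0 ?subr_ge0 ?(ltW q1)//.
  by rewrite ler_piMr// lerBlDr lerDl exprn_ge0.
split.
  rewrite (_ : a = fun n => a 0%N + series (fun k => a k.+1 - a k) n); last by apply/funext => n; exact: aE.
  apply: is_cvgD; first exact: is_cvg_cst.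
  apply: normed_cvg; apply: (@series_le_cvg _ _ (geometric B q)) => [n||n|].
  - exact: normr_ge0.
  - by move=> n; exact: geometric_ge0.
  - exact: h.
  - exact: is_cvg_geometric_series.
move=> k; rewrite aE; apply: (le_trans (ler_normD _ _)); rewrite lerD2l; apply: le_trans (gE k).
rewrite !seriesEnat/=; apply: (le_trans (ler_norm_sum _ _ _)); apply: ler_sum => i _; exact: h.
Qed.

(** flat 0 (n w) = exp (- 1 / (n w)) tends to the indicator of w > 0, so that smooth functions reach
    indicators of open sets. *)
Lemma window_zero (H w : R -> R) : measurable_fun setT H -> measurable_fun setT w ->
  Ig (fun x => (0 < w x)%R%:R * H x) ->
  (forall n : nat, \int[leb]_x (flat 0 (n%:R * w x) * H x) = 0) ->
  \int[leb]_x ((0 < w x)%R%:R * H x) = 0.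
Proof.
move=> mH mw iH z.
have mfl : measurable_fun setT (flat 0 : R -> R) by exact: smooth_measurable (smooth_flat 0).
have mF n : measurable_fun setT (fun x => flat 0 (n%:R * w x) * H x).
  by apply: measurable_funM => //; apply: measurableT_comp => //; exact: measurable_funM.
have fl1 y : `|flat 0 y : R| <= 1.
  rewrite ger0_norm ?flat_ge0// /flat; case: ltP => // y0.
  by rewrite expr0 mul1r -expR0 ler_expR oppr_le0 invr_ge0 ltW.
have le n x : `|flat 0 (n%:R * w x) * H x| <= `|(0 < w x)%R%:R * H x|.
  rewrite !normrM ler_wpM2r//; case: ltP => w0; first by rewrite normr1.
  by rewrite flat_le0 ?normr0// mulr_ge0_le0.
have cv : {ae leb, forall x, (fun n => flat 0 (n%:R * w x) * H x) @ \oo --> (0 < w x)%R%:R * H x}.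
  apply: aeW => x; apply: cvgM; last exact: cvg_cst.
  case: ltP => w0; last first.
    by under eq_fun do rewrite flat_le0 ?mulr_ge0_le0//; exact: cvg_cst.
  rewrite -cvg_shiftS.
  rewrite (_ : (fun n => _) = fun n => expR (- ((w x)^-1 * n.+1%:R^-1))); last first.
    by apply/funext => n; rewrite /= /flat mulr_gt0// expr0 mul1r invfM mulrC.
  have -> : true%:R = expR (- ((w x)^-1 * 0)) :> R by rewrite mulr0 oppr0 expR0.
  apply: continuous_cvg; first exact: continuous_expR.
  by apply: cvgN; apply: cvgM; [exact: cvg_cst|exact: cvg_harmonic].
have [_ C] := @DCT R _ _ _ mF (Ig_meas iH) (Ig_abs iH) le cv.
have C0 : (fun n => \int[leb]_x (flat 0 (n%:R * w x) * H x)) @ \oo --> (0 : R).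
  by under eq_fun do rewrite z; exact: cvg_cst.
exact: (cvg_unique _ C C0).
Qed.

Lemma measurable_pos_ind (w : R -> R) : measurable_fun setT w -> measurable_fun setT (fun x => (0 < w x)%R%:R : R).
Proof.
move=> mw; have := measurable_fun_ltr (measurable_cst (0 : R)) mw.
move=> h; exact: (measurableT_comp (f := fun b : bool => b%:R : R)).
Qed.

(** On the torus cos (x - m) - cos l is a periodic function that is positive on the arc |x - m| < l;
    the last hypothesis keeps y off the neighbouring copies of the arc. *)
Lemma cos_window (l y : R) : 0 <= l -> l <= pi -> `|y| <= 2 * pi - l -> (cos l < cos y) = (`|y| < l).
Proof.
move=> l0 lp yb.
have -> : cos y = cos `|y| by case: (ger0P y) => _; rewrite ?cosN.
have y0 := normr_ge0 y; move: yb y0; move: `|y| => {}y yb y0.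
have [yp|yp] := leP y pi.
  by rewrite ltr_cos// ?in_itv/= ?y0 ?l0.
have -> : cos y = cos (2 * pi - y).
  by rewrite mulr_natl cosB cos2pi sin2pi mul1r mul0r addr0.
rewrite ltr_cos ?in_itv/= ?l0 ?lp//; last by apply/andP; split; lra.
by apply/idP/idP => h; exfalso; lra.
Qed.

(** Up to an end point, each interval is the positivity set of a smooth w: l^2 - (x - m)^2 on the
    line, cos (x - m) - cos l on the torus. By [window_zero] the integral of H over it is 0. *)
Lemma ae0_of_tests K (H : R -> R) : (forall n : nat, Ig (fun x => \1_(`[- n%:R, n%:R[) x * H x)) ->
  (forall x, x \notin dom K -> H x = 0) ->
  (forall phi, test_space K phi -> \int[leb]_x (H x * phi x) = 0) ->
  {ae leb, forall x, H x = 0}.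
Proof.
move=> iH dH hH; apply: (ae0_of_intervals iH) => a b.
have mH : measurable_fun setT H.
  apply: (measurable_fun_cvg (fun n => Ig_meas (iH n))) => x _.
  apply: cvg_near_cst; near=> n; rewrite indE in_itv/= (_ : (_ <= _ < _) = true) ?mul1r//.
  have : `|x| < n%:R by near: n; exact: nbhs_infty_gtr.
  by rewrite ltr_norml => /andP[/ltW -> ->].
suff key (m l : R) (w : R -> R) : 0 < l -> smooth w -> (forall n : nat, test_space K (fun x => flat 0 (n%:R * w x))) ->
   (forall x, x \in dom K -> (0 < w x) = (`|x - m| < l)) ->
   \int[leb]_x (\1_(`[m - l, m + l[) x * H x) = 0.
  have gen (a' b' : R) (w : R -> R) : a' < b' -> smooth w -> (forall n : nat, test_space K (fun x => flat 0 (n%:R * w x))) ->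
     (forall x, x \in dom K -> (0 < w x) = (`|x - (a' + b') / 2| < (b' - a') / 2)) ->
     \int[leb]_x (\1_(`[a', b'[) x * H x) = 0.
    move=> ab sw tw hw; have := key ((a' + b') / 2) ((b' - a') / 2) w _ sw tw hw.
    have -> : (a' + b') / 2 - (b' - a') / 2 = a' by field.
    have -> : (a' + b') / 2 + (b' - a') / 2 = b' by field.
    by apply; rewrite divr_gt0// subr_gt0.
  have sflat (n : nat) (w : R -> R) : smooth w -> forall k x, derivable (derive1n k (fun x => flat 0 (n%:R * w x))) x 1.
    move=> sw; apply/smoothE; apply: (smooth_comp (smooth_flat 0)).
    by apply: smoothM => //; exact: smooth_cst.
  have smx (m : R) : smooth (fun x : R => x - m) by apply: smoothB; [exact: smooth_id|exact: smooth_cst].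
  have emp (a' b' : R) : b' <= a' -> \int[leb]_x (\1_(`[a', b'[) x * H x) = 0.
    move=> ba; rewrite -[RHS](Int0 (R := R)); apply: Int_ext => x; rewrite indE in_itv/=.
    by rewrite (_ : (_ <= _ < _) = false) ?mul0r//; apply/negbTE/negP => /andP[h1 h2]; lra.
  case: K dH hH gen {key} => dH hH gen; last first.
    have [ba|ab] := leP b a; first exact: emp.
    pose m := (a + b) / 2; pose l := (b - a) / 2.
    have l0 : 0 < l by rewrite divr_gt0// subr_gt0.
    apply: (gen a b (fun x => l ^+ 2 - (x - m) ^+ 2)) => // [|n|x _].
    - apply: smoothB; first exact: smooth_cst.
      exact: smoothM.
    - split; first by apply: sflat; apply: smoothB; [exact: smooth_cst|exact: smoothM].
      exists (`|m| + l) => x hx; apply: flat_le0; apply: mulr_ge0_le0 => //; rewrite subr_le0.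
      rewrite -[(x - m) ^+ 2]real_normK ?num_real// lerXn2r ?nnegrE ?(ltW l0)//.
      by have := ler_distD 0 x m; have := ler_normB (x - m) (- m); rewrite opprK subrK normrN; lra.
    - rewrite subr_gt0 -[(x - m) ^+ 2]real_normK ?num_real// ltr_pXn2r ?nnegrE ?(ltW l0)//.
  pose a' := Num.max a 0; pose b' := Num.min b (2 * pi).
  transitivity (\int[leb]_x (\1_(`[a', b'[) x * H x)).
    apply: Int_ext => x; rewrite !indE !in_itv/= ge_max lt_min.
    have [/dom_bound/andP[-> ->]|xd] := boolP (x \in dom Torus); first by rewrite !andbT.
    by rewrite (dH _ xd) !mulr0.
  have [ba|ab] := leP b' a'; first exact: emp.
  have a0 : 0 <= a' by rewrite le_max lexx orbT.
  have b2 : b' <= 2 * pi by rewrite ge_min lexx orbT.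
  pose m := (a' + b') / 2; pose l := (b' - a') / 2.
  have sw : smooth (fun x => cos (x - m) - cos l).
    by apply: smoothB; [apply: (smooth_comp smooth_cos_sin.1)|exact: smooth_cst].
  apply: (gen a' b' (fun x => cos (x - m) - cos l)) => // [n|x /dom_bound/andP[x0 x2]].
    split; first exact: sflat.
    by move=> x; congr (flat 0 (_ * (_ - _))); rewrite mulr_natl addrAC cosD2pi.
  rewrite subr_gt0; apply: cos_window; rewrite ?ler_norml /l /m; try by (move: (ab) a0 b2; lra).
move=> l0 sw tw hw; have mw := smooth_measurable sw.
have E : {ae leb, forall x, \1_(`[m - l, m + l[) x * H x = (0 < w x)%R%:R * H x}.
  have := ae_notin [:: m - l]; apply: filterS => x; rewrite inE => xm.
  have [xd|xd] := boolP (x \in dom K); last by rewrite (dH _ xd) !mulr0.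
  rewrite hw// indE in_itv/= ltr_distl; congr (_%:R * _).
  by rewrite le_eqVlt eq_sym (negbTE xm).
have mI : measurable_fun setT (fun x => \1_(`[m - l, m + l[) x * H x).
  by apply: measurable_funM => //; exact: measurable_ind.
have mP : measurable_fun setT (fun x => (0 < w x)%R%:R * H x).
  by apply: measurable_funM => //; exact: measurable_pos_ind.
rewrite (Int_ae mI mP E); apply: window_zero => //; last first.
  by move=> n; rewrite -[RHS](hH _ (tw n)); apply: Int_ext => x; rewrite mulrC.
apply: Ig_ae mP E; have [n hn] : exists n : nat, `|m| + l < n%:R.
  by exists (Num.bound (`|m| + l)); apply: archi_boundP; rewrite addr_ge0// ltW.
apply: Ig_le (iH n) _ => // x; rewrite !normrM ler_wpM2r// !indE !in_itv/=.
case: (boolP (m - l <= x < m + l)) => [/andP[h1 h2]|_]; last by rewrite normr0.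
have := ler_norm m; have := ler_norm (- m); rewrite normrN => n1 n2.
by rewrite (_ : (_ <= _ < _) = true)//; apply/andP; split; lra.
Unshelve. all: by end_near. Qed.

Lemma symbol_class_ind (a b : R) : symbol_class (\1_(`[a, b[) : R -> R).
Proof.
split; first exact: measurable_ind.
exists (Num.max 1 (Num.max `|a| `|b|)).
  move=> z; rewrite indE in_itv/=; split.
    by rewrite le_max; case: (_ <= _ < _); rewrite ?normr1 ?normr0 ?lexx ?ler01.
  rewrite !gt_max => /and3P[_ az bz]; case: (boolP (_ <= _ < _)) => // /andP[h1 h2].
  have := ler_norm b; have := ler_norm (- a); rewrite normrN.
  by move: az bz; case: (ger0P z) => z0 az bz n1 n2; exfalso; lra.
by exists [:: a; b] => z; rewrite !inE negb_or => /andP[h1 h2]; exact: continuous_ind.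
Qed.

(** By density the hypothesis extends from transforms of test functions to all symbols, in
    particular to indicators of intervals; on the torus [k, k + 1[ isolates the value at k. The
    exponent p leaves room for the growth of the symbol of J^s. *)
Lemma freq_separation K p F : measurable_fun setT F -> L2 (fun x => wt (- p) (rho K x) * F (rho K x)) ->
  (forall phi, test_space K phi -> \int[leb]_x (F (rho K x) * ht K phi (rho K x)) = 0) ->
  {ae leb, forall x, F (rho K x) = 0}.
Proof.
move=> mF LF hF.
have symz sg : symbol_class sg -> Ig (fun x => F (rho K x) * sg (rho K x)) /\ \int[leb]_x (F (rho K x) * sg (rho K x)) = 0.
  move=> ssg; have [phi tp cp] := symbol_approx K p ssg.
  have [ms [M hs _]] := ssg.
  have split1 (g : R -> R) x : F (rho K x) * g (rho K x) = (wt (- p) (rho K x) * F (rho K x)) * (wt p (rho K x) * g (rho K x)).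
    by rewrite mulrACA wtNK mul1r.
  have Lwsg := L2_wt_symbol ms hs K p.
  have Lht n : L2 (fun x => wt p (rho K x) * ht K (phi n) (rho K x)) by have [] := Ig_wt_ht p (tp n).
  have iFs : Ig (fun x => F (rho K x) * sg (rho K x)).
    by have := L2M_Ig LF Lwsg; congr Ig; apply/funext => x; rewrite -split1.
  split=> //.
  have bd n : `|\int[leb]_x (F (rho K x) * sg (rho K x))| <=
     nr (fun x => wt (- p) (rho K x) * F (rho K x)) * Num.sqrt (n2 (fun x => wt p (rho K x) * (ht K (phi n) (rho K x) - sg (rho K x)))).
    have iFh : Ig (fun x => F (rho K x) * ht K (phi n) (rho K x)).
      by have := L2M_Ig LF (Lht n); congr Ig; apply/funext => x; rewrite -split1.
    rewrite -normrN -[X in `|X|]add0r -(hF _ (tp n)) -IntB//.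
    have Ld : L2 (fun x => wt p (rho K x) * (ht K (phi n) (rho K x) - sg (rho K x))).
      by have := L2B (Lht n) Lwsg; congr L2; apply/funext => x; rewrite mulrBr.
    apply: le_trans (CS_abs LF Ld); rewrite le_eqVlt; apply/orP; left; apply/eqP; congr `|_|.
    by apply: Int_ext => x; rewrite -mulrBr (split1 (fun z => ht K (phi n) z - sg z)).
  have cz : (fun n => nr (fun x => wt (- p) (rho K x) * F (rho K x)) * Num.sqrt (n2 (fun x => wt p (rho K x) * (ht K (phi n) (rho K x) - sg (rho K x))))) @ \oo --> (0 : R).
    rewrite -[X in _ --> X](mulr0 (nr (fun x => wt (- p) (rho K x) * F (rho K x)))) -[X in _ * X](@sqrtr0 R).
    apply: cvgM; first exact: cvg_cst.
    exact: (cvg_comp _ _ cp (@sqrt_continuous R 0)).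
  apply/eqP; rewrite -normr_le0; apply: (cvgr_to_ge cz).
  exact: nearW bd.
case: K LF hF symz => LF hF symz; last first.
  apply: ae0_of_intervals => [n|a b].
    by have [h _] := symz _ (symbol_class_ind (- n%:R) n%:R); move: h; congr Ig; apply/funext => x; rewrite mulrC.
  by have [_ h] := symz _ (symbol_class_ind a b); rewrite -[RHS]h; apply: Int_ext => x; rewrite mulrC.
apply: aeW => x; pose k : R := rho Torus x.
have [_] := symz _ (symbol_class_ind k (k + 1)).
rewrite (_ : (fun y => _) = (fun y => F k * \1_(`[k, k + 1[) y)); last first.
  apply/funext => y; rewrite !indE !in_itv/=.
  have yk : (k <= y < k + 1) = (rho Torus y == k).
    apply/idP/eqP => [h|<-]; last exact: rho_near.
    by rewrite /k /=; congr (_%:~R); apply: floor_def; rewrite -[(Num.floor x)%:~R]/k intrD.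
  have yk' : (k <= rho Torus y < k + 1) = (rho Torus y == k).
    apply/idP/eqP => [|->]; last by rewrite lexx ltrDl ltr01.
    by rewrite /k /= -[1 in X in _ < X]/(1%:~R) -intrD ltr_int ler_int ltzD1 => /andP[h1 h2]; congr (_%:~R); apply/eqP; rewrite eq_le h1 h2.
  by rewrite -[(Num.floor y)%:~R]/(rho Torus y) yk yk'; case: eqP => [->|]; rewrite ?mulr0.
by rewrite (IntZ (F k) (Ig_ind k (k + 1) true true)) Int_ind ?lerDl ?ler01// [k + 1]addrC addrK mulr1.
Qed.

(** Riesz-Fischer for a fast Cauchy sequence. The sum e of the 4^k (u (k+1) - u k)^2 is integrable,
    so almost everywhere the increments are at most sqrt (e x) 2^(-k), and the sequence is dominated
    by a W in L^2. Weak convergence is the form used afterwards. *)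
Lemma L2_complete (u : nat -> R -> R) (D : R) : (forall k, L2 (u k)) ->
  (forall k, n2 (fun x => u k.+1 x - u k x) <= D * 2^-1 ^+ k * 4^-1 ^+ k) ->
  exists2 G, L2 G & forall g, L2 g -> \int[leb]_x (u k x * g x) @[k --> \oo] --> \int[leb]_x (G x * g x).
Proof.
move=> Lu hu; pose d k x := 4 ^+ k * (u k.+1 x - u k x) ^+ 2.
have D0 : 0 <= D by have := le_trans (n2_ge0 _) (hu 0%N); rewrite !expr0 !mulr1.
have mu k : measurable_fun setT (u k) by have [] := Lu k.
have id' k : Ig (d k) by apply: IgZ; have [] := L2B (Lu k.+1) (Lu k).
have md k : measurable_fun setT (d k) := Ig_meas (id' k).
have d0 k x : 0 <= d k x by rewrite mulr_ge0 ?sqr_ge0 ?exprn_ge0.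
pose E x : \bar R := (\sum_(0 <= k <oo) (d k x)%:E)%E.
have mE : measurable_fun setT E.
  by apply: ge0_emeasurable_sum => [k x _ _|k _]; [rewrite lee_fin|apply/measurable_EFinP].
have E0 x : (0 <= E x)%E by apply: nneseries_ge0 => k _ _; rewrite lee_fin.
have iE : leb.-integrable setT E.
  apply/integrableP; split => //; rewrite (_ : (fun x => `|E x|)%E = E); last first.
    by apply/funext => x; rewrite gee0_abs.
  rewrite integral_nneseries//; last 2 first.
  - by move=> k; apply/measurable_EFinP; exact: md.
  - by move=> k x _; rewrite lee_fin; exact: d0.
  apply: (@le_lt_trans _ _ (\sum_(0 <= k <oo) (geometric D 2^-1 k)%:E)%E).
    apply: lee_nneseries => [k _ _|k _]; first by apply: integral_ge0 => x _; rewrite lee_fin; exact: d0.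
    rewrite -IntE//= lee_fin /d IntZ; last by have [] := L2B (Lu k.+1) (Lu k).
    apply: (le_trans (ler_wpM2l (exprn_ge0 k (ler0n _ 4)) (hu k))).
    by rewrite mulrCA -exprMn divff ?expr1n ?mulr1.
  have q1 : (`|2^-1 : R| < 1)%R by rewrite ger0_norm// invf_lt1// ltr1n.
  rewrite (_ : (\sum_(0 <= k <oo) _)%E = (D * (1 - 2^-1)^-1)%:E) ?ltry//.
  apply/cvg_lim => //; under eq_fun do rewrite sumEFin; apply/cvg_EFin; first by near=> n.
  exact: cvg_geometric_series.
have [ie _] := Ig_fine iE; pose e x := fine (E x).
have e0 x : 0 <= e x by exact: fine_ge0.
have fE : {ae leb, forall x, E x \is a fin_num}.
  by apply: filterS (integrable_ae measurableT iE) => x; apply.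
have step x k : E x \is a fin_num -> `|u k.+1 x - u k x| <= Num.sqrt (e x) * 2^-1 ^+ k.
  move=> Ef; have : d k x <= e x.
    rewrite -lee_fin fineK//; have h : (\sum_(0 <= i < k.+1) (d i x)%:E <= E x)%E.
      by apply: nneseries_lim_ge => i _ _; rewrite lee_fin.
    apply: le_trans h; rewrite big_nat_recr//= leeDr// sumEFin lee_fin sumr_ge0//.
  rewrite /d => h; have h4 : (0 : R) < 4 ^+ k by rewrite exprn_gt0.
  rewrite -(@ler_pXn2r _ 2) ?nnegrE ?mulr_ge0 ?sqrtr_ge0 ?exprn_ge0//.
  rewrite real_normK ?num_real// exprMn sqr_sqrtr// -exprM mulnC exprM exprVn.
  rewrite (_ : 2 ^+ 2 = 4 :> R) ?exprVn ?ler_pdivlMr// 1?mulrC//; ring.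
have half0 : (0 : R) <= 2^-1 by rewrite invr_ge0.
have half1 : (2^-1 : R) < 1 by rewrite invf_lt1// ltr1n.
pose ind x : R := (E x \is a fin_num)%:R.
have mind : measurable_fun setT ind.
  apply: (measurableT_comp (f := fun b : bool => b%:R : R)) => //.
  by apply: (measurable_fun_bool true); exact: emeasurable_fin_num.
pose W x := `|u 0%N x| + 2 * Num.sqrt (e x).
have LW : L2 W.
  apply: L2D; first exact: L2_abs.
  apply: L2Z; split; last by move: ie; congr Ig; apply/funext => x; rewrite sqr_sqrtr.
  exact: (measurableT_comp (continuous_measurable_fun (@sqrt_continuous R)) (Ig_meas ie)).
have fin x : E x \is a fin_num -> cvgn (u ^~ x) /\ forall k, `|u k x| <= W x.
  move=> Ef; have [c h] := cvg_of_geometric half0 half1 (fun k => step x k Ef).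
  by split => // k; apply: (le_trans (h k)); rewrite lerD2l (_ : 1 - 2^-1 = 2^-1) ?invrK 1?mulrC//; field.
pose G x := ind x * limn (u ^~ x).
have cG x : (fun k => ind x * u k x) @ \oo --> G x.
  rewrite /G /ind; case: (boolP (_ \is a fin_num)) => Ef; last by rewrite mul0r; under eq_fun do rewrite mul0r; exact: cvg_cst.
  by apply: cvgM; [exact: cvg_cst|have [] := fin x Ef].
have W0 x : 0 <= W x by rewrite addr_ge0 ?mulr_ge0 ?sqrtr_ge0.
have bW k x : `|ind x * u k x| <= W x.
  rewrite /ind; case: (boolP (_ \is a fin_num)) => Ef; last by rewrite mul0r normr0.
  by rewrite mul1r; have [_] := fin x Ef.
have miu k : measurable_fun setT (fun x => ind x * u k x) by exact: measurable_funM.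
have mG : measurable_fun setT G by apply: (measurable_fun_cvg miu) => x _; exact: cG.
have bG x : `|G x| <= W x.
  have c : (fun k => `|ind x * u k x|) @ \oo --> `|G x| by exact: cvg_norm (cG x).
  apply: (cvgr_to_le c); apply: nearW => k; exact: bW.
exists G; first by apply: L2_le mG LW _ => x; rewrite [leRHS]ger0_norm.
move=> g Lg; have [mg _] := Lg.
have eqk k : \int[leb]_x (u k x * g x) = \int[leb]_x (ind x * u k x * g x).
  apply: Int_ae; [exact: measurable_funM|exact: measurable_funM|].
  by apply: filterS fE => x Ef; rewrite /ind Ef mul1r.
rewrite (_ : (fun k => _) = (fun k => \int[leb]_x (ind x * u k x * g x))); last by apply/funext.
have iWg : Ig (fun x => W x * `|g x|) by apply: L2M_Ig => //; exact: L2_abs.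
have [] // := @DCT R _ _ _ (fun k => measurable_funM (miu k) mg) (measurable_funM mG mg) iWg.
- by move=> k x; rewrite normrM ler_wpM2r.
- by apply: aeW => x; apply: cvgM; [exact: cG|exact: cvg_cst].
Unshelve. all: by end_near. Qed.

(* [G] is the Hartley transform of [f] in L^2(K), defined by duality; on the line
   it is not given by an absolutely convergent integral. *)
Definition transform K f G := [/\ measurable_fun setT G, L2 (fun x => chi K x * f x), L2 (fun x => G (rho K x)) &
  forall g, Ig (fun x => g (rho K x)) -> L2 (fun x => g (rho K x)) ->
    \int[leb]_x (chi K x * f x * psi K (fun xi => g (rho K xi)) x) = (2 * pi)^-1 * \int[leb]_x (G (rho K x) * g (rho K x))].

Lemma psi_line c x : psi Line c x = (2 * pi)^-1 * ht Line c x.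
Proof.
rewrite /psi /ht; congr (_ * _); apply: Int_ext => xi.
by rewrite (congr1 (fun h => h xi) (chi_Line c)) /= mulrC [x * xi]mulrC mulrC.
Qed.

Lemma L2_chi_psi K c : Ig c -> L2 c -> L2 (fun x => chi K x * psi K c x).
Proof.
case: K => ic Lc.
  have := test_L2 (@test_one R); under eq_fun do rewrite mulr1; move=> Lchi.
  by apply: (L2Mb Lchi (measurable_psi Torus ic)) => x; exact: psi_bound.
rewrite chi_Line (_ : psi Line c = fun x => (2 * pi)^-1 * ht Line c x); last by apply/funext => x; exact: psi_line.
by apply: L2Z; have [] := bessel_line ic Lc.
Qed.

Lemma transformB K f f' G G' : transform K f G -> transform K f' G' ->
  transform K (fun x => f x - f' x) (fun z => G z - G' z).
Proof.
move=> [mG Lf LG hG] [mG' Lf' LG' hG'].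
have Lff : L2 (fun x => chi K x * (f x - f' x)).
  by have := L2B Lf Lf'; congr L2; apply/funext => x; rewrite mulrBr.
split => //; [exact: measurable_funB|exact: L2B|].
move=> g ig Lg; have Lp := L2_chi_psi K ig Lg.
have iP h : L2 (fun x => chi K x * h x) -> Ig (fun x => chi K x * h x * psi K (fun xi => g (rho K xi)) x).
  move=> Lh; have := L2M_Ig Lh Lp; congr Ig; apply/funext => x.
  move: (psi _ _ _) => p; transitivity (chi K x ^+ 2 * (h x * p)); first by ring.
  by rewrite chi_sqr mulrA.
transitivity (\int[leb]_x (chi K x * f x * psi K (fun xi => g (rho K xi)) x - chi K x * f' x * psi K (fun xi => g (rho K xi)) x)).
  by apply: Int_ext => x; ring.
rewrite (IntB (iP _ Lf) (iP _ Lf')) hG// hG'// -mulrBr -(IntB (L2M_Ig LG Lg) (L2M_Ig LG' Lg)).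
by congr (_ * _); apply: Int_ext => x; rewrite mulrBl.
Qed.

Lemma n2B_le f g : L2 f -> L2 g -> n2 (fun x => f x - g x) <= 2 * n2 f + 2 * n2 g.
Proof.
move=> Lf Lg; have [_ i1] := Lf; have [_ i2] := Lg; have [_ i3] := L2B Lf Lg.
rewrite /n2 -!IntZ// -IntD; [|exact: IgZ|exact: IgZ]; apply: Int_le => // [|x]; first by apply: IgD; exact: IgZ.
by have := sqr_ge0 (f x + g x); lra.
Qed.

(** On the torus the integral converges absolutely. On the line the transforms of the truncations of
    f form a fast Cauchy sequence by Bessel's inequality, and the norm of their weak limit G is
    bounded by testing against G. *)
Lemma transform_exists K f : L2 (fun x => chi K x * f x) ->
  exists2 G, transform K f G & n2 (fun x => G (rho K x)) <= 2 * pi * n2 (fun x => chi K x * f x).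
Proof.
case: K => Lf.
  have Lchi := test_L2 (@test_one R); have iF : Ig (fun x => chi Torus x * f x).
    have := L2M_Ig Lf Lchi; congr Ig; apply/funext => x.
    by rewrite mulr1 mulrAC -expr2 chi_sqr.
  have [Lh bh] := bessel iF Lf; exists (ht Torus f) => //; split => //; first exact: measurable_ht.
  by move=> g ig Lg; rewrite pairing//; congr (_ * _); apply: Int_ext => x; rewrite mulrC.
move: Lf; rewrite chi_Line => Lf; have [mf if2] := Lf.
pose B := n2 f; have tp := two_pi_gt0 (R := R).
have Lt n : L2 (fun x => (1 - cut n x) * f x).
  apply: L2_le _ Lf _ => [|x]; first by apply: measurable_funM => //; apply: measurable_funB => //; exact: measurable_cut.
  rewrite normrM ler_piMl// cutE; case: (`|x| <= n%:R)%R; rewrite ?subrr ?subr0 ?normr0 ?normr1//.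
have tail0 : n2 (fun x => (1 - cut n x) * f x) @[n --> \oo] --> (0 : R).
  rewrite (_ : (fun n => _) = (fun n => n2 f - \int[leb]_x (cut n x * f x ^+ 2))); last first.
    have ic n : Ig (fun x => cut n x * f x ^+ 2).
      have := IgMb (M := 1) if2 (measurable_cut n) => h.
      have {}h := h _; suff : Ig (fun x => f x ^+ 2 * cut n x) by congr Ig; apply/funext => x; rewrite mulrC.
      by apply: h => x; rewrite cutE; case: (`|x| <= n%:R)%R; rewrite ?normr0 ?normr1.
    apply/funext => n; rewrite /n2 -IntB//; apply: Int_ext => x.
    have := cut_sqr n x; move: (cut n x) => c h; transitivity ((1 - 2 * c + c ^+ 2) * f x ^+ 2); first by ring.
    by rewrite h; ring.
  by rewrite -[X in _ --> X](subrr (n2 f)); apply: cvgB; [exact: cvg_cst|exact: DCT_cut].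
(* Radii with tails at most 8^(-k), the rate that [L2_complete] asks for. *)
have /choice [r hr] k : exists n : nat, n2 (fun x => (1 - cut n x) * f x) <= 2^-1 ^+ k * 4^-1 ^+ k.
  have pk : (0 : R) < 2^-1 ^+ k * 4^-1 ^+ k by rewrite mulr_gt0 ?exprn_gt0 ?invr_gt0.
  have /cvgrPdist_le/(_ _ pk)[N _ hN] := tail0.
  by exists N; have := hN N (leqnn N); rewrite /= sub0r normrN ger0_norm ?n2_ge0.
pose fk k x := cut (r k) x * f x.
have Lk k : L2 (fk k).
  apply: L2_le _ Lf _ => [|x]; first by apply: measurable_funM => //; exact: measurable_cut.
  by rewrite normrM ler_piMl// cutE; case: (`|x| <= (r k)%:R)%R; rewrite ?normr0 ?normr1.
have ik k : Ig (fk k).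
  have := L2M_Ig Lf (_ : L2 (cut (r k) : R -> R)) => h.
  suff : Ig (fun x => f x * cut (r k) x) by congr Ig; apply/funext => x; rewrite mulrC.
  apply: h; split; first exact: measurable_cut.
  by have := Ig_cut Line (r k) (R := R); under eq_fun do rewrite -cut_sqr.
pose u k := ht Line (fk k).
have bess (h : R -> R) : Ig h -> L2 h -> L2 (ht Line h) /\ n2 (ht Line h) <= 2 * pi * n2 h.
  exact: bessel_line.
have uB k m x : u k x - u m x = ht Line (fun y => fk k y - fk m y) x.
  rewrite /u /ht -IntB; last 2 first.
  - by apply: Ig_ht; rewrite chi_Line.
  - by apply: Ig_ht; rewrite chi_Line.
  by apply: Int_ext => y; ring.
have [||G LG hG] := @L2_complete u (2 * pi * 4).
- by move=> k; have [] := bess _ (ik k) (Lk k).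
- move=> k; under [X in n2 X]eq_fun do rewrite uB.
  apply: (le_trans (bess _ (IgB (ik k.+1) (ik k)) (L2B (Lk k.+1) (Lk k))).2).
  rewrite -!mulrA ler_wpM2l// ler_wpM2l ?(ltW (pi_gt0 R))//.
  rewrite (_ : (fun x => _) = (fun x => (1 - cut (r k) x) * f x - (1 - cut (r k.+1) x) * f x)); last first.
    by apply/funext => x; rewrite /fk; ring.
  apply: (le_trans (n2B_le (Lt _) (Lt _))).
  have h1 := hr k; have h2 := hr k.+1; move: h1 h2; rewrite -!exprMn exprS.
  have : (0 : R) <= (2^-1 * 4^-1) ^+ k by rewrite exprn_ge0.
  move: (_ ^+ k) (n2 _) (n2 _) => p a b p0 h1 h2.
  rewrite (_ : 2^-1 * 4^-1 = 8^-1 :> R) in h2; last by field.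
  lra.
have Lu k : L2 (u k) by have [] := bess _ (ik k) (Lk k).
exists G.
  split => // [||g ig Lg]; [by case: LG|by rewrite chi_Line|].
  have Lp := L2_chi_psi Line ig Lg; rewrite chi_Line in Lp.
  have eqk k : \int[leb]_x (u k x * g x) = 2 * pi * (\int[leb]_x (f x * psi Line g x) - \int[leb]_x ((1 - cut (r k) x) * f x * psi Line g x)).
    rewrite -(IntB (L2M_Ig Lf Lp) (L2M_Ig (Lt (r k)) Lp)).
    have := @pairing R Line (fk k) g _ ig; rewrite chi_Line => /(_ (ik k)) h.
    apply: (mulfI (invr_neq0 (lt0r_neq0 tp))); rewrite mulKf ?lt0r_neq0// (_ : \int[leb]_x (u k x * g x) = \int[leb]_x (g x * u k x)).
      rewrite -h; apply: Int_ext => x; rewrite (congr1 (fun h => h x) (chi_Line (fk k))) /fk; ring.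
    by apply: Int_ext => x; rewrite mulrC.
  have c1 := hG g Lg.
  have c2 : (fun k => \int[leb]_x (u k x * g x)) @ \oo --> 2 * pi * \int[leb]_x (f x * psi Line g x).
    rewrite (_ : (fun k => _) = (fun k => 2 * pi * (\int[leb]_x (f x * psi Line g x) - \int[leb]_x ((1 - cut (r k) x) * f x * psi Line g x)))); last first.
      by apply/funext => k.
    apply: cvgM; first exact: cvg_cst; rewrite -[X in _ --> X]subr0; apply: cvgB; first exact: cvg_cst.
    apply: norm_cvg0; have cg : (fun k => geometric (nr (psi Line g)) 2^-1 k) @ \oo --> (0 : R).
      by apply: cvg_geometric; rewrite ger0_norm// invf_lt1// ltr1n.
    apply: (squeeze_cvgr _ (cvg_cst 0) cg); apply: nearW => k; rewrite normr_ge0/=.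
    apply: (le_trans (CS_abs (Lt _) Lp)); rewrite mulrC ler_wpM2l ?nr_ge0//.
    rewrite -[leRHS]ger0_norm ?exprn_ge0// -sqrtr_sqr ler_sqrt ?sqr_ge0//.
    apply: (le_trans (hr k)); rewrite expr2 ler_wpM2l ?exprn_ge0// lerXn2r ?nnegrE//.
    by rewrite lef_pV2 ?posrE// ler_nat.
  have e : \int[leb]_x (G x * g x) = 2 * pi * \int[leb]_x (f x * psi Line g x) by exact: (cvg_unique _ c1 c2).
  rewrite [in RHS](_ : \int[leb]_x _ = \int[leb]_x (G x * g x))// e mulKf ?lt0r_neq0//.
  by apply: Int_ext => x; rewrite (congr1 (fun h => h x) (chi_Line f)).
have cG := hG G LG.
have bk k : `|\int[leb]_x (u k x * G x)| <= Num.sqrt (2 * pi * n2 f) * nr G.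
  apply: (le_trans (CS_abs (Lu k) LG)); rewrite ler_wpM2r ?nr_ge0// ler_sqrt; last by rewrite mulr_ge0 ?n2_ge0 ?ltW.
  apply: (le_trans (bess _ (ik k) (Lk k)).2); rewrite ler_wpM2l ?(ltW tp)//; apply: n2_le => // x.
  by rewrite normrM ler_piMl// cutE; case: (`|x| <= (r k)%:R)%R; rewrite ?normr0 ?normr1.
have : `|\int[leb]_x (G x * G x)| <= Num.sqrt (2 * pi * n2 f) * nr G.
  have c : (fun k => `|\int[leb]_x (u k x * G x)|) @ \oo --> `|\int[leb]_x (G x * G x)| by exact: cvg_norm.
  by apply: (cvgr_to_le c); apply: nearW.
have -> : \int[leb]_x (G x * G x) = nr G ^+ 2 by rewrite sqr_nr; apply: Int_ext => x; rewrite expr2.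
rewrite ger0_norm ?sqr_ge0// => h.
rewrite -[n2 (fun x => G (rho Line x))]/(n2 G) -[n2 G]sqr_nr.
have [g0|g0] := eqVneq (nr G) 0; first by rewrite g0 expr0n mulr_ge0 ?n2_ge0 ?ltW.
have gp : 0 < nr G by rewrite lt_neqAle eq_sym g0 nr_ge0.
move: h; rewrite expr2 ler_pM2r// => h.
have S0 : 0 <= 2 * pi * n2 f by rewrite mulr_ge0 ?n2_ge0 ?(ltW tp).
by rewrite -[leRHS]sqr_sqrtr// expr2 ler_pM ?nr_ge0.
Qed.

Lemma test_psi K phi : test_space K phi ->
  {ae leb, forall x, chi K x * phi x = chi K x * psi K (fun xi => ht K phi (rho K xi)) x}.
Proof.
move=> tp; have := ae_notin [:: 0 : R]; apply: filterS => x; rewrite inE => x0.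
have [xd|xd] := boolP (x \in dom K); last by rewrite chi_out// !mul0r.
by rewrite (inversion tp xd) //; left.
Qed.

Lemma Ig_ht_rho K phi : test_space K phi -> Ig (fun x => ht K phi (rho K x)) /\ L2 (fun x => ht K phi (rho K x)).
Proof.
move=> tp; have := Ig_wt_ht 0 tp.
by rewrite (_ : (fun x => wt 0 _ * _) = fun x => ht K phi (rho K x))//; apply/funext => x; rewrite wt0 mul1r.
Qed.

Lemma transform_test K f G phi : transform K f G -> test_space K phi ->
  \int[leb]_x (chi K x * (f x * phi x)) = (2 * pi)^-1 * \int[leb]_x (G (rho K x) * ht K phi (rho K x)).
Proof.
move=> [mG [mf _] LG hG] tp; have [ih Lh] := Ig_ht_rho tp.
rewrite -(hG (ht K phi) ih Lh); apply: Int_ae.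
- under eq_fun do rewrite mulrA; apply: measurable_funM => //; exact: smooth_measurable (test_smooth tp).
- by apply: measurable_funM => //; exact: measurable_psi.
apply: filterS (test_psi tp) => x E.
by rewrite mulrCA E; ring.
Qed.

(** Integrated against a test function, the two sides agree by [transform_test] and [pairing];
    [ae0_of_tests] concludes. *)
Lemma transform_recover K f G : transform K f G -> Ig (fun x => G (rho K x)) ->
  {ae leb, forall x, chi K x * f x = chi K x * psi K (fun xi => G (rho K xi)) x}.
Proof.
move=> tr iG; have [mG Lf LG hG] := tr; have mp := measurable_psi K iG.
pose H x := chi K x * f x - chi K x * psi K (fun xi => G (rho K xi)) x.
have LH : L2 H by apply: L2B => //; exact: L2_chi_psi.
suff : {ae leb, forall x, H x = 0} by apply: filterS => x /eqP; rewrite subr_eq0 => /eqP.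
apply: (@ae0_of_tests K) => [n|x xd|phi tp].
- have := L2M_Ig LH (_ : L2 (\1_(`[- n%:R, n%:R[) : R -> R)) => h.
  suff : Ig (fun x => H x * \1_(`[- n%:R, n%:R[) x) by congr Ig; apply/funext => x; rewrite mulrC.
  apply: h; split; first exact: measurable_ind.
  have := Ig_ind (- n%:R : R) n%:R true true; congr Ig; apply/funext => x.
  by rewrite indE; case: (_ \in _); rewrite ?expr1n ?expr0n.
- by rewrite /H chi_out// !mul0r subrr.
have it := test_Ig tp; have Lt := test_L2 tp; have [ih Lh] := Ig_ht_rho tp.
have cs h x : chi K x * h x * (chi K x * phi x) = chi K x * (h x * phi x).
  by transitivity (chi K x ^+ 2 * (h x * phi x)); [ring|rewrite chi_sqr].
have i1 : Ig (fun x => chi K x * (f x * phi x)).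
  by have := L2M_Ig Lf Lt; congr Ig; apply/funext => x; exact: cs.
have i2 : Ig (fun x => chi K x * phi x * psi K (fun xi => G (rho K xi)) x).
  by apply: (IgMb it mp) => x; exact: psi_bound.
transitivity (\int[leb]_x (chi K x * (f x * phi x) - chi K x * phi x * psi K (fun xi => G (rho K xi)) x)).
  by apply: Int_ext => x; rewrite /H; ring.
by rewrite IntB// (transform_test tr tp) (pairing it iG) subrr.
Qed.

(** Duality turns the definition of J^s into the equality of D and wt s * G against transforms of
    test functions; [freq_separation] with p = |s| makes it hold almost everywhere. *)
Lemma J_transfer K s f h G D : transform K f G -> transform K h D -> is_J K s f h ->
  {ae leb, forall x, D (rho K x) = wt s (rho K x) * G (rho K x)}.
Proof.
move=> tf th hJ; have [mG _ LG hG] := tf; have [mD _ LD hD] := th.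
have mw := @measurable_wt R s.
suff : {ae leb, forall x, (fun z => D z - wt s z * G z) (rho K x) = 0}.
  by apply: filterS => x /eqP; rewrite subr_eq0 => /eqP.
have wle p q : p <= q -> forall z : R, `|wt p z| <= wt q z by move=> pq z; rewrite ger0_norm ?wt_ge0//; exact: wt_mono.
apply: (@freq_separation K `|s| (fun z => D z - wt s z * G z)) => [||phi tp].
- by apply: measurable_funB => //; exact: measurable_funM.
- have mr := @measurable_rho R K.
  have mwr q (E : R -> R) : measurable_fun setT E -> measurable_fun setT (fun x => wt q (rho K x) * E (rho K x)).
    by move=> mE; apply: measurable_funM; [exact: measurableT_comp (measurable_wt q) mr|exact: measurableT_comp mE mr].
  have L1 : L2 (fun x => wt (- `|s|) (rho K x) * D (rho K x)).
    apply: L2_le _ LD _ => [|x]; first by exact: mwr.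
    by rewrite normrM ler_piMl// ger0_norm ?wt_ge0// wt_le1// oppr_le0.
  have L2' : L2 (fun x => wt (s - `|s|) (rho K x) * G (rho K x)).
    apply: L2_le _ LG _ => [|x]; first by exact: mwr.
    by rewrite normrM ler_piMl// ger0_norm ?wt_ge0// wt_le1// subr_le0 ler_norm.
  have := L2B L1 L2'; congr L2; apply/funext => x.
  by rewrite /= addrC wtD; ring.
have [ih Lh] := Ig_ht_rho tp; have [iw Lw] := Ig_wt_ht s tp.
have := hJ phi tp; rewrite /multiplier_distr !integral_spaceE (transform_test th tp).
have -> : \int[leb]_x (chi K x * (f x * multiplier K (fun xi => J_symbol s (- xi)) phi x)) =
   \int[leb]_x (chi K x * f x * psi K (fun xi => wt s (rho K xi) * ht K phi (rho K xi)) x).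
  by apply: Int_ext => x; rewrite multiplier_JE// mulrA.
rewrite (hG (fun z => wt s z * ht K phi z) iw Lw) => /(mulfI (invr_neq0 (lt0r_neq0 (two_pi_gt0 (R := R))))) E.
rewrite (_ : \int[leb]_x _ = \int[leb]_x (D (rho K x) * ht K phi (rho K x) - G (rho K x) * (wt s (rho K x) * ht K phi (rho K x)))); last first.
  by apply: Int_ext => x; rewrite /=; ring.
by rewrite (IntB (L2M_Ig LD Lh) (L2M_Ig LG Lw)) E subrr.
Qed.

End Separation.

(** * The weak equation implies the evolution equation *)
Section DuBoisReymond.
Context {R : realType}.
Local Notation leb := (@lebesgue_measure R).
Implicit Types (t u x y : R).

Let bmp x : R := flat 0 (1 - x ^+ 2).
(** A smooth step from 0 to [mass], out of which smooth plateaus are built. *)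
Let prim y : R := \int[leb]_(x in `]-oo, y]) bmp x.
Let mass := \int[leb]_x bmp x.

Let bmp_smooth : smooth bmp.
Proof.
apply: smooth_comp; first exact: smooth_flat.
by apply: smoothB; [exact: smooth_cst|apply: smoothM; exact: smooth_id].
Qed.

Let bmp_ge0 x : 0 <= bmp x. Proof. exact: flat_ge0. Qed.

Let bmp_supp x : 1 <= `|x| -> bmp x = 0.
Proof.
by move=> h; rewrite /bmp flat_le0// subr_le0 -[x ^+ 2]real_normK ?num_real// exprn_ege1.
Qed.

Let Ig_bmp : Ig bmp.
Proof.
have : test_space Line bmp by split; [apply/smoothE|exists 1 => x /ltW; exact: bmp_supp].
by move/test_Ig; rewrite chi_Line.
Qed.

Let primE y : prim y = \int[leb]_x ((x <= y)%R%:R * bmp x).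
Proof.
rewrite /prim Rintegral_mkcond; apply: Int_ext => x; rewrite patchE mem_setE in_itv/=.
by case: (x <= y)%R; rewrite ?mul1r ?mul0r.
Qed.

Let Ig_cutoff y : Ig (fun x => (x <= y)%R%:R * bmp x).
Proof.
have m : measurable_fun setT (fun x : R => (x <= y)%R%:R : R).
  apply: (measurableT_comp (f := fun b : bool => b%:R : R)) => //.
  exact: measurable_fun_ler.
have := IgMb (M := 1) Ig_bmp m; move=> h.
suff : Ig (fun x => bmp x * (x <= y)%R%:R) by congr Ig; apply/funext => x; rewrite mulrC.
by apply: h => x; case: (x <= y)%R; rewrite ?normr1 ?normr0.
Qed.

Let prim_bound y : `|prim y| <= mass.
Proof.
rewrite primE ger0_norm; last by apply: Int_ge0 => x; rewrite mulr_ge0.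
by apply: Int_le => // x; case: (x <= y)%R; rewrite ?mul1r ?mul0r.
Qed.

Let prim_low y : y <= -1 -> prim y = 0.
Proof.
move=> y1; rewrite primE -[RHS](Int0 (R := R)); apply: Int_ext => x.
case: leP => h; rewrite ?mul0r// mul1r bmp_supp// ler0_norm; lra.
Qed.

Let prim_high y : 1 <= y -> prim y = mass.
Proof.
move=> y1; rewrite primE; apply: Int_ext => x.
by case: leP => h; rewrite ?mul1r// mul0r bmp_supp// ger0_norm; lra.
Qed.

Let is_derive_prim y : is_derive y 1 prim (bmp y).
Proof.
have ib : leb.-integrable [set` Interval -oo%O (BRight (y + 1))] (EFin \o bmp).
  by apply: (integrableS measurableT _ (@subsetT _ _) Ig_bmp); exact: measurable_itv.
have y1 : y < y + 1 by rewrite ltrDl.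
have [d e] := continuous_FTC1 y1 ib (ltNyr _) (@smooth_continuous _ _ bmp_smooth y).
by rewrite -e derive1E; exact: DeriveDef.
Qed.

Let prim_smooth : smooth prim.
Proof. by have [d e] := derive1P is_derive_prim; case => [//|n]; split; rewrite ?e. Qed.

Let mass_gt0 : 0 < mass.
Proof.
have m0 : 0 <= mass by exact: Int_ge0.
rewrite lt_neqAle m0 andbT eq_sym; apply/negP => /eqP z.
have p0 y : prim y = 0 by have := prim_bound y; rewrite z normr_le0 => /eqP.
have := is_derive_prim 0; rewrite (_ : prim = fun=> 0); last by apply/funext.
move=> d; have := @derive_val _ _ _ _ _ _ _ d; rewrite derive_cst /bmp expr0n subr0 => e.
by have := @flat_gt0 R 0 1 ltr01; rewrite -e ltxx.
Qed.

Section Times.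
Variables (T : R) (A g : R -> R).
Hypotheses (uA : ucont_on 0 T A) (ug : ucont_on 0 T g).
Hypothesis weak : forall th, smooth th -> (exists a b : R, [/\ 0 < a, b < T & forall t, t \notin `[a, b] -> th t = 0]) ->
  \int[leb]_(t in `[0, T]) (derive1 th t * A t + th t * g t) = 0.

(** Extension by 0 outside [0,T], so that translated and dilated integrals make sense on R. *)
Let ext (f : R -> R) t := \1_(`[0, T]) t * f t.

Let ext_bound f : ucont_on 0 T f -> exists2 B : R, 0 <= B & forall t, `|ext f t| <= B.
Proof.
move=> /ucont_bounded[B hB]; exists (Num.max B 0); first by rewrite le_max lexx orbT.
move=> t; rewrite /ext indE in_itv/=; case: (boolP (_ <= _ <= _)) => h; rewrite ?mul1r ?mul0r ?normr0 le_max ?hB ?lexx ?orbT//.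
Qed.

Let Ig_ext f : ucont_on 0 T f -> Ig (ext f).
Proof.
move=> /ucont_int; rewrite integrable_mkcond; last exact: measurable_itv.
congr (is_true (leb.-integrable _ _)).
apply/funext => t; rewrite patchE mem_setE in_itv/= /ext /= indE in_itv/=.
by case: (_ <= _ <= _); rewrite ?mul1r ?mul0r.
Qed.

Let moll (f : R -> R) (t : R) n := \int[leb]_y (bmp y * ext f (n.+1%:R^-1 * y + t)).

Let moll_cvg f t : ucont_on 0 T f -> 0 < t < T -> moll f t @ \oo --> mass * f t.
Proof.
move=> uf tT; have [B B0 hB] := ext_bound uf; have mf := Ig_meas (Ig_ext uf).
have mF n : measurable_fun setT (fun y => bmp y * ext f (n.+1%:R^-1 * y + t)).
  apply: measurable_funM; first exact: Ig_meas Ig_bmp.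
  by apply: measurableT_comp mf _; apply: measurable_funD => //; exact: measurable_funM.
have le n y : `|bmp y * ext f (n.+1%:R^-1 * y + t)| <= B * bmp y.
  by rewrite normrM mulrC [`|bmp y|]ger0_norm// ler_wpM2r.
have cv : {ae leb, forall y, (fun n => bmp y * ext f (n.+1%:R^-1 * y + t)) @ \oo --> bmp y * f t}.
  apply: aeW => y; apply: cvgM; first exact: cvg_cst.
  have c0 : (fun n => n.+1%:R^-1 * y + t : R) @ \oo --> t.
    rewrite -[X in _ --> X]add0r -[X in _ --> X + _](mul0r y); apply: cvgD; last exact: cvg_cst.
    by apply: cvgM; [exact: cvg_harmonic|exact: cvg_cst].
  apply/cvgrPdist_le => e e0; have [d d0 hd] := uf e e0.
  have /andP[t0 tT'] := tT; near=> n.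
  have n1 : `|t - (n.+1%:R^-1 * y + t)| < d.
    by near: n; move/cvgrPdist_lt : c0; apply.
  have n2 : `|t - (n.+1%:R^-1 * y + t)| < t.
    by near: n; move/cvgrPdist_lt : c0; apply.
  have n3 : `|t - (n.+1%:R^-1 * y + t)| < T - t.
    by near: n; move/cvgrPdist_lt : c0; apply; rewrite subr_gt0.
  have n4 : 0 <= n.+1%:R^-1 * y + t <= T.
    by move: n2 n3; move: (n.+1%:R^-1 * y) => w; rewrite !ltr_norml => /andP[a1 a2] /andP[a3 a4]; apply/andP; split; lra.
  rewrite /ext indE in_itv/= n4 mul1r; apply: hd => //.
  by rewrite (ltW t0) (ltW tT').
have [_] := @DCT R _ _ _ mF (measurable_funM (Ig_meas Ig_bmp) (measurable_cst (f t))) (IgZ B Ig_bmp) le cv.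
rewrite (_ : \int[leb]_x _ = mass * f t)//.
by rewrite /mass mulrC -IntZ//; apply: Int_ext => y; rewrite mulrC.
Unshelve. all: by end_near. Qed.

Lemma near_harmonic (e : R) : 0 < e -> \forall n \near \oo, (n.+1%:R^-1 : R) < e.
Proof.
move=> e0; have /cvgrPdist_lt/(_ _ e0) := @cvg_harmonic R.
by apply: filterS => n; rewrite /= sub0r normrN ger0_norm.
Qed.

(** For large n, th n is a smooth plateau of height [mass] between t0 and t, with ramps within 1 /
    (n + 1) of the two ends. Its derivative concentrates there and yields mollified values of A at
    t0 and t. *)
Lemma dubois_open t0 t : 0 < t0 -> t0 < t -> t < T -> A t - A t0 = \int[leb]_(x in `[t0, t]) g x.
Proof.
move=> a0 a1 a2.
pose th n x := prim (n.+1%:R * x + - (n.+1%:R * t0)) - prim (n.+1%:R * x + - (n.+1%:R * t)).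
have lin (n : nat) (a x : R) : is_derive x 1 (fun x : R => n.+1%:R * x + - a) n.+1%:R.
  apply: (@is_derive_quad _ _ _ _ 0) => h; rewrite mul0r.
  by have -> : n.+1%:R * (x + h) + - a - (n.+1%:R * x + - a) - h * n.+1%:R = 0 by [ring]; rewrite normr0.
have d1 n x : is_derive x 1 (th n) (bmp (n.+1%:R * x + - (n.+1%:R * t0)) * n.+1%:R - bmp (n.+1%:R * x + - (n.+1%:R * t)) * n.+1%:R).
  have dc a := @is_derive1_comp R prim (fun x => n.+1%:R * x + - a) x _ _ (is_derive_prim _) (lin n a x).
  exact: (is_deriveB (dc _) (dc _)).
have sth n : smooth (th n).
  have sl a : smooth (fun x => n.+1%:R * x + - a).
    by apply: smoothD; [apply: smoothM; [exact: smooth_cst|exact: smooth_id]|exact: smooth_cst].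
  by apply: smoothB; apply: smooth_comp => //; exact: sl.
have t0T : 0 < t0 < T by rewrite a0 (lt_trans a1 a2).
have tT : 0 < t < T by rewrite a2 (lt_trans a0 a1).
have shiftE n a f : ucont_on 0 T f -> Ig (fun x => n.+1%:R * (bmp (n.+1%:R * x + - (n.+1%:R * a)) * ext f x)) /\
    \int[leb]_x (n.+1%:R * (bmp (n.+1%:R * x + - (n.+1%:R * a)) * ext f x)) = moll f a n.
  move=> uf; pose N : R := n.+1%:R; have N0 : 0 < N by rewrite ltr0n.
  have [B B0 hB] := ext_bound uf; have mf := Ig_meas (Ig_ext uf).
  have ih : Ig (fun y => bmp y * ext f (N^-1 * y + a)).
    apply: (IgMb (M := B) Ig_bmp) => [|y]; last exact: hB.
    by apply: measurableT_comp mf _; apply: measurable_funD => //; exact: measurable_funM.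
  have E x : ext f x = ext f (N^-1 * (N * x + - (N * a)) + a).
    by congr ext; field; exact: lt0r_neq0.
  rewrite (_ : (fun x => _) = (fun x => N * (fun y => bmp y * ext f (N^-1 * y + a)) (N * x + - (N * a)))); last first.
    by apply/funext => x; rewrite -/N {1}(E x).
  split; first exact: IgZ (Ig_affine _ N0 ih).
  by rewrite (IntZ _ (Ig_affine _ N0 ih)) (Int_affine _ N0 ih) mulVKf// lt0r_neq0.
have mth n : measurable_fun setT (th n) by exact: smooth_measurable.
have bth n x : `|th n x| <= mass + mass.
  by rewrite /th; apply: (le_trans (ler_normB _ _)); exact: lerD.
have ithg n : Ig (fun x => th n x * ext g x).
  have := IgMb (Ig_ext ug) (mth n) (bth n); congr Ig; apply/funext => x; exact: mulrC.
have eqn : \forall n \near \oo, moll A t0 n - moll A t n + \int[leb]_x (th n x * ext g x) = 0.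
  near=> n; have h1 : (n.+1%:R^-1 : R) < t0 by near: n; exact: near_harmonic a0.
  have h2 : (n.+1%:R^-1 : R) < T - t by near: n; apply: near_harmonic; rewrite subr_gt0.
  pose N : R := n.+1%:R; have N0 : 0 < N by rewrite ltr0n.
  have := weak (sth n); move=> w; rewrite -[RHS]w; last first.
    exists (t0 - N^-1), (t + N^-1); split; [by rewrite subr_gt0|by rewrite -ltrBrDl|].
    move=> x; rewrite in_itv/= negb_and -!ltNge => /orP[h|h]; rewrite /th -/N.
      have k1 : N * x < N * t0 - 1 by rewrite -[1](mulfV (lt0r_neq0 N0)) -mulrBr ltr_pM2l.
      have k2 : N * t0 < N * t by rewrite ltr_pM2l.
      by rewrite !prim_low ?subrr//; move: k1 k2; lra.
    have k1 : N * t + 1 < N * x by rewrite -[1](mulfV (lt0r_neq0 N0)) -mulrDr ltr_pM2l.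
    have k2 : N * t0 < N * t by rewrite ltr_pM2l.
    by rewrite !prim_high ?subrr//; move: k1 k2; lra.
  have [_ th'] := derive1P (d1 n).
  have [i1 <-] := shiftE n t0 A uA; have [i2 <-] := shiftE n t A uA.
  rewrite -(IntB i1 i2) -(IntD (IgB i1 i2) (ithg n)) Int_itv th'.
  by apply: Int_ext => x; rewrite /ext; ring.
have prim_cvg a x : x != a -> (fun n => prim (n.+1%:R * x + - (n.+1%:R * a))) @ \oo --> mass * (a <= x)%R%:R.
  move=> xa; apply: cvg_near_cst; near=> n.
  have h : (n.+1%:R^-1 : R) < `|x - a| by near: n; apply: near_harmonic; rewrite normr_gt0 subr_eq0.
  pose N : R := n.+1%:R; have N0 : 0 < N by rewrite ltr0n.
  have hN : 1 < N * `|x - a| by rewrite mulrC -ltr_pdivrMr// mul1r.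
  rewrite -/N -mulrBr; case: leP => ax; rewrite ?mulr1 ?mulr0.
    by apply: prim_high; move: hN; rewrite ger0_norm ?subr_ge0// => /ltW.
  by apply: prim_low; move: hN; rewrite ltr0_norm ?subr_lt0// mulrN ltrNr => /ltW.
have lim3 : (fun n => \int[leb]_x (th n x * ext g x)) @ \oo --> mass * \int[leb]_(x in `[t0, t]) g x.
  have iI : Ig (fun x => \1_(`[t0, t]) x * ext g x).
    have := IgMb (M := 1) (Ig_ext ug) (measurable_ind (BLeft t0) (BRight t)) _.
    move=> h; suff : Ig (fun x => ext g x * \1_(`[t0, t]) x) by congr Ig; apply/funext => x; exact: mulrC.
    by apply: h => x; rewrite indE; case: (_ \in _); rewrite ?normr1 ?normr0.
  have -> : mass * \int[leb]_(x in `[t0, t]) g x = \int[leb]_x (mass * (\1_(`[t0, t]) x * ext g x)).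
    rewrite (IntZ _ iI) Int_itv; congr (_ * _); apply: Int_ext => x.
    rewrite /ext !indE !in_itv/=; case: (boolP (t0 <= x <= t)) => [/andP[h1 h2]|_]; last by rewrite !mul0r.
    by rewrite (_ : (0 <= x <= T)) ?mul1r//; apply/andP; split; lra.
  have le n x : `|th n x * ext g x| <= (mass + mass) * `|ext g x| by rewrite normrM ler_wpM2r.
  have cv : {ae leb, forall x, (fun n => th n x * ext g x) @ \oo --> mass * (\1_(`[t0, t]) x * ext g x)}.
    have := ae_notin [:: t0; t]; apply: filterS => x; rewrite !inE negb_or => /andP[x1 x2].
    rewrite mulrA; apply: cvgM; last exact: cvg_cst.
    have -> : mass * \1_(`[t0, t]) x = mass * (t0 <= x)%R%:R - mass * (t <= x)%R%:R.
      rewrite -mulrBr indE in_itv/=; congr (_ * _); rewrite [x <= t]leNgt lt_neqAle eq_sym x2/=.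
      case: (leP t x) => h; rewrite ?andbF ?andbT ?subr0//.
      by rewrite (_ : t0 <= x) ?subrr//; apply: le_trans h; exact: ltW.
    by apply: cvgB; exact: prim_cvg.
  by have [] := @DCT R _ _ _ (fun n => Ig_meas (ithg n)) (Ig_meas (IgZ mass iI)) (IgZ _ (Ig_abs (Ig_ext ug))) le cv.
have L : (fun n => moll A t0 n - moll A t n + \int[leb]_x (th n x * ext g x)) @ \oo -->
   mass * A t0 - mass * A t + mass * \int[leb]_(x in `[t0, t]) g x.
  by apply: cvgD => //; apply: cvgB; exact: moll_cvg.
have L0 : (fun n => moll A t0 n - moll A t n + \int[leb]_x (th n x * ext g x)) @ \oo --> (0 : R).
  exact: cvg_near_cst.
have : mass * A t0 - mass * A t + mass * \int[leb]_(x in `[t0, t]) g x = 0 by exact: (cvg_unique _ L L0).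
rewrite -mulrBr -mulrDr => /eqP; rewrite mulf_eq0 gt_eqF//= => /eqP; lra.
Unshelve. all: by end_near. Qed.

(** The ends 0 and T, which the supports of test functions avoid, are reached by uniform continuity
    of A and boundedness of g. *)
Lemma dubois t0 t : 0 <= t0 -> t0 <= t -> t <= T -> A t - A t0 = \int[leb]_(x in `[t0, t]) g x.
Proof.
move=> a0 a1 a2.
have ig a b : 0 <= a -> b <= T -> leb.-integrable `[a, b] (EFin \o g).
  by move=> h1 h2; apply: ucont_int; exact: ucont_sub h1 h2 ug.
move: a1 a2; rewrite le_eqVlt => /predU1P[<- a2|a1 a2].
  rewrite subrr; apply/esym/eqP; rewrite -normr_le0.
  have [B hB] := ucont_bounded ug; rewrite -[leRHS](mulr0 B) -(subrr t0).
  by apply: (Rint_le_cst (lexx t0) (ig _ _ a0 a2)) => x /andP[h1 h2]; apply: hB; lra.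
have room (h : R) : 0 < h -> h <= (t - t0) / 4 ->
    [/\ t0 <= t0 + h, t0 + h <= t & t0 + h <= t - h] /\ [/\ t - h <= t, 0 <= t0 + h & 0 <= t - h].
  by move=> h0 ht'; split; split; lra.
have close (x1 x2 x3 x4 x5 x6 e : R) : `|x1 - x3| <= e / 4 -> `|x4 - x2| <= e / 4 -> `|x5| <= e / 4 -> `|x6| <= e / 4 ->
    `|x1 - x2 - (x5 + (x3 - x4 + x6))| <= e.
  by rewrite !ler_norml => /andP[? ?] /andP[? ?] /andP[? ?] /andP[? ?]; apply/andP; split; lra.
apply/eqP; rewrite -subr_eq0 -normr_le0; apply/ler_addgt0Pr => e e0; rewrite add0r.
have [B0 hB0] := ucont_bounded ug; pose B := Num.max B0 1.
have B1 : 0 < B by rewrite lt_max ltr01 orbT.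
have hB x : 0 <= x <= T -> `|g x| <= B by move=> h; rewrite le_max hB0.
have [d d0 hd] := uA (divr_gt0 e0 (ltr0n _ 4)).
pose h := Num.min (d / 2) (Num.min ((t - t0) / 4) (e / (4 * B))).
have h0 : 0 < h by rewrite !lt_min !divr_gt0 ?subr_gt0 ?mulr_gt0.
have hd2 : h <= d / 2 by rewrite ge_min lexx.
have ht' : h <= (t - t0) / 4 by rewrite !ge_min lexx orbT.
have hB4 : B * h <= e / 4.
  have : h <= e / (4 * B) by rewrite !ge_min lexx !orbT.
  by rewrite -(ler_pM2l B1) => /le_trans; apply; rewrite le_eqVlt; apply/orP; left; apply/eqP; field; exact: lt0r_neq0.
have e1 : A (t - h) - A (t0 + h) = \int[leb]_(x in `[t0 + h, t - h]) g x by apply: dubois_open; lra.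
have c1 := @Rint_cat R t0 (t0 + h) t g _ _ (ig _ _ a0 a2).
have c2 := @Rint_cat R (t0 + h) (t - h) t g _ _ (ig _ _ _ a2).
have [[f1 f2 f3] [f4 f5 f6]] := room h h0 ht'; have f7 : h < d by rewrite (le_lt_trans hd2)// gtr_pMr// invf_lt1// ltr1n.
rewrite (c1 f1 f2) (c2 f3 f4 f5).
have n1 : `|A t - A (t - h)| <= e / 4 .
  apply: hd; [by rewrite a2 (ltW (le_lt_trans a0 a1))|by rewrite f6 (le_trans f4 a2)|].
  by rewrite opprB addrC subrK gtr0_norm.
have n2 : `|A (t0 + h) - A t0| <= e / 4.
  apply: hd; [by rewrite f5 (le_trans f2 a2)|by rewrite a0 (le_trans f1 (le_trans f2 a2))|].
  by rewrite addrAC subrr add0r gtr0_norm.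
have small a b : 0 <= a -> a <= b -> b <= T -> b - a = h -> `|\int[leb]_(x in `[a, b]) g x| <= e / 4.
  move=> p1 p2 p3 p4; apply: le_trans hB4; rewrite -p4.
  apply: (Rint_le_cst p2 (ig _ _ p1 p3)) => x /andP[q1 q2]; apply: hB.
  by rewrite (le_trans p1 q1) (le_trans q2 p3).
have n3 : `|\int[leb]_(x in `[t0, t0 + h]) g x| <= e / 4.
  by apply: small => //; [exact: le_trans f2 a2|rewrite addrAC subrr add0r].
have n4 : `|\int[leb]_(x in `[t - h, t]) g x| <= e / 4.
  by apply: small => //; rewrite opprB addrC subrK.
by rewrite -e1; exact: close n1 n2 n3 n4.
Qed.

End Times.
End DuBoisReymond.

(** * From weak solutions to the evolution equation in frequency *)

Section SolutionEvolves.
Context {R : realType}.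
Local Notation leb := (@lebesgue_measure R).
Implicit Types (f g phi sg : R -> R) (K : spatial_domain) (x y z t u : R).

Lemma L2_ae f g : L2 f -> measurable_fun setT g -> {ae leb, forall x, f x = g x} -> L2 g /\ n2 g = n2 f.
Proof.
move=> [mf i] mg E; have E2 : {ae leb, forall x, f x ^+ 2 = g x ^+ 2} by apply: filterS E => x ->.
have [mf2 mg2] : measurable_fun setT (fun x => f x ^+ 2) /\ measurable_fun setT (fun x => g x ^+ 2).
  by split; exact: measurable_funX.
by split; [split => //; exact: Ig_ae i mg2 E2|rewrite /n2 (Int_ae mf2 mg2 E2)].
Qed.

(** As the infimum is below e, some h = J^s f has norm below e; its transform is wt s * G by
    [J_transfer], and Bessel's inequality gives the factor sqrt (2 pi). *)
Lemma H_norm_transform K s f G (e : \bar R) : transform K f G -> (H_norm K s f < e)%E ->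
  L2 (fun x => wt s (rho K x) * G (rho K x)) /\
  exists2 b : R, (b%:E < e)%E & nr (fun x => wt s (rho K x) * G (rho K x)) <= Num.sqrt (2 * pi) * b.
Proof.
move=> tf /ereal_inf_lt[_ [h [[mh hlt] hJ] <-]] he.
have [Lh hE] := Lp_norm2 mh hlt; have [D tD bD] := transform_exists Lh.
have [mG _ _ _] := tf; have [mD _ LD _] := tD; have mr := @measurable_rho R K.
have mw : measurable_fun setT (fun x => wt s (rho K x) * G (rho K x)).
  by apply: measurable_funM; [exact: measurableT_comp (measurable_wt s) mr|exact: measurableT_comp mG mr].
have [L E] := L2_ae LD mw (J_transfer tf tD hJ); split=> //.
exists (nr (fun x => chi K x * h x)); first by rewrite -hE.
have tp := two_pi_gt0 (R := R).
by rewrite /nr E -sqrtrM ?(ltW tp)// ler_sqrt// mulr_ge0 ?n2_ge0 ?(ltW tp).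
Qed.

(** A transform is chosen at each time. Continuity at each time in the H^s norm passes to the
    frequency side by linearity and becomes uniform by compactness of [0,T]. *)
Lemma transform_continuous K s T (v : R -> R -> R) : 0 <= s -> C_H K T s v ->
  exists2 G : R -> R -> R, (forall t, 0 <= t <= T -> transform K (v t) (G t)) &
    weighted_continuous K s T (fun t x => G t (rho K x)).
Proof.
move=> s0 [hv cv].
have inT t : (t \in `[0, T]) = (0 <= t <= T) by rewrite in_itv.
have /choice [G hG] t : exists G, 0 <= t <= T -> transform K (v t) G /\ L2 (fun x => wt s (rho K x) * G (rho K x)).
  have [tT|_] := boolP (0 <= t <= T); last by exists (fun=> 0).
  have [_ [mv lv] hn] : in_H K s (v t) by apply: hv; rewrite inT.
  have [Lv _] := Lp_norm2 mv lv; have [G tG _] := transform_exists Lv.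
  by exists G => _; split => //; have [] := H_norm_transform tG hn.
exists G; first by move=> t /hG[].
have mr := @measurable_rho R K; split.
  move=> t /hG[[mG _ _ _] L]; split => //; exact: measurableT_comp mG mr.
pose dist t u := nr (fun x => wt s (rho K x) * (G t (rho K x) - G u (rho K x))).
have Ld t u : 0 <= t <= T -> 0 <= u <= T -> L2 (fun x => wt s (rho K x) * (G t (rho K x) - G u (rho K x))).
  by move=> /hG[_ L1] /hG[_ L2']; have := L2B L1 L2'; congr L2; apply/funext => x; rewrite mulrBr.
have distC t u : dist t u = dist u t.
  by rewrite /dist -nrN; congr nr; apply/funext => x; rewrite -mulrN opprB.
have distD t u w : 0 <= t <= T -> 0 <= u <= T -> 0 <= w <= T -> dist t w <= dist t u + dist u w.
  move=> tT uT wT; apply: le_trans (nr_triangle (Ld _ _ tT uT) (Ld _ _ uT wT)).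
  by rewrite le_eqVlt; apply/orP; left; apply/eqP; congr nr; apply/funext => x; ring.
have loc t e : 0 <= t <= T -> 0 < e -> exists2 d : R, 0 < d & forall u, 0 <= u <= T -> `|t - u| < d -> dist u t <= e.
  move=> tT e0; pose e' := e / Num.sqrt (2 * pi).
  have sp : 0 < Num.sqrt (2 * pi : R) by rewrite sqrtr_gt0 two_pi_gt0.
  have tI : t \in `[0, T] by rewrite inT.
  have nb : nbhs (0%E : \bar R) [set y | (y < e'%:E)%E] by apply: open_nbhs_nbhs; split; [exact: open_ereal_lt_ereal|rewrite /= lte_fin divr_gt0].
  have /= := cv t tI _ nb; rewrite /within /= => /nbhs_ballP[d d0 hd]; exists d => // u uT tu.
  have uI : u \in `[0, T] by rewrite inT.
  have hu := hd u tu uI; have [tt _] := hG t tT; have [tu' _] := hG u uT.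
  have [_ [b be hb]] := H_norm_transform (transformB tu' tt) hu.
  apply: (le_trans hb); rewrite -ler_pdivlMl// mulrC; move: be; rewrite lte_fin => /ltW; exact.
move=> e e0.
have [d d0 hd] : exists2 d : R, 0 < d & forall t, 0 <= t <= T -> forall u, 0 <= u <= T -> `|t - u| < d -> dist t u <= e.
  have cov : \forall d \near (0 : R)^'+, `[0, T] `<=` (fun t => forall u, 0 <= u <= T -> `|t - u| < d -> 0 <= t <= T -> dist t u <= e).
    apply: ((compact_near_coveringP `[0, T]).1 (@segment_compact R 0 T)) => x; rewrite /= in_itv/= => xT.
    have [d0 d00 hd0] := loc x (e / 2) xT (divr_gt0 e0 (ltr0n _ 2)).
    have d2 : 0 < d0 / 2 by rewrite divr_gt0.
    exists ([set t | `|x - t| < d0 / 2], [set d | d < d0 / 2]).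
      by split => /=; [exact: (nbhsx_ballx x _ d2)|exact: nbhs_right_lt].
    move=> [t d] /= [xt dd] u uT tu tT.
    have xu : `|x - u| < d0 by have := ler_distD t x u; move: xt dd tu; lra.
    have xt' : `|x - t| < d0 by move: xt d2; lra.
    apply: le_trans (distD _ _ _ tT xT uT) _; rewrite [dist x u]distC.
    by have := hd0 t tT xt'; have := hd0 u uT xu; lra.
  near (0 : R)^'+ => d; exists d; first by near: d; exact: nbhs_right_gt.
  have h : `[0, T] `<=` (fun t => forall u, 0 <= u <= T -> `|t - u| < d -> 0 <= t <= T -> dist t u <= e) by near: d.
  by move=> t tT u uT tu; apply: (h t) => //; rewrite /= in_itv.
exists d => // t u tT uT tu; exact: hd.
Unshelve. all: by end_near. Qed.

(** Serves the symbols omega and xi, both O (1 + z^2); the reflection preserves L^2 norms. *)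
Lemma reflect_bound K (m h : R -> R) (C : R) : 0 <= C -> measurable_fun setT m -> measurable_fun setT h ->
  (forall z, `|m z| <= C * wt 2 z) -> L2 (fun x => wt 2 (rho K x) * h (rho K x)) ->
  L2 (fun x => m (rho K x) * h (- rho K x)) /\
  nr (fun x => m (rho K x) * h (- rho K x)) <= C * nr (fun x => wt 2 (rho K x) * h (rho K x)).
Proof.
move=> C0 mm mh hm Lh; have mr := @measurable_rho R K.
have mN : measurable_fun setT (fun x : R => - x) by exact: measurable_funN.
have m1 : measurable_fun setT (fun z => m (- z) * h z).
  by apply: measurable_funM => //; exact: measurableT_comp mm mN.
have le x : `|m (- rho K x) * h (rho K x)| <= `|C * (wt 2 (rho K x) * h (rho K x))|.
  rewrite normrM [leRHS]normrM (ger0_norm C0) [`|wt 2 _ * _|]normrM (ger0_norm (wt_ge0 _ _)) mulrA ler_wpM2r//.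
  by rewrite -wt_even.
have L1 : L2 (fun x => m (- rho K x) * h (rho K x)) by apply: L2_le (measurableT_comp m1 mr) (L2Z C Lh) le.
have [L E] := L2_rho_opp m1 L1.
have e x : m (rho K x) * h (- rho K x) = m (- - rho K x) * h (- rho K x) by rewrite opprK.
rewrite (_ : (fun x => m (rho K x) * h (- rho K x)) = fun x => m (- - rho K x) * h (- rho K x)); last by apply/funext.
split => //; rewrite {1}/nr E -/(nr _); apply: le_trans (nr_le L1 (L2Z C Lh) le) _.
by rewrite (nrZ C Lh) ger0_norm.
Qed.

(** Since alpha + 1 <= 2 the growth is at most quadratic at high frequency, and continuity covers
    the rest. The weight of exponent 2 is therefore the one used in the density argument. *)
Lemma omega_growth (alpha : R) (omega : R -> R) : 0 < alpha -> alpha <= 1 -> hypothesis1 alpha omega ->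
  [/\ continuous omega, (forall z, omega (- z) = - omega z) &
   exists2 C : R, 0 <= C & forall z, `|omega z| <= C * wt 2 z].
Proof.
move=> a0 a1 [[d _] _ om [x0 x00 hx]]; have co : continuous omega by exact: derivable_continuous.
split => //; have [c [C [c0 C0 hC]]] := hx 0%N isT.
have [B B0 hB] := continuous_bounded (- x0) x0 co.
exists (B + C); first by rewrite addr_ge0// ltW.
move=> z; have w1 := wt_ge1 z (ler0n R 2).
have [h|h] := leP x0 `|z|; last first.
  apply: le_trans (_ : B * 1 <= _); last first.
    by apply: ler_pM => //; rewrite lerDl ltW.
  by rewrite mulr1; apply: hB; move: h; rewrite ltr_norml => /andP[/ltW -> /ltW].
have /andP[_] := hC z h; rewrite subr0 => h1; apply: (le_trans h1).
apply: ler_pM; rewrite ?powR_ge0 ?lerDr ?(ltW C0)//.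
rewrite -sqr_powR_half// real_normK ?num_real// /wt.
apply: le_trans (_ : (1 + z ^+ 2) `^ ((alpha + 1) / 2) <= _).
  apply: ge0_ler_powR; rewrite ?nnegrE ?addr_ge0 ?sqr_ge0 ?lerDr//.
  by rewrite divr_ge0// addr_ge0// ltW.
by apply: ler_powR; [exact: wt_base|lra].
Qed.

Lemma derive1_scale (a : R) f : (forall x, derivable f x 1) -> derive1 (fun x => a * f x) = fun x => a * derive1 f x.
Proof.
move=> df; have d x : is_derive x 1 (fun x => a * f x) (a * derive1 f x).
  exact: (is_deriveZ a (derive1_is (df x))).
by have [_] := derive1P d.
Qed.

Lemma test_product K T (th : R -> R) phi : smooth th ->
  (exists a b : R, [/\ 0 < a, b < T & forall t, t \notin `[a, b] -> th t = 0]) -> test_space K phi ->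
  test_spacetime K T (fun t x => th t * phi x).
Proof.
move=> sth [a [b [a0 bT hab]]] tp; have sp := test_smooth tp; split; last first.
- case: K tp => -[_]; first by move=> pp t x; rewrite pp.
  by move=> [M hM]; exists M => t x /hM ->; rewrite mulr0.
- by exists a, b; split => // t x /hab ->; rewrite mul0r.
move=> i j.
have dn k f : derive1n k.+1 f = derive1 (derive1n k f) by [].
have E1 : iter j dx (fun t x => th t * phi x) = fun t x => th t * derive1n j phi x.
  elim: j => [//|j ih]; rewrite iterS ih; apply/funext => t; apply/funext => x.
  by rewrite /dx derive1_scale ?dn// => y; apply: smooth_derivable; exact: smooth_derive1n.
have E2 : iter i dt (iter j dx (fun t x => th t * phi x)) = fun t x => derive1n i th t * derive1n j phi x.
  rewrite E1; elim: i => [//|i ih]; rewrite iterS ih; apply/funext => t; apply/funext => x.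
  rewrite /dt (_ : (fun t0 => _) = (fun t0 => derive1n j phi x * derive1n i th t0)); last by apply/funext => y; rewrite mulrC.
  by rewrite derive1_scale ?dn 1?mulrC// => y; apply: smooth_derivable; exact: smooth_derive1n.
have si := smooth_derive1n i sth; have sj := smooth_derive1n j sp.
rewrite /= E2; split.
  move=> t x; split.
    rewrite (_ : (fun t0 => _) = (fun t0 => derive1n j phi x * derive1n i th t0)); last by apply/funext => y; rewrite mulrC.
    by apply: smooth_derivable; exact: smoothZ.
  by apply: smooth_derivable; exact: smoothZ.
move=> p; apply: cvgM.
- apply: (@cvg_comp _ _ _ fst (derive1n i th) _ (nbhs p.1)); first exact: cvg_fst.
  exact: (@smooth_continuous _ _ si).
- apply: (@cvg_comp _ _ _ snd (derive1n j phi) _ (nbhs p.2)); first exact: cvg_snd.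
  exact: (@smooth_continuous _ _ sj).
Qed.

Lemma ucont_smooth (a b : R) f : smooth f -> ucont_on a b f.
Proof.
move=> sf; have [L L0 hL] := smooth_lip a b sf => e e0.
exists (e / (L + 1)); first by rewrite divr_gt0// ltr_wpDl.
move=> t u ta ua tu; apply: (le_trans (hL t u ta ua)).
have L1 : 0 < L + 1 by rewrite ltr_wpDl.
move: tu; rewrite ltr_pdivlMr// => /ltW tu; apply: le_trans tu.
by rewrite mulrC ler_wpM2l// lerDl.
Qed.

Lemma Ig_chi_test K f phi : L2 (fun x => chi K x * f x) -> test_space K phi -> Ig (fun x => chi K x * (f x * phi x)).
Proof.
move=> Lf tp; have := L2M_Ig Lf (test_L2 tp); congr Ig; apply/funext => x.
by transitivity (chi K x ^+ 2 * (f x * phi x)); [ring|rewrite chi_sqr].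
Qed.

Section Equation.
Variables (K : spatial_domain) (omega : R -> R) (s T C : R) (u0 : R -> R) (v : R -> R -> R) (G : R -> R -> R).
Hypotheses (s12 : 2^-1 < s) (om : continuous omega) (omN : forall z, omega (- z) = - omega z).
Hypotheses (C0 : 0 <= C) (hC : forall z, `|omega z| <= C * wt 2 z).
Hypothesis tr : forall t, 0 <= t <= T -> transform K (v t) (G t).
Hypothesis hc : weighted_continuous K s T (fun t x => G t (rho K x)).
Hypothesis sol : is_solution K omega T u0 v.

Let c t x := G t (rho K x).
Let mom : measurable_fun setT omega. Proof. exact: continuous_measurable_fun. Qed.

Let nr_diff0 f : nr (fun x => f x - f x) = 0.
Proof.
rewrite /nr /n2 (_ : \int[leb]_x _ = 0) ?sqrtr0// -[RHS](Int0 (R := R)).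
by apply: Int_ext => x; rewrite subrr expr0n.
Qed.

Let ucont_pair sg : L2 (fun x => sg (rho K x)) -> ucont_on 0 T (fun t => freq_pair K (c t) sg).
Proof.
move=> Ls; apply: (ucont_freq_pair s12 hc (P := nr (fun x => sg (rho K x)))) => //; first exact: nr_ge0.
by move=> t u _ _; rewrite nr_diff0 mulr_ge0 ?nr_ge0.
Qed.

Let ucont_quad sg : measurable_fun setT sg -> L2 (fun x => sg (rho K x)) -> ucont_on 0 T (fun t => Q K (c t) (c t) sg).
Proof.
move=> ms Ls; apply: (ucont_Q s12 hc (P := nr (fun x => sg (rho K x)))) => //; first exact: nr_ge0.
by move=> t u _ _; rewrite nr_diff0 mulr_ge0 ?nr_ge0.
Qed.

Let reflect_ht phi : test_space K phi -> L2 (fun x => omega (rho K x) * ht K phi (- rho K x)) /\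
  Ig (fun x => omega (rho K x) * ht K phi (- rho K x)).
Proof.
move=> tp; have mh := measurable_ht (test_Ig tp); have mr := @measurable_rho R K.
have [i2 L2'] := Ig_wt_ht 2 tp; have [L _] := reflect_bound C0 mom mh hC L2'; split=> //.
have m2 : measurable_fun setT (fun z => wt 2 z * ht K phi z) by apply: measurable_funM => //; exact: measurable_wt.
have [i3 _] := rho_opp m2 i2; have [mL _] := L.
apply: Ig_le mL (IgZ C i3) _ => x; rewrite !normrM (ger0_norm C0) (ger0_norm (wt_ge0 _ _)) wt_even mulrA ler_wpM2r//.
Qed.

(** Products th (t) phi (x) reduce the equation to a scalar one in time; Parseval rewrites its three
    terms in frequency and the du Bois-Reymond lemma integrates it. *)
Let test_equation phi : test_space K phi -> forall t0 t, 0 <= t0 -> t0 <= t -> t <= T ->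
  freq_pair K (c t) (ht K phi) - freq_pair K (c t0) (ht K phi) =
  \int[leb]_(tau in `[t0, t]) (freq_pair K (c tau) (fun z => omega z * ht K phi (- z)) - Q K (c tau) (c tau) (ht K (derive1 phi))).
Proof.
move=> tp; have tp' := test_derive1 tp.
have [ih Lh] := Ig_ht_rho tp; have [ih' Lh'] := Ig_ht_rho tp'.
have mh' := measurable_ht (test_Ig tp').
have [Lw iw] := reflect_ht tp; have tp0 := two_pi_gt0 (R := R).
pose A t := freq_pair K (c t) (ht K phi).
pose g t := freq_pair K (c t) (fun z => omega z * ht K phi (- z)) - Q K (c t) (c t) (ht K (derive1 phi)).
have uA : ucont_on 0 T A by exact: ucont_pair.
have ug : ucont_on 0 T g by apply: ucontB; [exact: ucont_pair|exact: ucont_quad].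
apply: (dubois uA ug) => th sth supp.
have [_ /(_ _ (test_product sth supp tp)) W] := sol.
have uth' := ucont_smooth 0 T (smooth_derive1 sth).
have uth := ucont_smooth 0 T sth.
have uF : ucont_on 0 T (fun t => derive1 th t * A t + th t * g t) by apply: ucontD; apply: ucontM.
(* The sign and the factor (2 pi)^-1 from Parseval are common to the three terms. *)
apply: (mulfI (_ : - (2 * pi)^-1 != 0 :> R)); first by rewrite oppr_eq0 invr_neq0// lt0r_neq0.
rewrite mulr0 -[RHS]W -(Rint_Z _ uF) !Int_itv; apply: Int_ext => t.
rewrite indE in_itv/=; case: (boolP (0 <= t <= T)) => [tT|_]; last by rewrite !mul0r.
rewrite !mul1r; have trt := tr tT; have [mG Lv LG hG] := trt.
have [iG _] := wcont_L1 s12 hc tT; have sp := test_smooth tp.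
have e1 : integral_space K (fun x => v t x * dt (fun t x => th t * phi x) t x) = derive1 th t * ((2 * pi)^-1 * A t).
  have <- := transform_test trt tp; rewrite integral_spaceE -(IntZ _ (Ig_chi_test Lv tp)); apply: Int_ext => x.
  rewrite /dt (_ : (fun t0 => _) = (fun t0 => phi x * th t0)); last by apply/funext => y; rewrite mulrC.
  by rewrite derive1_scale => [|y]; [ring|exact: smooth_derivable].
have e2 : multiplier_distr K (L_symbol omega) (v t) (fun x => th t * phi x) = th t * ((2 * pi)^-1 * freq_pair K (c t) (fun z => omega z * ht K phi (- z))).
  have eh y : omega (rho K y) * ht K (fun x => th t * phi x) (- rho K y) = th t * (omega (rho K y) * ht K phi (- rho K y)).
    by rewrite htZ; [ring|exact: test_Ig].
  pose h z := th t * (omega z * ht K phi (- z)).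
  have ihh : Ig (fun y => h (rho K y)) by exact: IgZ.
  have Lhh : L2 (fun y => h (rho K y)) by exact: L2Z.
  rewrite /multiplier_distr integral_spaceE.
  transitivity (\int[leb]_x (chi K x * v t x * psi K (fun y => h (rho K y)) x)).
    apply: Int_ext => x; rewrite multiplier_LE//; last 2 first.
    - exact: testZ.
    - by under eq_fun do rewrite eh.
    by rewrite mulrA; congr (_ * psi _ _ _); apply/funext => y; rewrite eh.
  rewrite (hG h ihh Lhh) mulrCA; congr (_ * _); rewrite /freq_pair -(IntZ _ (L2M_Ig LG Lw)).
  by apply: Int_ext => x; rewrite /h /c; ring.
have e3 : integral_space K (fun x => v t x ^+ 2 * dx (fun t x => th t * phi x) t x) = th t * ((2 * pi)^-1 * Q K (c t) (c t) (ht K (derive1 phi))).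
  have mp := measurable_psi K iG; have ip' := test_Ig tp'.
  have iq : Ig (fun x => chi K x * (psi K (c t) x ^+ 2 * derive1 phi x)).
    have pb x : `|psi K (c t) x ^+ 2| <= (pi^-1 * \int[leb]_x `|c t x|) ^+ 2.
      by rewrite normrX lerXn2r ?nnegrE//; [apply: le_trans (psi_bound K 0 iG)|exact: psi_bound].
    have := IgMb ip' (measurable_funX 2 mp) pb; congr Ig; apply/funext => x; ring.
  rewrite -(pairing_sqr ip' iG) integral_spaceE -(IntZ _ iq); apply: Int_ae.
  - have [mv _] := Lv; have md := smooth_measurable (test_smooth tp').
    rewrite (_ : (fun x => _) = (fun x => (chi K x * v t x) ^+ 2 * (th t * derive1 phi x))); last first.
      apply/funext => x; rewrite /dx derive1_scale => [|y]; last exact: smooth_derivable.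
      by rewrite exprMn chi_sqr; ring.
    by apply: measurable_funM; [exact: measurable_funX|exact: measurable_funM].
  - exact: measurable_funM (measurable_cst _) (Ig_meas iq).
  (* The transform is integrable because s > 1/2, so v equals its inverse transform almost
     everywhere and v^2 may be replaced by psi^2. *)
  apply: filterS (transform_recover trt iG) => x E.
  rewrite /dx derive1_scale => [|y]; last exact: smooth_derivable.
  have E2 : chi K x * v t x ^+ 2 = chi K x * psi K (c t) x ^+ 2.
    by rewrite -[X in X * _ = _]chi_sqr -[X in _ = X * _]chi_sqr -!exprMn E.
  by rewrite mulrA E2; ring.
by rewrite e1 e2 e3 /g; ring.
Qed.

(** Density: the equation holds for transforms of test functions, and approximation in L^2 with
    weight 2 controls the three symbols built from sg, omega sg and z sg at once. *)
Lemma solution_evolves : evolves K omega T c.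
Proof.
move=> sg ssg t0 t a0 a1 a2; have [phi tp cp] := symbol_approx K 2 ssg.
have [ms [M hs _]] := ssg; have mr := @measurable_rho R K.
have [B B0 hB] := wcont_bounded hc; pose W := wnorm K s * B.
have W0 : 0 <= wnorm K s by exact: nr_ge0.
have cB u : 0 <= u <= T -> [/\ L2 (c u), nr (c u) <= B, Ig (c u) & \int[leb]_x `|c u x| <= W].
  move=> uT; have [L h] := wcont_L2 s12 hc uT; have [i h'] := wcont_L1 s12 hc uT.
  split => //; first exact: le_trans h (hB u uT).
  by apply: (le_trans h'); rewrite ler_wpM2l// hB.
have Lws := L2_wt_symbol ms hs K 2; have Ls := L2_symbol ms hs K.
have mh n : measurable_fun setT (ht K (phi n)) by apply: measurable_ht; exact: test_Ig.
have mh' n : measurable_fun setT (ht K (derive1 (phi n))) by apply: measurable_ht; apply: test_Ig; exact: test_derive1.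
pose h n z := ht K (phi n) z - sg z.
have mhh n : measurable_fun setT (h n) by exact: measurable_funB.
have Lh n : L2 (fun x => wt 2 (rho K x) * h n (rho K x)).
  have [_ L] := Ig_wt_ht 2 (tp n); have := L2B L Lws; congr L2; apply/funext => x; by rewrite mulrBr.
pose d n := nr (fun x => wt 2 (rho K x) * h n (rho K x)).
have [Lo0 _] := reflect_bound C0 mom ms hC Lws.
have mneg : measurable_fun setT (fun z : R => - z) by exact: measurable_funN.
have hneg z : `|- z| <= 1 * wt 2 z.
  rewrite mul1r normrN wt2; have := sqr_ge0 (`|z| - 1); rewrite sqrrB1 real_normK ?num_real//.
  by have := normr_ge0 z; have := sqr_ge0 z; lra.
have [Ln0 _] := reflect_bound ler01 mneg ms hneg Lws.
have msg' : measurable_fun setT (fun z => - z * sg (- z)).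
  by apply: measurable_funM => //; exact: measurableT_comp ms mneg.
have bA n u : 0 <= u <= T -> `|freq_pair K (c u) (ht K (phi n)) - freq_pair K (c u) sg| <= B * d n.
  move=> uT; have [Lc nc _ _] := cB u uT; have [_ L1] := Ig_ht_rho (tp n).
  rewrite -freq_pairBr//; apply: (le_trans (freq_pair_bound Lc (L2B L1 Ls))).
  apply: ler_pM; rewrite ?nr_ge0//; apply: nr_le (L2B L1 Ls) (Lh n) _ => x.
  by rewrite [leRHS]normrM ler_peMl// ger0_norm ?wt_ge0// wt_ge1.
have bM n u : 0 <= u <= T -> `|freq_pair K (c u) (fun z => omega z * ht K (phi n) (- z)) - freq_pair K (c u) (fun z => omega z * sg (- z))| <= B * (C * d n).
  move=> uT; have [Lc nc _ _] := cB u uT; have [L1 _] := reflect_ht (tp n).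
  have [L2' b2] := reflect_bound C0 mom (mhh n) hC (Lh n).
  have E x : omega (rho K x) * ht K (phi n) (- rho K x) - omega (rho K x) * sg (- rho K x) = omega (rho K x) * h n (- rho K x) by rewrite /h mulrBr.
  rewrite -freq_pairBr//; apply: (le_trans (freq_pair_bound Lc _)); under eq_fun do rewrite E; first exact: L2'.
  by apply: ler_pM; rewrite ?nr_ge0.
have bQ n u : 0 <= u <= T -> `|Q K (c u) (c u) (ht K (derive1 (phi n))) - Q K (c u) (c u) (fun z => - z * sg (- z))| <= W * (B * d n).
  move=> uT; have [Lc nc ic wc] := cB u uT; have [_ L1] := Ig_ht_rho (test_derive1 (tp n)).
  have [L2' b2] := reflect_bound ler01 mneg (mhh n) hneg (Lh n).
  have E x : ht K (derive1 (phi n)) (rho K x) - - rho K x * sg (- rho K x) = - rho K x * h n (- rho K x).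
    by rewrite ht_derive1// /h mulrBr.
  have LE : L2 (fun x => ht K (derive1 (phi n)) (rho K x) - - rho K x * sg (- rho K x)) by under eq_fun do rewrite E.
  rewrite -Q_B//; apply: (le_trans (Q_bound (measurable_funB (mh' n) msg') LE Lc ic)).
  apply: ler_pM => //; [by apply: Int_ge0|by rewrite mulr_ge0 ?nr_ge0|].
  apply: ler_pM; rewrite ?nr_ge0//; move: b2; rewrite mul1r; apply: le_trans.
  by rewrite le_eqVlt; apply/orP; left; apply/eqP; congr nr; apply/funext => x; exact: E.
have tT : 0 <= t <= T by rewrite a2 (le_trans a0 a1).
have t0T : 0 <= t0 <= T by rewrite a0 (le_trans a1 a2).
pose gs u := freq_pair K (c u) (fun z => omega z * sg (- z)) - Q K (c u) (c u) (fun z => - z * sg (- z)).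
pose gn n u := freq_pair K (c u) (fun z => omega z * ht K (phi n) (- z)) - Q K (c u) (c u) (ht K (derive1 (phi n))).
have us : ucont_on t0 t gs by apply: (ucont_sub a0 a2); apply: ucontB; [exact: ucont_pair|exact: ucont_quad].
have un n : ucont_on t0 t (gn n).
  apply: (ucont_sub a0 a2); apply: ucontB; first by apply: ucont_pair; have [] := reflect_ht (tp n).
  by apply: ucont_quad => //; have [] := Ig_ht_rho (test_derive1 (tp n)).
pose D := 2 * B + (B * C + W * B) * (t - t0).
have alg (p1 p2 p3 p4 q q' k e : R) : p1 - p2 = q -> `|q - q'| <= k * e * (t - t0) ->
    `|p1 - p3| <= B * e -> `|p2 - p4| <= B * e -> `|p3 - p4 - q'| <= (2 * B + k * (t - t0)) * e.
  by move=> <-; rewrite !ler_norml => /andP[? ?] /andP[? ?] /andP[? ?]; apply/andP; split; lra.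
have key n : `|freq_pair K (c t) sg - freq_pair K (c t0) sg - \int[leb]_(u in `[t0, t]) gs u| <= D * d n.
  have E := test_equation (tp n) a0 a1 a2; rewrite -/(gn n) in E.
  have bI : `|\int[leb]_(u in `[t0, t]) gn n u - \int[leb]_(u in `[t0, t]) gs u| <= (B * C + W * B) * d n * (t - t0).
    rewrite -(Rint_B (un n) us); apply: (Rint_le_cst a1 (ucont_int (ucontB (un n) us))).
    move=> u /andP[u1 u2]; have uT : 0 <= u <= T by rewrite (le_trans a0 u1) (le_trans u2 a2).
    have := bM n u uT; have := bQ n u uT; rewrite /gn /gs.
    move: (freq_pair _ _ _) (freq_pair _ _ _) (Q _ _ _ _) (Q _ _ _ _) => p1 p2 q1 q2.
    rewrite !ler_norml => /andP[? ?] /andP[? ?]; apply/andP; split; lra.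
  exact: alg E bI (bA n t tT) (bA n t0 t0T).
have cD : (fun n => D * d n) @ \oo --> (0 : R).
  rewrite -[X in _ --> X](mulr0 D) -[X in _ * X](@sqrtr0 R).
  apply: cvgM; first exact: cvg_cst.
  exact: (cvg_comp _ _ cp (@sqrt_continuous R 0)).
apply/eqP; rewrite -subr_eq0 -normr_le0; apply: (cvgr_to_ge cD); exact: nearW.
Qed.

End Equation.

End SolutionEvolves.

(** * The bound in W^{r,oo} *)
Section UniformBound.
Context {R : realType}.
Local Notation leb := (@lebesgue_measure R).
Implicit Types (f g phi sg : R -> R) (K : spatial_domain) (x y z t u : R).

(* To be applied to the W^{r,oo} norm as a function of time, whose measurability is
   not known: the integral of a nonnegative function is a supremum over the simple
   functions below it. *)
Lemma ge0_integral_mono (D : set R) (f g : R -> \bar R) :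
  (forall x, D x -> (0 <= f x)%E) -> (forall x, D x -> (f x <= g x)%E) ->
  (\int[leb]_(x in D) f x <= \int[leb]_(x in D) g x)%E.
Proof.
move=> f0 fg; have g0 x : D x -> (0 <= g x)%E by move=> Dx; exact: le_trans (f0 x Dx) (fg x Dx).
rewrite ge0_integralE// [leRHS]ge0_integralE//; apply: ereal_sup_le => _ [h hf <-].
exists h => // x; apply: (le_trans (hf x)).
by rewrite !patchE; case: ifP => // /set_mem; exact: fg.
Qed.

Lemma blk_dyadic (N n : nat) z : (0 < N)%N ->
  blk (N * 2 ^ n) z = (`|z| < (N * 2 ^ n.+1)%:R)%R%:R - (`|z| < (N * 2 ^ n)%:R)%R%:R.
Proof.
move=> N0; rewrite blkE ?muln_gt0 ?N0 ?expn_gt0// -mulrnA -mulnA -expnSr.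
have le : (N * 2 ^ n)%:R <= (N * 2 ^ n.+1)%:R :> R by rewrite ler_nat leq_mul2l leq_exp2l// leqnSn orbT.
rewrite [_ <= `|z|]leNgt; case: (ltP `|z| (N * 2 ^ n)%:R) => h1 /=; last by rewrite subr0.
by rewrite (lt_le_trans h1 le) subrr.
Qed.

Section FixedTime.
Variables (K : spatial_domain) (r : R) (omega : R -> R) (f G : R -> R) (N : nat).
Hypotheses (tf : transform K f G) (iG : Ig (fun x => G (rho K x))) (N0 : (0 < N)%N).
Variables (M : nat -> R) (B q L : R).
Hypotheses (q0 : 0 <= q) (q1 : q < 1) (hL : \int[leb]_x `|G (rho K x)| <= L).
Hypothesis hM : forall j y, `|freq_pair K (fun x => G (rho K x)) (kw (N * 2 ^ j) r omega y 0)| <= M j.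
Hypothesis MB : forall j, M j <= B * q ^+ j.

(** Bound for the frequencies below N, which the Strichartz estimate does not reach: there the
    weight is bounded and the transform integrable. *)
Definition low_bound : R := (1 + N%:R ^+ 2) `^ (`|r| / 2) * L.

(** The symbol of J^r cut at |z| < N 2^n; consecutive cuts differ by one dyadic block. *)
Let dy (n : nat) z : R := (`|z| < (N * 2 ^ n)%:R)%R%:R * wt r z.

Let dy_bound n z : `|dy n z| <= (1 + (N * 2 ^ n)%:R ^+ 2) `^ (`|r| / 2).
Proof.
rewrite /dy normrM; case: ltP => h; last by rewrite normr0 mul0r powR_ge0.
rewrite normr1 mul1r ger0_norm ?wt_ge0//; apply: le_trans (wt_mono z (ler_norm r)) _.
rewrite /wt; apply: ge0_ler_powR; rewrite ?divr_ge0 ?nnegrE ?addr_ge0 ?sqr_ge0//.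
by rewrite lerD2l -[z ^+ 2]real_normK ?num_real// lerXn2r ?nnegrE// ltW.
Qed.

Let mdy n : measurable_fun setT (dy n).
Proof.
apply: measurable_funM; last exact: measurable_wt.
apply: (measurableT_comp (f := fun b : bool => b%:R : R)) => //.
by apply: measurable_fun_ltr => //; exact: measurableT_comp.
Qed.

Let cn n xi := G (rho K xi) * dy n (rho K xi).

Let Ig_cn n : Ig (cn n).
Proof.
apply: (IgMb iG) => [|x]; last exact: dy_bound.
exact: measurableT_comp (mdy n) (@measurable_rho R K).
Qed.

Let H n x := psi K (cn n) x.

Let H_step n x : `|H n.+1 x - H n x| <= B * q ^+ n.
Proof.
apply: le_trans (MB n); apply: le_trans (hM n x).
rewrite /H /psi -mulrBr -(IntB (Ig_psi K x (Ig_cn n.+1)) (Ig_psi K x (Ig_cn n))).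
rewrite normrM (_ : \int[leb]_xi _ = freq_pair K (fun x => G (rho K x)) (kw (N * 2 ^ n) r omega x 0)); last first.
  apply: Int_ext => xi; rewrite /cn /dy /kw /wave blk_dyadic// mul0r addr0; ring.
rewrite ler_piMl// ger0_norm ?invr_ge0 ?(ltW two_pi_gt0)// invf_le1 ?two_pi_gt0//.
by have := @pi_ge2 R; lra.
Qed.

Let L0 : 0 <= L. Proof. by apply: le_trans hL; exact: Int_ge0. Qed.

Let H0 x : `|H 0%N x| <= low_bound.
Proof.
apply: (le_trans (psi_bound K x (Ig_cn 0%N))).
have i0 := Ig_abs (Ig_cn 0%N); have i1 := Ig_abs iG.
apply: (@le_trans _ _ (\int[leb]_x `|cn 0%N x|)).
  rewrite ler_piMl//; first exact: Int_ge0.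
  by rewrite invf_le1 ?pi_gt0//; have := @pi_ge2 R; lra.
rewrite /low_bound; apply: le_trans (ler_wpM2l (powR_ge0 _ _) hL); rewrite -IntZ//.
apply: Int_le => // [|x']; first exact: IgZ.
by rewrite /cn normrM mulrC ler_wpM2r//; have := dy_bound 0%N (rho K x'); rewrite expn0 muln1.
Qed.

Let E := low_bound + B / (1 - q).

Let H_lim x : cvgn (H ^~ x) /\ forall n, `|H n x| <= E.
Proof.
have [c h] := cvg_of_geometric q0 q1 (fun n => H_step n x); split => // n.
by apply: (le_trans (h n)); rewrite lerD2r; exact: H0.
Qed.

(** The truncations H n of J^r f converge uniformly, their increments being dyadic blocks of
    geometric size. The limit h is bounded and represents J^r f in the sense of distributions, so it
    is admissible in the infimum that defines the norm. *)
Lemma W_norm_bound : (W_norm K r +oo f <= (low_bound + B / (1 - q))%:E)%E.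
Proof.
have [mG Lf LG hG] := tf.
pose h x := limn (H ^~ x).
have ch x : H ^~ x @ \oo --> h x by have [] := H_lim x.
have mH n : measurable_fun setT (H n) by exact: measurable_psi.
have mh : measurable_fun setT h by apply: (measurable_fun_cvg mH) => x _; exact: ch.
have bh x : `|h x| <= E.
  have c : (fun n => `|H n x|) @ \oo --> `|h x| by exact: cvg_norm (ch x).
  by apply: (cvgr_to_le c); apply: nearW => n; have [_] := H_lim x.
have E0 : 0 <= E by apply: le_trans (bh 0).
have Lh : (Lp_norm K +oo h <= E%:E)%E.
  rewrite /Lp_norm unlock; case: ifP => _; last by rewrite lee_fin.
  apply/ess_sup_inf.ess_supP; apply: aeW => x /=; rewrite restrict_chi.
  by rewrite lee_fin normrM; apply: (le_trans _ (bh x)); rewrite ler_piMl// chi_le1.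
apply: (le_trans _ Lh); apply: ereal_inf_lbound; exists h => //; split.
  by split; [exact: measurable_funTS|exact: le_lt_trans Lh (ltry _)].
move=> phi tp; have it := test_Ig tp; have [iw Lw] := Ig_wt_ht r tp.
have [ih _] := Ig_ht_rho tp.
rewrite /multiplier_distr !integral_spaceE.
have -> : \int[leb]_x (chi K x * (f x * multiplier K (fun xi => J_symbol r (- xi)) phi x)) =
   \int[leb]_x (chi K x * f x * psi K (fun xi => wt r (rho K xi) * ht K phi (rho K xi)) x).
  by apply: Int_ext => x; rewrite multiplier_JE// mulrA.
rewrite (hG (fun z => wt r z * ht K phi z) iw Lw).
have e n : \int[leb]_x (chi K x * phi x * H n x) = (2 * pi)^-1 * \int[leb]_x (cn n x * ht K phi (rho K x)).
  exact: pairing.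
have hp : (fun n => \int[leb]_x (chi K x * phi x * H n x)) @ \oo --> \int[leb]_x (chi K x * phi x * h x).
  have le n x : `|chi K x * phi x * H n x| <= E * `|chi K x * phi x|.
    by rewrite normrM mulrC ler_wpM2r//; have [_] := H_lim x.
  have cv : {ae leb, forall x, (fun n => chi K x * phi x * H n x) @ \oo --> chi K x * phi x * h x}.
    by apply: aeW => x; apply: cvgM; [exact: cvg_cst|exact: ch].
  by have [] := @DCT R _ _ _ (fun n => measurable_funM (Ig_meas it) (mH n)) (measurable_funM (Ig_meas it) mh) (IgZ E (Ig_abs it)) le cv.
have iGw : Ig (fun x => G (rho K x) * (wt r (rho K x) * ht K phi (rho K x))) by exact: L2M_Ig.
have mht : measurable_fun setT (fun x => ht K phi (rho K x)) by exact: Ig_meas.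
have hc : (fun n => \int[leb]_x (cn n x * ht K phi (rho K x))) @ \oo --> \int[leb]_x (G (rho K x) * (wt r (rho K x) * ht K phi (rho K x))).
  have le n x : `|cn n x * ht K phi (rho K x)| <= `|G (rho K x) * (wt r (rho K x) * ht K phi (rho K x))|.
    rewrite /cn /dy (_ : _ * _ * _ = (`|rho K x| < (N * 2 ^ n)%:R)%R%:R * (G (rho K x) * (wt r (rho K x) * ht K phi (rho K x)))); last by ring.
    by rewrite normrM ler_piMl//; case: (`|rho K x| < _)%R; rewrite ?normr1 ?normr0.
  have cv : {ae leb, forall x, (fun n => cn n x * ht K phi (rho K x)) @ \oo --> G (rho K x) * (wt r (rho K x) * ht K phi (rho K x))}.
    apply: aeW => x; apply: cvg_near_cst; near=> n.
    rewrite /cn /dy (_ : (`|rho K x| < _)%R = true) ?mul1r ?mulrA//.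
    have h1 : `|rho K x| < n%:R by near: n; exact: nbhs_infty_gtr.
    apply: (lt_le_trans h1); rewrite ler_nat; apply: (leq_trans (ltnW (ltn_expl n (ltnSn 1)))).
    by rewrite leq_pmull.
  by have [] := @DCT R _ _ _ (fun n => measurable_funM (Ig_meas (Ig_cn n)) mht) (Ig_meas iGw) (Ig_abs iGw) le cv.
have hc' : (fun n => \int[leb]_x (chi K x * phi x * H n x)) @ \oo --> (2 * pi)^-1 * \int[leb]_x (G (rho K x) * (wt r (rho K x) * ht K phi (rho K x))).
  rewrite (_ : (fun n => _) = fun n => (2 * pi)^-1 * \int[leb]_x (cn n x * ht K phi (rho K x))); last by apply/funext => n; exact: e.
  by apply: cvgM; [exact: cvg_cst|exact: hc].
rewrite (_ : \int[leb]_x (chi K x * (h x * phi x)) = \int[leb]_x (chi K x * phi x * h x)).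
  exact: (cvg_unique _ hp hc').
by apply: Int_ext => x; ring.
Unshelve. all: by end_near. Qed.

End FixedTime.
Lemma W_norm_ge0 K r p f : (0 <= W_norm K r p f)%E.
Proof. by apply: le_ereal_inf_tmp => _ [h _ <-]; exact: Lnorm_ge0. Qed.

(* The time integral of the square of the dyadic block at frequency [n] gains
   [n^(-2 eps)] when [r] is [eps] below the Strichartz exponent. *)
Lemma dyadic_decay (alpha s eps : R) (N j : nat) : (0 < N)%N -> let r := s - (1 / 2 - alpha / 4) - eps in
  ((N * 2 ^ j)%:R `^ (r - s)) ^+ 2 * ((N * 2 ^ j)%:R * (N * 2 ^ j)%:R `^ (- (alpha / 2))) =
  N%:R `^ (- (2 * eps)) * ((2 : R) `^ (- (eps / 2)) ^+ 4) ^+ j.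
Proof.
move=> N0 r; have n0 : 0 < (N * 2 ^ j)%:R :> R by rewrite ltr0n muln_gt0 N0 expn_gt0.
rewrite -[X in _ * (X * _)]powRr1 ?(ltW n0)// -powRD; last by rewrite (gt_eqF n0) implybT.
rewrite -powR_mulrn ?powR_ge0// -powRrM -powRD; last by rewrite (gt_eqF n0) implybT.
rewrite (_ : _ + _ = - (2 * eps)); last by rewrite /r; field.
rewrite natrM powRM ?ler0n//; congr (_ * _).
have e2 : (2 ^+ j : R) = 2 `^ j%:R by rewrite powR_mulrn.
rewrite natrX e2 -powRrM -exprM -powR_mulrn ?powR_ge0// -powRrM; congr (_ `^ _).
by rewrite natrM; field.
Qed.

(** The integrals of the squared blocks are O (q^(4 j)). Half of this decay makes the sum S of M_j^2
    / q^(2 j) integrable in time; the other half turns S (t) < oo into M_j (t) <= sqrt (S (t)) q^j,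
    summable in j. The squared norm is thus at most a constant plus a multiple of S. *)
Lemma solution_L2_Winfty K (alpha s eps T : R) (omega u0 : R -> R) (v : R -> R -> R) :
  0 < alpha -> alpha <= 1 -> 2^-1 < s -> hypothesis1 alpha omega -> 0 < eps -> 0 < T ->
  C_H K T s v -> is_solution K omega T u0 v -> L2_Winfty K T (s - (1 / 2 - alpha / 4) - eps) v.
Proof.
move=> a0 a1 s12 hyp e0 T0 cv sol; set r := s - _ - _.
have [om omN [C C0 hC]] := omega_growth a0 a1 hyp.
have s0 : 0 <= s by lra.
have [G tr hc] := transform_continuous s0 cv.
have ec := solution_evolves s12 om omN C0 hC tr hc sol.
have [B B0 hB] := wcont_bounded hc.
pose c t x := G t (rho K x).
have [N0 [A A0 hA]] := freq_sup_int r om omN s12 hc ec B0 hB a0 a1 hyp T0.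
pose N := N0.+1; pose M j t := freq_sup K omega r c (N * 2 ^ j) t.
(* q^4 = 2^(- 2 eps) is the ratio of the bounds of two consecutive dyadic blocks. *)
pose q : R := 2 `^ (- (eps / 2)).
have q0 : 0 < q by rewrite powR_gt0.
have q1 : q < 1.
  have h : (1 : R) `^ (eps / 2) < 2 `^ (eps / 2).
    by apply: gt0_ltr_powR; rewrite ?nnegrE ?divr_gt0// ltr1n.
  by rewrite powR1 in h; rewrite /q powRN invf_lt1 ?powR_gt0.
have NN j : (N0 < N * 2 ^ j)%N by rewrite -[N0.+1]muln1 leq_mul2l expn_gt0 orbT.
have Np j : (0 < N * 2 ^ j)%N by rewrite muln_gt0 expn_gt0.
pose A' := A * N%:R `^ (- (2 * eps)).
have hM j : \int[leb]_(t in `[0, T]) (M j t ^+ 2) <= A' * (q ^+ 4) ^+ j.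
  by apply: (le_trans (hA _ (NN j))); rewrite -mulrA dyadic_decay// mulrA.
pose L := wnorm K s * B; pose E0 := low_bound r N L.
pose S t : \bar R := (\sum_(0 <= j <oo) (M j t ^+ 2 / (q ^+ 2) ^+ j)%:E)%E.
have term0 j t : 0 <= M j t ^+ 2 / (q ^+ 2) ^+ j by rewrite divr_ge0 ?sqr_ge0 ?exprn_ge0 ?(ltW q0).
have S0 t : (0 <= S t)%E by apply: nneseries_ge0 => j _ _; rewrite lee_fin.
pose kk := 2 / (1 - q) ^+ 2.
have kk0 : 0 < kk by rewrite divr_gt0// exprn_gt0// subr_gt0.
have point t : t \in `]0, T[ -> (W_norm K r +oo (v t) ^+ 2 <= (2 * E0 ^+ 2)%:E + kk%:E * S t)%E.
  rewrite in_itv/= => /andP[t0 tT].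
  have tI : 0 <= t <= T by rewrite (ltW t0) (ltW tT).
  have [Sf|Sf] := boolP (S t \is a fin_num); last first.
    have -> : S t = +oo%E by apply/eqP; rewrite -leye_eq leNgt -ge0_fin_numE.
    by rewrite gt0_muley ?lte_fin// addey// leey.
  pose b := fine (S t); have b0 : 0 <= b by exact: fine_ge0.
  have MB j : M j t <= Num.sqrt b * q ^+ j.
    have M0 : 0 <= M j t by exact: (@freq_sup_ge0 R K omega s T r c).
    have h : M j t ^+ 2 / (q ^+ 2) ^+ j <= b.
      rewrite -lee_fin fineK//; have h : (\sum_(0 <= i < j.+1) (M i t ^+ 2 / (q ^+ 2) ^+ i)%:E <= S t)%E.
        by apply: nneseries_lim_ge => i _ _; rewrite lee_fin.
      by apply: le_trans h; rewrite big_nat_recr//= leeDr// sumEFin lee_fin sumr_ge0.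
    rewrite -(@ler_pXn2r _ 2) ?nnegrE ?mulr_ge0 ?sqrtr_ge0 ?exprn_ge0 ?(ltW q0)//.
    rewrite exprMn sqr_sqrtr// -exprM mulnC exprM -ler_pdivrMr// exprn_gt0// exprn_gt0//.
  have [iG wG] := wcont_L1 s12 hc tI.
  have hL : \int[leb]_x `|G t (rho K x)| <= L.
    by apply: (le_trans wG); rewrite ler_wpM2l ?nr_ge0// hB.
  have hMy j y : `|freq_pair K (fun x => G t (rho K x)) (kw (N * 2 ^ j) r omega y 0)| <= M j t.
    exact: (@freq_sup_ge R K omega s T r c).
  have := W_norm_bound (tr t tI) iG (ltn0Sn N0) (ltW q0) q1 hL hMy MB.
  have := W_norm_ge0 K r +oo (v t); case: (W_norm _ _ _ _) => [w| |]//.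
  rewrite !lee_fin => w0 wb; rewrite -(fineK Sf) -/b -!EFinM -EFinD lee_fin -expr2.
  apply: (@le_trans _ _ ((E0 + Num.sqrt b / (1 - q)) ^+ 2)).
    by rewrite lerXn2r ?nnegrE// (le_trans w0 wb).
  have -> : kk * b = 2 * (Num.sqrt b / (1 - q)) ^+ 2.
    by rewrite exprMn sqr_sqrtr// exprVn /kk; ring.
  by have := sqr_ge0 (E0 - Num.sqrt b / (1 - q)); lra.
rewrite /L2_Winfty.
apply: (@le_lt_trans _ _ (\int[leb]_(t in `]0%R, T[) ((2 * E0 ^+ 2)%:E + kk%:E * S t))%E).
  apply: ge0_integral_mono => t tI; first by rewrite expe2 mule_ge0 ?W_norm_ge0.
  by apply: point; rewrite inE in tI *.
have uM j : ucont_on 0 T (fun t => M j t ^+ 2).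
  have u1 : ucont_on 0 T (M j) by exact: (@ucont_freq_sup R K omega s T r c).
  by rewrite (_ : (fun t => _) = fun t => M j t * M j t); [exact: ucontM|apply/funext => t; rewrite expr2].
pose F j t := M j t ^+ 2 / (q ^+ 2) ^+ j.
have uF j : ucont_on 0 T (F j).
  by rewrite (_ : F j = fun t => ((q ^+ 2) ^+ j)^-1 * M j t ^+ 2); [exact: ucontZ|apply/funext => t; rewrite /F mulrC].
have sub : `]0, T[ `<=` `[0, T] by move=> t /=; rewrite !in_itv/= => /andP[/ltW -> /ltW ->].
have mF j : measurable_fun `[0, T] (EFin \o F j) by exact: measurable_int (ucont_int (uF j)).
have mF' j : measurable_fun `]0, T[ (EFin \o F j) by exact: measurable_funS (mF j).
have mS : measurable_fun `]0, T[ S by apply: ge0_emeasurable_sum => [j t _ _|j _]; [rewrite lee_fin|exact: mF'].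
have mD : measurable (`]0, T[ : set R) by exact: measurable_itv.
rewrite ge0_integralD//; last 3 first.
- by move=> t _; rewrite lee_fin mulr_ge0 ?sqr_ge0.
- by move=> t _; rewrite mule_ge0 ?lee_fin ?(ltW kk0).
- by apply: measurable_funeM.
rewrite lte_add_pinfty//.
  have lT : leb `]0, T[ = T%:E by rewrite lebesgue_measure_itv/= lte_fin T0 sube0.
  by rewrite integral_cst// [X in (_ * X)%E]lT ltry.
rewrite ge0_integralZl_EFin ?(ltW kk0)// lte_mul_pinfty ?lee_fin ?(ltW kk0)//.
rewrite integral_nneseries//; last by move=> j t _; rewrite lee_fin.
apply: (@le_lt_trans _ _ (\sum_(0 <= j <oo) (geometric A' (q ^+ 2) j)%:E)%E).
  apply: lee_nneseries => [j _ _|j _]; first by apply: integral_ge0 => t _; rewrite lee_fin.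
  apply: (@le_trans _ _ (\int[leb]_(t in `[0%R, T]) (F j t)%:E)%E).
    apply: (@ge0_subset_integral _ _ R leb `]0, T[%classic `[0, T]%classic mD _ (EFin \o F j)) => //.
    - exact: mF.
    by move=> t _; rewrite lee_fin; exact: term0.
  rewrite -(fineK (integrable_fin_num _ (ucont_int (uF j))))// lee_fin.
  have -> : fine (\int[leb]_(t in `[0%R, T]) (EFin \o F j) t)%E = ((q ^+ 2) ^+ j)^-1 * \int[leb]_(t in `[0, T]) (M j t ^+ 2).
    by rewrite -(Rint_Z _ (uM j)) /Rintegral; congr fine; apply: eq_integral => t _; rewrite /F mulrC.
  rewrite mulrC ler_pdivrMr ?exprn_gt0// ?exprn_gt0//; apply: (le_trans (hM j)).
  have e4 : (q ^+ 4) ^+ j = (q ^+ 2) ^+ j * (q ^+ 2) ^+ j by rewrite -exprMn -exprD.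
  by rewrite e4 [leLHS]mulrA.
have q2 : `|q ^+ 2| < 1 by rewrite ger0_norm ?sqr_ge0// exprn_ilt1// ltW.
rewrite (_ : (\sum_(0 <= j <oo) _)%E = (A' * (1 - q ^+ 2)^-1)%:E) ?ltry//.
apply/cvg_lim => //; under eq_fun do rewrite sumEFin; apply/cvg_EFin; first by near=> n.
exact: cvg_geometric_series.
Unshelve. all: by end_near. Qed.

End UniformBound.

Theorem corollary1p6 (R : realType) (K : spatial_domain) (alpha s : R) (omega : R -> R)
  (alpha_gt0 : 0 < alpha) (alpha_le1 : alpha <= 1)
  (s_gt : Num.max (1 / 2) (s_threshold alpha) < s)
  (homega : hypothesis1 alpha omega)
  (s' eps A0 beta0 : R)
  (s'_gt : s_tilde_threshold alpha < s') (s'_le : s' <= s)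
  (eps_gt0 : 0 < eps) (A0_gt0 : 0 < A0) (beta0_gt0 : 0 < beta0)
  (hlwp : locally_wellposed K omega alpha s s' eps A0 beta0)
  (u0 : R -> R) (hu0 : in_H K s u0) :
  let T := existence_time K s' A0 beta0 u0 in
  unique_solution_in K omega T u0 (C_H K T s).
Proof.
move=> T; have [[u [[uC uW] us un]] _] := hlwp u0 hu0.
exists u; split; [exact: uC|exact: us|move=> v vC vs].
apply: (un v _ vs); split; first exact: vC.
have s12 : 2^-1 < s by move: s_gt; rewrite gt_max => /andP[]; rewrite mul1r.
(* [fine] of a nonnegative extended number is nonnegative, so the base 1 + norm of the power is
   positive. *)
have T0 : 0 < T.
  rewrite /T /existence_time mulr_gt0// powR_gt0// ltr_wpDr//.
  by apply: fine_ge0; exact: W_norm_ge0.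
exact: (solution_L2_Winfty alpha_gt0 alpha_le1 s12 homega eps_gt0 T0 vC vs).
Qed.
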